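(* Let $n\geqslant2$, let $D,D'\subset\mathbb{R}^n$ be domains, let $\delta>0$, let $A\subset D'$ be a continuum, and let $Q:D'\to[0,\infty]$ be a Lebesgue measurable function. Let $\mathfrak{S}_{\delta,A,Q}(D,D')$ be the family of all open, discrete and closed mappings $f$ of $D$ onto $D'$ that satisfy the inverse Poletsky inequality with the function $Q$ at every point $y_0\in f(D)$ and for which $h(f^{-1}(A),\partial D)\geqslant\delta$. Suppose that $D$ has a weakly flat boundary, $Q\in L^1(D')$, and $D'$ is locally connected on its boundary. Then every $f\in\mathfrak{S}_{\delta,A,Q}(D,D')$ extends by continuity to a mapping $\overline{f}:\overline{D}\to\overline{D'}$, $\overline{f}|_D=f$, with $\overline{f}(\overline{D})=\overline{D'}$, and the family $\mathfrak{S}_{\delta,A,Q}(\overline{D},\overline{D'})$ consisting of all extended mappings $\overline{f}:\overline{D}\to\overline{D'}$ is equicontinuous in $\overline{D}$ with respect to the chordal metric: for every $x_0\in\overline{D}$ and $\varepsilon>0$ there is $\tau=\tau(\varepsilon,x_0)>0$ such that $x\in\overline{D}$, $h(x,x_0)<\tau$ implies $h(\overline{f}(x),\overline{f}(x_0))<\varepsilon$ for all $\overline{f}\in\mathfrak{S}_{\delta,A,Q}(\overline{D},\overline{D'})$.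
   Context: Mappings are continuous; a domain is a nonempty open connected set; a continuum is a nonempty compact connected set. $\overline{\mathbb{R}^n}=\mathbb{R}^n\cup\{\infty\}$ carries the chordal metric $h(x,y)=\frac{|x-y|}{\sqrt{1+|x|^2}\sqrt{1+|y|^2}}$ for $x,y\ne\infty$, $h(x,\infty)=\frac{1}{\sqrt{1+|x|^2}}$. Closures, boundaries and neighbourhoods of boundary points are taken in $\overline{\mathbb{R}^n}$. For sets $E,F\subset\overline{\mathbb{R}^n}$, $h(E,F)=\inf_{x\in E,\,y\in F}h(x,y)$. A mapping $f:D\to D'$ is open if it maps open sets to open sets, discrete if every $f^{-1}(y)$ consists of isolated points, and closed if $f(C)$ is closed in $D'$ whenever $C$ is closed in $D$. $S(x_0,r)=\{x\in\mathbb{R}^n:|x-x_0|=r\}$, and $m$ is Lebesgue measure. Modulus: for a family $\Gamma$ of curves, $M(\Gamma)=\inf\int_{\mathbb{R}^n}\rho^n(x)\,dm(x)$, the infimum being over all Borel functions $\rho:\mathbb{R}^n\to[0,\infty]$ with $\int_\gamma\rho\,|dx|\geqslant1$ for every locally rectifiable $\gamma\in\Gamma$. For $y_0\in\mathbb{R}^n$ and $0<r_1<r_2<\infty$ put $A(y_0,r_1,r_2)=\{y\in\mathbb{R}^n:r_1<|y-y_0|<r_2\}$. For $E,F\subset\overline{\mathbb{R}^n}$ and a domain $G\subset\mathbb{R}^n$, $\Gamma(E,F,G)$ is the family of all curves $\gamma:[a,b]\to\overline{\mathbb{R}^n}$ with $\gamma(a)\in E$, $\gamma(b)\in F$ and $\gamma(t)\in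 G$ for $t\in(a,b)$. For $f:D\to\mathbb{R}^n$, $y_0\in f(D)$ and $0<r_1<r_2<\infty$, $\Gamma_f(y_0,r_1,r_2)$ is the family of all curves $\gamma$ in $D$ such that $f(\gamma)=f\circ\gamma\in\Gamma(S(y_0,r_1),S(y_0,r_2),A(y_0,r_1,r_2))$. Inverse Poletsky inequality: $f$ satisfies the inverse Poletsky inequality with the function $Q$ at $y_0\in f(D)$ if for all $0<r_1<r_2<\infty$ $$M(\Gamma_f(y_0,r_1,r_2))\leqslant\int_{f(D)}Q(y)\cdot\eta^n(|y-y_0|)\,dm(y)$$ for every Lebesgue measurable $\eta:(r_1,r_2)\to[0,\infty]$ with $\int_{r_1}^{r_2}\eta(r)\,dr\geqslant1$; here $\eta$ is extended by $0$ outside $(r_1,r_2)$. A domain $G$ is locally connected on its boundary if for every $x_0\in\partial G$ and every neighbourhood $U$ of $x_0$ there is a neighbourhood $V\subset U$ of $x_0$ such that $V\cap G$ is connected. A domain $G$ has a weakly flat boundary if for every $x_0\in\partial G$, every $P>0$ and every neighbourhood $U$ of $x_0$ there is a neighbourhood $V\subset U$ of $x_0$ such that $M(\Gamma(E,F,G))>P$ for all continua $E,F\subset G$ each of which intersects both $\partial U$ and $\partial V$. *)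

(* Defs.v *)
From HB Require Import structures.
From mathcomp Require Import all_boot all_order all_algebra.
From mathcomp Require Import all_classical all_reals all_analysis.
From mathcomp Require Import measurable_realfun.
From mathcomp Require Import ring.

Set Implicit Arguments.
Unset Strict Implicit.
Unset Printing Implicit Defensive.
Import Order.TTheory GRing.Theory Num.Theory.
Import numFieldNormedType.Exports.

Local Open Scope classical_set_scope.
Local Open Scope ring_scope.

(* The library norm on ['rV[R]_n] is the sup norm; it induces the topology of
   R^n, but |x| below always denotes the Euclidean norm. *)
Section Euclidean_norm.
Context {R : realType}.

Definition enorm n (x : 'rV[R]_n) : R := Num.sqrt (\sum_i x 0 i ^+ 2).

Lemma enorm_ge0 n (x : 'rV[R]_n) : 0 <= enorm x.
Proof. exact: sqrtr_ge0. Qed.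

Lemma sum_sqr_ge0 n (x : 'rV[R]_n) : 0 <= \sum_i x 0 i ^+ 2.
Proof. by apply: sumr_ge0 => i _; exact: sqr_ge0. Qed.

Lemma enorm_sqr n (x : 'rV[R]_n) : enorm x ^+ 2 = \sum_i x 0 i ^+ 2.
Proof. by rewrite /enorm sqr_sqrtr// sum_sqr_ge0. Qed.

Lemma enorm_eq0 n (x : 'rV[R]_n) : enorm x = 0 -> x = 0.
Proof.
move=> x0; have : \sum_i x 0 i ^+ 2 = 0 by rewrite -enorm_sqr x0 expr0n.
move=> /eqP; rewrite psumr_eq0; last by move=> i _; exact: sqr_ge0.
move=> /allP xi0; apply/rowP => i; rewrite mxE.
by have := xi0 i (mem_index_enum _) => /=; rewrite sqrf_eq0 => /eqP.
Qed.

Lemma enormN n (x : 'rV[R]_n) : enorm (- x) = enorm x.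
Proof. by congr Num.sqrt; apply: eq_bigr => i _; rewrite mxE sqrrN. Qed.

Lemma dot_le_enorm n (x y : 'rV[R]_n) :
  \sum_i x 0 i * y 0 i <= enorm x * enorm y.
Proof.
set p := \sum_i _.
have [y0|y0] := eqVneq (enorm y) 0.
  rewrite y0 mulr0 /p big1// => i _.
  by rewrite (enorm_eq0 y0) mxE mulr0.
have B0 : 0 < enorm y ^+ 2 by rewrite exprn_gt0// lt_neqAle eq_sym y0 enorm_ge0.
have := sum_sqr_ge0 (\row_i (enorm y ^+ 2 * x 0 i - p * y 0 i)).
have -> : \sum_i (\row_i (enorm y ^+ 2 * x 0 i - p * y 0 i)) 0 i ^+ 2 =
    enorm y ^+ 2 * ((enorm x * enorm y) ^+ 2 - p ^+ 2).
  transitivity (\sum_i ((enorm y ^+ 2) ^+ 2 * (x 0 i ^+ 2)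
      - 2 * enorm y ^+ 2 * p * (x 0 i * y 0 i) + p ^+ 2 * y 0 i ^+ 2)).
    by apply: eq_bigr => i _; rewrite mxE; ring.
  rewrite big_split sumrB /= -!mulr_sumr -/p -!enorm_sqr; ring.
rewrite pmulr_rge0// subr_ge0 => pxy.
apply: le_trans (ler_norm p) _.
by rewrite -ler_sqr ?nnegrE ?mulr_ge0 ?enorm_ge0// real_normK ?num_real.
Qed.

Lemma enormD n (x y : 'rV[R]_n) : enorm (x + y) <= enorm x + enorm y.
Proof.
rewrite -ler_sqr ?nnegrE ?addr_ge0 ?enorm_ge0// enorm_sqr.
have -> : \sum_i (x + y) 0 i ^+ 2 =
    enorm x ^+ 2 + enorm y ^+ 2 + 2 * \sum_i x 0 i * y 0 i.
  rewrite !enorm_sqr mulr_sumr -!big_split /=.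
  by apply: eq_bigr => i _; rewrite mxE; ring.
rewrite (_ : (enorm x + enorm y) ^+ 2 =
  enorm x ^+ 2 + enorm y ^+ 2 + 2 * (enorm x * enorm y)); last by ring.
by rewrite lerD2l ler_pM2l ?ltr0n ?dot_le_enorm.
Qed.

Definition esphere n (x0 : 'rV[R]_n) (r : R) : set 'rV[R]_n :=
  [set x | enorm (x - x0) = r].

Definition annulus n (y0 : 'rV[R]_n) (r1 r2 : R) : set 'rV[R]_n :=
  [set y | r1 < enorm (y - y0) < r2].

End Euclidean_norm.

Definition extRn (R : realType) (n : nat) : Type := option 'rV[R]_n.

Section chordal_metric.
Context {R : realType} {n : nat}.
Local Notation T := (extRn R n).

Definition emb (x : 'rV[R]_n) : T := Some x.
Definition infinity : T := None.

Definition chordal (x y : T) : R :=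
  match x, y with
  | Some u, Some v =>
      enorm (u - v) /
        (Num.sqrt (1 + enorm u ^+ 2) * Num.sqrt (1 + enorm v ^+ 2))
  | Some u, None | None, Some u => (Num.sqrt (1 + enorm u ^+ 2))^-1
  | None, None => 0
  end.

(* The chordal metric is the Euclidean distance between images under the
   stereographic projection onto a sphere of radius 1/2, whence the triangle
   inequality. *)
Definition stereo (x : T) : 'rV[R]_(n + 1) :=
  if x is Some u then
    row_mx ((1 + enorm u ^+ 2)^-1 *: u)
           (const_mx (enorm u ^+ 2 / (1 + enorm u ^+ 2)))
  else row_mx 0 (const_mx 1).

Lemma sqr_enorm_row_mx m (u : 'rV[R]_n) (v : 'rV[R]_m) :
  enorm (row_mx u v) ^+ 2 = enorm u ^+ 2 + enorm v ^+ 2.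
Proof.
rewrite !enorm_sqr big_split_ord /=; congr (_ + _).
  by apply: eq_bigr => i _; rewrite row_mxEl.
by apply: eq_bigr => i _; rewrite row_mxEr.
Qed.

Lemma sqr_enorm_scale_sub (a b : R) (u v : 'rV[R]_n) :
  enorm (a *: u - b *: v) ^+ 2 =
  a ^+ 2 * enorm u ^+ 2 + b ^+ 2 * enorm v ^+ 2
  - 2 * a * b * \sum_i u 0 i * v 0 i.
Proof.
rewrite !enorm_sqr !mulr_sumr -sumrN -!big_split /=.
by apply: eq_bigr => i _; rewrite !mxE; ring.
Qed.

Lemma chordalE x y : chordal x y = enorm (stereo x - stereo y).
Proof.
have h_ge0 : 0 <= chordal x y.
  by case: x y => [u|] [v|] //=; rewrite divr_ge0 ?enorm_ge0 ?mulr_ge0.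
apply/eqP; rewrite -(@eqrXn2 _ 2) ?enorm_ge0//; apply/eqP.
have p1 (u : 'rV[R]_n) : 0 < 1 + enorm u ^+ 2.
  by rewrite (lt_le_trans ltr01)// lerDl sqr_ge0.
have s1 (u : 'rV[R]_n) : Num.sqrt (1 + enorm u ^+ 2) ^+ 2 = 1 + enorm u ^+ 2.
  by rewrite sqr_sqrtr// ltW.
have c1 (c : R) : enorm (const_mx c : 'rV[R]_1) ^+ 2 = c ^+ 2.
  by rewrite enorm_sqr big_ord1 mxE.
have cB (c d : R) : const_mx c - const_mx d = const_mx (c - d) :> 'rV[R]_1.
  by apply/rowP => i; rewrite !mxE.
case: x y {h_ge0} => [u|] [v|] /=; rewrite ?opp_row_mx ?add_row_mx
    ?sqr_enorm_row_mx ?cB ?c1.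
- rewrite exprMn exprVn exprMn !s1 sqr_enorm_scale_sub.
  have -> : enorm (u - v) ^+ 2 =
      enorm u ^+ 2 + enorm v ^+ 2 - 2 * \sum_i u 0 i * v 0 i.
    by have := sqr_enorm_scale_sub 1 1 u v; rewrite !scale1r => ->; ring.
  by field; rewrite !lt0r_neq0.
- rewrite exprVn s1 subr0.
  have := sqr_enorm_scale_sub (1 + enorm u ^+ 2)^-1 0 u u.
  rewrite scale0r subr0 => ->.
  by field; exact: lt0r_neq0.
- rewrite exprVn s1 sub0r enormN.
  have := sqr_enorm_scale_sub (1 + enorm v ^+ 2)^-1 0 v v.
  rewrite scale0r subr0 => ->.
  by field; exact: lt0r_neq0.
- by rewrite !subrr enorm_sqr expr0n big1 ?add0r// => i _; rewrite mxE expr0n.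
Qed.

Lemma chordalxx x : chordal x x = 0.
Proof.
case: x => [u|//] /=; rewrite subrr.
suff -> : enorm (0 : 'rV[R]_n) = 0 by rewrite mul0r.
by rewrite /enorm big1 ?sqrtr0// => i _; rewrite mxE expr0n.
Qed.

Lemma chordal_positivity x y : chordal x y = 0 -> x = y.
Proof.
have p1 (u : 'rV[R]_n) : 0 < Num.sqrt (1 + enorm u ^+ 2).
  by rewrite sqrtr_gt0 (lt_le_trans ltr01)// lerDl sqr_ge0.
case: x y => [u|] [v|] //=.
- have p0 : (Num.sqrt (1 + enorm u ^+ 2) * Num.sqrt (1 + enorm v ^+ 2))^-1 != 0.
    by rewrite invr_eq0 mulf_neq0// lt0r_neq0.
  move/eqP; rewrite mulf_eq0 (negbTE p0) orbF => /eqP /enorm_eq0 /eqP.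
  by rewrite subr_eq0 => /eqP ->.
- by move/eqP; rewrite invr_eq0 gt_eqF ?p1.
- by move/eqP; rewrite invr_eq0 gt_eqF ?p1.
Qed.

Lemma chordal_sym x y : chordal x y = chordal y x.
Proof. by rewrite !chordalE -enormN opprB. Qed.

Lemma chordal_triangle y x z : chordal x z <= chordal x y + chordal y z.
Proof.
rewrite !chordalE; apply: le_trans (enormD _ _).
by rewrite addrA subrK.
Qed.

HB.instance Definition _ := Choice.on T.
HB.instance Definition _ := isMetric.Build R T
  chordalxx chordal_positivity chordal_sym chordal_triangle.

Definition chordal_dist (E F : set T) : \bar R :=
  ereal_inf [set (chordal xy.1 xy.2)%:E | xy in E `*` F].

End chordal_metric.

Arguments extRn : clear implicits.
Arguments infinity {R n}.

Section topology.

Definition domain {R : realType} {n : nat} (D : set 'rV[R]_n) :=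
  [/\ D !=set0, open D & connected D].

Definition continuum {T : topologicalType} (K : set T) :=
  [/\ K !=set0, compact K & connected K].

Definition boundary {T : topologicalType} (U : set T) : set T :=
  closure U `\` U^°.

Context {R : realType} {n : nat}.
Implicit Types (D : set 'rV[R]_n) (f : 'rV[R]_n -> 'rV[R]_n).

(* Closure and boundary in the extended space *)
Definition ecl D : set (extRn R n) := closure (emb @` D).
Definition ebd D : set (extRn R n) := boundary (emb @` D).

(* A mapping of D is represented by a total function, of which only the
   values on D are relevant. *)
Definition mapping_onto D D' f :=
  {within D, continuous f} /\ f @` D = D'.

Definition open_mapping D f :=
  forall U, open U -> U `<=` D -> open (f @` U).

Definition discrete_mapping D f :=
  forall y x, (D `&` f @^-1` [set y]) x ->
  exists2 U, nbhs x U & U `&` (D `&` f @^-1` [set y]) = [set x].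

Definition closed_mapping D D' f :=
  forall C, closed C -> exists2 C', closed C' & f @` (D `&` C) = D' `&` C'.

Definition locally_connected_on_boundary D :=
  forall x0, ebd D x0 -> forall U, nbhs x0 U ->
  exists V, [/\ nbhs x0 V, V `<=` U & connected (V `&` emb @` D)].

End topology.

Section Lebesgue_measure_Rn.
Context {R : realType} (n : nat).
Local Open Scope ereal_scope.

Definition box (ab : 'rV[R]_n * 'rV[R]_n) : set 'rV[R]_n :=
  [set x | forall i, (ab.1 0 i <= x 0 i <= ab.2 0 i)%R].

Definition box_volume (ab : 'rV[R]_n * 'rV[R]_n) : R :=
  (\prod_i Num.max 0 (ab.2 0 i - ab.1 0 i))%R.

Definition box_cover (X : set 'rV[R]_n) : set (set ('rV[R]_n * 'rV[R]_n)) :=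
  [set C | countable C /\ X `<=` \bigcup_(ab in C) box ab].

Definition lebesgue_outer (X : set 'rV[R]_n) : \bar R :=
  ereal_inf [set \esum_(ab in C) (box_volume ab)%:E | C in box_cover X].

Lemma box_volume_ge0 ab : 0 <= (box_volume ab)%:E.
Proof. by rewrite lee_fin; apply: prodr_ge0 => i _; rewrite le_max lexx. Qed.

Lemma lebesgue_outer0 : lebesgue_outer set0 = 0.
Proof.
apply/eqP; rewrite eq_le; apply/andP; split.
  apply: ereal_inf_lbound; exists set0; last by rewrite esum_set0.
  by split; [exact: countable0|exact: sub0set].
apply: le_ereal_inf_tmp => _ [C _ <-].
by apply: esum_ge0 => ab _; exact: box_volume_ge0.
Qed.

Lemma lebesgue_outer_ge0 X : 0 <= lebesgue_outer X.
Proof.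
apply: le_ereal_inf_tmp => _ [C _ <-].
by apply: esum_ge0 => ab _; exact: box_volume_ge0.
Qed.

Lemma le_lebesgue_outer : {homo lebesgue_outer : A B / A `<=` B >-> A <= B}.
Proof.
move=> A B AB; apply: ereal_inf_le_tmp => _ [C [cC BC] <-].
by exists C => //; split => //; exact: subset_trans BC.
Qed.

Lemma lebesgue_outer_sigma_subadditive : sigma_subadditive lebesgue_outer.
Proof.
move=> A; have [[i ioo]|] := pselect (exists i, lebesgue_outer (A i) = +oo).
  rewrite (eseries_pinfty _ _ ioo) ?leey// => k _.
  by rewrite -ltNye (lt_le_trans _ (lebesgue_outer_ge0 _)).
rewrite -forallNE => Aoo.
suff add2e (e : {posnum R}) : lebesgue_outer (\bigcup_k A k) <=
    \sum_(i <oo) lebesgue_outer (A i) + e%:num%:E.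
  by apply/lee_addgt0Pr => _/posnumP[].
rewrite (le_trans _ (epsilon_trick _ _ _))//; last first.
  by move=> k; exact: lebesgue_outer_ge0.
pose P k C := box_cover (A k) C /\ \esum_(ab in C) (box_volume ab)%:E <=
  lebesgue_outer (A k) + (e%:num / (2 ^ k.+1)%:R)%:E.
have [C PC] : {C : nat -> set ('rV[R]_n * 'rV[R]_n) & forall k, P k (C k)}.
  apply: (@choice _ _ P) => k.
  have fA : lebesgue_outer (A k) \is a fin_num.
    rewrite ge0_fin_numE ?lebesgue_outer_ge0// lt_neqAle leey andbT.
    exact/eqP/Aoo.
  have ek0 : (0 < e%:num / (2 ^ k.+1)%:R)%R by [].
  have [_ [C AC <-] /ltW CA] := lb_ereal_inf_adherent ek0 fA.
  by exists C.
apply: (@le_trans _ _ (\esum_(ab in \bigcup_k C k) (box_volume ab)%:E)).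
  apply: ereal_inf_lbound; exists (\bigcup_k C k) => //; split.
    by apply: bigcup_countable => // k _; exact: (PC k).1.1.
  by move=> x [k _ /(PC k).1.2[ab Cab abx]]; exists ab => //; exists k.
rewrite seqDU_bigcup_eq esum_bigcupT; first last.
- by move=> ab; exact: box_volume_ge0.
- exact: trivIset_seqDU.
rewrite -nneseries_esumT; last first.
  by move=> k; apply: esum_ge0 => ab _; exact: box_volume_ge0.
apply: lee_nneseries => [k _ _|k _].
  by apply: esum_ge0 => ab _; exact: box_volume_ge0.
apply: le_trans (PC k).2.
rewrite esum_mkcond [leRHS]esum_mkcond; apply: le_esum => ab _.
case: ifPn => [|_]; last by case: ifPn => // _; exact: box_volume_ge0.
by move=> /set_mem Ckab; rewrite mem_set//; exact: (subset_seqDU Ckab).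
Qed.

HB.instance Definition _ := isOuterMeasure.Build R 'rV[R]_n lebesgue_outer
  lebesgue_outer0 lebesgue_outer_ge0 le_lebesgue_outer
  lebesgue_outer_sigma_subadditive.

(* R^n with the sigma-algebra of Lebesgue measurable sets *)
Definition lebRn := caratheodory_type lebesgue_outer.

HB.instance Definition _ := Measurable.on lebRn.

Definition lebesgueRn : set lebRn -> \bar R := lebesgue_outer.

HB.instance Definition _ := isMeasure.Build _ _ _ lebesgueRn
  (caratheodory_measure0 lebesgue_outer)
  (@caratheodory_measure_ge0 _ _ lebesgue_outer)
  (@caratheodory_measure_sigma_additive _ _ lebesgue_outer).

(* R^n with the sigma-algebra of Borel sets *)
Definition borelRn := g_sigma_algebraType (@open 'rV[R]_n).

HB.instance Definition _ := Measurable.on borelRn.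

End Lebesgue_measure_Rn.

Arguments lebRn : clear implicits.
Arguments borelRn : clear implicits.
Arguments lebesgueRn {R} n.

Section curves.
Context {R : realType} {n : nat}.

Record curve := Curve {
  cstart : R ;
  cend : R ;
  cpath :> R -> extRn R n }.
Implicit Types (g : curve) (Gamma : set curve).

Definition is_curve g :=
  cstart g < cend g /\ {within `[cstart g, cend g], continuous (cpath g)}.

Definition map_curve (f : 'rV[R]_n -> 'rV[R]_n) g : curve :=
  Curve (cstart g) (cend g) (omap f \o g).

Definition curves_joining (E F : set (extRn R n)) (G : set 'rV[R]_n) :
    set curve :=
  [set g | [/\ is_curve g, E (g (cstart g)), F (g (cend g)) &
    forall t, cstart g < t < cend g -> (emb @` G) (g t)]].

(* Coordinates of a point of the curve, with junk value 0 at infinity *)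
Definition curve_pt g (t : R) : 'rV[R]_n := odflt 0 (g t).

Definition clength g (a b : R) : \bar R :=
  ereal_sup [set (\sum_(0 <= k < size s)
      enorm (curve_pt g (nth b (a :: s) k.+1) - curve_pt g (nth b (a :: s) k)))%:E
    | s in [set s | itv_partition a b s]].

(* Local rectifiability concerns curves in R^n, so a curve through infinity
   is not locally rectifiable. *)
Definition locally_rectifiable g :=
  (forall t, cstart g <= t <= cend g -> g t <> infinity) /\
  (forall a b, cstart g <= a -> a <= b -> b <= cend g ->
    (clength g a b < +oo)%E).

Definition arclength g (t : R) : R := fine (clength g (cstart g) t).

(* The parametrization by arc length: the value at s is g t for any t such
   that the length of g up to t is s. *)
Definition normal_rep g (s : R) : 'rV[R]_n :=
  curve_pt g (xget (cstart g)
    [set t | cstart g <= t <= cend g /\ arclength g t = s]).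

Definition line_integral (rho : 'rV[R]_n -> \bar R) g : \bar R :=
  \int[@lebesgue_measure R]_(s in `[0, arclength g (cend g)])
    rho (normal_rep g s).

Definition admissible Gamma : set ('rV[R]_n -> \bar R) :=
  [set rho | [/\ measurable_fun [set: borelRn R n] (rho : borelRn R n -> \bar R),
    (forall x, 0 <= rho x)%E &
    forall g, Gamma g -> locally_rectifiable g ->
      (1 <= line_integral rho g)%E]].

Definition modulus Gamma : \bar R :=
  ereal_inf [set (\int[lebesgueRn n]_x (rho x ^+ n))%E
    | rho in admissible Gamma].

End curves.

Arguments curve : clear implicits.

Section mappings.
Context {R : realType} {n : nat}.
Implicit Types (D G : set 'rV[R]_n) (f : 'rV[R]_n -> 'rV[R]_n).
Implicit Types (Q : 'rV[R]_n -> \bar R).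

Definition weakly_flat_boundary G :=
  forall x0, ebd G x0 -> forall P : R, 0 < P -> forall U, nbhs x0 U ->
  exists V, [/\ nbhs x0 V, V `<=` U &
    forall E F : set (extRn R n), continuum E -> continuum F ->
      E `<=` emb @` G -> F `<=` emb @` G ->
      E `&` boundary U !=set0 -> E `&` boundary V !=set0 ->
      F `&` boundary U !=set0 -> F `&` boundary V !=set0 ->
      (P%:E < modulus (curves_joining E F G))%E].

Definition Gamma_f D f (y0 : 'rV[R]_n) (r1 r2 : R) : set (curve R n) :=
  [set g | [/\ is_curve g,
    forall t, cstart g <= t <= cend g -> (emb @` D) (g t) &
    curves_joining (emb @` esphere y0 r1) (emb @` esphere y0 r2)
      (annulus y0 r1 r2) (map_curve f g)]].

(* [wlength idfun]^* is the outer measure underlying the completed Lebesgue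
   measure on the line. *)
Definition lebR := caratheodory_type ((wlength (@idfun R))^*)%mu.

Definition inverse_Poletsky D f Q (y0 : 'rV[R]_n) :=
  forall r1 r2 : R, 0 < r1 -> r1 < r2 ->
  forall eta : R -> \bar R,
    (forall r, r1 < r < r2 -> (0 <= eta r)%E) ->
    measurable_fun (`]r1, r2[ : set lebR) (eta : lebR -> \bar R) ->
    (1 <= \int[@completed_lebesgue_measure R]_(r in `]r1, r2[) eta r)%E ->
    (modulus (Gamma_f D f y0 r1 r2) <=
     \int[lebesgueRn n]_(y in f @` D)
       (Q y * (eta \_ `]r1, r2[) (enorm (y - y0)) ^+ n))%E.

Definition frakS D D' (delta : R) (A : set 'rV[R]_n) Q :
    set ('rV[R]_n -> 'rV[R]_n) :=
  [set f | [/\ mapping_onto D D' f,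
    [/\ open_mapping D f, discrete_mapping D f & closed_mapping D D' f],
    forall y0, (f @` D) y0 -> inverse_Poletsky D f Q y0 &
    (delta%:E <= chordal_dist (emb @` (D `&` f @^-1` A)) (ebd D))%E]].

Definition continuous_extension D D' f (g : extRn R n -> extRn R n) :=
  [/\ {within ecl D, continuous g}, {homo g : x / ecl D x >-> ecl D' x} &
    forall x, D x -> g (emb x) = emb (f x)].

Definition frakS_ext D D' (delta : R) (A : set 'rV[R]_n) Q :
    set (extRn R n -> extRn R n) :=
  [set g | exists2 f, frakS D D' delta A Q f & continuous_extension D D' f g].

Definition equicontinuous_in (X : set (extRn R n))
    (S : set (extRn R n -> extRn R n)) :=
  forall x0, X x0 -> forall e : R, 0 < e ->
  exists2 tau : R, 0 < tau & forall g, S g -> forall x, X x ->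
    chordal x x0 < tau -> chordal (g x) (g x0) < e.

End mappings.

(* Main.v *)
From HB Require Import structures.
Require Import Defs.
From mathcomp Require Import all_boot all_order all_algebra.
From mathcomp Require Import all_classical all_reals all_analysis.
From mathcomp Require Import measurable_realfun.
From mathcomp Require Import ring lra.
Import Order.TTheory GRing.Theory Num.Theory.
Import numFieldNormedType.Exports.

Set Implicit Arguments.
Unset Strict Implicit.
Unset Printing Implicit Defensive.

Local Open Scope classical_set_scope.
Local Open Scope ring_scope.

(** The inverse Poletsky inequality is used with constant test functions only:
    the curves in D whose images cross the annulus r1 < |y - y0| < r2 about a
    point y0 of D' have modulus at most q / (r2 - r1)^n, where q bounds the
    integral of Q ([inverse_Poletsky_const]). On the other side, the modulus of
    the curves joining two disjoint continua of D that come close to a point x0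
    of the closure and also leave a fixed neighbourhood of x0 is large: at a
    boundary point by weak flatness, at an interior point because such continua
    cross many disjoint rings ([loewner_interior]). The mappings are proper
    ([proper_preimage]), and a continuum of D' lifts to a continuum of D through
    any preimage of any of its points ([lift_continuum]). Together these facts
    give the dichotomy [reach_dichotomy]: if two regions of D' separated by an
    annulus both contain values taken near x0, then all values in one of the two
    regions are taken near x0, since otherwise two large lifts would come close
    to each other.

    All conclusions follow from a bound on the oscillation near x0 that is
    uniform over the family ([frakS_oscillation]). If it fails, there are
    mappings f and points x, x' tending to x0 along an ultrafilter such that
    f x and f x' have different limits. As D' is locally connected on its
    boundary, the dichotomy applies to neighbourhoods of the two limits and
    yields a ball of values taken near x0 ([reach_ball]). It then shows that at
    most one value b of D' is not taken near x0 ([reach_all_but_one]), because a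
    point does not disconnect D'.

    - If x0 lies in D, two opposite rays issuing from b are lifted from points
      near x0. Being proper, f takes the rays out of every compact subset of D,
      and annuli with radii in geometric progression separate the rays; this
      contradicts the first paragraph ([no_interior_point]).
    - If x0 is on the boundary, the points of f^-1(A) stay away from x0, so b
      lies in A. A short segment from b has a large lift that starts near x0, so
      every continuum that comes close to x0 and whose image avoids a ball about
      b is small ([shadow]). If x0 is isolated in the boundary, lifts of rays
      therefore run into x0, where they contradict weak flatness
      ([no_isolated_point]). Otherwise, points of D near different boundary
      points near x0 lie in different components of f^-1(W), where W is D'
      without a ball about b, and there are arbitrarily many such components
      ([no_cluster_point]). But each of them is mapped onto W, and lifting the
      sides of a small square shows that each carries a fixed amount of the
      energy of a density of bounded energy ([class_count]).

    The lower bounds for energies, [ring_crossing] and [two_center_crossing],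
    are obtained by averaging over random polygons. The vertices of a polygon
    are displaced by a common random vector, except for the two end points,
    which are approached inside coordinate hyperplanes. In a hyperplane the
    exponent n exceeds the dimension, so that points have positive capacity
    there ([cost_cone]); hyperplanes through suitable points of the continua
    carry a controlled part of the energy ([good_slice]). *)

(** * Lebesgue measure on the Borel sets *)

Section borel_maps.
Context {R : realType}.

Lemma continuous_borel_measurable n (h : 'rV[R]_n -> R) :
  continuous h -> measurable_fun [set: borelRn R n] (h : borelRn R n -> R).
Proof.
move=> ch; apply: (measurability _ (RGenOpens.measurableE R)) => _ [B [a [b ->]] <-].
rewrite setTI; apply: sub_sigma_algebra.
by apply: open_comp => // x _; exact: ch.
Qed.

Lemma measurable_coord n i :
  measurable_fun [set: borelRn R n] (fun x : borelRn R n => (x : 'rV[R]_n) 0 i).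
Proof. by apply: continuous_borel_measurable; exact: coord_continuous. Qed.

Lemma closed_box n (ab : 'rV[R]_n * 'rV[R]_n) : closed (box ab).
Proof.
rewrite [X in closed X](_ : _ = \bigcap_(i in [set: 'I_n])
    ((fun x : 'rV[R]_n => x 0 i) @^-1` `[ab.1 0 i, ab.2 0 i]%classic)).
  apply: closed_bigI => i _.
  apply: closed_comp; last exact: itv_closed.
  by move=> x _; exact: coord_continuous.
apply/seteqP; split => [x h i _|x h i] /=; first by rewrite in_itv/=; exact: h.
by have := h i I; rewrite /= in_itv.
Qed.

Lemma measurable_box n (ab : 'rV[R]_n * 'rV[R]_n) :
  measurable (box ab : set (borelRn R n)).
Proof.
rewrite -[box ab]setCK; apply: measurableC; apply: sub_sigma_algebra.
exact/closed_openC/closed_box.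
Qed.

(** Rational boxes form a countable base, so a map is Borel as soon as its
    coordinates are. *)
Lemma open_bigcup_box n (U : set 'rV[R]_n) : open U ->
  U = \bigcup_(p in [set p : 'rV[rat]_n * 'rV[rat]_n |
    box (map_mx ratr p.1, map_mx ratr p.2) `<=` U])
    box (map_mx ratr p.1, map_mx ratr p.2).
Proof.
move=> oU; apply/seteqP; split => [x Ux|x [p pU /pU]//].
have [e /= e0 xeU] : exists2 e : R, 0 < e & ball x e `<=` U.
  by apply/nbhs_ballP; exact: open_nbhs_nbhs.
have ha i : exists q : rat, ratr q \in `](x 0 i - e), (x 0 i)[.
  by apply: rat_in_itvoo; rewrite ltrBlDr ltrDl.
have hb i : exists q : rat, ratr q \in `](x 0 i), (x 0 i + e)[.
  by apply: rat_in_itvoo; rewrite ltrDl.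
have {ha}[a ha] := choice ha; have {hb}[b hb] := choice hb.
have xab : box (map_mx ratr (\row_i a i), map_mx ratr (\row_i b i)) x.
  move=> i; rewrite /= !mxE; have := ha i; have := hb i.
  by rewrite !in_itv/= => /andP[/ltW -> _] /andP[_ /ltW ->].
exists (\row_i a i, \row_i b i) => //= y yab; apply: xeU.
split => // j i; rewrite !ord1.
have := ha i; have := hb i; have := yab i; rewrite /= !mxE !in_itv/=.
rewrite /ball/= => /andP[ay yb] /andP[xb be] /andP[ea ax].
by rewrite ltr_distlC; apply/andP; split; lra.
Qed.

Lemma measurable_into_borel d (T : measurableType d) n (phi : T -> 'rV[R]_n) :
  (forall i, measurable_fun setT (fun x => phi x 0 i)) ->
  measurable_fun setT (phi : T -> borelRn R n).
Proof.
move=> mphi.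
apply: (@measurability _ _ T (borelRn R n) setT _ (@open 'rV[R]_n)) => //.
move=> _ [U oU <-]; rewrite setTI (open_bigcup_box oU) preimage_bigcup.
rewrite bigcup_mkcond; apply: countable_bigcupT_measurable => [|p].
  exact: countableP.
case: ifPn => // _.
rewrite [X in measurable X](_ : _ = \bigcap_(i in [set: 'I_n])
  ((fun x => phi x 0 i) @^-1` `[(map_mx ratr p.1 : 'rV[R]_n) 0 i,
     (map_mx ratr p.2 : 'rV[R]_n) 0 i]%classic)).
  apply: fin_bigcap_measurable => // i _; rewrite -[X in measurable X]setTI.
  exact: mphi.
apply/seteqP; split => [x h i _|x h i] /=; first by rewrite in_itv/=; exact: h.
by have := h i I; rewrite /= in_itv.
Qed.

End borel_maps.

Section borel_sub_lebesgue.
Context {R : realType}.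
Local Open Scope ereal_scope.

(** A hyperplane cuts every box of a cover into two boxes whose volumes add up.
    Since half-spaces generate the Borel sets, these are Lebesgue measurable. *)
Lemma halfspace_caratheodory n (i : 'I_n) (c : R) :
  (lebesgue_outer (n := n)).-caratheodory [set x : 'rV[R]_n | (x 0 i <= c)%R].
Proof.
apply: (@le_caratheodory_measurable R 'rV[R]_n (lebesgue_outer (n := n))) => X.
apply: le_ereal_inf_tmp => _ [C [cC XC] <-].
pose lo (ab : 'rV[R]_n * 'rV[R]_n) : 'rV[R]_n * 'rV[R]_n :=
  (ab.1, \row_j (if j == i then Num.min (ab.2 0 j) c else ab.2 0 j)%R).
pose hi (ab : 'rV[R]_n * 'rV[R]_n) : 'rV[R]_n * 'rV[R]_n :=
  (\row_j (if j == i then Num.max (ab.1 0 j) c else ab.1 0 j)%R, ab.2).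
have volE ab : (box_volume ab)%:E = (box_volume (lo ab))%:E + (box_volume (hi ab))%:E.
  rewrite -EFinD; congr EFin; rewrite /box_volume.
  rewrite (bigD1 i)//= [in X in _ = (X + _)%R](bigD1 i)//=.
  rewrite [in X in _ = (_ + X)%R](bigD1 i)//= !mxE eqxx.
  have E (F : 'I_n -> R) : (forall j, j != i -> F j = Num.max 0 (ab.2 0 j - ab.1 0 j))%R ->
      (\prod_(j < n | j != i) F j =
       \prod_(j < n | j != i) Num.max 0 (ab.2 0 j - ab.1 0 j))%R.
    by move=> h; apply: eq_bigr.
  rewrite (E (fun j => Num.max 0 ((lo ab).2 0 j - ab.1 0 j))%R); last first.
    by move=> j /negbTE ji; rewrite mxE ji.
  rewrite (E (fun j => Num.max 0 (ab.2 0 j - (hi ab).1 0 j))%R); last first.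
    by move=> j /negbTE ji; rewrite mxE ji.
  rewrite -mulrDl; congr (_ * _)%R.
  rewrite /Num.max /Num.min; do ! case: ifPn; lra.
have esumle (g : 'rV[R]_n * 'rV[R]_n -> 'rV[R]_n * 'rV[R]_n) (Y : set 'rV[R]_n) :
   (forall x ab, Y x -> C ab -> box ab x -> box (g ab) x) ->
   lebesgue_outer (X `&` Y) <= \esum_(ab in C) (box_volume (g ab))%:E.
  move=> h.
  apply: (@le_trans _ _ (\esum_(ab in g @` C) (box_volume ab)%:E)).
    apply: ereal_inf_lbound; exists (g @` C) => //; split.
      exact: sub_countable (card_image_le _ _) cC.
    move=> x [/XC [ab Cab abx] Yx]; exists (g ab); first by exists ab.
    exact: h.
  apply: ge_ereal_sup => _ [F [finF FC] <-].
  have hx x : exists y, F x -> C y /\ g y = x.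
    have [/FC[y Cy <-]|] := pselect (F x); first by exists y.
    by exists x.
  have [k hk] := choice hx; pose s := k @` F.
  have sC : s `<=` C by move=> _ [x Fx <-]; have [] := hk _ Fx.
  have sF : set_bij s F g.
    split => [_ [x Fx <-]|_ _ /set_mem[x Fx <-] /set_mem[y Fy <-]|x Fx].
    - by have [_ ->] := hk _ Fx.
    - by have [_ ->] := hk _ Fx; have [_ ->] := hk _ Fy => ->.
    - by exists (k x); [exists x|have [] := hk _ Fx].
  have -> : \sum_(x \in F) (box_volume x)%:E = \sum_(x \in s) (box_volume (g x))%:E.
    exact: (reindex_fsbig g s F).
  by apply: esum_ge; exists s => //; split => //; exact: finite_image.
under eq_esum do rewrite volE.
rewrite esumD; [|move=> *; exact: box_volume_ge0..].
apply: leeD; apply: esumle.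
  move=> x ab /= xc _ abx j; rewrite /= mxE; have := abx j.
  by case: ifPn => // /eqP ->; rewrite le_min xc andbT.
move=> x ab /= /negP; rewrite -ltNge => /ltW xc _ abx j; rewrite /= mxE; have := abx j.
by case: ifPn => // /eqP ->; rewrite ge_max xc andbT.
Qed.
End borel_sub_lebesgue.

Section lebesgue_borel.
Context {R : realType}.
Local Open Scope ereal_scope.

Lemma measurable_idfun_leb_borel n :
  measurable_fun [set: lebRn R n] (idfun : lebRn R n -> borelRn R n).
Proof.
apply: (@measurable_into_borel _ _ (lebRn R n)) => i.
apply: (measurability _ (RGenOInfty.measurableE R)) => _ [_ [c ->] <-].
rewrite setTI (_ : _ @^-1` _ = ~` [set x : 'rV[R]_n | (x 0 i <= c)%R]).
  apply: measurableC; exact: halfspace_caratheodory.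
apply/seteqP; split => x /=; rewrite in_itv/= andbT.
  by move=> cx; apply/negP; rewrite -ltNge.
by move=> /negP; rewrite -ltNge.
Qed.

Lemma borel_lebesgue_measurable n (A : set (borelRn R n)) :
  measurable A -> measurable (A : set (lebRn R n)).
Proof.
move=> mA; have := @measurable_idfun_leb_borel n measurableT _ mA.
by rewrite setTI.
Qed.

(** Densities of families of curves are Borel functions; on the Borel
    sigma-algebra products and Fubini's theorem are at hand. *)
Definition lebB n : set (borelRn R n) -> \bar R := @lebesgue_outer R n.

Let lebB0 n : @lebB n set0 = 0. Proof. exact: lebesgue_outer0. Qed.
Let lebB_ge0 n A : 0 <= @lebB n A. Proof. exact: lebesgue_outer_ge0. Qed.
Let lebB_sigma_additive n : semi_sigma_additive (@lebB n).
Proof.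
move=> F mF tF mUF.
apply: (@measure_semi_sigma_additive _ (lebRn R n) R (lebesgueRn n)) => //.
  by move=> k; exact: borel_lebesgue_measurable.
exact: borel_lebesgue_measurable.
Qed.

HB.instance Definition _ n := isMeasure.Build _ _ _ (@lebB n)
  (@lebB0 n) (@lebB_ge0 n) (@lebB_sigma_additive n).

Lemma measurable_borel_leb n (g : 'rV[R]_n -> \bar R) :
  measurable_fun [set: borelRn R n] (g : borelRn R n -> \bar R) ->
  measurable_fun [set: lebRn R n] (g : lebRn R n -> \bar R).
Proof.
move=> mg _ Y mY; have := mg measurableT Y mY.
exact: borel_lebesgue_measurable.
Qed.

Lemma lebB_box n ab : @lebB n (box ab) <= (box_volume ab)%:E.
Proof.
apply: ereal_inf_lbound; exists [set ab]; last first.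
  by rewrite esum_set1// box_volume_ge0.
by split; [exact: countable1|move=> x abx; exists ab].
Qed.

Lemma integral_lebB n (g : 'rV[R]_n -> \bar R) :
  measurable_fun [set: borelRn R n] (g : borelRn R n -> \bar R) ->
  (forall x, 0 <= g x) ->
  \int[lebesgueRn n]_x g x = \int[@lebB n]_x g x.
Proof.
move=> mg g0.
have H := @ge0_integral_pushforward _ _ (lebRn R n) (borelRn R n) R idfun
  (@measurable_idfun_leb_borel n) (lebesgueRn n) setT g measurableT mg (fun x _ => g0 x).
rewrite preimage_setT in H; apply: (eq_trans (esym H)).
exact: (@eq_measure_integral _ (borelRn R n) R setT (@lebB n) _ g
  (fun _ _ _ => erefl)).
Qed.

Lemma countable_esum_enum (T : choiceType) (x0 : T) (C : set T) : countable C ->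
  exists (e : nat -> T) (P : pred nat), C = e @` [set k | P k] /\
    forall a : T -> \bar R, (forall x, 0 <= a x) ->
      \esum_(x in C) a x = \sum_(k <oo | P k) a (e k).
Proof.
move=> /countable_injP[f finj].
have hx k : exists x, (f @` C) k -> C x /\ f x = k.
  have [[x Cx <-]|] := pselect ((f @` C) k); first by exists x.
  by exists x0.
have [e he] := choice hx.
have ef x : C x -> e (f x) = x.
  move=> Cx; have [Ce fe] := he (f x) (ex_intro2 _ _ x Cx erefl).
  by apply: finj => //; rewrite inE.
pose P := [pred k | `[< (f @` C) k >]].
have PE : [set k | P k] = f @` C.
  by apply/seteqP; split => k /=; [move/asboolP|move=> h; apply/asboolP].
exists e, P; split.
  rewrite PE; apply/seteqP; split => [x Cx|_ [_ [x Cx <-] <-]].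
    by exists (f x); [exists x|exact: ef].
  by rewrite ef.
move=> a a0; rewrite nneseries_esum// PE.
apply: reindex_esum; split.
- by move=> _ [x Cx <-]; rewrite ef.
- move=> _ _ /set_mem[x Cx <-] /set_mem[y Cy <-].
  by rewrite !ef// => ->.
- by move=> x Cx; exists (f x); [exists x|exact: ef].
Qed.

End lebesgue_borel.

(** * Changes of variables *)

Section push.
Context {R : realType} d (X : measurableType d) (mu : {measure set X -> \bar R}).
Variables (n : nat) (h : X -> R) (phi : X -> 'rV[R]_n) (C : R).
Hypothesis mh : measurable_fun setT h.
Hypothesis h0 : forall x, 0 <= h x.
Hypothesis mphi : measurable_fun setT (phi : X -> borelRn R n).
Hypothesis C0 : 0 < C.
Hypothesis hbox : forall ab, (\int[mu]_x ((h x)%:E * (\1_(box ab) (phi x))%:E) <=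
  C%:E * (box_volume ab)%:E)%E.
Local Open Scope ereal_scope.

Let mind (B : set (borelRn R n)) : measurable B ->
  measurable_fun setT (fun x => (h x)%:E * (\1_B (phi x))%:E).
Proof.
move=> mB; apply/measurable_EFinP; apply: measurable_funM => //.
apply: (@measurableT_comp _ _ _ _ _ _ (\1_B : borelRn R n -> R)) => //.
Qed.

Let push_set (B : set (borelRn R n)) : measurable B ->
  \int[mu]_x ((h x)%:E * (\1_B (phi x))%:E) <= C%:E * @lebB R n B.
Proof.
move=> mB; rewrite -lee_pdivrMl//; apply: le_ereal_inf_tmp => _ [K [cK BK] <-].
rewrite lee_pdivrMl//.
have [e [P [KE ->//]]] := @countable_esum_enum R _ (0%R, 0%R) K cK; last first.
  by move=> x; exact: box_volume_ge0.
pose F k x := if P k then (h x)%:E * (\1_(box (e k)) (phi x))%:E else 0.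
have F0 k x : 0 <= F k x.
  by rewrite /F; case: ifPn => // _; rewrite mule_ge0// lee_fin//.
have mF k : measurable_fun setT (F k).
  by rewrite /F; case: (P k) => //; apply: mind; exact: measurable_box.
apply: (@le_trans _ _ (\int[mu]_x \sum_(k <oo) F k x)).
  apply: ge0_le_integral => //.
  - by move=> x _; rewrite mule_ge0// lee_fin//.
  - exact: mind.
  - by apply: ge0_emeasurable_sum => // k x _ _; exact: F0.
  move=> x _; rewrite indicE; case: (boolP (phi x \in B)) => [/set_mem Bx|_]; last first.
    by rewrite mule0 nneseries_ge0// => k _ _; exact: F0.
  have := BK _ Bx; rewrite KE => -[_ [k Pk <-] xk].
  rewrite mule1.
  apply: le_trans (nneseries_lim_ge k.+1 _); last by move=> *; exact: F0.
  rewrite big_nat_recr//= {2}/F Pk indicE mem_set// mule1 leeDr//.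
  by apply: sume_ge0 => j _; exact: F0.
rewrite integral_nneseries// -nneseriesZl//; last first.
  by move=> *; exact: box_volume_ge0.
rewrite [leRHS]eseries_mkcond; apply: lee_nneseries => [k _ _|k _].
  by apply: integral_ge0 => x _; exact: F0.
by rewrite /F; case: (P k); rewrite ?integral0//; exact: hbox.
Qed.

Import HBNNSimple.

(** A measure that is at most C times the volume on boxes is at most C times
    Lebesgue measure, because Lebesgue measure is an infimum over covers by
    boxes. Every change of variables below is read off from this. *)
Lemma integral_push_le (g : 'rV[R]_n -> \bar R) :
  measurable_fun [set: borelRn R n] (g : borelRn R n -> \bar R) ->
  (forall x, 0 <= g x) ->
  \int[mu]_x ((h x)%:E * g (phi x)) <= C%:E * \int[@lebB R n]_y g y.
Proof.
move=> mg g0; pose g_ := nnsfun_approx (@measurableT _ (borelRn R n)) mg.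
have mgphi k : measurable_fun setT (fun x => (h x)%:E * (g_ k (phi x))%:E).
  apply/measurable_EFinP; apply: measurable_funM => //.
  by apply: (@measurableT_comp _ _ _ _ _ _ (g_ k)).
have nd x : {homo (fun k => g_ k x) : a b / (a <= b)%N >-> (a <= b)%R}.
  by move=> a b ab; exact/lefP/(nd_nnsfun_approx _ mg).
have gcvg x : (g_ k x)%:E @[k --> \oo] --> g x.
  by apply: cvg_nnsfun_approx => // y _; exact: g0.
have gle k x : (g_ k x)%:E <= g x.
  have ndE : nondecreasing_seq (fun k => (g_ k x)%:E).
    by move=> a b ab; rewrite lee_fin; exact: nd.
  have /cvg_lim <- := gcvg x => //.
  have /cvg_lim -> := ereal_nondecreasing_cvgn ndE => //.
  by apply: ereal_sup_ubound; exists k.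
have -> : \int[mu]_x ((h x)%:E * g (phi x)) =
    limn (fun k => \int[mu]_x ((h x)%:E * (g_ k (phi x))%:E)).
  rewrite -monotone_convergence//; last first.
  - by move=> x _ a b ab; rewrite lee_wpmul2l// lee_fin//; exact: nd.
  - by move=> k x _; rewrite mule_ge0// lee_fin.
  by apply: eq_integral => x _; apply/esym/cvg_lim => //; exact: cvgeZl.
apply: lime_le.
  apply: ereal_nondecreasing_is_cvgn => a b ab; apply: ge0_le_integral => //.
  - by move=> x _; rewrite mule_ge0// lee_fin.
  - by move=> x _; rewrite lee_wpmul2l// lee_fin//; exact: nd.
apply: nearW => k.
apply: (@le_trans _ _ (C%:E * \int[@lebB R n]_y (g_ k y)%:E)); last first.
  apply: lee_wpmul2l; first by rewrite lee_fin ltW.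
  apply: ge0_le_integral => //.
  - by move=> y _; rewrite lee_fin.
  - by apply/measurable_EFinP; exact: measurable_funP.
rewrite integral_nnsfun// patch_setT sintegralE.
have mf r : measurable (g_ k @^-1` [set r]) by exact: measurable_sfunP.
under eq_integral => x _.
  rewrite fimfunE -fsumEFin// ge0_mule_fsumr; last first.
    by move=> r; rewrite /= EFinM nnfun_muleindic_ge0.
  over.
rewrite ge0_integral_fsum//; last 2 first.
- move=> r /=; under eq_fun do rewrite /= EFinM muleCA -EFinM.
  apply/measurable_EFinP; apply: measurable_funM => //.
  by apply/measurable_EFinP; exact: mind.
- move=> r x _; apply: mule_ge0; first by rewrite lee_fin.
  by rewrite EFinM nnfun_muleindic_ge0.
rewrite ge0_mule_fsumr; last first.
  move=> r; have [r0|r0] := leP 0%R r; first by rewrite mule_ge0.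
  by rewrite preimage_nnfun0// measure0 mule0.
rewrite !fsbig_finite//; apply: lee_sum => r _.
have [r0|r0] := leP 0%R r; last first.
  rewrite preimage_nnfun0// measure0 !mule0 integral0_eq// => x _.
  by rewrite indic0 mulr0 mule0.
under eq_integral do rewrite EFinM muleCA.
rewrite ge0_integralZl//; last 2 first.
- exact: mind.
- by move=> x _; rewrite mule_ge0// lee_fin.
rewrite muleCA lee_wpmul2l// ?lee_fin//.
exact: push_set.
Qed.
End push.

(** * The volume of cubes *)

Section cube.
Context {R : realType}.
Local Open Scope ereal_scope.
Local Notation mu := (@lebesgue_measure R).

Definition cube n (a b : R) : set 'rV[R]_n := box (const_mx a, const_mx b).

Lemma cubeP n (a b : R) (x : 'rV[R]_n) :
  cube a b x <-> forall i, (a <= x 0 i <= b)%R.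
Proof. by split=> h i; have := h i; rewrite /= !mxE. Qed.

Let tailv n (x : 'rV[R]_n.+1) : 'rV[R]_n := (\row_i x 0 (lift ord0 i))%R.
Let tail n (ab : 'rV[R]_n.+1 * 'rV[R]_n.+1) := (tailv ab.1, tailv ab.2).

Let box_volume_tail n (ab : 'rV[R]_n.+1 * 'rV[R]_n.+1) :
  box_volume ab =
  (Num.max 0 (ab.2 0 ord0 - ab.1 0 ord0) * box_volume (tail ab))%R.
Proof.
rewrite /box_volume big_ord_recl; congr (_ * _)%R.
by apply: eq_bigr => i _; rewrite /= !mxE.
Qed.

Lemma mu_itvcc (a b : R) : mu `[a, b]%classic = (Num.max 0 (b - a))%:E.
Proof.
rewrite lebesgue_measure_itv/= lte_fin; case: ltP => ab.
  by rewrite max_r// subr_ge0 ltW.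
by rewrite max_l// subr_le0.
Qed.

(** Slicing: for each first coordinate in [a, b] the slices of a cover of the
    cube cover a cube of one dimension less. *)
Lemma lebesgue_outer_cube n (a b : R) : (a <= b)%R ->
  ((b - a) ^+ n)%:E <= lebesgue_outer (cube (n := n) a b).
Proof.
move=> ab; elim: n => [|n IH].
  rewrite expr0; apply: le_ereal_inf_tmp => _ [K [cK cover] <-].
  have [k Kk _] : (\bigcup_(k in K) box k) (0%R : 'rV[R]_0).
    by apply: cover; apply/cubeP => -[].
  apply: le_trans (esum_ge _); last first.
    exists [set k]; first by split => // _ ->.
    exact: lexx.
  by rewrite fsbig_set1 /box_volume big_ord0.
apply: le_ereal_inf_tmp => _ [K [cK cover] <-].
have [e [P [KE ->]]] := @countable_esum_enum R _ (0%R, 0%R) K cK; last first.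
  by move=> x; exact: box_volume_ge0.
pose I k := `[((e k).1 0 ord0)%R, ((e k).2 0 ord0)%R]%classic.
pose f k (t : R) := if P k then (box_volume (tail (e k)))%:E * (\1_(I k) t)%:E else 0.
have f0 k t : 0 <= f k t.
  by rewrite /f; case: ifPn => // _; rewrite mule_ge0 ?lee_fin ?box_volume_ge0// -lee_fin box_volume_ge0.
have mf k : measurable_fun setT (f k).
  rewrite /f; case: (P k) => //; apply: emeasurable_funM => //.
  by apply/measurable_EFinP; apply: measurable_indic; exact: measurable_itv.
apply: (@le_trans _ _ (\int[mu]_(t in `[a, b]) ((b - a) ^+ n)%:E)).
  by rewrite integral_cst//= mu_itvcc exprSr EFinM max_r// subr_ge0.
apply: (@le_trans _ _ (\int[mu]_(t in `[a, b]) \sum_(k <oo) f k t)).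
  apply: ge0_le_integral => //.
  - by move=> t _; rewrite lee_fin exprn_ge0// subr_ge0.
  - apply: measurable_funTS.
    by apply: (@ge0_emeasurable_sum _ _ _ setT f xpredT) => // k _; exact: mf.
  move=> t; rewrite /= in_itv/= => tab.
  pose F k : set 'rV[R]_n := if P k && (t \in I k) then box (tail (e k)) else set0.
  apply: (le_trans IH); apply: (@le_trans _ _ (lebesgue_outer (\bigcup_k F k))).
    apply: le_lebesgue_outer => x /cubeP xab.
    have : cube a b (\row_i (if unlift ord0 i is Some j then x 0 j else t))%R.
      by apply/cubeP => i; rewrite mxE; case: unliftP => [j _|_].
    move=> /cover; rewrite KE => -[_ [k /= Pk <-] xk]; exists k => //.
    have tI : t \in I k.
      by rewrite inE /I/= in_itv/=; have := xk ord0; rewrite mxE unlift_none.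
    rewrite /F Pk tI => i; have := xk (lift ord0 i).
    by rewrite /= !mxE liftK.
  apply: le_trans (lebesgue_outer_sigma_subadditive _) _.
  apply: lee_nneseries => [k _ _|k _]; first exact: lebesgue_outer_ge0.
  rewrite /F /f; case: (P k) => /=; last by rewrite lebesgue_outer0.
  rewrite indicE; case: (t \in I k); rewrite ?mule1 ?mule0 ?lebesgue_outer0//.
  exact: lebB_box.
rewrite integral_nneseries//; last first.
  by move=> k; apply: measurable_funTS; exact: mf.
rewrite [leRHS]eseries_mkcond; apply: lee_nneseries => [k _ _|k _].
  by apply: integral_ge0 => t _; exact: f0.
apply: (@le_trans _ _ (\int[mu]_t f k t)).
  by apply: ge0_subset_integral => //; exact: mf.
rewrite /f; case: (P k); last by rewrite integral0.
rewrite ge0_integralZl//; first last.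
- exact: box_volume_ge0.
- by apply/measurable_EFinP; apply: measurable_indic; exact: measurable_itv.
rewrite integral_indic//=; last exact: measurable_itv.
by rewrite [_ `&` _]setIT mu_itvcc -EFinM box_volume_tail mulrC.
Qed.

Lemma cube_volume n (a b : R) : (a <= b)%R ->
  box_volume (const_mx a : 'rV_n, const_mx b) = ((b - a) ^+ n)%R.
Proof.
move=> ab; rewrite /box_volume; under eq_bigr do rewrite /= !mxE max_r ?subr_ge0//.
by rewrite prodr_const card_ord.
Qed.

Lemma lebB_cube n (a b : R) : (a <= b)%R ->
  @lebB R n (cube a b) = ((b - a) ^+ n)%:E.
Proof.
move=> ab; apply/eqP; rewrite eq_le lebesgue_outer_cube// andbT.
by apply: le_trans (lebB_box _) _; rewrite cube_volume.
Qed.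

Lemma measurable_cube n (a b : R) : measurable (cube a b : set (borelRn R n)).
Proof. exact: measurable_box. Qed.

Let lebB_sigma_finite n : sigma_finite setT (@lebB R n).
Proof.
exists (fun k => cube (- k%:R)%R k%:R).
  apply/esym/seteqP; split => // x _.
  have [k xk] : exists k, forall i, (`|(x : 'rV[R]_n) 0 i| <= k%:R)%R.
    have [k kx] : exists k : nat, (`|(x : 'rV[R]_n)| < k%:R)%R.
      by exists (Num.truncn `|(x : 'rV[R]_n)|).+1; exact: truncnS_gt.
    exists k => i; apply: le_trans (ltW kx).
    rewrite [leRHS]/Num.norm /= mx_normrE; apply/bigmax_geP; right => /=.
    by exists (ord0, i).
  by exists k => //; apply/cubeP => i; rewrite -ler_norml.
move=> k; split; first exact: measurable_cube.
by rewrite /= [ltLHS]lebB_cube ?ltry// lerNl (le_trans _ (ler0n _ _))// oppr_le0.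
Qed.

HB.instance Definition _ n :=
  @Measure_isSigmaFinite.Build _ _ _ (@lebB R n) (@lebB_sigma_finite n).

End cube.

(** * Integrals on the line and on products *)

Section calculus.
Context {R : realType}.
Local Notation mu := (@lebesgue_measure R).

Let powR_itv_le (n : nat) (e : R) : (0 < n)%N -> (0 < e < 1)%R ->
  (\int[mu]_(s in `[e, 1%R]) (s `^ (n%:R^-1 - 1))%:E <= n%:R%:E)%E.
Proof.
move=> n0 /andP[e0 e1].
have nV0 : (0 < n%:R^-1 :> R)%R by rewrite invr_gt0 ltr0n.
have der (x : R) : (0 < x)%R ->
    is_derive x 1 (fun s => n%:R * s `^ n%:R^-1)%R (x `^ (n%:R^-1 - 1))%R.
  move=> x0; have := is_deriveZ n%:R (is_derive1_powR n%:R^-1 x0).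
  by rewrite scalerA mulfV ?scale1r// pnatr_eq0 -lt0n.
have cont (a x : R) : (0 < x)%R -> {for x, continuous (fun s => s `^ a)%R}.
  move=> x0; apply/differentiable_continuous/derivable1_diffP.
  by have [] := is_derive1_powR a x0.
rewrite (@continuous_FTC2 _ _ (fun s => n%:R * s `^ n%:R^-1)%R) //.
- rewrite powR1 mulr1 -EFinB lee_fin lerBlDr lerDl.
  by rewrite mulr_ge0// powR_ge0.
- apply: continuous_in_subspaceT => x; rewrite inE/= in_itv/= => /andP[ex _].
  by apply: cont; exact: lt_le_trans ex.
- split => [x| |].
  + rewrite in_itv/= => /andP[ex _].
    by have [] := der x (lt_trans e0 ex).
  + apply: cvg_at_right_filter; apply: cvgM; first exact: cvg_cst.
    exact: cont.
  + apply: cvg_at_left_filter; apply: cvgM; first exact: cvg_cst.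
    exact: cont.
- move=> x; rewrite in_itv/= => /andP[ex _]; rewrite derive1E.
  by have [_ ->] := der x (lt_trans e0 ex).
Qed.

Local Open Scope ereal_scope.

Lemma integral_powR_root_le (n : nat) : (0 < n)%N ->
  \int[mu]_(s in `]0%R, 1%R]) (s `^ (n%:R^-1 - 1)%R)%:E <= n%:R%:E.
Proof.
move=> n0; pose F k : set R := `[(k.+2%:R^-1)%R, 1%R]%classic.
have mF k : measurable (F k) by exact: measurable_itv.
have -> : `]0%R, 1%R]%classic = \bigcup_k F k.
  apply/seteqP; split => [x|x [k _]]; rewrite /F /= !in_itv/=; last first.
    by move=> /andP[kx ->]; rewrite andbT (lt_le_trans _ kx)// invr_gt0 ltr0n.
  move=> /andP[x0 x1]; exists (Num.truncn x^-1) => //=; rewrite in_itv/= x1 andbT.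
  rewrite -[leRHS]invrK lef_pV2 ?posrE ?invr_gt0 ?ltr0n//.
  apply: le_trans (ltW (truncnS_gt _)) _.
  by rewrite ler_nat.
have nd : nondecreasing_seq F.
  move=> a b ab; rewrite subsetEset => x; rewrite /F /= !in_itv/= => /andP[ax ->].
  rewrite andbT; apply: le_trans ax; rewrite lef_pV2 ?posrE ?ltr0n//.
  by rewrite ler_nat !ltnS.
have mf k : measurable_fun (F k) (fun s : R => (s `^ (n%:R^-1 - 1)%R)%:E).
  by apply/measurable_EFinP; apply: measurable_funTS; exact: measurable_powR.
have f0 k x : F k x -> 0 <= (x `^ (n%:R^-1 - 1))%:E.
  by move=> _; rewrite lee_fin powR_ge0.
have cv := @ge0_nondecreasing_set_cvg_integral _ (measurableTypeR R) R F _ mu nd mF mf f0.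
rewrite -(cvg_lim _ cv)//; apply: lime_le.
  by apply/cvg_ex; eexists; exact: cv.
apply: nearW => k; apply: powR_itv_le => //.
by rewrite invr_gt0 ltr0n invf_lt1 ?ltr0n// ltr1n.
Qed.

Lemma fubini_tonelli_on d1 d2 (T1 : measurableType d1) (T2 : measurableType d2)
  (m1 : {sigma_finite_measure set T1 -> \bar R})
  (m2 : {sigma_finite_measure set T2 -> \bar R})
  (A : set T1) (B : set T2) (f : T1 -> T2 -> \bar R) :
  measurable A -> measurable B ->
  measurable_fun setT (fun z : T1 * T2 => f z.1 z.2) ->
  (forall x y, 0 <= f x y) ->
  \int[m1]_(x in A) \int[m2]_(y in B) f x y =
  \int[m2]_(y in B) \int[m1]_(x in A) f x y.
Proof.
move=> mA mB mf f0.
pose g (z : T1 * T2) := (\1_A z.1)%:E * ((\1_B z.2)%:E * f z.1 z.2).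
have g0 z : 0 <= g z by rewrite !mule_ge0// lee_fin.
have mg : measurable_fun setT g.
  apply: emeasurable_funM; last apply: emeasurable_funM => //.
  - apply/measurable_EFinP.
    by apply: (@measurableT_comp _ _ _ _ _ _ (\1_A : T1 -> R)).
  - apply/measurable_EFinP.
    by apply: (@measurableT_comp _ _ _ _ _ _ (\1_B : T2 -> R)).
have indE d (T : measurableType d) (m : {measure set T -> \bar R}) (D : set T)
    (h : T -> \bar R) : \int[m]_(x in D) h x = \int[m]_x ((\1_D x)%:E * h x).
  rewrite integral_mkcond; apply: eq_integral => x _.
  by rewrite patchE indicE; case: ifPn; rewrite ?mul1e ?mul0e.
have mf1 x : measurable_fun setT (f x).
  exact: (measurableT_comp mf (pair1_measurable x)).
have mf2 y : measurable_fun setT (f ^~ y).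
  exact: (measurableT_comp mf (pair2_measurable y)).
have := @fubini_tonelli _ _ _ _ R m1 m2 g mg g0; rewrite /g/= => E.
rewrite indE [RHS]indE.
transitivity (\int[m1]_x \int[m2]_y ((\1_A x)%:E * ((\1_B y)%:E * f x y))).
  apply: eq_integral => x _; rewrite indE ge0_integralZl//.
  - by apply: emeasurable_funM => //; exact/measurable_EFinP/measurable_indic.
  - by move=> y _; rewrite mule_ge0// lee_fin.
rewrite E; apply: eq_integral => y _.
rewrite -ge0_integralZl//; last exact: measurable_funTS.
Qed.

Lemma integral_indicl d (T : measurableType d) (m : {measure set T -> \bar R})
    (D : set T) (h : T -> \bar R) :
  \int[m]_(x in D) h x = \int[m]_x ((\1_D x)%:E * h x).
Proof.
rewrite integral_mkcond; apply: eq_integral => x _.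
by rewrite patchE indicE; case: ifPn; rewrite ?mul1e ?mul0e.
Qed.

Lemma measurable_integral_on d1 d2 (T1 : measurableType d1) (T2 : measurableType d2)
  (m1 : {sigma_finite_measure set T1 -> \bar R}) (A : set T1) (f : T1 -> T2 -> \bar R) :
  measurable A -> measurable_fun setT (fun z : T1 * T2 => f z.1 z.2) ->
  (forall x y, 0 <= f x y) ->
  measurable_fun setT (fun y => \int[m1]_(x in A) f x y).
Proof.
move=> mA mf f0.
pose g (z : T1 * T2) := (\1_A z.1)%:E * f z.1 z.2.
have g0 z : 0 <= g z by rewrite mule_ge0// lee_fin.
have mg : measurable_fun setT g.
  apply: emeasurable_funM => //; apply/measurable_EFinP.
  by apply: (@measurableT_comp _ _ _ _ _ _ (\1_A : T1 -> R)).
under eq_fun do rewrite integral_indicl.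
apply: (@measurable_fun_fubini_tonelli_G _ _ _ _ R m1 g mg g0).
Qed.

(** The elementary substitute for Hoelder's inequality. *)
Lemma young_pow (a : \bar R) (k : R) (n : nat) : (0 < n)%N -> 0 <= a -> (0 < k)%R ->
  a <= k%:E + (k ^- n.-1)%:E * a ^+ n.
Proof.
move=> n0 a0 k0; have [ak|ak] := leP a k%:E.
  by rewrite (le_trans ak)// leeDl// mule_ge0// ?expe_ge0// lee_fin invr_ge0 exprn_ge0// ltW.
apply: (@le_trans _ _ ((k ^- n.-1)%:E * a ^+ n)); last first.
  by rewrite leeDr// lee_fin ltW.
case: a a0 ak => [r| |]//.
- rewrite !lee_fin lte_fin -EFin_expe -EFinM lee_fin => r0 kr.
  rewrite -[in leRHS](prednK n0) exprS mulrCA ler_peMr// mulrC ler_pdivlMr ?exprn_gt0// mul1r.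
  by rewrite lerXn2r ?nnegrE// ltW.
- move=> _ _; rewrite (_ : +oo ^+ n = +oo) ?gt0_muley ?lte_fin ?invr_gt0 ?exprn_gt0//.
  by case: n n0 => // n _; elim: n => // n IH; rewrite expeS IH mulyy.
Qed.

End calculus.

(** * Integrals along segments *)

Section segments.
Context {R : realType}.
Local Notation mu := (@lebesgue_measure R).
Local Notation lam := (@lebB R _).

(** Moving along a coordinate axis is the elementary step of the paths below:
    such a segment stays in a line on which Fubini's theorem can be applied. *)
Definition upd n (x : 'rV[R]_n) (i : 'I_n) (t : R) : 'rV[R]_n :=
  \row_k (if k == i then t else x 0 k).

Definition segcost n (rho : 'rV[R]_n -> \bar R) (x y : 'rV[R]_n) : \bar R :=
  (\int[mu]_(s in `[0%R, 1%R])
     (rho (x + s *: (y - x))%R * (enorm (y - x))%:E))%E.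

Lemma updE n (x : 'rV[R]_n) i t k :
  upd x i t 0 k = if k == i then t else x 0 k.
Proof. by rewrite mxE. Qed.

Lemma box_volume_upd n (a b : 'rV[R]_n) i (x y : R) :
  box_volume (upd a i x, upd b i y) =
  Num.max 0 (y - x) * \prod_(k < n | k != i) Num.max 0 (b 0 k - a 0 k).
Proof.
rewrite /box_volume (bigD1 i)//= !updE eqxx; congr (_ * _).
by apply: eq_bigr => k /negbTE ki; rewrite !updE ki.
Qed.

Lemma box_volumeD1 n (ab : 'rV[R]_n * 'rV[R]_n) i :
  box_volume ab = Num.max 0 (ab.2 0 i - ab.1 0 i) *
    \prod_(k < n | k != i) Num.max 0 (ab.2 0 k - ab.1 0 k).
Proof. by rewrite /box_volume (bigD1 i). Qed.

Lemma measurable_affine1 (x l : R) : measurable_fun setT (fun s : R => x + s * l).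
Proof.
apply: measurable_funD => //; exact: mulrr_measurable.
Qed.

Lemma measurable_aff_ind (x l a b : R) :
  measurable_fun setT (fun s : R => (\1_`[a, b] (x + s * l) : R)).
Proof.
apply: (@measurableT_comp _ _ _ _ _ _ (\1_`[a, b] : R -> R)).
  exact: measurable_indic.
exact: measurable_affine1.
Qed.

Lemma integral_affine_itv (x l a b : R) :
  (\int[mu]_s (`|l| * \1_`[a, b] (x + s * l))%:E <= (Num.max 0 (b - a))%:E)%E.
Proof.
have [->|l0] := eqVneq l 0.
  under eq_integral do rewrite normr0 mul0r.
  by rewrite integral0 lee_fin le_max lexx.
pose a' := if 0 < l then (a - x) / l else (b - x) / l.
pose b' := if 0 < l then (b - x) / l else (a - x) / l.
have E (s : R) : \1_`[a, b] (x + s * l) = \1_`[a', b'] s :> R.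
  rewrite !indicE; congr (nat_of_bool _)%:R.
  apply/idP/idP; rewrite !inE/= !in_itv/= /a' /b' => /andP[h1 h2].
    case: (ltgtP 0 l) l0 => // ll _.
      by rewrite ler_pdivrMr// ler_pdivlMr//; apply/andP; split; lra.
    by rewrite ler_ndivrMr// ler_ndivlMr//; apply/andP; split; lra.
  move: h1 h2; case: (ltgtP 0 l) l0 => // ll _.
    by rewrite ler_pdivrMr// ler_pdivlMr// => *; apply/andP; split; lra.
  by rewrite ler_ndivrMr// ler_ndivlMr// => *; apply/andP; split; lra.
under eq_integral do rewrite E EFinM.
rewrite ge0_integralZl//; last by apply/measurable_EFinP; exact: measurable_indic.
rewrite integral_indic//= [_ `&` _]setIT mu_itvcc -EFinM lee_fin.
rewrite maxr_pMr// mulr0 (_ : _ * (b' - a') = b - a)//.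
rewrite /a' /b'; case: (ltgtP 0 l) l0 => // ll _; last first.
  by rewrite ltr0_norm//; field; rewrite lt_eqF.
by rewrite gtr0_norm//; field; rewrite gt_eqF.
Qed.

Lemma measurable_upd d (T : measurableType d) n (f : T -> 'rV[R]_n) (i : 'I_n) (g : T -> R) :
  measurable_fun setT (f : T -> borelRn R n) -> measurable_fun setT g ->
  measurable_fun setT ((fun x => upd (f x) i (g x)) : T -> borelRn R n).
Proof.
move=> mf mg; apply: measurable_into_borel => k.
under eq_fun do rewrite updE; case: (k == i) => //.
exact: (measurableT_comp (measurable_coord k) mf).
Qed.

Lemma measurable_segment d (T : measurableType d) n (x y : T -> 'rV[R]_n) (s : T -> R) :
  measurable_fun setT (x : T -> borelRn R n) ->
  measurable_fun setT (y : T -> borelRn R n) -> measurable_fun setT s ->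
  measurable_fun setT ((fun z => x z + s z *: (y z - x z)) : T -> borelRn R n).
Proof.
move=> mx my ms; apply: measurable_into_borel => k.
have mxk := measurableT_comp (measurable_coord k) mx.
have myk := measurableT_comp (measurable_coord k) my.
under eq_fun do rewrite !mxE.
apply: measurable_funD => //; apply: measurable_funM => //.
exact: measurable_funB.
Qed.

Lemma measurable_addc n (c : 'rV[R]_n) :
  measurable_fun setT ((fun w => c + w) : borelRn R n -> borelRn R n).
Proof.
apply: measurable_into_borel => k; under eq_fun do rewrite mxE.
by apply: measurable_funD => //; exact: measurable_coord.
Qed.

Section slices.
Variables (n : nat) (rho : 'rV[R]_n -> \bar R).
Hypothesis mrho : measurable_fun setT (rho : borelRn R n -> \bar R).
Hypothesis rho0 : forall x, (0 <= rho x)%E.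

(** Fubini's theorem for the slices orthogonal to a coordinate axis, read off
    from the volume of boxes; sg = 1 or -1 is the direction in which t moves. *)
Lemma integral_slices_le (i : 'I_n) (o sg L : R) : `|sg| = 1 -> 0 < L ->
  (\int[mu]_t \int[lam]_(u in cube (- L) L) rho (upd u i (o + t * sg)) <=
   (2 * L)%:E * \int[lam]_x rho x)%E.
Proof.
move=> sg1 L0.
pose phi (z : R * borelRn R n) := upd z.2 i (o + z.1 * sg).
have mphi : measurable_fun setT (phi : _ -> borelRn R n).
  apply: measurable_upd; first exact: measurable_snd.
  exact: (measurableT_comp (measurable_affine1 o sg) measurable_fst).
pose h (z : R * borelRn R n) : R := \1_(cube (- L) L : set (borelRn R n)) z.2.
have mC : measurable (cube (- L) L : set (borelRn R n)) by exact: measurable_cube.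
have mh : measurable_fun setT h.
  by apply: (@measurableT_comp _ _ _ _ _ _ (\1_(cube (- L) L : set (borelRn R n)) : _ -> R)).
have h0 z : 0 <= h z by [].
have L20 : 0 < 2 * L by rewrite mulr_gt0.
have mF : measurable_fun setT (fun z => (h z)%:E * rho (phi z))%E.
  apply: emeasurable_funM; first exact/measurable_EFinP.
  exact: (measurableT_comp mrho mphi).
have F0 z : (0 <= (h z)%:E * rho (phi z))%E by rewrite mule_ge0// lee_fin.
have := @integral_push_le R _ _ (mu \x lam)%E n h phi (2 * L) mh h0 mphi L20.
move=> /(_ _ rho mrho rho0); rewrite fubini_tonelli1//.
rewrite /fubini_F /h /phi/= => H.
under eq_integral do rewrite integral_indicl.
apply: H => ab.
pose B : set (borelRn R n) := box (upd ab.1 i (- L), upd ab.2 i L).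
have mB : measurable B by exact: measurable_box.
have ind0 (T : Type) (A : set T) x : (0 <= (\1_A x : R)%:E)%E by rewrite lee_fin.
have mI t : measurable_fun setT
   (fun u : borelRn R n => (\1_(box ab) (upd u i (o + t * sg)) : R)).
  apply: (@measurableT_comp _ _ _ _ _ _ (\1_(box ab) : borelRn R n -> R)).
    by apply: measurable_indic; exact: measurable_box.
  by apply: measurable_upd => //; exact: measurable_id.
have step1 t : (\int[lam]_u ((\1_(cube (- L) L) u)%:E *
    (\1_(box ab) (upd u i (o + t * sg)))%:E) <=
    (\1_`[ab.1 0%R i, ab.2 0%R i] (o + t * sg))%:E * (box_volume (upd ab.1 i (- L), upd ab.2 i L))%:E)%E.
  apply: (@le_trans _ _ (\int[lam]_u ((\1_`[ab.1 0%R i, ab.2 0%R i] (o + t * sg))%:E * (\1_B u)%:E))%E).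
    apply: ge0_le_integral => //.
    - by apply/measurable_EFinP; apply: measurable_funM.
    - by apply/measurable_EFinP; apply: measurable_funM.
    move=> u _; rewrite -!EFinM lee_fin !indicE.
    case: (boolP (u \in _)) => [/set_mem/cubeP uC|_]; last by rewrite mul0r mulr_ge0.
    case: (boolP (upd _ _ _ \in _)) => [/set_mem ub|_]; last by rewrite mulr0 mulr_ge0.
    rewrite mem_set/= ?mul1r ?mem_set//.
      move=> k; rewrite /= !updE; case: eqP => [->//|/eqP/negbTE ki].
      by have := ub k; rewrite /= updE ki.
    by have := ub i; rewrite /= updE eqxx in_itv.
  rewrite ge0_integralZl//; last by apply/measurable_EFinP.
  by rewrite integral_indic// setIT lee_wpmul2l//; exact: lebB_box.
pose G (z : R * borelRn R n) := ((h z)%:E * (\1_(box ab) (phi z))%:E)%E.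
have mG : measurable_fun setT G.
  apply/measurable_EFinP; apply: measurable_funM => //.
  apply: (@measurableT_comp _ _ _ _ _ _ (\1_(box ab) : borelRn R n -> R)) => //.
  by apply: measurable_indic; exact: measurable_box.
have G0 z : (0 <= G z)%E by rewrite /G /h mule_ge0 ?ind0.
rewrite (@fubini_tonelli1 _ _ _ _ R mu lam G mG G0).
apply: (@le_trans _ _ (\int[mu]_t ((\1_`[ab.1 0%R i, ab.2 0%R i] (o + t * sg))%:E * (box_volume (upd ab.1 i (- L), upd ab.2 i L))%:E))%E).
  apply: ge0_le_integral => //.
  - by move=> t _; apply: integral_ge0 => u _; rewrite mule_ge0 ?ind0.
  - exact: measurable_fun_fubini_tonelli_F.
  - apply: emeasurable_funM => //; apply/measurable_EFinP.
    exact: measurable_aff_ind.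
  - by move=> t _; exact: step1.
rewrite ge0_integralZr//; last 2 first.
- by apply/measurable_EFinP; exact: measurable_aff_ind.
- by rewrite box_volume_ge0.
have H1 : (\int[mu]_t (\1_`[ab.1 0%R i, ab.2 0%R i] (o + t * sg))%:E <=
    (Num.max 0 (ab.2 0%R i - ab.1 0%R i))%:E)%E.
  apply: le_trans (integral_affine_itv o sg _ _); rewrite sg1.
  by under [leRHS]eq_integral do rewrite mul1r.
apply: le_trans (lee_wpmul2r _ H1) _; first exact: box_volume_ge0.
rewrite -!EFinM lee_fin box_volume_upd (box_volumeD1 ab i).
rewrite (_ : Num.max 0 (L - - L) = 2 * L); last by rewrite max_r; lra.
by rewrite mulrCA mulrA.
Qed.

End slices.
End segments.

(** * Random paths of small cost *)

Section costs.
Context {R : realType}.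
Local Notation mu := (@lebesgue_measure R).
Local Notation lam := (@lebB R _).
Variables (n : nat).
Implicit Types (x y c p : 'rV[R]_n).

Lemma enorm_le_sup m (x : 'rV[R]_m) (M : R) :
  (forall k, `|x 0 k| <= M) -> enorm x <= m%:R * M.
Proof.
case: m x => [|m] x xM; first by rewrite mul0r /enorm big_ord0 sqrtr0.
have M0 : 0 <= M by exact: le_trans (xM ord0).
rewrite -ler_sqr ?nnegrE ?enorm_ge0 ?mulr_ge0// enorm_sqr.
apply: (@le_trans _ _ (\sum_(i < m.+1) M ^+ 2)).
  apply: ler_sum => i _; rewrite -real_normK ?num_real//.
  by rewrite lerXn2r ?nnegrE.
rewrite sumr_const card_ord exprMn -[leLHS]mulr_natl ler_wpM2r ?sqr_ge0//.
by rewrite -natrX ler_nat -mulnn leq_pmull.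
Qed.

Lemma coord_le_norm m (x : 'rV[R]_m) i : `|x 0 i| <= `|x|.
Proof.
rewrite [leRHS]/Num.norm /= mx_normrE; apply/bigmax_geP; right => /=.
by exists (ord0, i).
Qed.

Lemma enorm_le_norm m (x : 'rV[R]_m) : enorm x <= m%:R * `|x|.
Proof. by apply: enorm_le_sup => k; exact: coord_le_norm. Qed.

Lemma coord_le_enorm m (x : 'rV[R]_m) i : `|x 0 i| <= enorm x.
Proof.
rewrite -sqrtr_sqr ler_wsqrtr// (bigD1 i)//= lerDl.
by apply: sumr_ge0 => j _; exact: sqr_ge0.
Qed.

Lemma norm_le_enorm m (x : 'rV[R]_m) : `|x| <= enorm x.
Proof.
rewrite [leLHS]/Num.norm /= mx_normrE; apply/bigmax_leP; split.
  exact: enorm_ge0.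
by move=> [j i] _ /=; rewrite ord1 coord_le_enorm.
Qed.

Lemma enorm_lip m (x y : 'rV[R]_m) : `|enorm x - enorm y| <= enorm (x - y).
Proof.
have h1 := enormD (x - y) y; have h2 := enormD (y - x) x.
rewrite subrK in h1; rewrite subrK -opprB enormN in h2.
by rewrite ler_norml; apply/andP; split; lra.
Qed.

Lemma enorm_continuous m : continuous (@enorm R m).
Proof.
move=> x A /nbhs_ballP[e /= e0 eA]; apply/nbhs_ballP.
exists (e / m.+1%:R) => [|y]; first by rewrite /= divr_gt0// ltr0n.
move=> xy; apply: eA; move: xy; rewrite -!ball_normE /= ltr_pdivlMr ?ltr0n// mulrC => xy.
apply: le_lt_trans (enorm_lip _ _) _; apply: le_lt_trans (enorm_le_norm _) _.
by apply: le_lt_trans xy; rewrite ler_wpM2r// ler_nat.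
Qed.

Lemma sub_continuous m (a : 'rV[R]_m) : continuous (fun v : 'rV[R]_m => v - a).
Proof.
move=> v; exact: (@cvgB _ _ _ (nbhs v) _ id (cst a) v a (@cvg_id _ _) (cvg_cst _)).
Qed.

Lemma enorm_sub_continuous m (a : 'rV[R]_m) : continuous (fun v : 'rV[R]_m => enorm (v - a)).
Proof.
move=> v; apply: (@continuous_comp _ _ _ (fun v : 'rV[R]_m => v - a) (@enorm R m)).
  exact: sub_continuous.
exact: enorm_continuous.
Qed.

Lemma norm_sub_continuous m (a : 'rV[R]_m) : continuous (fun v : 'rV[R]_m => `|v - a|).
Proof.
move=> v; apply: (@continuous_comp _ _ _ (fun v : 'rV[R]_m => v - a) (fun v : 'rV[R]_m => `|v|)).
  exact: sub_continuous.
exact: norm_continuous.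
Qed.

Lemma enorm_upd x i t : enorm (x - upd x i t) = `|x 0 i - t|.
Proof.
rewrite -sqrtr_sqr /enorm (bigD1 i)//= !mxE eqxx big1 ?addr0//.
by move=> k /negbTE ki; rewrite !mxE ki subrr expr0n.
Qed.

Lemma segment_upd x i t s :
  upd x i t + s *: (x - upd x i t) = upd x i (t + s * (x 0 i - t)).
Proof.
apply/rowP => k; rewrite !mxE; case: eqP => [->//|_].
by rewrite subrr mulr0 addr0.
Qed.

Definition affmap (al : 'rV[R]_n) (be : 'I_n -> R) (w : 'rV[R]_n) : 'rV[R]_n :=
  \row_k (al 0 k + be k * w 0 k).

Lemma measurable_affmap al be :
  measurable_fun setT (affmap al be : borelRn R n -> borelRn R n).
Proof.
apply: measurable_into_borel => k; under eq_fun do rewrite mxE.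
apply: measurable_funD => //; apply: measurable_funM => //.
exact: measurable_coord.
Qed.

Lemma integral_push_affmap al be (W : set (borelRn R n)) (g : 'rV[R]_n -> \bar R) :
  (forall k, 0 < be k) -> measurable W ->
  measurable_fun setT (g : borelRn R n -> \bar R) -> (forall x, (0 <= g x)%E) ->
  (\int[lam]_(w in W) g (affmap al be w) <=
   ((\prod_k be k)^-1)%:E * \int[lam]_x g x)%E.
Proof.
move=> be0 mW mg g0; rewrite integral_indicl.
have be0' : 0 < \prod_k be k by apply: prodr_gt0 => k _.
apply: (@integral_push_le R _ _ lam n (\1_W) (affmap al be)) => //.
- exact: measurable_affmap.
- by rewrite invr_gt0.
move=> ab.
pose ab' : 'rV[R]_n * 'rV[R]_n :=
  (\row_k ((ab.1 0 k - al 0 k) / be k), \row_k ((ab.2 0 k - al 0 k) / be k)).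
apply: (@le_trans _ _ (\int[lam]_w (\1_(box ab' : set (borelRn R n)) w)%:E)%E).
  apply: ge0_le_integral => //.
  - apply/measurable_EFinP; apply: measurable_funM => //.
    apply: (@measurableT_comp _ _ _ _ _ _ (\1_(box ab) : borelRn R n -> R)) => //.
      by apply: measurable_indic; exact: measurable_box.
    exact: measurable_affmap.
  - by apply/measurable_EFinP; apply: measurable_indic; exact: measurable_box.
  move=> w _; rewrite -EFinM lee_fin !indicE.
  case: (boolP (affmap _ _ _ \in _)) => [/set_mem wb|_]; last by rewrite mulr0.
  rewrite mulr1 (mem_set (A := box ab')) ?ler_nat ?leq_b1// => k; have := wb k.
  rewrite /= !mxE ler_pdivrMr// ler_pdivlMr// => /andP[h1 h2].
  by apply/andP; split; rewrite ?lerBlDl ?lerBrDl mulrC.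
rewrite integral_indic//; last exact: measurable_box.
rewrite setIT; apply: le_trans (lebB_box _) _; rewrite -EFinM lee_fin /box_volume.
rewrite -prodfV -big_split/= le_eqVlt; apply/orP; left; apply/eqP.
apply: eq_bigr => k _; rewrite !mxE -mulrBl mulrC maxr_pMr ?invr_ge0 ?ltW// mulr0.
by congr (Num.max _ (_ * _)); ring.
Qed.

Section density.
Variable rho : 'rV[R]_n -> \bar R.
Hypothesis mrho : measurable_fun setT (rho : borelRn R n -> \bar R).
Hypothesis rho0 : forall x, (0 <= rho x)%E.

(** The random displacement w ranges over this cube and is common to all
    vertices of a path, so that a translation costs no more than the mean of
    the density. *)
Definition W : set (borelRn R n) := cube (- 4^-1) 4^-1.

Lemma measurable_W : measurable W. Proof. exact: measurable_cube. Qed.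

Lemma lebB_W : @lebB R n W = (2^-1 ^+ n)%:E.
Proof. by rewrite lebB_cube; [congr (_ ^+ _)%:E; lra|lra]. Qed.

Lemma lebB_W_le1 : (@lebB R n W <= 1)%E.
Proof. by rewrite lebB_W lee_fin exprn_ile1//; lra. Qed.

Lemma measurable_seg (x y : borelRn R n -> 'rV[R]_n) :
  measurable_fun setT (x : _ -> borelRn R n) ->
  measurable_fun setT (y : _ -> borelRn R n) ->
  measurable_fun setT (fun z : R * borelRn R n =>
    rho (x z.2 + z.1 *: (y z.2 - x z.2))).
Proof.
move=> mx my; apply: (measurableT_comp mrho).
apply: (@measurable_segment R _ _ n (x \o snd) (y \o snd) fst) => //.
- exact: (measurableT_comp mx measurable_snd).
- exact: (measurableT_comp my measurable_snd).
Qed.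

Lemma measurable_segcost (x y : borelRn R n -> 'rV[R]_n) :
  measurable_fun setT (x : _ -> borelRn R n) ->
  measurable_fun setT (y : _ -> borelRn R n) ->
  measurable_fun setT (fun w : borelRn R n => segcost rho (x w) (y w)).
Proof.
move=> mx my.
apply: (@measurable_integral_on R _ _ (measurableTypeR R) (borelRn R n) mu
  `[0%R, 1%R]%classic
  (fun s w => rho (x w + s *: (y w - x w)) * (enorm (y w - x w))%:E)%E) => //; last first.
  by move=> s w; rewrite mule_ge0// lee_fin enorm_ge0.
apply: emeasurable_funM; first exact: measurable_seg.
apply/measurable_EFinP.
have me := continuous_borel_measurable (@enorm_continuous n).
apply: (measurableT_comp me); apply: measurable_into_borel => k.
have mxk := measurableT_comp (measurable_coord k) (measurableT_comp mx measurable_snd).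
have myk := measurableT_comp (measurable_coord k) (measurableT_comp my measurable_snd).
by under eq_fun do rewrite !mxE; exact: measurable_funB.
Qed.

(** Translating a random point: each intermediate position is a translate of
    Lebesgue measure. *)
Lemma cost_translate c c' :
  (\int[lam]_(w in W) segcost rho (c + w) (c' + w) <=
   (enorm (c' - c))%:E * \int[lam]_x rho x)%E.
Proof.
have E w : c' + w - (c + w) = c' - c by apply/rowP => k; rewrite !mxE; ring.
have sE w : segcost rho (c + w) (c' + w) = (\int[mu]_(s in `[0%R, 1%R])
    (rho (c + w + s *: (c' - c))%R * (enorm (c' - c))%:E))%E.
  by rewrite /segcost E.
under eq_integral do rewrite sE.
have mF : measurable_fun setT (fun z : borelRn R n * R =>
    (rho (c + z.1 + z.2 *: (c' - c)) * (enorm (c' - c))%:E)%E).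
  apply: emeasurable_funM => //; apply: (measurableT_comp mrho).
  apply: measurable_into_borel => k; under eq_fun do rewrite !mxE.
  apply: measurable_funD.
    apply: measurable_funD => //.
    exact: (measurableT_comp (measurable_coord k) measurable_fst).
  by apply: measurable_funM.
rewrite (@fubini_tonelli_on R _ _ _ _ lam mu W `[0%R, 1%R]%classic
   (fun w s => rho (c + w + s *: (c' - c)) * (enorm (c' - c))%:E)%E) //; last 2 first.
- exact: measurable_W.
- by move=> w s; rewrite mule_ge0// lee_fin enorm_ge0.
apply: (@le_trans _ _ (\int[mu]_(s in `[0%R, 1%R]) ((enorm (c' - c))%:E * \int[lam]_x rho x))%E).
  apply: ge0_le_integral => //.
  - move=> s _; apply: integral_ge0 => w _.
    by rewrite mule_ge0// lee_fin enorm_ge0.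
  - apply: (@measurable_funTS _ _ (measurableTypeR R)).
    apply: (@measurable_integral_on R _ _ (borelRn R n) (measurableTypeR R) lam W
      (fun w s => rho (c + w + s *: (c' - c)) * (enorm (c' - c))%:E)%E) => //.
      exact: measurable_W.
    by move=> w s; rewrite mule_ge0// lee_fin enorm_ge0.
  move=> s _.
  have mW := measurable_W.
  have e0 : (0 <= (enorm (c' - c))%:E)%E by rewrite lee_fin enorm_ge0.
  have mr : measurable_fun W (fun w : borelRn R n => rho (c + w + s *: (c' - c))).
    apply: measurable_funTS; apply: (measurableT_comp mrho).
    apply: measurable_into_borel => k; under eq_fun do rewrite !mxE.
    by apply: measurable_funD => //; apply: measurable_funD => //; exact: measurable_coord.
  rewrite ge0_integralZr//.
  rewrite muleC lee_wpmul2l// ?lee_fin ?enorm_ge0//.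
  have := @integral_push_affmap (c + s *: (c' - c)) (fun=> 1) W rho (fun=> ltr01)
    measurable_W mrho rho0.
  rewrite big1// invr1 mul1e; apply: le_trans.
  rewrite le_eqVlt; apply/orP; left; apply/eqP; apply: eq_integral => w _.
  by congr rho; apply/rowP => k; rewrite !mxE; ring.
by rewrite integral_cst//= mu_itvcc subr0 max_r// mule1.
Qed.

(** Moving a random point along one coordinate axis. The length of the segment
    is the Jacobian of the sweep. *)
Lemma cost_move c i t :
  (\int[lam]_(w in W) segcost rho (upd (c + w) i t) (c + w) <=
   \int[lam]_x rho x)%E.
Proof.
have E w s : (rho (upd (c + w) i t + s *: (c + w - upd (c + w) i t)) *
    (enorm (c + w - upd (c + w) i t))%:E =
   (`|c 0%R i + w 0%R i - t|)%:E * rho (upd (c + w) i (t + s * (c 0%R i + w 0%R i - t))))%E.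
  by rewrite segment_upd enorm_upd muleC !mxE.
have sE w : segcost rho (upd (c + w) i t) (c + w) = (\int[mu]_(s in `[0%R, 1%R])
    ((`|c 0%R i + w 0%R i - t|)%:E *
     rho (upd (c + w) i (t + s * (c 0%R i + w 0%R i - t))%R)))%E.
  by rewrite /segcost; apply: eq_integral => s _; exact: E.
under eq_integral do rewrite sE.
pose l (w : borelRn R n) := c 0 i + (w : 'rV_n) 0 i - t.
have ml : measurable_fun setT l.
  by apply: measurable_funB => //; apply: measurable_funD => //; exact: measurable_coord.
pose I01 : set R := `[0%R, 1%R]%classic.
pose h (z : R * borelRn R n) : R := \1_I01 z.1 * (\1_W z.2 * `|l z.2|).
pose phi (z : R * borelRn R n) : 'rV[R]_n := upd (c + z.2) i (t + z.1 * l z.2).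
have mind2 (A : set (borelRn R n)) : measurable A ->
    measurable_fun setT (fun z : R * borelRn R n => (\1_A z.2 : R)).
  by move=> mA; apply: (@measurableT_comp _ _ _ _ _ _ (\1_A : borelRn R n -> R)).
have ml2 : measurable_fun setT (fun z : R * borelRn R n => l z.2).
  exact: (measurableT_comp ml measurable_snd).
have mh : measurable_fun setT h.
  apply: measurable_funM.
    by apply: (@measurableT_comp _ _ _ _ _ _ (\1_I01 : R -> R)) => //;
      apply: measurable_indic; exact: measurable_itv.
  apply: measurable_funM; first by apply: mind2; exact: measurable_W.
  exact: measurableT_comp.
have h0 z : 0 <= h z by rewrite !mulr_ge0.
have mphi : measurable_fun setT (phi : _ -> borelRn R n).
  apply: measurable_upd.
    exact: (measurableT_comp (measurable_addc c) measurable_snd).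
  by apply: measurable_funD => //; apply: measurable_funM.
have mF (g : 'rV[R]_n -> \bar R) : measurable_fun setT (g : borelRn R n -> \bar R) ->
    measurable_fun setT (fun z => (h z)%:E * g (phi z))%E.
  move=> mg; apply: emeasurable_funM; first exact/measurable_EFinP.
  exact: (measurableT_comp mg mphi).
have F0 (g : 'rV[R]_n -> \bar R) : (forall x, 0 <= g x)%E ->
    forall z, (0 <= (h z)%:E * g (phi z))%E.
  by move=> g0 z; rewrite mule_ge0// lee_fin.
have := @integral_push_le R _ _ (mu \x lam)%E n h phi 1 mh h0 mphi ltr01.
move=> /(_ _ rho mrho rho0); rewrite mul1e (@fubini_tonelli2 _ _ _ _ R mu lam _ (mF _ mrho) (F0 _ rho0)).
move=> H; rewrite integral_indicl; apply: le_trans (H _) => {H}.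
  rewrite le_eqVlt; apply/orP; left; apply/eqP; apply: eq_integral => w _.
  rewrite [in LHS]integral_indicl /fubini_G -ge0_integralZl//=; last 2 first.
  - apply: emeasurable_funM.
      by apply/measurable_EFinP; apply: measurable_indic; exact: measurable_itv.
    apply: emeasurable_funM => //.
    exact: (measurableT_comp mrho (measurableT_comp mphi (pair2_measurable w))).
  - by move=> s _; rewrite !mule_ge0// lee_fin.
  apply: eq_integral => s _; rewrite /h /phi /l/= !EFinM -!muleA.
  by rewrite muleCA.
move=> ab.
pose B : set (borelRn R n) := box (upd (ab.1 - c) i (- 4^-1), upd (ab.2 - c) i 4^-1).
have mB : measurable B by exact: measurable_box.
pose g x : \bar R := (\1_(box ab) x)%:E.
have mg : measurable_fun setT (g : borelRn R n -> \bar R).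
  by apply/measurable_EFinP; apply: measurable_indic; exact: measurable_box.
have g0 x : (0 <= g x)%E by rewrite lee_fin.
rewrite (@fubini_tonelli2 _ _ _ _ R mu lam _ (mF _ mg) (F0 _ g0)).
apply: (@le_trans _ _ (\int[lam]_w ((\1_B w)%:E * (Num.max 0 (ab.2 0 i - ab.1 0 i))%:E))%E).
  apply: ge0_le_integral => //.
  - by move=> w _; apply: integral_ge0 => s _; exact: F0.
  - exact: (@measurable_fun_fubini_tonelli_G _ _ (measurableTypeR R) (borelRn R n) R mu _ (mF _ mg) (F0 _ g0)).
  - by apply: emeasurable_funM => //; apply/measurable_EFinP; exact: measurable_indic.
  move=> w _; rewrite /fubini_G.
  apply: (@le_trans _ _ (\int[mu]_s ((\1_B w)%:E * (`|l w| * \1_`[ab.1 0%R i, ab.2 0%R i] (t + s * l w))%:E))%E).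
    apply: ge0_le_integral => //.
    - by move=> s _; exact: (F0 _ g0).
    - exact: (measurableT_comp (mF _ mg) (pair2_measurable w)).
    - apply: emeasurable_funM => //; apply/measurable_EFinP.
      by apply: measurable_funM => //; exact: measurable_aff_ind.
    move=> s _; rewrite /g /h /phi -!EFinM lee_fin/= !indicE.
    case: (boolP (s \in I01)) => [_|_]; last by rewrite !mul0r !mulr_ge0.
    case: (boolP (w \in W)) => [/set_mem/cubeP wW|_]; last by rewrite mul0r mulr0 mul0r !mulr_ge0.
    case: (boolP (upd _ _ _ \in _)) => [/set_mem ub|_]; last by rewrite mulr0 !mulr_ge0.
    rewrite (mem_set (A := B)) ?(mem_set (A := `[_, _]%classic)) ?mul1r ?mulr1//.
      by have := ub i; rewrite /= updE eqxx in_itv.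
    move=> k; rewrite /= !updE; case: eqP => [->//|/eqP/negbTE ki].
    have := ub k; rewrite /= updE ki !mxE => /andP[h1 h2].
    by apply/andP; split; lra.
  have mm : measurable_fun setT (fun s : R =>
      (`|l w| * \1_`[ab.1 0%R i, ab.2 0%R i] (t + s * l w))%:E).
    apply/measurable_EFinP; apply: measurable_funM => //; exact: measurable_aff_ind.
  rewrite ge0_integralZl//.
  by rewrite lee_wpmul2l ?lee_fin//; exact: integral_affine_itv.
have mm : measurable_fun setT (fun w : borelRn R n => (\1_B w : R)%:E).
  by apply/measurable_EFinP; exact: measurable_indic.
have m0 : (0 <= (Num.max 0 (ab.2 0 i - ab.1 0 i))%:E)%E.
  by rewrite lee_fin le_max lexx.
rewrite ge0_integralZr//.
rewrite integral_indic// setIT mul1e.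
apply: le_trans (lee_wpmul2r _ (lebB_box _)) _; first by rewrite lee_fin le_max lexx.
rewrite -EFinM lee_fin box_volume_upd (box_volumeD1 ab i) mulrC.
rewrite ler_wpM2l ?le_max ?lexx//.
rewrite (_ : Num.max 0 (4^-1 - - 4^-1) = 2^-1 :> R); last by rewrite max_r; lra.
rewrite (eq_bigr (fun k => Num.max 0 (ab.2 0 k - ab.1 0 k))); last first.
  by move=> k _; rewrite !mxE; congr Num.max; ring.
rewrite ler_piMl//; last by lra.
by apply: prodr_ge0 => k _; rewrite le_max lexx.
Qed.

End density.
End costs.

Lemma emeasurable_funX d (T : measurableType d) (R : realType) (D : set T)
    (f : T -> \bar R) n :
  measurable_fun D f -> measurable_fun D (fun x => f x ^+ n)%E.
Proof.
move=> mf; elim: n => [|n IH]; first exact: measurable_cst.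
by under eq_fun do rewrite expeS; exact: emeasurable_funM.
Qed.

Section cone.
Context {R : realType}.
Local Notation mu := (@lebesgue_measure R).
Local Notation lam := (@lebB R _).
Variables (n : nat).
Variable rho : 'rV[R]_n -> \bar R.
Hypothesis mrho : measurable_fun setT (rho : borelRn R n -> \bar R).
Hypothesis rho0 : forall x, (0 <= rho x)%E.
Hypothesis n0 : (0 < n)%N.
Local Notation W := (@W R n).

Lemma measurable_rhoX : measurable_fun setT ((fun x => rho x ^+ n)%E : borelRn R n -> \bar R).
Proof. exact: emeasurable_funX. Qed.

Lemma rhoX0 x : (0 <= rho x ^+ n)%E. Proof. exact: expe_ge0. Qed.

Definition slice_energy (L : R) (i : 'I_n) (t : R) : \bar R :=
  (\int[lam]_(u in cube (- L) L) (rho (upd u i t) ^+ n))%E.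

Lemma slice_energy_ge0 L i t : (0 <= slice_energy L i t)%E.
Proof. by apply: integral_ge0 => u _; exact: rhoX0. Qed.

Lemma measurable_slice_energy L i (o sg : R) :
  measurable_fun setT (fun t : R => slice_energy L i (o + t * sg)).
Proof.
apply: (@measurable_integral_on R _ _ (borelRn R n) (measurableTypeR R) lam
  (cube (- L) L) (fun u t => (rho (upd u i (o + t * sg)) ^+ n)%E)).
- exact: measurable_cube.
- apply: (measurableT_comp measurable_rhoX); apply: measurable_upd => //.
  exact: (measurableT_comp (measurable_affine1 o sg) measurable_snd).
- by move=> u t; exact: rhoX0.
Qed.

Section one_cone.
Variables (p c : 'rV[R]_n) (i : 'I_n) (L kap : R).
Hypothesis kap0 : 0 < kap.
Hypothesis pL : forall k, `|p 0 k| <= L.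
Hypothesis cL : forall k, `|c 0 k| + 4^-1 <= L.

Let t : R := p 0 i.
Let z (w : 'rV[R]_n) := upd (c + w) i t.
Let a : R := n%:R^-1 - 1.

Let L0 : 0 <= L.
Proof. by have := cL i; have := normr_ge0 (c 0 i); lra. Qed.

Let zW w k : W w -> `|z w 0 k| <= L.
Proof.
move=> /cubeP wW; rewrite updE; case: eqP => [_|_]; first exact: pL.
rewrite mxE; apply: le_trans (ler_normD _ _) _; apply: le_trans (cL k).
by rewrite lerD2l ler_norml wW.
Qed.

Let pow_a s : 0 < s ->
  ((kap * s `^ a) ^- n.-1) * (s ^+ n.-1)^-1 = kap ^- n.-1 * s `^ a.
Proof.
move=> s0; have sa0 : 0 < s `^ a by exact: powR_gt0.
rewrite exprMn invfM -mulrA; congr (_ * _).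
have H : (s `^ a) ^+ n * s ^+ n.-1 = 1.
  rewrite -powR_mulrn ?ltW// -powRrM /a mulrBl mulVf ?pnatr_eq0 -?lt0n// mul1r.
  rewrite -[X in 1 - X%:R](prednK n0) -natr1 opprD addrCA subrr addr0.
  by rewrite powR_invn ?ltW// mulVf// gt_eqF// exprn_gt0.
apply: (@mulfI _ ((s `^ a) ^+ n.-1 * s ^+ n.-1)).
  by rewrite mulf_neq0// gt_eqF// exprn_gt0.
rewrite -invfM mulfV; last by rewrite mulf_neq0// gt_eqF// exprn_gt0.
by rewrite mulrAC -exprSr prednK// H.
Qed.

Let psi_le s : 0 < s <= 1 ->
  (\int[lam]_(w in W) rho (p + s *: (z w - p)) <=
   (kap%:E + (kap ^- n.-1)%:E * slice_energy L i t) * (s `^ a)%:E)%E.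
Proof.
move=> /andP[s0 s1].
have sa0 : 0 < s `^ a by exact: powR_gt0.
have K0 : 0 < kap * s `^ a by rewrite mulr_gt0.
have mW := @measurable_W R n.
have mseg : measurable_fun setT ((fun w => p + s *: (z w - p)) : borelRn R n -> borelRn R n).
  apply: measurable_into_borel => k; under eq_fun do rewrite !mxE.
  apply: measurable_funD => //; apply: measurable_funM => //.
  apply: measurable_funB => //; case: (k == i) => //.
  by apply: measurable_funD => //; exact: measurable_coord.
have mr := measurableT_comp mrho mseg.
have mrX := measurableT_comp measurable_rhoX mseg.
apply: (@le_trans _ _ (\int[lam]_(w in W) ((kap * s `^ a)%:E +
    ((kap * s `^ a) ^- n.-1)%:E * rho (p + s *: (z w - p))%R ^+ n))%E).
  apply: ge0_le_integral => //.
  - exact: measurable_funTS.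
  - apply: measurable_funTS; apply: emeasurable_funD => //.
    exact: emeasurable_funM.
  - by move=> w _; exact: young_pow.
rewrite ge0_integralD//; last 3 first.
- by move=> w _; rewrite lee_fin ltW.
- by move=> w _; rewrite mule_ge0// ?rhoX0// lee_fin invr_ge0 exprn_ge0// ltW.
- by apply: measurable_funTS; exact: emeasurable_funM.
have JE : (\int[lam]_(w in W) (rho (p + s *: (z w - p))%R ^+ n) <=
    ((s ^+ n.-1)^-1)%:E * slice_energy L i t)%E.
  pose g u := ((\1_(cube (- L) L) u)%:E * rho (upd u i t) ^+ n)%E.
  have mg : measurable_fun setT (g : borelRn R n -> \bar R).
    apply: emeasurable_funM.
      by apply/measurable_EFinP; apply: measurable_indic; exact: measurable_cube.
    apply: (measurableT_comp measurable_rhoX).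
    by apply: measurable_upd => //; exact: measurable_id.
  have g0 u : (0 <= g u)%E by rewrite mule_ge0 ?rhoX0// lee_fin.
  pose al : 'rV[R]_n := \row_k (if k == i then 0 else p 0 k + s * (c 0 k - p 0 k)).
  pose be (k : 'I_n) := if k == i then 1 else s.
  have be0 k : 0 < be k by rewrite /be; case: ifP.
  have := @integral_push_affmap R n al be W g be0 mW mg g0.
  rewrite [X in (_ <= _ * X)%E](_ : _ = slice_energy L i t); last first.
    by rewrite /slice_energy [RHS]integral_indicl.
  rewrite (_ : \prod_k be k = s ^+ n.-1); last first.
    rewrite (bigD1 i)//= {1}/be eqxx mul1r (eq_bigr (fun=> s)).
      by rewrite prodr_const cardC1 card_ord.
    by move=> k /negbTE ki; rewrite /be ki.
  apply: le_trans; apply: ge0_le_integral => //.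
  - by move=> w _; exact: rhoX0.
  - exact: measurable_funTS.
  - apply: measurable_funTS; apply: (measurableT_comp mg).
    exact: measurable_affmap.
  - move=> w wW.
    have -> : p + s *: (z w - p) = upd (affmap al be w) i t.
      apply/rowP => k; rewrite !mxE; case: eqP => [->|ki]; first by rewrite subrr mulr0 addr0.
      by rewrite /be (introF eqP ki); ring.
    rewrite /g indicE mem_set ?mul1e//; apply/cubeP => k.
    rewrite -ler_norml !mxE /be; case: eqP => [_|ki].
      have /cubeP/(_ k) := wW; rewrite add0r mul1r => kW.
      apply: (@le_trans _ _ 4^-1); first by rewrite ler_norml.
      by have := cL k; have := normr_ge0 (c 0 k); lra.
    rewrite (_ : _ + _ = (1 - s) * p 0 k + s * z w 0 k); last first.
      by rewrite /z updE (introF eqP ki) mxE; ring.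
    apply: le_trans (ler_normD _ _) _; rewrite !normrM (gtr0_norm s0).
    rewrite ger0_norm ?subr_ge0//.
    rewrite -[leRHS](_ : (1 - s) * L + s * L = L); last by ring.
    by apply: lerD; rewrite ler_wpM2l ?subr_ge0 ?pL ?zW// ltW.
rewrite integral_cst//= ge0_muleDl//; last 2 first.
- by rewrite lee_fin ltW.
- by rewrite mule_ge0 ?slice_energy_ge0// lee_fin invr_ge0 exprn_ge0// ltW.
apply: leeD.
  rewrite -EFinM -[leRHS]mule1; apply: lee_wpmul2l; first by rewrite lee_fin ltW.
  exact: lebB_W_le1.
rewrite ge0_integralZl//; last 3 first.
- exact: measurable_funTS.
- by move=> w _; exact: rhoX0.
- by rewrite lee_fin invr_ge0 exprn_ge0// ltW.
apply: le_trans (lee_wpmul2l _ JE) _.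
  by rewrite lee_fin invr_ge0 exprn_ge0// ltW.
by rewrite muleA -EFinM pow_a// EFinM muleAC.
Qed.

(** The segments from a fixed point p to a random point of its hyperplane
    slice: the exponent n exceeds the dimension n - 1 of the slice, so points
    of the slice have positive capacity. *)
Lemma cost_cone :
  (\int[lam]_(w in W) segcost rho p (upd (c + w) i (p 0%R i)) <=
   (n%:R * (2 * L))%:E * (n%:R%:E *
     (kap%:E + (kap ^- n.-1)%:E * slice_energy L i (p 0%R i))))%E.
Proof.
have mW := @measurable_W R n.
have E0 : 0 <= n%:R * (2 * L) by rewrite !mulr_ge0.
have mz : measurable_fun setT (z : borelRn R n -> borelRn R n).
  by apply: measurable_upd => //; exact: measurable_addc.
have mF := @measurable_seg R n rho mrho (fun=> p) z (measurable_cst _) mz.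
have mw w : measurable_fun setT (fun s : R => rho (p + s *: (z w - p))).
  apply: (measurableT_comp mrho).
  by apply: (@measurable_segment R _ R n (fun=> p) (fun=> z w) id).
have mI : measurable_fun setT (fun w : borelRn R n => (\int[mu]_(s in `[0%R, 1%R]) rho (p + s *: (z w - p)))%E).
  by apply: (@measurable_integral_on R _ _ (measurableTypeR R) (borelRn R n) mu `[0%R, 1%R]%classic (fun s w => rho (p + s *: (z w - p)))).
apply: (@le_trans _ _ (\int[lam]_(w in W) ((n%:R * (2 * L))%:E *
   \int[mu]_(s in `[0%R, 1%R]) rho (p + s *: (z w - p))%R))%E).
  apply: ge0_le_integral => //.
  - move=> w _; apply: integral_ge0 => s _; rewrite mule_ge0// lee_fin.
    exact: enorm_ge0.
  - by apply: measurable_funTS; exact: measurable_segcost.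
  - by apply: measurable_funTS; apply: emeasurable_funM.
  move=> w wW; rewrite /segcost ge0_integralZr//; last 2 first.
  - exact: (@measurable_funTS _ _ (measurableTypeR R) _ _ _ (mw w)).
  - by rewrite lee_fin enorm_ge0.
  rewrite muleC lee_wpmul2r//; first by apply: integral_ge0.
  rewrite lee_fin; apply: enorm_le_sup => k; rewrite mxE.
  rewrite (_ : 2 * L = L + L); last by ring.
  apply: le_trans (ler_normD _ _) _; rewrite [ (- p) _ _ ]mxE normrN.
  by apply: lerD; [exact: zW|exact: pL].
have mIW : measurable_fun W (fun w : borelRn R n => (\int[mu]_(s in `[0%R, 1%R]) rho (p + s *: (z w - p)))%E).
  exact: measurable_funTS.
have I0 w : W w -> (0 <= \int[mu]_(s in `[0%R, 1%R]) rho (p + s *: (z w - p))%R)%E.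
  by move=> _; exact: integral_ge0.
rewrite ge0_integralZl//.
apply: lee_wpmul2l; first by rewrite lee_fin.
have mF' : measurable_fun setT (fun y : R * borelRn R n => rho (p + y.1 *: (z y.2 - p))).
  exact: mF.
rewrite -(@fubini_tonelli_on R _ _ (measurableTypeR R) (borelRn R n) mu lam `[0%R, 1%R]%classic W (fun s w => rho (p + s *: (z w - p))))//.
have mJ : measurable_fun setT (fun s : measurableTypeR R => (\int[lam]_(w in W) rho (p + s *: (z w - p)))%E).
  apply: (@measurable_integral_on R _ _ (borelRn R n) (measurableTypeR R) lam W (fun w s => rho (p + s *: (z w - p)))) => //.
  have mseg : measurable_fun setT ((fun y => p + y.2 *: (z y.1 - p)) :
      borelRn R n * measurableTypeR R -> borelRn R n).
    apply: (@measurable_segment R _ (borelRn R n * measurableTypeR R)%type n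
      (fun=> p) (z \o fst) snd) => //.
    exact: (measurableT_comp mz measurable_fst).
  exact: (measurableT_comp mrho mseg).
rewrite -integral_itv_obnd_cbnd; last exact: measurable_funTS.
set C := (kap%:E + _)%E.
have C0 : (0 <= C)%E.
  apply: adde_ge0; first by rewrite lee_fin ltW.
  by rewrite mule_ge0 ?slice_energy_ge0// lee_fin invr_ge0 exprn_ge0// ltW.
have mP : measurable_fun (`]0%R, 1%R]%classic : set R) (fun s : R => (s `^ a)%:E).
  by apply: measurable_funTS; apply/measurable_EFinP; exact: measurable_powR.
apply: (@le_trans _ _ (\int[mu]_(s in `]0%R, 1%R]) (C * (s `^ a)%:E))%E).
  apply: ge0_le_integral => //.
  - by move=> s _; apply: integral_ge0.
  - exact: measurable_funTS.
  - exact: emeasurable_funM.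
have P0 (s : R) : `]0%R, 1%R]%classic s -> (0 <= (s `^ a)%:E)%E.
  by rewrite lee_fin powR_ge0.
rewrite ge0_integralZl//.
by rewrite muleC lee_wpmul2r// integral_powR_root_le.
Qed.

End one_cone.
End cone.

Section affine_substitution.
Context {R : realType}.
Local Notation mu := (@lebesgue_measure R).

Lemma lebesgue_measure_affine (o k : R) (A : set R) : 0 < k -> measurable A ->
  (k%:E * mu [set s | A (o + s * k)%R] = mu A)%E.
Proof.
move=> k0 mA.
pose phi := (fun s => o + s * k) : measurableTypeR R -> measurableTypeR R.
have mphi : measurable_fun setT phi by exact: measurable_affine1.
pose mphi_mixin := isMeasurableFun.Build _ _ _ _ _ mphi.
pose P : {mfun _ >-> _} := HB.pack phi mphi_mixin.
have kE : (k%:E * mu [set s | A (o + s * k)%R] =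
    mscale (NngNum (ltW k0)) (pushforward mu P) A)%E by [].
rewrite kE.
apply/esym/lebesgue_measure_unique => //= _ [[a b]] _ <-.
rewrite /mscale/= /pushforward.
rewrite (_ : P @^-1` _ = `](a - o) / k, (b - o) / k]%classic); last first.
  apply/seteqP; split => s; rewrite /P /phi /= !in_itv/= ltr_pdivrMr// ler_pdivlMr//.
    by move=> /andP[h1 h2]; apply/andP; split; lra.
  by move=> /andP[h1 h2]; apply/andP; split; lra.
rewrite !lebesgue_measure_itv/= !lte_fin ltr_pM2r ?invr_gt0// ltrD2r.
case: ifPn => _; last by rewrite mule0.
by rewrite -!EFinD -EFinM; congr EFin; field; rewrite gt_eqF.
Qed.

Lemma integral_affine_pos (o k : R) (F : R -> \bar R) : 0 < k ->
  measurable_fun setT F -> (forall s, 0 <= F s)%E ->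
  (\int[mu]_s (k%:E * F (o + s * k)%R) = \int[mu]_s F s)%E.
Proof.
move=> k0 mF F0.
pose phi := (fun s => o + s * k) : measurableTypeR R -> measurableTypeR R.
have mphi : measurable_fun setT phi by exact: measurable_affine1.
pose mphi_mixin := isMeasurableFun.Build _ _ _ _ _ mphi.
pose P : {mfun _ >-> _} := HB.pack phi mphi_mixin.
rewrite ge0_integralZl//; last 2 first.
- exact: (measurableT_comp mF mphi).
- by rewrite lee_fin ltW.
have := @ge0_integral_pushforward _ _ _ _ R phi (measurable_funP P) mu setT F measurableT mF (fun x _ => F0 x).
rewrite preimage_setT => <-.
have := @ge0_integral_mscale _ (measurableTypeR R) R (pushforward mu P) setT measurableT (NngNum (ltW k0)) F mF (fun x _ => F0 x).
move=> /= <-; apply: eq_measure_integral => /= A mA _.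
exact: lebesgue_measure_affine.
Qed.

Lemma integral_oppr (F : R -> \bar R) :
  measurable_fun setT F -> (forall s, 0 <= F s)%E ->
  (\int[mu]_s F (- s)%R = \int[mu]_s F s)%E.
Proof.
move=> mF F0.
have mN : measurable_fun setT (-%R : measurableTypeR R -> measurableTypeR R).
  exact: oppr_measurable.
pose mphi_mixin := isMeasurableFun.Build _ _ _ _ _ mN.
pose P : {mfun _ >-> _} := HB.pack (-%R : measurableTypeR R -> measurableTypeR R) mphi_mixin.
have := @ge0_integral_pushforward _ _ _ _ R _ (measurable_funP P) mu setT F measurableT mF (fun x _ => F0 x).
rewrite preimage_setT => <-.
apply: eq_measure_integral => /= A mA _.
exact: lebesgue_measureN.
Qed.

Section seg.
Variables (n : nat) (rho : 'rV[R]_n -> \bar R).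
Hypothesis mrho : measurable_fun setT (rho : borelRn R n -> \bar R).
Hypothesis rho0 : forall x, (0 <= rho x)%E.

Lemma measurable_line (x v : 'rV[R]_n) :
  measurable_fun setT (fun s : R => rho (x + s *: v)).
Proof.
have mseg : measurable_fun setT ((fun s => x + s *: v) : R -> borelRn R n).
  apply: measurable_into_borel => k; under eq_fun do rewrite !mxE.
  by apply: measurable_funD => //; apply: measurable_funM.
exact: (measurableT_comp mrho mseg).
Qed.

Let F (x y : 'rV[R]_n) (s : R) : \bar R :=
  ((\1_(`[0%R, 1%R]%classic : set R) s)%:E * (rho (x + s *: (y - x)) * (enorm (y - x))%:E))%E.

Let mF x y : measurable_fun setT (F x y).
Proof.
apply: emeasurable_funM.
  by apply/measurable_EFinP; apply: measurable_indic; exact: measurable_itv.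
by apply: emeasurable_funM => //; exact: measurable_line.
Qed.

Let F0 x y s : (0 <= F x y s)%E.
Proof. by rewrite !mule_ge0// lee_fin ?enorm_ge0. Qed.

Let segcostE x y : segcost rho x y = (\int[mu]_s F x y s)%E.
Proof. by rewrite /segcost integral_indicl. Qed.

Lemma segcost_ge0 x y : (0 <= segcost rho x y)%E.
Proof. by rewrite segcostE; apply: integral_ge0 => s _; exact: F0. Qed.

Lemma segcost_sym x y : segcost rho x y = segcost rho y x.
Proof.
rewrite !segcostE -(integral_affine_pos 1 ltr01 (mF y x) (F0 y x)).
have mG : measurable_fun setT (fun s : R => (1%:E * F y x (1 + s * 1)%R)%E).
  apply: emeasurable_funM => //.
  exact: (measurableT_comp (mF y x) (measurable_affine1 1 1)).
rewrite -(integral_oppr mG); last by move=> s; rewrite mul1e F0.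
apply: eq_integral => s _; rewrite mul1e mulr1 /F -opprB enormN.
congr (_%:E * (rho _ * _))%E; last by apply/rowP => k; rewrite !mxE; ring.
rewrite !indicE; congr (nat_of_bool _)%:R.
by apply/idP/idP; rewrite !inE /= !in_itv/= => /andP[h1 h2]; apply/andP; split; lra.
Qed.

Lemma integral_segment x y : 0 < enorm (y - x) ->
  (\int[mu]_(s in `[0%R, enorm (y - x)]) rho (x + (s / enorm (y - x)) *: (y - x))%R =
   segcost rho x y)%E.
Proof.
set l := enorm (y - x) => l0; rewrite segcostE.
have lV0 : 0 < l^-1 by rewrite invr_gt0.
rewrite -(integral_affine_pos 0 lV0 (mF x y) (F0 x y)) integral_indicl.
apply: eq_integral => s _; rewrite add0r /F -/l.
have E (i r : \bar R) : ((l^-1)%:E * (i * (r * l%:E)) = i * r)%E.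
  by rewrite muleCA; congr (_ * _)%E; rewrite muleCA -EFinM mulVf ?gt_eqF// mule1.
rewrite E; congr (_%:E * _)%E.
rewrite !indicE; congr (nat_of_bool _)%:R.
apply/idP/idP; rewrite !inE /= !in_itv/= => /andP[h1 h2]; apply/andP; split.
- by rewrite divr_ge0// ltW.
- by rewrite ler_pdivrMr// mul1r.
- by move: h1; rewrite pmulr_lge0.
- by move: h2; rewrite ler_pdivrMr// mul1r.
Qed.

End seg.

Lemma integral_shift_itv (G : R -> \bar R) (a l : R) :
  measurable_fun setT G -> (forall s, 0 <= G s)%E ->
  (\int[mu]_(s in `[a, (a + l)%R]) G (s - a)%R = \int[mu]_(s in `[0%R, l]) G s)%E.
Proof.
move=> mG G0; rewrite [LHS]integral_indicl [RHS]integral_indicl.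
pose F s := ((\1_(`[0%R, l]%classic : set R) s)%:E * G s)%E.
have mF : measurable_fun setT F.
  apply: emeasurable_funM => //.
  by apply/measurable_EFinP; apply: measurable_indic; exact: measurable_itv.
have F0 s : (0 <= F s)%E by rewrite mule_ge0// lee_fin.
rewrite -[RHS](integral_affine_pos (- a) ltr01 mF F0).
apply: eq_integral => s _; rewrite mul1e mulr1 /F (addrC (- a)).
congr (_%:E * _)%E; rewrite !indicE; congr (nat_of_bool _)%:R.
by apply/idP/idP; rewrite !inE /= !in_itv/= => /andP[h1 h2]; apply/andP; split; lra.
Qed.

End affine_substitution.

Section good_slice.
Context {R : realType}.
Local Notation mu := (@lebesgue_measure R).
Local Notation lam := (@lebB R _).
Variables (n : nat).
Variable rho : 'rV[R]_n -> \bar R.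
Hypothesis mrho : measurable_fun setT (rho : borelRn R n -> \bar R).
Hypothesis rho0 : forall x, (0 <= rho x)%E.
Hypothesis n0 : (0 < n)%N.

(** Young's inequality in place of Hoelder's: kap is chosen small first, and
    then the energy. *)
Lemma energy_integral_le (L kap : R) : 0 < L -> 0 < kap ->
  (forall x, ~ cube (- L) L x -> rho x = 0%E) ->
  (\int[lam]_x rho x <=
   ((2 * L) ^+ n * kap)%:E + (kap ^- n.-1)%:E * \int[lam]_x (rho x ^+ n))%E.
Proof.
move=> L0 kap0 rhoL.
have mC : measurable (cube (- L) L : set (borelRn R n)) by exact: measurable_cube.
have mX := measurable_rhoX mrho.
have X0 : forall x, (0 <= rho x ^+ n)%E by exact: rhoX0.
have k0 : (0 <= (kap ^- n.-1)%:E)%E by rewrite lee_fin invr_ge0 exprn_ge0// ltW.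
pose I (x : borelRn R n) : \bar R := (\1_(cube (- L) L : set (borelRn R n)) x)%:E.
have mI : measurable_fun setT I by apply/measurable_EFinP; exact: measurable_indic.
have I0 x : (0 <= I x)%E by rewrite lee_fin.
have kap00 : (0 <= kap%:E)%E by rewrite lee_fin ltW.
have mIk : measurable_fun setT (fun x => I x * kap%:E)%E by exact: emeasurable_funM.
have Ik0 x : (0 <= I x * kap%:E)%E by rewrite mule_ge0.
have mkX : measurable_fun setT (fun x : borelRn R n => (kap ^- n.-1)%:E * (rho x ^+ n))%E.
  exact: emeasurable_funM.
have kX0 x : (0 <= (kap ^- n.-1)%:E * (rho x ^+ n))%E by rewrite mule_ge0.
apply: (@le_trans _ _ (\int[lam]_x (I x * kap%:E + (kap ^- n.-1)%:E * (rho x ^+ n)))%E).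
  apply: ge0_le_integral => //; first exact: emeasurable_funD.
  move=> x _; rewrite /I indicE; case: (boolP (x \in _)) => [_|xL].
    by rewrite mul1e; exact: young_pow.
  rewrite rhoL; last by move=> /mem_set xL'; rewrite xL' in xL.
  by rewrite mul0e add0e mule_ge0// expe_ge0.
rewrite ge0_integralD// ge0_integralZr// ge0_integralZl//.
rewrite integral_indic// setIT EFinM; apply: leeD => //.
apply: lee_wpmul2r => //.
by rewrite [leLHS]lebB_cube; [rewrite lee_fin (_ : L - - L = 2 * L)//; ring|lra].
Qed.

(** Averaging over the position of a hyperplane: some level t in [a, b] is good
    for all 2n hyperplanes at distance t from o at the same time. *)
Lemma good_slice (o : 'rV[R]_n) (a b L theta : R) : a < b -> 0 < L -> 0 < theta ->
  (\int[lam]_x (rho x ^+ n) < theta%:E)%E ->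
  exists t, [/\ a <= t, t <= b & forall i sg, `|sg| = 1 ->
    (slice_energy rho L i (o 0%R i + t * sg)%R <=
     (4 * n%:R * L * theta / (b - a))%:E)%E].
Proof.
move=> ab L0 th0 lt_th; apply: contrapT => /forallNP H.
set K := 4 * n%:R * L * theta / (b - a).
pose f k (t : R) := (slice_energy rho L k (o 0 k + t * 1)%R +
  slice_energy rho L k (o 0 k + t * (-1))%R)%E.
have mf k : measurable_fun setT (f k).
  by apply: emeasurable_funD; exact: measurable_slice_energy.
have f0 k t : (0 <= f k t)%E by rewrite adde_ge0 ?slice_energy_ge0.
have K0 : 0 <= K by rewrite divr_ge0 ?mulr_ge0 ?ler0n// ?ltW// subr_gt0.
suff : ((K * (b - a))%:E <= (4 * n%:R * L)%:E * \int[lam]_x (rho x ^+ n))%E.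
  apply/negP; rewrite -ltNge /K divfK ?gt_eqF ?subr_gt0// [ltRHS]EFinM.
  by rewrite lte_pmul2l// lte_fin !mulr_gt0 ?ltr0n.
apply: (@le_trans _ _ (\int[mu]_(t in `[a, b]) \sum_(k < n) f k t)%E).
  apply: (@le_trans _ _ (\int[mu]_(t in `[a, b]) K%:E)%E).
    by rewrite integral_cst//= mu_itvcc max_r// subr_ge0 ltW.
  have ms : measurable_fun setT (fun t : R => \sum_(k < n) f k t)%E.
    exact: emeasurable_sum.
  apply: ge0_le_integral => //.
  - exact: measurable_funTS.
  move=> t; rewrite /= in_itv/= => /andP[at_ tb].
  have [k [sg [sg1 /negP]]] : exists k (sg : R), `|sg| = 1 /\ ~ (slice_energy rho L k (o 0%R k + t * sg)%R <= K%:E)%E.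
    apply: contrapT => H'; apply: (H t); split => // k sg sg1.
    by apply: contrapT => H''; apply: H'; exists k, sg.
  rewrite -ltNge => /ltW Kle; apply: (le_trans Kle).
  apply: (@le_trans _ _ (f k t)).
    rewrite /f; have : sg = 1 \/ sg = -1.
      have [s0|s0] := leP 0 sg; first by left; rewrite -sg1 ger0_norm.
      by right; rewrite -sg1 ltr0_norm// opprK.
    by case=> ->; rewrite ?leeDl ?leeDr ?slice_energy_ge0.
  by rewrite (bigD1 k)//= leeDl//; apply: sume_ge0 => j _; exact: f0.
apply: (@le_trans _ _ (\int[mu]_t \sum_(k < n) f k t)%E).
  apply: ge0_subset_integral => //; first exact: emeasurable_sum.
  by move=> t _; apply: sume_ge0 => k _; exact: f0.
rewrite ge0_integral_sum//.
apply: (@le_trans _ _ (\sum_(k < n) (2%:E * ((2 * L)%:E * \int[lam]_x (rho x ^+ n))))%E).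
  apply: lee_sum => k _; rewrite ge0_integralD//; last 4 first.
  - by move=> t _; exact: slice_energy_ge0.
  - exact: measurable_slice_energy.
  - by move=> t _; exact: slice_energy_ge0.
  - exact: measurable_slice_energy.
  rewrite -[2%R]/(1 + 1)%R EFinD ge0_muleDl// !mul1e.
  have mX := measurable_rhoX mrho.
  apply: leeD; apply: (integral_slices_le mX) => //.
  - by move=> x; exact: rhoX0.
  - exact: normr1.
  - by move=> x; exact: rhoX0.
  - by rewrite normrN normr1.
set Y := (_ * _)%E; rewrite (eq_bigr (fun=> 1%:E * Y)%E); last by rewrite mul1e.
rewrite -ge0_sume_distrl// sumEFin sumr_const card_ord /Y !muleA -!EFinM.
rewrite le_eqVlt; apply/orP; left; apply/eqP; congr (_%:E * _)%E; ring.
Qed.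

End good_slice.

Section polygons.
Context {R : realType}.
Local Notation mu := (@lebesgue_measure R).
Local Notation lam := (@lebB R _).
Variable n : nat.
Local Notation W := (@W R n).
Implicit Types (x y p q c : 'rV[R]_n) (rho : 'rV[R]_n -> \bar R).

Fixpoint polycost rho x (s : seq 'rV[R]_n) : \bar R :=
  (if s is y :: s' then segcost rho x y + polycost rho y s' else 0)%E.

Fixpoint polyin (S : set 'rV[R]_n) x (s : seq 'rV[R]_n) : Prop :=
  if s is y :: s' then
    (forall t : R, 0 <= t <= 1 -> S (x + t *: (y - x))) /\ polyin S y s'
  else True.

(** From p to q through three displaced centers. The first and the last segment
    lie in the coordinate slices through p and q, the second and the last but
    one are parallel to a coordinate axis. *)
Definition hexpath p i c0 c1 c2 j q (w : 'rV[R]_n) : seq 'rV[R]_n :=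
  [:: upd (c0 + w) i (p 0 i); c0 + w; c1 + w; c2 + w;
      upd (c2 + w) j (q 0 j); q].

(** If the energy is small and the slices through p and q are no worse than
    average, then a random polygon from p to q has small expected cost. *)
Lemma polygon_energy (L M : R) : (0 < n)%N -> 0 < L -> 0 <= M ->
  exists2 theta : R, 0 < theta & forall rho,
    measurable_fun setT (rho : borelRn R n -> \bar R) ->
    (forall x, 0 <= rho x)%E ->
    (forall x, ~ cube (- L) L x -> rho x = 0%E) ->
    (\int[lam]_x (rho x ^+ n) <= theta%:E)%E ->
    forall p q i j c0 c1 c2,
      (forall k, `|p 0 k| <= L) -> (forall k, `|q 0 k| <= L) ->
      (forall k, `|c0 0 k| + 4^-1 <= L) -> (forall k, `|c1 0 k| + 4^-1 <= L) ->
      (forall k, `|c2 0 k| + 4^-1 <= L) ->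
      (slice_energy rho L i (p 0%R i) <= (M * theta)%:E)%E ->
      (slice_energy rho L j (q 0%R j) <= (M * theta)%:E)%E ->
      exists2 w, cube (- 4^-1) 4^-1 w &
        (polycost rho p (hexpath p i c0 c1 c2 j q w) < 1)%E.
Proof.
move=> n0 L0 M0.
pose C := (n%:R * (2 * L) + 1) * (n%:R + (2 * L) ^+ n + 1).
have nL0 : 0 <= n%:R * (2 * L) by rewrite !mulr_ge0 ?ler0n// ltW.
have LX0 : 0 <= (2 * L) ^+ n by rewrite exprn_ge0// mulr_ge0// ltW.
have C0 : 0 < C by apply: mulr_gt0; apply: ltr_wpDl => //; rewrite addr_ge0.
pose v : R := 2^-1 ^+ n.
have v0 : 0 < v by rewrite exprn_gt0.
pose kap := v / (14 * C).
have kap0 : 0 < kap by rewrite divr_gt0// mulr_gt0.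
pose theta := kap ^+ n.-1 * kap / (M + 1).
have M1 : 0 < M + 1 by rewrite ltr_wpDl.
have th0 : 0 < theta.
  by apply: divr_gt0 => //; apply: mulr_gt0 => //; rewrite exprn_gt0.
exists theta => // rho mrho rho0 rhoL rhoth p q i j c0 c1 c2 pL qL c0L c1L c2L sp sq.
pose X := C * (2 * kap).
have kapV : 0 <= kap ^- n.-1 by rewrite invr_ge0 exprn_ge0// ltW.
have eX : kap ^- n.-1 * ((M + 1) * theta) = kap.
  rewrite /theta mulrC (mulrC (M + 1)) divfK; last by rewrite gt_eqF.
  by rewrite mulrAC mulfV ?mul1r// gt_eqF// exprn_gt0.
clearbody theta.
have Cn : n%:R * (2 * L) * n%:R <= C.
  rewrite /C; apply: ler_pM; rewrite ?ler0n//; first by rewrite lerDl.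
  by rewrite -addrA lerDl addr_ge0.
have CL : (n%:R * (2 * L) + 1) * ((2 * L) ^+ n + 1) <= C.
  rewrite /C ler_pM2l ?ltr_wpDl//.
  by rewrite -addrA lerDr ler0n.
have cone (r : 'rV[R]_n) k : (slice_energy rho L k (r 0%R k) <= (M * theta)%:E)%E ->
    ((n%:R * (2 * L))%:E * (n%:R%:E *
     (kap%:E + (kap ^- n.-1)%:E * slice_energy rho L k (r 0%R k))) <= X%:E)%E.
  move=> h; apply: (@le_trans _ _ ((n%:R * (2 * L))%:E * (n%:R%:E *
     (kap%:E + (kap ^- n.-1)%:E * (M * theta)%:E)))%E).
    apply: lee_wpmul2l; first by rewrite lee_fin.
    apply: lee_wpmul2l; first by rewrite lee_fin.
    by apply: leeD => //; apply: lee_wpmul2l => //; rewrite lee_fin.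
  rewrite -!EFinM lee_fin mulrA /X.
  have h1 : 0 <= n%:R * (2 * L) * n%:R by rewrite mulr_ge0.
  have h2 : 0 <= kap ^- n.-1 * (M * theta) by rewrite !mulr_ge0// ltW//.
  have h3 : 0 <= kap + kap ^- n.-1 * (M * theta) by rewrite addr_ge0// ltW.
  apply: ler_pM => //; rewrite (_ : 2 * kap = kap + kap); last by ring.
  rewrite lerD2l -[leRHS]eX ler_wpM2l// ler_wpM2r//; first exact: ltW.
  by rewrite lerDl.
have lin : (\int[lam]_x rho x <= (((2 * L) ^+ n + 1) * kap)%:E)%E.
  apply: le_trans (energy_integral_le mrho rho0 n0 L0 kap0 rhoL) _.
  rewrite [leRHS](_ : _ = ((2 * L) ^+ n * kap)%:E + kap%:E)%E; last first.
    by rewrite -EFinD mulrDl mul1r.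
  apply: leeD => //.
  rewrite -[leRHS](_ : (kap ^- n.-1 * ((M + 1) * theta))%:E = _); last by rewrite eX.
  rewrite EFinM; apply: lee_wpmul2l; first by rewrite lee_fin.
  apply: (le_trans rhoth); rewrite lee_fin; apply: ler_peMl; [exact: ltW|by rewrite lerDr].
have L2k : 0 <= ((2 * L) ^+ n + 1) * kap.
  by apply: mulr_ge0; [rewrite addr_ge0|exact: ltW].
have moveX : (\int[lam]_x rho x <= X%:E)%E.
  apply: (le_trans lin); rewrite lee_fin /X.
  apply: (@le_trans _ _ (C * kap)); last first.
    by apply: ler_wpM2l; [exact: ltW|lra].
  apply: ler_wpM2r; [exact: ltW|apply: le_trans CL].
  by apply: ler_peMl; [rewrite addr_ge0|rewrite lerDr].
have transX c c' : (forall k, `|c 0 k| + 4^-1 <= L) -> (forall k, `|c' 0 k| + 4^-1 <= L) ->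
    ((enorm (c' - c))%:E * \int[lam]_x rho x <= X%:E)%E.
  move=> cL c'L.
  apply: (@le_trans _ _ ((n%:R * (2 * L))%:E * (((2 * L) ^+ n + 1) * kap)%:E)%E).
    apply: (@le_trans _ _ ((n%:R * (2 * L))%:E * \int[lam]_x rho x)%E).
      rewrite lee_wpmul2r ?integral_ge0// lee_fin; apply: enorm_le_sup => k.
      rewrite !mxE; apply: le_trans (ler_normB _ _) _.
      by have := cL k; have := c'L k; lra.
    by rewrite lee_wpmul2l// lee_fin.
  rewrite -EFinM lee_fin /X; apply: (@le_trans _ _ (C * kap)); last first.
    by apply: ler_wpM2l; [exact: ltW|lra].
  rewrite [leLHS]mulrA; apply: ler_wpM2r; [exact: ltW|apply: le_trans CL].
  by apply: ler_wpM2r; [rewrite addr_ge0|rewrite lerDl].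
apply: contrapT => H.
have {}H w : W w -> (1 <= polycost rho p (hexpath p i c0 c1 c2 j q w))%E.
  by move=> Ww; rewrite leNgt; apply/negP => h; apply: H; exists w.
have mp : measurable_fun setT ((fun=> p) : borelRn R n -> borelRn R n) by exact: measurable_cst.
have mq : measurable_fun setT ((fun=> q) : borelRn R n -> borelRn R n) by exact: measurable_cst.
have mc c := @measurable_addc R n c.
have mu1 c k (t : R) : measurable_fun setT ((fun w => upd (c + w) k t) : borelRn R n -> borelRn R n).
  by apply: measurable_upd => //; exact: mc.
pose F (k : 'I_6) (w : borelRn R n) : \bar R :=
  nth 0%E [:: segcost rho p (upd (c0 + w) i (p 0%R i));
     segcost rho (upd (c0 + w) i (p 0%R i)) (c0 + w);
     segcost rho (c0 + w) (c1 + w); segcost rho (c1 + w) (c2 + w);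
     segcost rho (c2 + w) (upd (c2 + w) j (q 0%R j));
     segcost rho (upd (c2 + w) j (q 0%R j)) q] k.
have FE w : (polycost rho p (hexpath p i c0 c1 c2 j q w) = \sum_(k < 6) F k w)%E.
  by rewrite !big_ord_recl big_ord0.
have mF k : measurable_fun setT (F k).
  by case: k => -[|[|[|[|[|[|//]]]]]] h; rewrite /F/=; exact: measurable_segcost.
have F0 k w : (0 <= F k w)%E.
  by case: k => -[|[|[|[|[|[|//]]]]]] h; rewrite /F/=; exact: segcost_ge0.
have FX k : (\int[lam]_(w in W) F k w <= X%:E)%E.
  case: k => -[|[|[|[|[|[|//]]]]]] h; rewrite /F/=.
  - exact: le_trans (cost_cone mrho rho0 n0 i kap0 pL c0L) (cone _ _ sp).
  - exact: le_trans (cost_move mrho rho0 _ _ _) moveX.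
  - exact: le_trans (cost_translate mrho rho0 _ _) (transX _ _ c0L c1L).
  - exact: le_trans (cost_translate mrho rho0 _ _) (transX _ _ c1L c2L).
  - have -> : (\int[lam]_(w in W) segcost rho (c2 + w) (upd (c2 + w) j (q 0%R j)) =
        \int[lam]_(w in W) segcost rho (upd (c2 + w) j (q 0%R j)) (c2 + w))%E.
      by apply: eq_integral => w _; exact: segcost_sym.
    exact: le_trans (cost_move mrho rho0 _ _ _) moveX.
  - have -> : (\int[lam]_(w in W) segcost rho (upd (c2 + w) j (q 0%R j)) q =
        \int[lam]_(w in W) segcost rho q (upd (c2 + w) j (q 0%R j)))%E.
      by apply: eq_integral => w _; exact: segcost_sym.
    exact: le_trans (cost_cone mrho rho0 n0 j kap0 qL c2L) (cone _ _ sq).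
have mW := @measurable_W R n.
have : (v%:E <= \int[lam]_(w in W) \sum_(k < 6) F k w)%E.
  rewrite -lebB_W -[leLHS]mul1e -(integral_cst _ mW); apply: ge0_le_integral => //.
  - by apply: measurable_funTS; exact: emeasurable_sum.
  - by move=> w Ww; rewrite -FE; exact: H.
rewrite ge0_integral_sum//; last by move=> k; apply: measurable_funTS; exact: mF.
apply/negP; rewrite -ltNge.
apply: (@le_lt_trans _ _ (\sum_(k < 6) X%:E)%E); first exact: lee_sum.
rewrite sumEFin lte_fin sumr_const card_ord /X /kap.
have -> : C * (2 * (v / (14 * C))) *+ 6 = v * (12 / 14).
  by rewrite -mulr_natr; field; rewrite gt_eqF.
by rewrite gtr_pMr// ltr_pdivrMr// mul1r ltr_nat.
Qed.

End polygons.

(** * Crossing rings by short polygons *)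

Section crossing.
Context {R : realType}.
Local Notation lam := (@lebB R _).
Variable n : nat.
Implicit Types (x y p q c o : 'rV[R]_n) (rho : 'rV[R]_n -> \bar R) (E F S : set 'rV[R]_n).

Definition restr_to S rho x : \bar R := ((\1_S x)%:E * rho x)%E.

Lemma restr_to_ge0 S rho : (forall x, 0 <= rho x)%E -> forall x, (0 <= restr_to S rho x)%E.
Proof. by move=> rho0 x; rewrite mule_ge0// lee_fin. Qed.

Lemma measurable_restr_to S rho : measurable (S : set (borelRn R n)) ->
  measurable_fun setT (rho : borelRn R n -> \bar R) ->
  measurable_fun setT (restr_to S rho : borelRn R n -> \bar R).
Proof.
move=> mS mrho; apply: emeasurable_funM => //.
by apply/measurable_EFinP; exact: measurable_indic.
Qed.

Lemma restr_to_expe S rho x : (0 < n)%N ->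
  (restr_to S rho x ^+ n = (\1_S x)%:E * rho x ^+ n)%E.
Proof.
move=> n0; rewrite /restr_to indicE; case: (x \in S); rewrite ?mul1e// !mul0e.
by case: n n0 => // m _; rewrite expeS mul0e.
Qed.

Lemma restr_toE S rho x : S x -> restr_to S rho x = rho x.
Proof. by move=> Sx; rewrite /restr_to indicE mem_set// mul1e. Qed.

Lemma polycost_restr S rho x s : polyin S x s ->
  polycost (restr_to S rho) x s = polycost rho x s.
Proof.
elim: s x => //= y s IH x [xy /IH ->]; congr (_ + _)%E.
apply: eq_integral => t; rewrite inE/= in_itv/= => t01.
by rewrite restr_toE//; exact: xy.
Qed.

Lemma norm_coord x : 0 < `|x| -> exists i, `|x 0 i| = `|x|.
Proof.
move=> x0; have : mx_norm x != 0 by rewrite gt_eqF.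
by move=> /mx_norm_neq0[[i j] xE]; exists j; rewrite [RHS]xE/= (ord1 i).
Qed.

Lemma norm_le_coord x (M : R) : 0 <= M -> (forall i, `|x 0 i| <= M) -> `|x| <= M.
Proof.
move=> M0 xM; rewrite [leLHS]/Num.norm /= mx_normrE; apply/bigmax_leP; split => //.
by move=> [j i] _ /=; rewrite ord1.
Qed.

Lemma sg_coord x (t : R) i : `|x 0 i| = t -> 0 < t ->
  exists2 sg : R, `|sg| = 1 & x 0 i = t * sg.
Proof.
move=> xt t0; exists (x 0 i / t); last by rewrite mulrCA mulfV ?mulr1// gt_eqF.
by rewrite normrM normfV xt (gtr0_norm t0) mulfV// gt_eqF.
Qed.

(** Rings are taken for the sup norm, whose spheres consist of coordinate
    slices. *)
Definition ring o (r : R) : set 'rV[R]_n := [set x | r / 2 <= `|x - o| <= 2 * r].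

Lemma measurable_ring o r : measurable (ring o r : set (borelRn R n)).
Proof.
pose A := (fun x => `|x - o|) @^-1` `[r / 2, 2 * r]%classic.
rewrite (_ : ring o r = A); last first.
  by apply/seteqP; split => x; rewrite /A /ring/= in_itv.
have cA : closed A.
  apply: closed_comp; last exact: itv_closed.
  by move=> x _; exact: norm_sub_continuous.
rewrite -[A]setCK; apply: measurableC; apply: sub_sigma_algebra.
exact: closed_openC.
Qed.

Section segments_in_ring.
Let inring x i : `|x| <= 2 -> 1 / 2 <= `|x 0 i| -> ring 0 1 x.
Proof.
move=> x2 xi; rewrite /ring/= subr0 mulr1 x2 andbT.
exact: le_trans xi (coord_le_norm _ _).
Qed.

Let conv (a b M t : R) : 0 <= t <= 1 -> `|a| <= M -> `|b| <= M -> `|a + t * (b - a)| <= M.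
Proof.
move=> /andP[t0 t1]; rewrite !ler_norml => /andP[a1 a2] /andP[b1 b2].
have h1 : 0 <= (1 - t) * (M - a) by rewrite mulr_ge0// subr_ge0.
have h2 : 0 <= t * (M - b) by rewrite mulr_ge0// subr_ge0.
have h3 : 0 <= (1 - t) * (M + a) by rewrite mulr_ge0 ?subr_ge0// -lerBlDl sub0r.
have h4 : 0 <= t * (M + b) by rewrite mulr_ge0// -lerBlDl sub0r.
by apply/andP; split; nra.
Qed.

Lemma seg_norm x y (M t : R) : 0 <= t <= 1 -> 0 <= M ->
  (forall k, `|x 0 k| <= M) -> (forall k, `|y 0 k| <= M) -> `|x + t *: (y - x)| <= M.
Proof.
by move=> t01 M0 xM yM; apply: norm_le_coord => // k; rewrite !mxE; exact: conv.
Qed.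

Variables (i : 'I_n) (sg t : R) (w p : 'rV[R]_n).
Hypothesis sg1 : `|sg| = 1.
Hypothesis t12 : 1 <= t <= 2.
Hypothesis wW : cube (- 4^-1) 4^-1 w.
Hypothesis pt : `|p| <= t.
Hypothesis pi : p 0 i = t * sg.
Definition facec k (s : R) : 'rV[R]_n := upd 0 k (3 / 2 * s).

Let wk k : `|w 0 k| <= 1 / 4.
Proof. by rewrite ler_norml mul1r; exact: (cubeP _ _ _).1 wW k. Qed.

Let sgP : sg = 1 \/ sg = -1.
Proof.
have [s0|s0] := leP 0 sg; first by left; rewrite -sg1 ger0_norm.
by right; rewrite -sg1 ltr0_norm// opprK.
Qed.

Lemma facec_bound k s l : `|s| = 1 -> `|facec k s 0 l| + 4^-1 <= 2.
Proof.
move=> s1; rewrite updE; case: ifP => _; last by rewrite mxE normr0; lra.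
by rewrite normrM s1 mulr1 ger0_norm; lra.
Qed.

Lemma seg_ring1 s : 0 <= s <= 1 ->
  ring 0 1 (p + s *: (upd (facec i sg + w) i (p 0 i) - p)).
Proof.
move=> s01; apply: (inring (i := i)).
  apply: seg_norm => // k.
    by apply: le_trans (coord_le_norm _ _) _; apply: le_trans pt _; case/andP: t12.
  rewrite updE; case: eqP => [_|/eqP/negbTE ki].
    rewrite pi normrM sg1 mulr1 ger0_norm; first by case/andP: t12.
    by case/andP: t12 => t1 _; rewrite (le_trans _ t1).
  by rewrite mxE updE ki !mxE add0r (le_trans (wk k))//; lra.
rewrite !mxE eqxx subrr mulr0 addr0 pi normrM sg1 mulr1.
by case/andP: t12 => t1 _; apply: le_trans (ler_norm _); lra.
Qed.

Lemma seg_ring2 s : 0 <= s <= 1 ->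
  ring 0 1 (upd (facec i sg + w) i (p 0 i) +
    s *: (facec i sg + w - upd (facec i sg + w) i (p 0 i))).
Proof.
move=> s01; have [t1 t2] := andP t12; have [s0 s1] := andP s01.
have := wk i; rewrite ler_norml => /andP[w1 w2].
rewrite segment_upd; apply: (inring (i := i)); last first.
  rewrite updE eqxx mxE updE eqxx pi.
  case: sgP => ->; [apply: le_trans (ler_norm _)|rewrite -normrN; apply: le_trans (ler_norm _)]; nra.
apply: norm_le_coord => // k; rewrite updE; case: eqP => [_|/eqP/negbTE ki].
  rewrite mxE updE eqxx pi ler_norml.
  by case: sgP => ->; apply/andP; split; nra.
by rewrite mxE updE ki !mxE add0r (le_trans (wk k))//; lra.
Qed.

(** Two displaced face centers that are not opposite see each other in the
    ring; opposite faces are connected through a third one. *)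
Lemma seg_ring3 k s' s : `|s'| = 1 -> (k = i -> s' = sg) -> 0 <= s <= 1 ->
  ring 0 1 (facec i sg + w + s *: (facec k s' + w - (facec i sg + w))).
Proof.
move=> s'1 ki s01; have [s0 s1] := andP s01.
have s'P : s' = 1 \/ s' = -1.
  have [h|h] := leP 0 s'; first by left; rewrite -s'1 ger0_norm.
  by right; rewrite -s'1 ltr0_norm// opprK.
have le2 : `|facec i sg + w + s *: (facec k s' + w - (facec i sg + w))| <= 2.
  by apply: seg_norm => // l; rewrite mxE; apply: le_trans (ler_normD _ _) _;
    [apply: le_trans (facec_bound i l sg1)|apply: le_trans (facec_bound k l s'1)];
    rewrite lerD2l; apply: le_trans (wk l) _; lra.
have wi := wk i; have wkk := wk k; rewrite !ler_norml in wi wkk.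
move: wi wkk => /andP[wi1 wi2] /andP[wk1 wk2].
have [kiE|kiN] := eqVneq k i.
  apply: (inring (i := i)) => //; rewrite !mxE kiE eqxx (ki kiE).
  rewrite (_ : _ + _ = 3 / 2 * sg + w 0 i); last by ring.
  case: sgP => ->; [apply: le_trans (ler_norm _)|rewrite -normrN; apply: le_trans (ler_norm _)]; lra.
have ikN : (i == k) = false by rewrite eq_sym; exact: negbTE.
have [h|h] := leP s (1 / 2).
  apply: (inring (i := i)) => //; rewrite !mxE eqxx ikN.
  rewrite (_ : _ + _ = (1 - s) * (3 / 2 * sg) + w 0 i); last by ring.
  case: sgP => ->; [apply: le_trans (ler_norm _)|rewrite -normrN; apply: le_trans (ler_norm _)]; nra.
apply: (inring (i := k)) => //; rewrite !mxE eqxx (negbTE kiN).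
rewrite (_ : _ + _ = s * (3 / 2 * s') + w 0 k); last by ring.
case: s'P => ->; [apply: le_trans (ler_norm _)|rewrite -normrN; apply: le_trans (ler_norm _)]; nra.
Qed.

End segments_in_ring.
End crossing.

Section crossing2.
Context {R : realType}.
Local Notation lam := (@lebB R _).
Variable n : nat.
Implicit Types (x y p q c o : 'rV[R]_n) (rho : 'rV[R]_n -> \bar R) (E F S : set 'rV[R]_n).

Let seg_rev S x y : (forall t : R, 0 <= t <= 1 -> S (x + t *: (y - x))) ->
  forall t : R, 0 <= t <= 1 -> S (y + t *: (x - y)).
Proof.
move=> h t /andP[t0 t1].
have -> : y + t *: (x - y) = x + (1 - t) *: (y - x).
  by apply/rowP => k; rewrite !mxE; ring.
by apply: h; apply/andP; split; lra.
Qed.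

Let quarter_le4 : 4^-1 <= 4 :> R. Proof. by lra. Qed.

Let abs_le4 (u : R) : - 4^-1 <= u <= 4^-1 -> `|u| <= 4.
Proof. by rewrite ler_norml => /andP[h1 h2]; apply/andP; split; lra. Qed.

(** The level t is chosen so that all 2n faces of the cube of radius t are good;
    the points of E and F of norm t lie on such faces. *)
Let ring_unit : (1 < n)%N -> exists2 theta : R, 0 < theta & forall rho E F,
  measurable_fun setT (rho : borelRn R n -> \bar R) -> (forall x, 0 <= rho x)%E ->
  (forall t, 1 <= t <= 2 -> exists2 p, E p & `|p| = t) ->
  (forall t, 1 <= t <= 2 -> exists2 p, F p & `|p| = t) ->
  (\int[lam]_(x in ring 0 1) (rho x ^+ n) < theta%:E)%E ->
  exists x s, [/\ E x, F (last x s), polyin (ring 0 1) x s & (polycost rho x s < 1)%E].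
Proof.
move=> n1; have n0 : (0 < n)%N by exact: ltnW.
have M0 : 0 <= 8 * n%:R :> R by [].
have [theta th0 H] := @polygon_energy R n 2 (8 * n%:R) n0 (ltr0n _ 2) M0.
exists theta => // rho E F mrho rho0 EE FF lt_th.
have mS := @measurable_ring R n 0 1.
pose r := restr_to (ring 0 1) rho.
have mr : measurable_fun setT (r : borelRn R n -> \bar R) by exact: measurable_restr_to.
have r0 := restr_to_ge0 (ring 0 1) rho0.
have rX : (\int[lam]_x (r x ^+ n) < theta%:E)%E.
  apply: le_lt_trans lt_th; rewrite [leRHS]integral_indicl le_eqVlt.
  by apply/orP; left; apply/eqP; apply: eq_integral => x _; exact: restr_to_expe.
have rL x : ~ cube (- 2) 2 x -> r x = 0%E.
  move=> xL; rewrite /r /restr_to indicE memNset ?mul0e//.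
  rewrite /ring/= mulr1 subr0 => /andP[_ x2]; apply: xL; apply/cubeP => k.
  by rewrite -ler_norml (le_trans (coord_le_norm _ _)).
have [t [t1 t2 good]] := good_slice mr r0 n0 0 (ltr_nat R 1 2) (ltr0n _ 2) th0 rX.
have t12 : 1 <= t <= 2 by rewrite t1.
have tgt0 : 0 < t by exact: lt_le_trans t1.
have {}good k sg : `|sg| = 1 -> (slice_energy r 2 k (t * sg) <= (8 * n%:R * theta)%:E)%E.
  move=> sg1; have := good k sg sg1; rewrite mxE add0r => /le_trans; apply.
  by rewrite lee_fin le_eqVlt; apply/orP; left; apply/eqP; field.
have [p Ep pt] := EE t t12; have [q Fq qt] := FF t t12.
have [i pi] : exists i, `|p 0 i| = `|p| by apply: norm_coord; rewrite pt.
have [j qj] : exists j, `|q 0 j| = `|q| by apply: norm_coord; rewrite qt.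
have [sp sp1 pE] := sg_coord (etrans pi pt) tgt0.
have [sq sq1 qE] := sg_coord (etrans qj qt) tgt0.
have [k ki] : exists k : 'I_n, k != i.
  have [i0|i0] := eqVneq i (Ordinal n0).
    by exists (Ordinal n1); rewrite i0.
  by exists (Ordinal n0); rewrite eq_sym.
pose k1 := if i == j then k else i.
pose s1 := if i == j then 1 else sp.
have s11 : `|s1| = 1 by rewrite /s1; case: ifP => // _; rewrite normr1.
have slp : (slice_energy r 2 i (p 0%R i) <= (8 * n%:R * theta)%:E)%E by rewrite pE good.
have slq : (slice_energy r 2 j (q 0%R j) <= (8 * n%:R * theta)%:E)%E by rewrite qE good.
have ple l : `|p 0 l| <= 2 by rewrite (le_trans (coord_le_norm _ _))// pt.
have qle l : `|q 0 l| <= 2 by rewrite (le_trans (coord_le_norm _ _))// qt.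
have [w wW cost] := H r mr r0 rL (ltW rX) p q i j (facec i sp) (facec k1 s1) (facec j sq)
  ple qle (fun l => facec_bound i l sp1) (fun l => facec_bound k1 l s11)
  (fun l => facec_bound j l sq1) slp slq.
exists p, (hexpath p i (facec i sp) (facec k1 s1) (facec j sq) j q w).
have inr : polyin (ring 0 1) p (hexpath p i (facec i sp) (facec k1 s1) (facec j sq) j q w).
  have pt' : `|p| <= t by rewrite pt.
  have qt' : `|q| <= t by rewrite qt.
  split; first by move=> s; exact: (seg_ring1 sp1 t12 wW pt' pE).
  split; first by move=> s; exact: (seg_ring2 sp1 t12 wW pE).
  split.
    move=> s; apply: seg_ring3 => //; rewrite /k1 /s1.
    by case: eqP => // _ kiE; rewrite kiE eqxx in ki.
  split.
    move=> s; apply: seg_ring3 => //; rewrite /k1 /s1.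
    case: eqP => [ij jk|ij ji]; last by rewrite ji in ij.
    by rewrite ij jk eqxx in ki.
  split; first by apply: seg_rev => s; exact: (seg_ring2 sq1 t12 wW qE).
  by split => //; apply: seg_rev => s; exact: (seg_ring1 sq1 t12 wW qt' qE).
by split => //; rewrite -(polycost_restr rho inr).
Qed.

Let cross_unit : (1 < n)%N -> exists2 theta : R, 0 < theta & forall rho E F q0,
  measurable_fun setT (rho : borelRn R n -> \bar R) -> (forall x, 0 <= rho x)%E ->
  (forall t, 2^-1 <= t <= 1 -> exists2 p, E p & `|p| = t) ->
  `|q0| <= 2 ->
  (forall t, 2^-1 <= t <= 1 -> exists2 p, F p & `|p - q0| = t) ->
  (\int[lam]_x (rho x ^+ n) < theta%:E)%E ->
  exists x s, [/\ E x, F (last x s) & (polycost rho x s < 1)%E].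
Proof.
move=> n1; have n0 : (0 < n)%N by exact: ltnW.
have M0 : 0 <= 32 * n%:R :> R by [].
have [theta th0 H] := @polygon_energy R n 4 (32 * n%:R) n0 (ltr0n _ 4) M0.
exists theta => // rho E F q0 mrho rho0 EE q02 FF lt_th.
pose C : set 'rV[R]_n := cube (- 4) 4.
have mC : measurable (C : set (borelRn R n)) by exact: measurable_cube.
pose r := restr_to C rho.
have mr : measurable_fun setT (r : borelRn R n -> \bar R) by exact: measurable_restr_to.
have r0 := restr_to_ge0 C rho0.
have rX : (\int[lam]_x (r x ^+ n) < theta%:E)%E.
  apply: le_lt_trans lt_th; apply: ge0_le_integral => //.
  - by move=> x _; rewrite expe_ge0.
  - exact: measurable_rhoX.
  - exact: measurable_rhoX.
  - move=> x _; rewrite restr_to_expe// indicE.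
    by case: (x \in C); rewrite ?mul1e// mul0e expe_ge0.
have rL x : ~ cube (- 4) 4 x -> r x = 0%E.
  by move=> xL; rewrite /r /restr_to indicE memNset ?mul0e.
have h12 : 2^-1 < 1 :> R by rewrite invf_lt1// ltr1n.
have Cenv x M : `|x| <= 4 -> forall l, `|x 0 l| <= 4.
  by move=> x4 l; rewrite (le_trans (coord_le_norm _ _)).
have ME : 4 * n%:R * 4 * theta / (1 - 2^-1) = 32 * n%:R * theta.
  by field; rewrite ?subr_eq0 ?gt_eqF.
have [t [t1 t2 good]] := good_slice mr r0 n0 0 h12 (ltr0n _ 4) th0 rX.
have [t' [t1' t2' good']] := good_slice mr r0 n0 q0 h12 (ltr0n _ 4) th0 rX.
have tgt0 : 0 < t by apply: lt_le_trans t1; rewrite invr_gt0.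
have tgt0' : 0 < t' by apply: lt_le_trans t1'; rewrite invr_gt0.
have [p Ep pt] := EE t (introT andP (conj t1 t2)).
have [q Fq qt] := FF t' (introT andP (conj t1' t2')).
have [i pi] : exists i, `|p 0 i| = `|p| by apply: norm_coord; rewrite pt.
have [j qj] : exists j, `|(q - q0) 0 j| = `|q - q0| by apply: norm_coord; rewrite qt.
have [sp sp1 pE] := sg_coord (etrans pi pt) tgt0.
have [sq sq1 qE] := sg_coord (etrans qj qt) tgt0'.
have slp : (slice_energy r 4 i (p 0%R i) <= (32 * n%:R * theta)%:E)%E.
  by have := good i sp sp1; rewrite mxE add0r -pE ME.
have slq : (slice_energy r 4 j (q 0%R j) <= (32 * n%:R * theta)%:E)%E.
  have := good' j sq sq1; rewrite -qE ME !mxE.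
  by rewrite (_ : q0 0 j + (q 0 j - q0 0 j) = q 0 j)//; ring.
have ple l : `|p 0 l| <= 4.
  by rewrite (le_trans (coord_le_norm _ _))// pt (le_trans t2)// ler1n.
have qle l : `|q 0 l| <= 4.
  apply: le_trans (coord_le_norm _ _) _; rewrite -(subrK q0 q).
  by apply: le_trans (ler_normD _ _) _; rewrite qt (le_trans (lerD t2' q02))//; lra.
have zle l : `|(0 : 'rV[R]_n) 0 l| + 4^-1 <= 4 by rewrite mxE normr0 add0r.
have [w wW cost] := H r mr r0 rL (ltW rX) p q i j 0 0 0 ple qle zle zle zle slp slq.
exists p, (hexpath p i 0 0 0 j q w); split => //.
have wle l : `|(0 + w) 0 l| <= 4.
  by rewrite add0r; have /cubeP/(_ l) := wW; exact: abs_le4.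
have ule (v : 'rV[R]_n) m (s : R) : `|s| <= 4 -> (forall l, `|v 0 l| <= 4) ->
    forall l, `|upd v m s 0 l| <= 4.
  by move=> s4 vle l; rewrite updE; case: ifP.
have ins (x y : 'rV[R]_n) : (forall l, `|x 0 l| <= 4) -> (forall l, `|y 0 l| <= 4) ->
    forall s : R, 0 <= s <= 1 -> C (x + s *: (y - x)).
  move=> xle yle s s01; apply/cubeP => l; rewrite -ler_norml.
  by apply: le_trans (coord_le_norm _ _) _; exact: seg_norm.
suff inr : polyin C p (hexpath p i 0 0 0 j q w) by rewrite -(polycost_restr rho inr).
have zpl := ule _ i _ (ple i) wle; have zql := ule _ j _ (qle j) wle.
by do !split; exact: ins.
Qed.

Lemma segcost_scale rho o (r : R) x y : 0 < r ->
  segcost (fun u => r%:E * rho (o + r *: u)%R)%E x y =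
  segcost rho (o + r *: x) (o + r *: y).
Proof.
move=> r0; apply: eq_integral => s _.
have -> : o + r *: y - (o + r *: x) = r *: (y - x).
  by apply/rowP => k; rewrite !mxE; ring.
have -> : o + r *: x + s *: (r *: (y - x)) = o + r *: (x + s *: (y - x)).
  by apply/rowP => k; rewrite !mxE; ring.
have -> : enorm (r *: (y - x)) = r * enorm (y - x).
  have := sqr_enorm_scale_sub r 0 (y - x) 0; rewrite scale0r subr0.
  rewrite expr0n/= mul0r addr0 mulr0 mul0r subr0 -exprMn => /eqP.
  by rewrite eqrXn2 ?mulr_ge0 ?enorm_ge0 ?ltW// => /eqP.
by rewrite EFinM muleA (muleC r%:E (rho _)).
Qed.

Lemma polycost_scale rho o (r : R) x s : 0 < r ->
  polycost (fun u => r%:E * rho (o + r *: u)%R)%E x s =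
  polycost rho (o + r *: x) [seq o + r *: u | u <- s].
Proof.
by move=> r0; elim: s x => //= y s IH x; rewrite IH segcost_scale.
Qed.

Lemma polyin_scale S o (r : R) x s :
  polyin [set u | S (o + r *: u)] x s -> polyin S (o + r *: x) [seq o + r *: u | u <- s].
Proof.
elim: s x => //= y s IH x [xy /IH h]; split => // t t01.
have -> : o + r *: x + t *: (o + r *: y - (o + r *: x)) = o + r *: (x + t *: (y - x)).
  by apply/rowP => k; rewrite !mxE; ring.
exact: xy.
Qed.

Lemma expe_mulE (r : R) (y : \bar R) k :
  0 < r -> (0 <= y)%E -> ((r%:E * y) ^+ k = (r ^+ k)%:E * y ^+ k)%E.
Proof.
move=> r0 y0; elim: k => [|k IH]; first by rewrite !expr0 mule1.
by rewrite !expeS IH exprS EFinM muleACA.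
Qed.

(** The energy of order n is conformally invariant: the Jacobian of a homothety
    cancels the n-th power of its factor. *)
Lemma integral_scale (g : 'rV[R]_n -> \bar R) o (r : R) : 0 < r ->
  measurable_fun setT (g : borelRn R n -> \bar R) -> (forall x, 0 <= g x)%E ->
  (\int[lam]_u ((r ^+ n)%:E * g (o + r *: u)%R) <= \int[lam]_x g x)%E.
Proof.
move=> r0 mg g0.
have mgo : measurable_fun setT ((fun u => g (o + r *: u)) : borelRn R n -> \bar R).
  have mo : measurable_fun setT ((fun u => o + r *: u) : borelRn R n -> borelRn R n).
    apply: measurable_into_borel => k; under eq_fun do rewrite !mxE.
    apply: measurable_funD => //; apply: measurable_funM => //.
    exact: measurable_coord.
  exact: (measurableT_comp mg mo).
rewrite ge0_integralZl//; last by rewrite lee_fin exprn_ge0// ltW.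
have := @integral_push_affmap R n o (fun=> r) setT g (fun=> r0) measurableT mg g0.
rewrite prodr_const card_ord => H.
rewrite -lee_pdivlMl ?exprn_gt0//.
apply: le_trans H; rewrite le_eqVlt; apply/orP; left; apply/eqP.
apply: eq_integral => u _; congr g.
by apply/rowP => k; rewrite !mxE.
Qed.

(** The polygon stays in a ring that is only slightly larger, so that the
    estimates for disjoint rings add up. *)
Lemma ring_crossing : (1 < n)%N -> exists2 theta : R, 0 < theta & forall rho E F o r,
  0 < r ->
  measurable_fun setT (rho : borelRn R n -> \bar R) -> (forall x, 0 <= rho x)%E ->
  (forall t, r <= t <= 2 * r -> exists2 p, E p & `|p - o| = t) ->
  (forall t, r <= t <= 2 * r -> exists2 p, F p & `|p - o| = t) ->
  (\int[lam]_(x in ring o r) (rho x ^+ n) < theta%:E)%E ->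
  exists x s, [/\ E x, F (last x s), polyin (ring o r) x s & (polycost rho x s < 1)%E].
Proof.
move=> n1; have n0 : (0 < n)%N by exact: ltnW.
have [theta th0 H] := ring_unit n1; exists theta => // rho E F o r r0 mrho rho0 EE FF lt_th.
have sE (G : set 'rV[R]_n) : (forall t, r <= t <= 2 * r -> exists2 p, G p & `|p - o| = t) ->
    forall t, 1 <= t <= 2 -> exists2 p, [set u | G (o + r *: u)] p & `|p| = t.
  move=> GG t /andP[t1 t2]; have [|p Gp pt] := GG (r * t).
    by apply/andP; split; nra.
  have pE : o + r *: (r^-1 *: (p - o)) = p.
    by rewrite scalerA mulfV ?gt_eqF// scale1r addrC subrK.
  exists (r^-1 *: (p - o)); first by rewrite /= pE.
  by rewrite normrZ pt gtr0_norm ?invr_gt0// mulKf// gt_eqF.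
pose rs u := (r%:E * rho (o + r *: u)%R)%E.
have mo : measurable_fun setT ((fun u => o + r *: u) : borelRn R n -> borelRn R n).
  apply: measurable_into_borel => k; under eq_fun do rewrite !mxE.
  apply: measurable_funD => //; apply: measurable_funM => //.
  exact: measurable_coord.
have mrs : measurable_fun setT (rs : borelRn R n -> \bar R).
  by apply: emeasurable_funM => //; exact: (measurableT_comp mrho mo).
have rs0 x : (0 <= rs x)%E by rewrite mule_ge0// lee_fin ltW.
have ringE u : ring 0 1 u -> ring o r (o + r *: u).
  rewrite /ring/= subr0 addrC addKr normrZ gtr0_norm// mul1r => /andP[h1 h2].
  by apply/andP; split; nra.
have ringE' u : ring o r (o + r *: u) -> ring 0 1 u.
  rewrite /ring/= subr0 addrC addKr normrZ gtr0_norm// mul1r => /andP[h1 h2].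
  by apply/andP; split; nra.
have rsX : (\int[lam]_(u in ring 0 1) (rs u ^+ n) < theta%:E)%E.
  apply: le_lt_trans lt_th; rewrite [leLHS]integral_indicl [leRHS]integral_indicl.
  pose g x := ((\1_(ring o r) x)%:E * rho x ^+ n)%E.
  have mg : measurable_fun setT (g : borelRn R n -> \bar R).
    apply: emeasurable_funM; last exact: measurable_rhoX.
    by apply/measurable_EFinP; exact: measurable_indic (measurable_ring _ _).
  have g0 x : (0 <= g x)%E by rewrite mule_ge0 ?expe_ge0// lee_fin.
  apply: le_trans (integral_scale o r0 mg g0); rewrite le_eqVlt; apply/orP; left; apply/eqP.
  apply: eq_integral => u _; rewrite /g !indicE.
  have [uS|uS] := pselect (ring 0 1 u).
    rewrite !mem_set//; last exact: ringE.
    by rewrite !mul1e /rs expe_mulE.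
  by rewrite !memNset ?mul0e ?mule0// => /ringE'.
have [x [s [Ex Fx px cx]]] := H rs _ _ mrs rs0 (sE E EE) (sE F FF) rsX.
exists (o + r *: x), [seq o + r *: u | u <- s]; split => //.
- by rewrite (last_map (fun u => o + r *: u)).
- apply: polyin_scale.
  elim: s x px {Ex Fx cx} => //= y s IH x [xy /IH h]; split => // t t01.
  by apply: ringE; exact: xy.
- by rewrite -polycost_scale.
Qed.

(** Here the polygon is not confined to a ring: all that matters is the distance
    of the two centers in comparison with the size of the two sets. *)
Lemma two_center_crossing : (1 < n)%N -> exists2 theta : R, 0 < theta & forall rho E F p0 q0 d,
  0 < d -> `|q0 - p0| <= 2 * d ->
  measurable_fun setT (rho : borelRn R n -> \bar R) -> (forall x, 0 <= rho x)%E ->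
  (forall t, d / 2 <= t <= d -> exists2 p, E p & `|p - p0| = t) ->
  (forall t, d / 2 <= t <= d -> exists2 p, F p & `|p - q0| = t) ->
  (\int[lam]_x (rho x ^+ n) < theta%:E)%E ->
  exists x s, [/\ E x, F (last x s) & (polycost rho x s < 1)%E].
Proof.
move=> n1; have [theta th0 H] := cross_unit n1; exists theta => //.
move=> rho E F p0 q0 r r0 pq mrho rho0 EE FF lt_th.
have sE (G : set 'rV[R]_n) o : (forall t, r / 2 <= t <= r -> exists2 p, G p & `|p - o| = t) ->
    forall t, 2^-1 <= t <= 1 -> exists2 p, [set u | G (p0 + r *: u)] p & `|p - r^-1 *: (o - p0)| = t.
  move=> GG t /andP[t1 t2]; have [|p Gp pt] := GG (r * t).
    by apply/andP; split; nra.
  have pE : p0 + r *: (r^-1 *: (p - p0)) = p.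
    by rewrite scalerA mulfV ?gt_eqF// scale1r addrC subrK.
  exists (r^-1 *: (p - p0)); first by rewrite /= pE.
  rewrite -scalerBr opprB addrA subrK.
  by rewrite normrZ pt gtr0_norm ?invr_gt0// mulKf// gt_eqF.
pose rs u := (r%:E * rho (p0 + r *: u)%R)%E.
have mo : measurable_fun setT ((fun u => p0 + r *: u) : borelRn R n -> borelRn R n).
  apply: measurable_into_borel => k; under eq_fun do rewrite !mxE.
  apply: measurable_funD => //; apply: measurable_funM => //.
  exact: measurable_coord.
have mrs : measurable_fun setT (rs : borelRn R n -> \bar R).
  by apply: emeasurable_funM => //; exact: (measurableT_comp mrho mo).
have rs0 x : (0 <= rs x)%E by rewrite mule_ge0// lee_fin ltW.
have rsX : (\int[lam]_u (rs u ^+ n) < theta%:E)%E.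
  apply: le_lt_trans lt_th.
  apply: le_trans (integral_scale p0 r0 (measurable_rhoX mrho) (rhoX0 rho0)).
  rewrite le_eqVlt; apply/orP; left; apply/eqP.
  by apply: eq_integral => u _; rewrite /rs expe_mulE.
have q02 : `|r^-1 *: (q0 - p0)| <= 2.
  by rewrite normrZ gtr0_norm ?invr_gt0// ler_pdivrMl// mulrC.
have EE' t : 2^-1 <= t <= 1 -> exists2 p, [set u | E (p0 + r *: u)] p & `|p| = t.
  by move=> /(sE E p0 EE)[p Ep]; rewrite subrr scaler0 subr0; exists p.
have [x [s [Ex Fx cx]]] := H rs _ _ _ mrs rs0 EE' q02 (sE F q0 FF) rsX.
exists (p0 + r *: x), [seq p0 + r *: u | u <- s]; split => //.
- by rewrite (last_map (fun u => p0 + r *: u)).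
- by rewrite -polycost_scale.
Qed.
End crossing2.

(** * The length of curves *)

Section lengths.
Context {R : realType} {n : nat}.
Implicit Types (h : R -> 'rV[R]_n) (a b c : R) (s : seq R).

Lemma enorm0 : enorm (0 : 'rV[R]_n) = 0.
Proof. by rewrite /enorm big1 ?sqrtr0// => i _; rewrite mxE expr0n. Qed.

Lemma enorm_le_sum (x : 'rV[R]_n) : enorm x <= \sum_i `|x 0 i|.
Proof.
have S0 : 0 <= \sum_i `|x 0 i| by apply: sumr_ge0.
rewrite -ler_sqr ?nnegrE ?enorm_ge0// enorm_sqr expr2 mulr_suml.
apply: ler_sum => i _; rewrite -[leLHS]ger0_norm ?sqr_ge0// expr2 normrM; apply: ler_wpM2l => //.
by rewrite (bigD1 i)//= lerDl sumr_ge0.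
Qed.

Fixpoint inscribed h a s : R :=
  if s is y :: s' then enorm (h y - h a) + inscribed h y s' else 0.

Definition len h a b : \bar R :=
  ereal_sup [set (inscribed h a s)%:E | s in [set s | itv_partition a b s]].

Lemma inscribedE h a b s : itv_partition a b s ->
  \sum_(0 <= k < size s) enorm (h (nth b (a :: s) k.+1) - h (nth b (a :: s) k)) =
  inscribed h a s.
Proof.
elim: s a => [|y s IH] a; first by rewrite big_geq.
move=> /itv_partition_cons ys /=; rewrite big_nat_recl//= -(IH y ys).
by congr (_ + _); apply: eq_big_nat.
Qed.

Lemma inscribed_cat h a s t :
  inscribed h a (s ++ t) = inscribed h a s + inscribed h (last a s) t.
Proof. by elim: s a => [|y s IH] a /=; rewrite ?add0r// IH addrA. Qed.

Lemma len_ge h a b s : itv_partition a b s -> ((inscribed h a s)%:E <= len h a b)%E.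
Proof. by move=> abs; apply: ereal_sup_ubound; exists s. Qed.

Lemma lenxx h a : len h a a = 0%E.
Proof.
apply/eqP; rewrite eq_le; apply/andP; split.
  by apply: ge_ereal_sup => _ [s /itv_partitionxx -> <-].
have aa : itv_partition a a [::] by split.
exact: len_ge aa.
Qed.

Lemma len_ge_chord h a b : a <= b -> ((enorm (h b - h a))%:E <= len h a b)%E.
Proof.
rewrite le_eqVlt => /predU1P[<-|/(@itv_partition1 _ R)/len_ge].
  by rewrite lenxx subrr enorm0.
by move=> /(_ h); rewrite /= addr0.
Qed.

Lemma len_ge0 h a b : a <= b -> (0 <= len h a b)%E.
Proof. by move=> ab; apply: le_trans (len_ge_chord h ab); rewrite lee_fin enorm_ge0. Qed.

(** Inserting a node does not shorten the inscribed polygon. *)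
Lemma inscribed_split h a b c s : a < c -> c < b -> itv_partition a b s ->
  exists s1 s2, [/\ itv_partition a c s1, itv_partition c b s2 &
    inscribed h a s <= inscribed h a s1 + inscribed h c s2].
Proof.
elim: s a => [|y s IH] a ac cb.
  by move=> /itv_partition_nil abE; move: (lt_trans ac cb); rewrite abE ltxx.
move=> [/= /andP[ay ys] sb].
have yb : itv_partition y b s by split.
have [yc|cy|yc] := ltgtP y c.
- have [s1 [s2 [[p1 l1] p2 le12]]] := IH y yc cb yb.
  exists (y :: s1), s2; split => //; first by split => //=; rewrite ay.
  by rewrite /= -addrA lerD2l.
- exists [:: c], (y :: s); split.
  + exact: itv_partition1.
  + by split => //=; rewrite cy.
  + rewrite /= addr0 addrA lerD2r.
    have -> : h y - h a = (h c - h a) + (h y - h c) by rewrite [RHS]addrC subrKA.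
    exact: enormD.
- exists [:: c], s; split; [exact: itv_partition1|by rewrite -yc|].
  by rewrite /= yc addr0.
Qed.

Lemma lenD h a b c : a <= c -> c <= b -> len h a b = (len h a c + len h c b)%E.
Proof.
rewrite le_eqVlt => /predU1P[<-|ac]; first by rewrite lenxx add0e.
rewrite le_eqVlt => /predU1P[<-|cb]; first by rewrite lenxx adde0.
apply/eqP; rewrite eq_le; apply/andP; split.
  apply: ge_ereal_sup => _ [s /(inscribed_split h ac cb)[s1 [s2 [p1 p2 le12]]] <-].
  apply: le_trans (leeD (len_ge h p1) (len_ge h p2)).
  by rewrite -EFinD lee_fin.
have H1 s1 : itv_partition a c s1 -> ((inscribed h a s1)%:E + len h c b <= len h a b)%E.
  move=> p1; rewrite addeC -leeBrDr//; apply: ge_ereal_sup => _ [s2 p2 <-].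
  rewrite leeBrDr// -EFinD addrC.
  have [_ /eqP l1] := p1; have := inscribed_cat h a s1 s2; rewrite l1 => <-.
  exact: len_ge (itv_partition_cat p1 p2).
have l0 := len_ge0 h (ltW cb).
have [lE|fin] := eqVneq (len h c b) +oo%E.
  have := H1 _ (itv_partition1 ac); rewrite lE addey// leye_eq => /eqP ->.
  by rewrite leey.
have fl : len h c b \is a fin_num by rewrite ge0_fin_numE// ltey.
rewrite -leeBrDr//; apply: ge_ereal_sup => _ [s1 p1 <-].
by rewrite leeBrDr//; exact: H1.
Qed.

Lemma inscribed_coord h a b s : itv_partition a b s ->
  inscribed h a s <= \sum_i variation a b (fun t => h t 0 i) s.
Proof.
move=> abs; rewrite -(inscribedE h abs) /variation exchange_big /=.
apply: ler_sum => k _ /=.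
apply: le_trans (enorm_le_sum _) _.
by apply: ler_sum => i _; rewrite !mxE.
Qed.

Lemma variation_le_inscribed h a b s i : itv_partition a b s ->
  variation a b (fun t => h t 0 i) s <= inscribed h a s.
Proof.
move=> abs; rewrite -(inscribedE h abs) /variation.
apply: ler_sum => k _ /=; apply: le_trans (coord_le_enorm _ i).
by rewrite !mxE.
Qed.

Lemma len_bounded_variation h a b i : (len h a b < +oo)%E ->
  bounded_variation a b (fun t => h t 0 i).
Proof.
move=> lfin; have [[s0 s0P]|no] := pselect (exists s, itv_partition a b s); last first.
  by exists 0; move=> _ [s sP <-]; case: no; exists s.
have ab := itv_partition_le s0P.
have fl : len h a b \is a fin_num by rewrite ge0_fin_numE// len_ge0.
exists (fine (len h a b)); move=> _ [s sP <-].
by rewrite -lee_fin fineK// (le_trans _ (len_ge h sP))// lee_fin variation_le_inscribed.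
Qed.

(** The length is squeezed between the variations of the coordinates, which
    gives its continuity from that of the total variation. *)
Lemma len_le_TV h a b : a <= b -> (len h a b <= \sum_i total_variation a b (fun t => h t 0%R i))%E.
Proof.
move=> ab; apply: ge_ereal_sup => _ [s sP <-].
apply: (@le_trans _ _ (\sum_i (variation a b (fun t => h t 0%R i) s)%:E)%E).
  by rewrite sumEFin lee_fin inscribed_coord.
by apply: lee_sum => i _; apply: ereal_sup_ubound; exists (variation a b (fun t => h t 0 i) s) => //; exists s.
Qed.

End lengths.

Section chordal_topology.
Context {R : realType} {n : nat}.
Implicit Types (x u : 'rV[R]_n).

Lemma sqrt_1sqr_ge1 (a : R) : 1 <= Num.sqrt (1 + a ^+ 2).
Proof. by rewrite -[leLHS]sqrtr1 ler_wsqrtr// lerDl sqr_ge0. Qed.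

Lemma sqrt_1sqr_le (a : R) : 0 <= a -> Num.sqrt (1 + a ^+ 2) <= 1 + a.
Proof.
move=> a0; rewrite -[leRHS]ger0_norm ?addr_ge0// -sqrtr_sqr ler_wsqrtr//; nra.
Qed.

Lemma chordal_le x u : chordal (emb x) (emb u) <= enorm (x - u).
Proof.
rewrite /chordal/= ler_pdivrMr.
  by rewrite ler_peMr ?enorm_ge0// mulr_ege1// sqrt_1sqr_ge1.
by rewrite mulr_gt0// (lt_le_trans ltr01)// sqrt_1sqr_ge1.
Qed.

(** Points chordally close to a finite point are finite and close to it in R^n,
    so R^n is open in the extended space and carries its usual topology. *)
Lemma chordal_enorm x (e : R) : 0 < e -> exists2 d : R, 0 < d &
  forall y : extRn R n, chordal (emb x) y < d -> exists2 u, y = emb u & enorm (x - u) < e.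
Proof.
move=> e0; set c := Num.sqrt (1 + enorm x ^+ 2).
have c1 : 1 <= c by exact: sqrt_1sqr_ge1.
have x0 := enorm_ge0 x.
have c0 : 0 < c by exact: lt_le_trans c1.
pose M := 1 + enorm x; have M0 : 0 < M by rewrite ltr_pwDl.
exists (Num.min (2 * c)^-1 (e / (2 * c * M))).
  by rewrite lt_min; apply/andP; split; rewrite ?invr_gt0 ?divr_gt0 ?mulr_gt0.
move=> [u|]; rewrite /chordal/= -/c lt_min => /andP[h1 h2]; last first.
  by move: h1; rewrite invfM ltr_pMl ?invr_gt0// invf_gt1// ltNge ler1n.
exists u => //; set D := enorm (x - u) in h1 h2 *.
set cu := Num.sqrt _ in h1 h2.
have D0 : 0 <= D by exact: enorm_ge0.
have cu0 : 0 < cu by rewrite (lt_le_trans ltr01)// sqrt_1sqr_ge1.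
have cuM : cu <= M + D.
  apply: le_trans (sqrt_1sqr_le (enorm_ge0 u)) _; rewrite /M -addrA lerD2l.
  have -> : u = x - (x - u) by rewrite subKr.
  by apply: le_trans (enormD _ _) _; rewrite enormN.
move: h1 h2; rewrite !ltr_pdivrMr ?mulr_gt0//.
have -> : (2 * c)^-1 * (c * cu) = cu / 2 by field; rewrite gt_eqF.
have -> : e / (2 * c * M) * (c * cu) = e * cu / (2 * M) by field; rewrite !gt_eqF.
rewrite ltr_pdivlMr ?mulr_gt0// => h1 h2.
have DM : D < M by lra.
have h4 : cu <= 2 * M by rewrite (le_trans cuM)// mulr_natl mulr2n lerD2l ltW.
have h3 : e * cu <= e * (2 * M) by rewrite ler_pM2l.
have : D * (2 * M) < e * (2 * M) by apply: lt_le_trans h3; rewrite -ltr_pdivlMr ?mulr_gt0.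
by rewrite ltr_pM2r// mulr_gt0.
Qed.

End chordal_topology.

Section arclength.
Context {R : realType} {n : nat}.
Implicit Types (g : curve R n) (a b t : R).

Lemma clengthE g a b : clength g a b = len (curve_pt g) a b.
Proof.
congr ereal_sup; apply/seteqP; split => _ [s sP <-]; exists s => //.
  by rewrite inscribedE.
by rewrite inscribedE.
Qed.

Lemma curve_pt_continuous g a b i :
  {within `[a, b], continuous (cpath g)} -> (forall t, a <= t <= b -> g t <> infinity) ->
  {within `[a, b], continuous (fun t => curve_pt g t 0 i)}.
Proof.
move=> cg gfin; apply/subspace_continuousP => t tab.
move/subspace_continuousP : cg => /(_ t tab) gt.
apply/cvgrPdist_lt => e e0.
have [u tu] : exists u, g t = emb u.
  move: tab; rewrite /= in_itv/= => tab.
  by case: (g t) (gfin t tab) => [u _|//]; exists u.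
have [d d0 H] := chordal_enorm u e0.
have /gt : nbhs (g t) [set y | chordal (g t) y < d].
  by apply/nbhs_ballP; exists d.
move=> K.
have {K} : \forall s \near within `[a, b] (nbhs t), chordal (g t) (g s) < d by exact: K.
apply: filterS => s; rewrite tu => /H[v sv uv].
rewrite /from_subspace /curve_pt tu sv /=; apply: le_lt_trans uv.
by apply: le_trans (coord_le_enorm _ i); rewrite !mxE.
Qed.

Lemma arclength_continuous g : is_curve g -> locally_rectifiable g ->
  {within `[cstart g, cend g], continuous (arclength g)}.
Proof.
move=> [ab cg] [gfin rect]; set a := cstart g in ab cg gfin rect *.
set b := cend g in ab cg gfin rect *.
set h := curve_pt g; pose f i (t : R) := h t 0 i.
have lab : (len h a b < +oo)%E by rewrite -clengthE rect// ltW.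
have bv i : bounded_variation a b (f i) by exact: len_bounded_variation lab.
have cf i : {within `[a, b], continuous (f i)} by exact: curve_pt_continuous cg gfin.
have cV i := total_variation_continuous ab (cf i) (bv i).
apply/subspace_continuousP => t tab; apply/cvgrPdist_lt => e e0.
have e'0 : 0 < e / n.+1%:R by rewrite divr_gt0.
have : \forall s \near within `[a, b] (nbhs t), forall i : 'I_n,
   `|fine (total_variation a t (f i)) - fine (total_variation a s (f i))| < e / n.+1%:R.
  apply: filter_forall => i; move/subspace_continuousP : (cV i) => /(_ t tab).
  by move=> /cvgrPdist_lt/(_ _ e'0).
move=> near1; have near2 : \forall s \near within `[a, b] (nbhs t), a <= s <= b.
  by apply: withinT; exact: nbhs_filter.
move: near1 near2; apply: filterS2 => s H sab.
have tab' : a <= t <= b by move: tab; rewrite /= in_itv.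
have tvfin x y i : a <= x -> x <= y -> y <= b -> total_variation x y (f i) \is a fin_num.
  move=> ax xy yb; apply/bounded_variationP => //.
  apply: (bounded_variationl xy yb).
  exact: (bounded_variationr ax (le_trans xy yb)).
have lfin x y : a <= x -> x <= y -> y <= b -> len h x y \is a fin_num.
  move=> ax xy yb; rewrite ge0_fin_numE ?len_ge0//.
  by rewrite -clengthE rect.
have key x y : a <= x -> x <= y -> y <= b ->
    (forall i : 'I_n, `|fine (total_variation a y (f i)) - fine (total_variation a x (f i))| < e / n.+1%:R) ->
    `|arclength g y - arclength g x| < e.
  move=> ax xy yb Hi; rewrite /arclength !clengthE -/a -/h.
  rewrite (lenD h ax xy) fineD ?lfin//; last exact: le_trans xy yb.
  rewrite addrAC subrr add0r ger0_norm ?fine_ge0 ?len_ge0//.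
  have : (len h x y <= \sum_i total_variation x y (f i))%E by exact: len_le_TV.
  rewrite -{1}(fineK (lfin _ _ ax xy yb)).
  have -> : (\sum_i total_variation x y (f i) = (\sum_i fine (total_variation x y (f i)))%:E)%E.
    by rewrite -sumEFin; apply: eq_bigr => i _; rewrite fineK// tvfin.
  rewrite lee_fin => /le_lt_trans; apply.
  apply: (@le_lt_trans _ _ (\sum_(i < n) e / n.+1%:R)).
    apply: ler_sum => i _; have := Hi i.
    rewrite (total_variationD (f i) ax xy) fineD ?tvfin//; last exact: le_trans xy yb.
    rewrite addrAC subrr add0r => /ltW; apply: le_trans; exact: ler_norm.
  rewrite sumr_const card_ord -[X in X < _]mulr_natr -mulrA gtr_pMr//.
  by rewrite mulrC ltr_pdivrMr// mul1r ltr_nat.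
have [/andP[a1 b1] /andP[a2 b2]] := (tab', sab).
have [ts|st] := leP t s.
  by rewrite distrC; apply: key => // i; rewrite distrC.
by apply: key => //; exact: ltW.
Qed.

End arclength.

(** * Subcurves and unit speed paths *)

Section short_paths.
Context {R : realType} {n : nat}.
Implicit Types (h : R -> 'rV[R]_n) (a b c t : R) (rho : 'rV[R]_n -> \bar R).
Local Notation mu := (@lebesgue_measure R).

(** Non-expansive paths: sections of them are curves of finite length, and they
    are measurable without further ado. *)
Definition short h := forall s t, enorm (h t - h s) <= `|t - s|.

Lemma short_coord_continuous h i : short h -> continuous (fun t => h t 0 i).
Proof.
move=> hs t; apply/cvgrPdist_lt => e e0; near=> s.
have := coord_le_enorm (h t - h s) i; rewrite !mxE => /le_lt_trans; apply.
apply: le_lt_trans (hs _ _) _.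
near: s; exact: (@cvgr_dist_lt _ _ _ (nbhs t) _ id t).
Unshelve. all: by end_near. Qed.

Lemma measurable_short h : short h -> measurable_fun setT (h : R -> borelRn R n).
Proof.
move=> hs; apply: measurable_into_borel => i.
by apply: continuous_measurable_fun; exact: short_coord_continuous.
Qed.

Lemma inscribed_le h a b s : (forall x y, a <= x -> x <= y -> y <= b -> enorm (h y - h x) <= y - x) ->
  itv_partition a b s -> inscribed h a s <= b - a.
Proof.
elim: s a => [|y s IH] a H; first by move=> /itv_partition_nil ->; rewrite /= subrr.
move=> abs; have yb := itv_partition_cons abs.
have [/= /andP[ay _] _] := abs; have yleb := itv_partition_le yb.
have -> : b - a = (y - a) + (b - y) by rewrite [RHS]addrC subrKA.
apply: lerD; first by apply: H => //; exact: ltW.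
by apply: IH => // x z yx; apply: H; exact: le_trans (ltW ay) yx.
Qed.

Lemma len_le h a b : (forall x y, a <= x -> x <= y -> y <= b -> enorm (h y - h x) <= y - x) ->
  a <= b -> (len h a b <= (b - a)%:E)%E.
Proof.
by move=> H ab; apply: ge_ereal_sup => _ [s sP <-]; rewrite lee_fin; exact: inscribed_le.
Qed.

Lemma short_len h a b : short h -> a <= b -> (len h a b <= (b - a)%:E)%E.
Proof.
move=> hs ab; apply: len_le => // x y _ xy _; apply: le_trans (hs _ _) _.
by rewrite ger0_norm// subr_ge0.
Qed.

(** Unit speed on [a, b] is inherited by every subinterval, since none of the
    lengths can exceed the time elapsed. *)
Lemma unit_speed_sub h a b c d : short h -> a <= c -> c <= d -> d <= b ->
  (len h a b = (b - a)%:E)%E -> (len h c d = (d - c)%:E)%E.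
Proof.
move=> hs ac cd db; rewrite (lenD h (le_trans ac cd) db) (lenD h ac cd).
have h1 := short_len hs ac; have h2 := short_len hs cd; have h3 := short_len hs db.
have f1 : len h a c \is a fin_num by rewrite ge0_fin_numE ?len_ge0// (le_lt_trans h1)// ltry.
have f2 : len h c d \is a fin_num by rewrite ge0_fin_numE ?len_ge0// (le_lt_trans h2)// ltry.
have f3 : len h d b \is a fin_num by rewrite ge0_fin_numE ?len_ge0// (le_lt_trans h3)// ltry.
move: h1 h2 h3; rewrite -(fineK f1) -(fineK f2) -(fineK f3) -!EFinD !lee_fin.
by move=> h1 h2 h3 [h4]; congr _%:E; lra.
Qed.

Lemma short_curve h a b : short h -> a < b ->
  is_curve (Curve a b (emb \o h)) /\ locally_rectifiable (Curve a b (emb \o h)).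
Proof.
move=> hs ab; split.
  split => //=; apply: continuous_subspaceT => t.
  move=> A /nbhs_ballP[e /= e0 eA]; apply/nbhs_ballP; exists e => //= s.
  rewrite /ball/= => ts; apply: eA; rewrite /ball/=.
  apply: le_lt_trans ts; apply: le_trans (chordal_le _ _) _; exact: hs.
split => //= c d ac cd db; rewrite clengthE.
apply: le_lt_trans (short_len _ cd) (ltry _).
by move=> s t; exact: hs.
Qed.

Lemma line_integral_unit_speed h a b rho : short h -> a < b ->
  measurable_fun setT (rho : borelRn R n -> \bar R) -> (forall x, 0 <= rho x)%E ->
  len h a b = (b - a)%:E ->
  line_integral rho (Curve a b (emb \o h)) = (\int[mu]_(s in `[a, b]) rho (h s))%E.
Proof.
move=> hs ab mrho rho0 lab.
have al t : a <= t -> t <= b -> arclength (Curve a b (emb \o h)) t = t - a.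
  by move=> at_ tb; rewrite /arclength clengthE (unit_speed_sub hs (lexx a) at_ tb lab).
rewrite /line_integral/= al ?lexx//; last exact: ltW.
have mG : measurable_fun setT (fun s => rho (h (a + s))).
  apply: (measurableT_comp mrho); apply: measurable_short => s t.
  by apply: le_trans (hs _ _) _; rewrite [a + t]addrC addrKA.
have := @integral_shift_itv R (fun s : R => rho (h (a + s))) a (b - a) mG (fun s => rho0 _).
rewrite addrC subrK => H; transitivity (\int[mu]_(s in `[0%R, (b - a)%R]) rho (h (a + s)%R))%E.
  apply: eq_integral => s; rewrite inE/= in_itv/= => /andP[s0 sb].
  rewrite /normal_rep; congr rho; case: xgetP => [t _ [/= /andP[at_ tb]]|/(_ (a + s))].
    by move=> ts; rewrite al// in ts; rewrite -ts /curve_pt/= [a + _]addrC subrK.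
  case; split => /=; last by rewrite al; [rewrite addrC addKr|rewrite lerDl|rewrite -lerBrDl].
  by rewrite lerDl s0/= -lerBrDl.
rewrite -H; apply: eq_integral => s _.
by rewrite addrC subrK.
Qed.

End short_paths.

Section subcurves.
Context {R : realType} {n : nat}.
Implicit Types (g : curve R n) (a b t : R) (rho : 'rV[R]_n -> \bar R).
Local Notation mu := (@lebesgue_measure R).

Section fixed_curve.
Variable g : curve R n.
Hypotheses (cg : is_curve g) (rg : locally_rectifiable g).
Local Notation a := (cstart g).
Local Notation b := (cend g).
Local Notation h := (curve_pt g).

Let ab : a < b. Proof. by case: cg. Qed.

Let lfin c d : a <= c -> c <= d -> d <= b -> len h c d \is a fin_num.
Proof. by move=> ac cd db; rewrite ge0_fin_numE ?len_ge0// -clengthE rg.2. Qed.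

Lemma arclengthB c d : a <= c -> c <= d -> d <= b ->
  arclength g d - arclength g c = fine (len h c d).
Proof.
move=> ac cd db; rewrite /arclength !clengthE (lenD h ac cd) fineD ?lfin//.
  by rewrite addrAC subrr add0r.
exact: le_trans db.
Qed.

Lemma arclength_start : arclength g a = 0.
Proof. by rewrite /arclength clengthE lenxx. Qed.

Lemma arclength_mono c d : a <= c -> c <= d -> d <= b -> arclength g c <= arclength g d.
Proof. by move=> ac cd db; rewrite -subr_ge0 arclengthB// fine_ge0// len_ge0. Qed.

Lemma curve_pt_lip c d : a <= c -> c <= d -> d <= b ->
  enorm (h d - h c) <= arclength g d - arclength g c.
Proof.
move=> ac cd db; rewrite arclengthB// -lee_fin fineK ?lfin//.
exact: len_ge_chord.
Qed.

Lemma curve_pt_dist c d : a <= c <= b -> a <= d <= b ->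
  enorm (h d - h c) <= `|arclength g d - arclength g c|.
Proof.
move=> /andP[ac cb] /andP[ad db]; have [cd|/ltW dc] := leP c d.
  by apply: le_trans (curve_pt_lip ac cd db) _; exact: ler_norm.
rewrite -enormN opprB distrC.
by apply: le_trans (curve_pt_lip ad dc cb) _; exact: ler_norm.
Qed.

Lemma arclength_onto s : 0 <= s <= arclength g b ->
  exists2 t, a <= t <= b & arclength g t = s.
Proof.
move=> /andP[s0 sb]; have L0 : 0 <= arclength g b by exact: le_trans sb.
have [|t] := @IVT _ (arclength g) a b s (ltW ab) (arclength_continuous cg rg).
  by rewrite arclength_start min_l// s0 max_r.
by rewrite in_itv/= => tab <-; exists t.
Qed.

Lemma normal_repP s : 0 <= s <= arclength g b ->
  exists t, [/\ a <= t <= b, arclength g t = s & normal_rep g s = h t].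
Proof.
move=> /arclength_onto[t tab ts]; rewrite /normal_rep.
case: xgetP => [u _ [uab us]|/(_ t)]; first by exists u.
by case; split.
Qed.

Let clamp (s : R) := Num.max 0 (Num.min s (arclength g b)).

Let L0 : 0 <= arclength g b.
Proof. by rewrite -arclength_start arclength_mono// ltW. Qed.

Let clamp_itv s : 0 <= clamp s <= arclength g b.
Proof. by rewrite /clamp le_max lexx/= ge_max L0/= ge_min lexx orbT. Qed.

Let clampE s : 0 <= s <= arclength g b -> clamp s = s.
Proof. by move=> /andP[s0 sL]; rewrite /clamp min_l// max_r. Qed.

Let clamp_short s t : `|clamp t - clamp s| <= `|t - s|.
Proof.
rewrite /clamp; move: (arclength g b) L0 => L L0'.
wlog st : s t / s <= t => [H|].
  have [st|/ltW ts] := leP s t; first exact: H.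
  by rewrite distrC [leRHS]distrC; exact: H.
have h1 : Num.min s L <= Num.min t L by rewrite le_min !ge_min st lexx orbT.
have h2 : Num.min t L <= Num.min s L + (t - s).
  by have [sL|sL] := leP s L; have [tL|tL] := leP t L; lra.
move: (Num.min s L) (Num.min t L) h1 h2 => x y h1 h2.
rewrite [leRHS]ger0_norm ?subr_ge0// ger0_norm.
  by have [x0|x0] := leP 0 x; have [y0|y0] := leP 0 y; lra.
by rewrite subr_ge0 ge_max !le_max lexx/= h1 orbT.
Qed.

Let nr s := normal_rep g (clamp s).

Let nr_short : short nr.
Proof.
move=> s t; apply: le_trans (clamp_short s t).
rewrite /nr; have [u [uab us ->]] := normal_repP (clamp_itv s).
have [v [vab vs ->]] := normal_repP (clamp_itv t).
by apply: le_trans (curve_pt_dist uab vab) _; rewrite us vs.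
Qed.

Lemma measurable_line_integrand rho : measurable_fun setT (rho : borelRn R n -> \bar R) ->
  measurable_fun (`[0, arclength g b]%classic : set R) (fun s : R => rho (normal_rep g s)).
Proof.
move=> mrho; apply: (eq_measurable_fun (fun s : R => rho (nr s))).
  by move=> s; rewrite inE/= in_itv/= => sab; rewrite /nr clampE.
have mG : measurable_fun setT (fun s : R => rho (nr s)).
  by apply: (measurableT_comp mrho); exact: measurable_short nr_short.
exact: (@measurable_funTS _ _ (measurableTypeR R)).
Qed.

(** The normal representation of a subcurve is a translate of a restriction of
    the normal representation of the curve. *)
Lemma line_integral_subcurve rho c d : a <= c -> c < d -> d <= b ->
  measurable_fun setT (rho : borelRn R n -> \bar R) -> (forall x, 0 <= rho x)%E ->
  [/\ is_curve (Curve c d g), locally_rectifiable (Curve c d g) &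
  (line_integral rho (Curve c d g) <= line_integral rho g)%E].
Proof.
move=> ac cd db mrho rho0.
have al t : c <= t -> t <= d -> arclength (Curve c d g) t = arclength g t - arclength g c.
  move=> ct td; rewrite {1}/arclength clengthE /= arclengthB//.
  exact: le_trans db.
split.
- split => //=; case: cg => _; apply: continuous_subspaceW => t /=.
  by rewrite !in_itv/= => /andP[ct td]; rewrite (le_trans ac)//= (le_trans td).
- split => /=.
    by move=> t /andP[ct td]; apply: rg.1; rewrite (le_trans ac)//= (le_trans td).
  move=> x y cx xy yd; rewrite clengthE.
  have := rg.2 x y (le_trans ac cx) xy (le_trans yd db); by rewrite clengthE.
set A := arclength g c; set L := arclength g d - A.
have A0 : 0 <= A by rewrite -arclength_start arclength_mono// (le_trans (ltW cd)).
have L1 : 0 <= L by rewrite subr_ge0 arclength_mono// ltW.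
have AL : A + L <= arclength g b.
  by rewrite /L addrC subrK arclength_mono// (le_trans ac)// ltW.
have mG : measurable_fun setT (fun s => rho (nr s)).
  by apply: (measurableT_comp mrho); exact: measurable_short nr_short.
have mG' : measurable_fun setT (fun s : R => rho (nr (s + A))).
  apply: (measurableT_comp mrho); apply: measurable_short => s t.
  by apply: le_trans (nr_short _ _) _; rewrite [s + A]addrC addrKA.
have H := @integral_shift_itv R (fun s : R => rho (nr (s + A))) A L mG' (fun s => rho0 _).
have alL : arclength (Curve c d g) d = L by rewrite al// ltW.
rewrite /line_integral [cend (Curve c d g)]/= alL.
have -> : (\int[mu]_(s in `[0%R, L]) rho (normal_rep (Curve c d g) s) =
   \int[mu]_(s in `[0%R, L]) rho (nr (s + A)%R))%E.
  apply: eq_integral => s; rewrite inE/= in_itv/= => /andP[s0 sL].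
  have sAL : 0 <= s + A <= arclength g b.
    by rewrite addr_ge0//= (le_trans _ AL)// addrC lerD2l.
  rewrite /nr clampE//; congr rho.
  have [t [tab ts ->]] := normal_repP sAL.
  rewrite {1}/normal_rep; case: xgetP => [u _ [/= /andP[cu ud] us]|].
    rewrite al// in us; apply/eqP; rewrite -subr_eq0; apply/eqP/enorm_eq0/eqP.
    rewrite eq_le enorm_ge0 andbT.
    have uab : a <= u <= b by rewrite (le_trans ac cu) (le_trans ud db).
    apply: le_trans (curve_pt_dist tab uab) _.
    by rewrite ts -us subrK subrr normr0.
  have t'P : 0 <= s <= L by rewrite s0.
  move=> no; exfalso.
  have [||t'] := @IVT _ (arclength g) c d (s + A) (ltW cd).
  - apply: continuous_subspaceW (arclength_continuous cg rg) => v /=.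
    by rewrite !in_itv/= => /andP[cv vd]; rewrite (le_trans ac cv) (le_trans vd db).
  - rewrite min_l; last by rewrite arclength_mono// ltW.
    rewrite max_r; last by rewrite arclength_mono// ltW.
    by rewrite -/A lerDr s0 -lerBrDr.
  rewrite in_itv/= => /andP[ct' t'd] t's; apply: (no t'); split => /=.
    by rewrite ct'.
  by rewrite al// t's addrK.
rewrite -H; have -> : (\int[mu]_(s in `[A, (A + L)%R]) rho (nr (s - A + A)%R) =
    \int[mu]_(s in `[A, (A + L)%R]) rho (nr s))%E.
  by apply: eq_integral => s _; rewrite subrK.
have -> : (\int[mu]_(s in `[0%R, arclength g b]) rho (normal_rep g s) =
   \int[mu]_(s in `[0%R, arclength g b]) rho (nr s))%E.
  by apply: eq_integral => s; rewrite inE/= in_itv/= => sab; rewrite /nr clampE.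
apply: ge0_subset_integral => //.
- exact: measurable_funTS mG.
- move=> s; rewrite /= !in_itv/= => /andP[As sA].
  by rewrite (le_trans A0 As) (le_trans sA AL).
Qed.

End fixed_curve.
End subcurves.

(** * Polygons *)

Section polygonal_paths.
Context {R : realType} {n : nat}.
Implicit Types (x y : 'rV[R]_n) (s : seq 'rV[R]_n) (rho : 'rV[R]_n -> \bar R).
Local Notation mu := (@lebesgue_measure R).

Fixpoint polylen x s : R :=
  if s is y :: s' then enorm (y - x) + polylen y s' else 0.

(** The polygon x :: s traversed at unit speed; before time 0 the first
    segment is prolonged, so that the path is short on the whole line. *)
Fixpoint polypath x s (t : R) : 'rV[R]_n :=
  if s is y :: s' then
    let l := enorm (y - x) in
    if t < l then x + (t / l) *: (y - x) else polypath y s' (t - l)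
  else x.

Lemma polylen_ge0 x s : 0 <= polylen x s.
Proof. by elim: s x => //= y s IH x; rewrite addr_ge0 ?enorm_ge0. Qed.

Lemma polypath0 x s : polypath x s 0 = x.
Proof.
elim: s x => //= y s IH x; case: ltP => l0; first by rewrite mul0r scale0r addr0.
have : enorm (y - x) = 0 by apply/eqP; rewrite eq_le l0 enorm_ge0.
by move=> lE; rewrite lE subr0 IH; apply/eqP; rewrite -subr_eq0; apply/eqP/enorm_eq0.
Qed.

Lemma polypath_last x s : polypath x s (polylen x s) = last x s.
Proof.
elim: s x => //= y s IH x; rewrite ltNge lerDl polylen_ge0/=.
by rewrite addrC addKr IH.
Qed.

Lemma enormZ (a : R) x : enorm (a *: x) = `|a| * enorm x.
Proof.
apply/eqP; rewrite -(@eqrXn2 _ 2) ?mulr_ge0 ?enorm_ge0// exprMn real_normK ?num_real//.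
have := sqr_enorm_scale_sub a 0 x 0; rewrite scale0r subr0 => ->.
by rewrite expr0n/= mul0r addr0 mulr0 mul0r subr0.
Qed.

Lemma polypath_short x s : short (polypath x s).
Proof.
elim: s x => [x u t|y s IH x]; first by rewrite /= subrr enorm0.
have sgn (a b : R) : a <= b -> enorm (polypath x (y :: s) b - polypath x (y :: s) a) <= b - a.
  move=> ab /=; set l := enorm (y - x).
  have l0 : 0 <= l by exact: enorm_ge0.
  have seg (c d : R) : c <= d ->
      enorm ((x + (d / l) *: (y - x)) - (x + (c / l) *: (y - x))) <= d - c.
    move=> cd; rewrite opprD addrACA subrr add0r -scalerBl -mulrBl enormZ -/l.
    rewrite ger0_norm ?mulr_ge0 ?subr_ge0 ?invr_ge0//.
    have [->|lN0] := eqVneq l 0; first by rewrite mulr0 subr_ge0.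
    by rewrite mulfVK.
  case: ltP => bl; case: ltP => al.
  - exact: seg.
  - by move: (lt_le_trans bl al); rewrite ltNge ab.
  - have := IH y 0 (b - l); rewrite polypath0 subr0 ger0_norm ?subr_ge0// => h1.
    have [lE|lN0] := eqVneq l 0.
      have xy : y = x by apply/eqP; rewrite -subr_eq0; apply/eqP/enorm_eq0.
      have -> : x + (a / l) *: (y - x) = y by rewrite xy subrr scaler0 addr0.
      rewrite (le_trans h1)// lerB// lE.
      by rewrite lE in al; exact: ltW.
    have := seg a l (ltW al); rewrite divff// scale1r [x + (y - x)]addrC subrK => h2.
    apply: (@le_trans _ _ ((b - l) + (l - a))); last by rewrite subrKA.
    apply: le_trans (lerD h1 h2); apply: le_trans (enormD _ _).
    by rewrite subrKA.
  - apply: le_trans (IH y _ _) _; rewrite opprB subrKA.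
    by rewrite ger0_norm// subr_ge0.
move=> u t; have [ut|/ltW tu] := leP u t.
  by rewrite ger0_norm ?subr_ge0//; exact: sgn.
by rewrite -enormN opprB distrC ger0_norm ?subr_ge0//; exact: sgn.
Qed.

Lemma len_shift (h h' : R -> 'rV[R]_n) (a b c : R) : (forall t, a <= t -> h' (t + c) = h t) ->
  (len h a b <= len h' (a + c) (b + c))%E.
Proof.
move=> hh'; apply: ge_ereal_sup => _ [s sP <-].
have [sp sl] := sP.
have E : inscribed h a s = inscribed h' (a + c) [seq t + c | t <- s].
  elim: s a sp hh' {sP sl} => //= y s IH a /andP[ay ys] H.
  rewrite (IH y)//; last by move=> t yt; apply: H; exact: le_trans (ltW ay) yt.
  by rewrite H ?ltW// H.
rewrite E; apply: len_ge; split; last by rewrite (last_map (fun t => t + c)) (eqP sl).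
elim: s a sp {hh' sP sl E} => //= y s IH a /andP[ay ys].
by rewrite ltrD2r ay IH.
Qed.

Lemma polypath_unit_speed x s : (len (polypath x s) 0 (polylen x s) = (polylen x s - 0)%:E)%E.
Proof.
apply/eqP; rewrite eq_le short_len ?polylen_ge0//=; last exact: polypath_short.
elim: s x => [x|y s IH x]; first by rewrite /= lenxx subr0.
rewrite subr0 [polylen _ _]/=; set l := enorm (y - x).
have l0 : 0 <= l by exact: enorm_ge0.
have p0 := polylen_ge0 y s.
rewrite (lenD _ l0) ?lerDl// EFinD; apply: leeD.
  apply: le_trans (len_ge_chord _ l0).
  by rewrite polypath0 /= -/l ltxx subrr polypath0 lee_fin.
have H : forall t, 0 <= t -> polypath x (y :: s) (t + l) = polypath y s t.
  by move=> t t0 /=; rewrite -/l ltNge lerDr t0 addrK.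
have := le_trans (IH y) (len_shift (polylen y s) H).
by rewrite subr0 add0r addrC.
Qed.

Lemma polypath_in (S : set 'rV[R]_n) x s : polyin S x s -> S x ->
  forall t, 0 <= t <= polylen x s -> S (polypath x s t).
Proof.
elim: s x => //= y s IH x [xy yS] Sx t /andP[t0 tl]; case: ltP => h.
  apply: xy; rewrite divr_ge0 ?enorm_ge0//= ler_pdivrMr ?mul1r; first exact: ltW.
  exact: le_lt_trans t0 h.
apply: IH => //; last by rewrite subr_ge0 h/= lerBlDl.
by have := xy 1; rewrite scale1r addrC subrK; apply; rewrite ler01 lexx.
Qed.

(** The first segment is half open in the splitting of the interval, so that the
    polygon path is given on each part by a single formula. *)
Lemma polypath_integral rho x s :
  measurable_fun setT (rho : borelRn R n -> \bar R) -> (forall x, 0 <= rho x)%E ->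
  (\int[mu]_(t in `[0%R, polylen x s]) rho (polypath x s t) <= polycost rho x s)%E.
Proof.
move=> mrho rho0; have mG x' s' : measurable_fun setT (fun t : R => rho (polypath x' s' t)).
  by apply: (measurableT_comp mrho); apply: measurable_short; exact: polypath_short.
elim: s x => [x|y s IH x]; first by rewrite /= set_itv1 integral_set1.
rewrite [polylen _ _]/= [polycost _ _ _]/=; set l := enorm (y - x).
have l0 : 0 <= l by exact: enorm_ge0.
have p0 := polylen_ge0 y s.
pose P t := polypath x (y :: s) t.
have -> : (`[0, l + polylen y s]%classic : set R) = `[0, l[%classic `|` `[l, l + polylen y s]%classic.
  apply/seteqP; split => t /=; rewrite !in_itv/=.
    by move=> /andP[t0 tl]; have [tl'|tl'] := ltP t l; [left; rewrite t0|right; rewrite tl].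
  move=> [/andP[t0 tl]|/andP[t0 tl]]; first by rewrite t0/= (le_trans (ltW tl))// lerDl.
  by rewrite (le_trans l0 t0) tl.
rewrite ge0_integral_setU//=; first last.
- rewrite disj_set2E; apply/eqP/seteqP; split => // t [] /=; rewrite !in_itv/=.
  by move=> /andP[_ tl] /andP[lt_ _]; move: (lt_le_trans tl lt_); rewrite ltxx.
- exact: (@measurable_funTS _ _ (measurableTypeR R) _ _ _ (mG x (y :: s))).
apply: leeD.
  have [lE|lN0] := eqVneq l 0; first by rewrite lE set_itv_ge ?bnd_simp ?ltxx// integral_set0 segcost_ge0.
  have lpos : 0 < l by rewrite lt_neqAle eq_sym lN0.
  rewrite -(integral_segment mrho rho0 lpos).
  pose G t := rho (x + (t / l) *: (y - x)).
  have mGG : measurable_fun setT (fun t : R => G t).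
    apply: (measurableT_comp mrho); apply: measurable_into_borel => k.
    under eq_fun do rewrite !mxE.
    apply: measurable_funD => //; apply: measurable_funM => //.
    exact: measurable_funM.
  have -> : (\int[mu]_(t in `[0%R, l[) rho (polypath x (y :: s) t) = \int[mu]_(t in `[0%R, l[) G t)%E.
    by apply: eq_integral => t; rewrite inE/= in_itv/= -/l => /andP[_ ->].
  apply: ge0_subset_integral => //.
  - exact: (@measurable_funTS _ _ (measurableTypeR R)).
  - by move=> t _; exact: rho0.
  - by move=> t; rewrite /= !in_itv/= => /andP[-> /ltW].
apply: le_trans (IH y).
have := @integral_shift_itv R (fun t : R => rho (polypath y s t)) l (polylen y s) (mG y s) (fun t => rho0 _).
move=> <-; rewrite le_eqVlt; apply/orP; left; apply/eqP; apply: eq_integral => t.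
by rewrite inE/= in_itv/= -/l => /andP[lt_ _]; rewrite ltNge lt_.
Qed.

End polygonal_paths.

(** * Moduli of families of curves *)

Section modulus_tools.
Context {R : realType} {n : nat}.
Implicit Types (Gamma : set (curve R n)) (rho : 'rV[R]_n -> \bar R) (g : curve R n).
Local Notation lam := (@lebB R n).

Definition density rho :=
  measurable_fun setT (rho : borelRn R n -> \bar R) /\ (forall x, 0 <= rho x)%E.

Lemma modulus_density Gamma (B : \bar R) : (modulus Gamma < B)%E ->
  exists rho, [/\ density rho,
    forall g, Gamma g -> locally_rectifiable g -> (1 <= line_integral rho g)%E &
    (\int[lam]_x (rho x ^+ n) < B)%E].
Proof.
move=> /ereal_inf_lt[_ [rho [mrho rho0 adm] <-] lt_B]; exists rho; split => //.
by rewrite -integral_lebB//; [exact: emeasurable_funX|move=> x; exact: expe_ge0].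
Qed.

Lemma modulus_ge Gamma (B : \bar R) : (forall rho, density rho ->
    (forall g, Gamma g -> locally_rectifiable g -> (1 <= line_integral rho g)%E) ->
    (B <= \int[lam]_x (rho x ^+ n))%E) -> (B <= modulus Gamma)%E.
Proof.
move=> H; apply: le_ereal_inf_tmp => _ [rho [mrho rho0 adm] <-].
rewrite integral_lebB//; [exact: H|exact: emeasurable_funX|].
by move=> x; exact: expe_ge0.
Qed.

Lemma modulus_le Gamma rho : density rho ->
  (forall g, Gamma g -> locally_rectifiable g -> (1 <= line_integral rho g)%E) ->
  (modulus Gamma <= \int[lam]_x (rho x ^+ n))%E.
Proof.
move=> [mrho rho0] adm; rewrite -integral_lebB//; last 2 first.
- exact: emeasurable_funX.
- by move=> x; exact: expe_ge0.
by apply: ereal_inf_lbound; exists rho.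
Qed.

Lemma line_integral_le rho rho' g : is_curve g -> locally_rectifiable g ->
  density rho -> density rho' -> (forall x, rho x <= rho' x)%E ->
  (line_integral rho g <= line_integral rho' g)%E.
Proof.
move=> cg rg [mr r0] [mr' r0'] le_rho.
have m1 := measurable_line_integrand cg rg mr.
have m2 := measurable_line_integrand cg rg mr'.
by apply: (@ge0_le_integral _ (measurableTypeR R)).
Qed.

(** Finitely many families of bounded modulus have a common admissible
    density, the maximum of nearly extremal ones. *)
Lemma joint_density (m : nat) (Gamma : nat -> set (curve R n)) (B : nat -> R) :
  (0 < n)%N -> (forall k, (k < m)%N -> 0 < B k /\ (modulus (Gamma k) <= (B k)%:E)%E) ->
  exists rho, [/\ density rho,
    (\int[lam]_x (rho x ^+ n) <= (\sum_(k < m) 2 * B k)%:E)%E &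
    forall k g, (k < m)%N -> Gamma k g -> is_curve g -> locally_rectifiable g ->
      (1 <= line_integral rho g)%E].
Proof.
move=> n0; elim: m => [_|m IH H].
  exists (fun=> 0%E); split => //.
  rewrite big_ord0 integral0_eq// => x _.
  by rewrite -(prednK n0) expeS mul0e.
have [|rho [drho Irho adm]] := IH; first by move=> k km; apply: H; exact: ltnW.
have [B0 MB] := H m (leqnn _).
have [|rho' [drho' adm' Irho']] := @modulus_density (Gamma m) (2 * B m)%:E.
  by apply: le_lt_trans MB _; rewrite lte_fin; lra.
pose r x := maxe (rho x) (rho' x).
have dr : density r.
  split; first by apply: measurable_maxe; [exact: drho.1|exact: drho'.1].
  by move=> x; rewrite le_max drho.2.
exists r; split => //.
  rewrite big_ord_recr/= EFinD.
  have m1 := emeasurable_funX n drho.1; have m2 := emeasurable_funX n drho'.1.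
  apply: (@le_trans _ _ (\int[lam]_x (rho x ^+ n + rho' x ^+ n))%E); last first.
    rewrite ge0_integralD//; [by apply: leeD => //; exact: ltW| |].
      by move=> x _; exact/expe_ge0/drho.2.
    by move=> x _; exact/expe_ge0/drho'.2.
  apply: ge0_le_integral => //.
  - by move=> x _; exact/expe_ge0/dr.2.
  - exact: emeasurable_funX dr.1.
  - exact: emeasurable_funD.
  - move=> x _; rewrite /r maxEle; case: ifP => _.
      by rewrite leeDr// expe_ge0// drho.2.
    by rewrite leeDl// expe_ge0// drho'.2.
move=> k g; rewrite ltnS leq_eqVlt => /predU1P[->|km] Gg cg rg.
  apply: le_trans (adm' g Gg rg) _; apply: line_integral_le => // x.
  by rewrite /r le_max lexx orbT.
apply: le_trans (adm k g km Gg cg rg) _; apply: line_integral_le => // x.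
by rewrite /r le_max lexx.
Qed.

(** A common admissible density is admissible for the larger family, because
    passing to a subcurve does not increase line integrals. *)
Lemma modulus_subcurves (m : nat) (Gamma : nat -> set (curve R n)) (B : nat -> R)
    (G : set (curve R n)) :
  (0 < n)%N -> (forall k, (k < m)%N -> 0 < B k /\ (modulus (Gamma k) <= (B k)%:E)%E) ->
  (forall g, G g -> is_curve g /\ exists k c d, [/\ (k < m)%N, cstart g <= c, c < d,
     d <= cend g & Gamma k (Curve c d g)]) ->
  (modulus G <= (\sum_(k < m) 2 * B k)%:E)%E.
Proof.
move=> n0 HB HG; have [rho [drho Irho adm]] := joint_density n0 HB.
apply: le_trans Irho; apply: modulus_le => // g Gg rg.
have [cg [k [c [d [km ac cd db Gk]]]]] := HG g Gg.
have [cg' rg' le_int] := line_integral_subcurve cg rg ac cd db drho.1 drho.2.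
by apply: le_trans le_int; exact: adm km Gk cg' rg'.
Qed.

Lemma polypath_lower rho x s (a b : R) : density rho ->
  0 <= a -> a < b -> b <= polylen x s ->
  (1 <= line_integral rho (Curve a b (emb \o polypath x s)))%E ->
  (1 <= polycost rho x s)%E.
Proof.
move=> [mr r0] a0 ab bl h1; apply: (le_trans h1).
apply: le_trans (polypath_integral x s mr r0).
have sh := polypath_short x s.
rewrite (line_integral_unit_speed sh ab mr r0).
  apply: (@ge0_subset_integral _ (measurableTypeR R)) => //.
  - apply: (@measurable_funTS _ _ (measurableTypeR R)).
    by apply: (measurableT_comp mr); exact: measurable_short.
  - by move=> t; rewrite /= !in_itv/= => /andP[at_ tb]; rewrite (le_trans a0 at_) (le_trans tb bl).
exact: (unit_speed_sub sh a0 (ltW ab) bl (polypath_unit_speed x s)).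
Qed.

(** A polygon from E to F in D is, at unit speed, one of the curves joining E to
    F, so a density of small cost on it is not admissible. *)
Lemma polygon_admissible rho (E F D : set 'rV[R]_n) x s : density rho ->
  (forall g, curves_joining (emb @` E) (emb @` F) D g -> locally_rectifiable g ->
     (1 <= line_integral rho g)%E) ->
  E x -> F (last x s) -> x <> last x s -> D x -> polyin D x s -> (1 <= polycost rho x s)%E.
Proof.
move=> drho adm Ex Fs xs Dx Ds.
have l0 : 0 < polylen x s.
  rewrite lt_neqAle polylen_ge0 andbT; apply: contra_not_neq xs => l0.
  by rewrite -polypath_last -l0 polypath0.
have [cg rg] := short_curve (polypath_short x s) l0.
apply: (@polypath_lower _ x s 0 (polylen x s)) => //.
apply: adm => //; split => //.
- by exists x => //=; rewrite /= polypath0.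
- by exists (last x s) => //=; rewrite polypath_last.
- move=> t /= /andP[t0 tl]; exists (polypath x s t) => //.
  by apply: polypath_in => //; rewrite (ltW t0) (ltW tl).
Qed.

(** Superadditivity of the energy over disjoint sets; it turns many disjoint
    rings, or many disjoint components, into a large modulus. *)
Lemma integral_disjoint_ge (S : nat -> set 'rV[R]_n) (h : 'rV[R]_n -> \bar R) (th : R) (K : nat) :
  measurable_fun setT (h : borelRn R n -> \bar R) -> (forall x, 0 <= h x)%E ->
  (forall k, measurable (S k : set (borelRn R n))) ->
  (forall i j, (i < j < K)%N -> S i `&` S j = set0) ->
  (forall k, (k < K)%N -> th%:E <= \int[lam]_(x in S k) h x)%E ->
  ((K%:R * th)%:E <= \int[lam]_x h x)%E.
Proof.
move=> mh h0 mS dS HS.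
apply: (@le_trans _ _ (\int[lam]_(x in \big[setU/set0]_(k < K) S k) h x)%E); last first.
  apply: ge0_subset_integral => //; apply: bigsetU_measurable => k _; exact: mS.
elim: K dS HS => [|K IH] dS HS; first by rewrite mul0r big_ord0 integral_set0.
rewrite big_ord_recr/= ge0_integral_setU//; first last.
- rewrite disj_set2E; apply/eqP/seteqP; split => // x [].
  rewrite -bigcup_mkord => -[i /= iK Six] SKx.
  by have := dS i K; rewrite iK ltnSn => /(_ isT) E0; rewrite -[False]/(set0 x) -E0.
- exact: measurable_funTS.
- by apply: bigsetU_measurable => k _; exact: mS.
rewrite -addn1 natrD mulrDl mul1r EFinD; apply: leeD; last exact: HS.
apply: IH => [i j /andP[ij jK]|k kK]; first by apply: dS; rewrite ij ltnS ltnW.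
by apply: HS; rewrite ltnS ltnW.
Qed.

End modulus_tools.

Section Loewner.
Context {R : realType} {n : nat}.
Implicit Types (D E F : set 'rV[R]_n).
Local Notation lam := (@lebB R n).

(** Weak flatness at a single point, stated for disjoint continua that meet a
    small neighbourhood and leave a large one. *)
Definition loewner D (x0 : extRn R n) := forall P : R, 0 < P -> forall U, nbhs x0 U ->
  exists V, [/\ nbhs x0 V, V `<=` U & forall E F, continuum E -> continuum F ->
    E `<=` D -> F `<=` D -> E `&` F = set0 ->
    (exists2 x, E x & V (emb x)) -> (exists2 x, F x & V (emb x)) ->
    (exists2 x, E x & ~ U (emb x)) -> (exists2 x, F x & ~ U (emb x)) ->
    (P%:E < modulus (curves_joining (emb @` E) (emb @` F) D))%E].

Lemma emb_continuous : continuous (emb : 'rV[R]_n -> extRn R n).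
Proof.
move=> x A /nbhs_ballP[e /= e0 eA]; apply/nbhs_ballP.
exists (e / n.+1%:R) => /=; first by rewrite divr_gt0.
move=> y; rewrite -ball_normE /= => xy; apply: eA; rewrite /ball/=.
apply: le_lt_trans (chordal_le _ _) _; apply: le_lt_trans (enorm_le_norm _) _.
move: xy; rewrite ltr_pdivlMr// => /le_lt_trans; apply.
by rewrite mulrC ler_wpM2l// ler_nat.
Qed.

Lemma emb_nbhs (x : 'rV[R]_n) (A : set 'rV[R]_n) : nbhs x A -> nbhs (emb x) (emb @` A).
Proof.
move=> /nbhs_ballP[e /= e0 eA]; have [d d0 H] := chordal_enorm x e0.
apply/nbhs_ballP; exists d => //= y; rewrite /ball/= => /H[u -> xu].
exists u => //; apply: eA; rewrite -ball_normE /=.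
exact: le_lt_trans (norm_le_enorm _) xu.
Qed.

Lemma nbhs_emb (x : 'rV[R]_n) (A : set (extRn R n)) : nbhs (emb x) A -> nbhs x (emb @^-1` A).
Proof. exact: emb_continuous. Qed.

(** The distance from o takes all intermediate values on a connected set. *)
Lemma continuum_meets_spheres E o (a b t : R) : connected E ->
  (exists2 x, E x & `|x - o| <= a) -> (exists2 x, E x & b <= `|x - o|) -> a <= t <= b ->
  exists2 x, E x & `|x - o| = t.
Proof.
move=> cE [x Ex xa] [y Ey yb] /andP[at_ tb].
pose N z := `|z - o|.
have cN : continuous N by exact: norm_sub_continuous.
have cNE : connected (N @` E).
  by apply: connected_continuous_connected => //; exact: continuous_subspaceT.
have /connected_intervalP/(_ (N x) (N y)) := cNE.
move=> /(_ (ex_intro2 _ _ x Ex erefl) (ex_intro2 _ _ y Ey erefl) t).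
by rewrite (le_trans xa at_) (le_trans tb yb) => /(_ isT)[z Ez <-]; exists z.
Qed.

(** Disjoint continua running from near an interior point to far from it are
    joined inside arbitrarily many disjoint rings of D. *)
Lemma loewner_interior D x : (1 < n)%N -> open D -> D x -> loewner D (emb x).
Proof.
move=> n1 oD Dx P P0 U xU; have n0 : (0 < n)%N by exact: ltnW.
have [theta th0 ringH] := @ring_crossing R n n1.
have [r0 /= r00 r0D] : nbhs_ball x (D `&` emb @^-1` U).
  by apply/nbhs_ballP; apply: filterI; [exact: open_nbhs_nbhs|exact: nbhs_emb].
pose r k : R := r0 / 4 / 8 ^+ k.
have rk0 k : 0 < r k by rewrite !divr_gt0// exprn_gt0.
have rS k : r k.+1 = r k / 8 by rewrite /r exprS; field; rewrite ?gt_eqF ?exprn_gt0.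
have rmono i j : (i <= j)%N -> r j <= r i.
  elim: j => [|j IH]; first by rewrite leqn0 => /eqP ->.
  rewrite leq_eqVlt => /predU1P[->//|/IH]; rewrite rS; have := rk0 j; lra.
have r2 k : 2 * r k < r0 by have := rmono 0%N k (leq0n _); have := r00; rewrite {2}/r expr0; lra.
have [K PK] : exists K : nat, P < K%:R * theta.
  exists (Num.truncn (P / theta)).+1.
  by rewrite -ltr_pdivrMr//; exact: truncnS_gt.
exists (emb @` ball x (r K)); split.
- by apply: emb_nbhs; exact: nbhsx_ballx.
- move=> _ [y xy <-]; have [] // : (D `&` emb @^-1` U) y.
  apply: r0D; apply: le_ball xy; have := r2 K; have := rk0 K; lra.
move=> E F cE cF ED FD EF0 EV FV EU FU.
apply: (@lt_le_trans _ _ (K%:R * theta)%:E); first by rewrite lte_fin.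
apply: modulus_ge => rho drho adm.
have meet (G : set 'rV[R]_n) k : (k < K)%N -> continuum G ->
    (exists2 y, G y & (emb @` ball x (r K)) (emb y)) -> (exists2 y, G y & ~ U (emb y)) ->
    forall t, r k <= t <= 2 * r k -> exists2 p, G p & `|p - x| = t.
  move=> kK [_ _ cG] [y Gy [y' xy' [yy']]] [z Gz zU] t /andP[t1 t2].
  apply: (@continuum_meets_spheres G x (r k) (2 * r k)) => //; last by rewrite t1.
    exists y => //; rewrite -yy'; move: xy'; rewrite -ball_normE /= distrC => /ltW/le_trans; apply.
    by apply: rmono; exact: ltnW.
  exists z => //; rewrite leNgt; apply/negP => zr; apply: zU.
  have [] // : (D `&` emb @^-1` U) z.
  by apply: r0D; rewrite -ball_normE /= distrC (lt_trans zr).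
apply: (@integral_disjoint_ge _ _ (fun k => ring x (r k))).
- exact: emeasurable_funX drho.1.
- by move=> y; exact/expe_ge0/drho.2.
- by move=> k; exact: measurable_ring.
- move=> i j /andP[ij jK]; apply/seteqP; split => // y [/andP[h1 _] /andP[_ h2]].
  have := rmono _ _ ij; rewrite rS; have := rk0 i; have := le_trans h1 h2; lra.
move=> k kK; rewrite leNgt; apply/negP => lt_th.
have [p [s [Ep Fs ps]]] := ringH rho E F x (r k) (rk0 k) drho.1 drho.2
  (meet E k kK cE EV EU) (meet F k kK cF FV FU) lt_th.
have ringD y : ring x (r k) y -> D y.
  move=> /andP[_ h]; have [] // : (D `&` emb @^-1` U) y.
  by apply: r0D; rewrite -ball_normE /= distrC (le_lt_trans h).
apply/negP; rewrite -leNgt.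
apply: (polygon_admissible drho adm Ep Fs) => //.
- move=> pE; have : (E `&` F) p by split => //; rewrite pE.
  by rewrite EF0.
- exact: ED.
- elim: s p ps {Ep Fs} => //= y s IH p [py ys]; split; last exact: IH.
  by move=> t t01; apply: ringD; exact: py.
Qed.

Lemma connected_meets_boundary (T : topologicalType) (K U : set T) : connected K ->
  (exists2 x, K x & U x) -> (exists2 x, K x & ~ U x) -> K `&` boundary U !=set0.
Proof.
move=> cK [x Kx Ux] [y Ky Uy]; apply: contrapT => no.
have KI : K `&` U = K.
  apply: cK.
  - by exists x.
  - exists (interior U); first exact: open_interior.
    apply/seteqP; split => z [Kz Uz]; split => //; last exact: interior_subset.
    apply: contrapT => nU; apply: no; exists z; split => //; split => //.
    exact: subset_closure.
  - exists (closure U); first exact: closed_closure.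
    apply/seteqP; split => z [Kz Uz]; split => //; first exact: subset_closure.
    apply: contrapT => nU; apply: no; exists z; split => //; split => //.
    by move=> /interior_subset.
by have : (K `&` U) y by [rewrite KI]; case.
Qed.

Lemma loewner_boundary D x0 : weakly_flat_boundary D -> ebd D x0 -> loewner D x0.
Proof.
move=> wf x0D P P0 U x0U; have [V [x0V VU H]] := wf x0 x0D P P0 U x0U.
exists V; split => // E F cE cF ED FD _ EV FV EU FU.
have emb_continuum (G : set 'rV[R]_n) : continuum G -> continuum (emb @` G : set (extRn R n)).
  move=> [[x Gx] kG cG]; split; first by exists (emb x), x.
  - by apply: continuous_compact => //; exact/continuous_subspaceT/emb_continuous.
  - by apply: connected_continuous_connected => //; exact/continuous_subspaceT/emb_continuous.
have meets (G : set 'rV[R]_n) (W : set (extRn R n)) : continuum G ->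
    (exists2 x, G x & W (emb x)) -> (exists2 x, G x & ~ W (emb x)) ->
    (emb @` G : set (extRn R n)) `&` boundary W !=set0.
  move=> /emb_continuum[_ _ cG] [x Gx Wx] [y Gy Wy].
  apply: connected_meets_boundary => //.
    by exists (emb x) => //; exists x.
  by exists (emb y) => //; exists y.
have inU (G : set 'rV[R]_n) : (exists2 x, G x & V (emb x)) -> exists2 x, G x & U (emb x).
  by move=> [x Gx Vx]; exists x => //; exact: VU.
have outV (G : set 'rV[R]_n) : (exists2 x, G x & ~ U (emb x)) -> exists2 x, G x & ~ V (emb x).
  by move=> [x Gx Ux]; exists x => //; move/VU.
by apply: H; [exact: emb_continuum|exact: emb_continuum|exact: image_subset|exact: image_subset
  |apply: meets => //; exact: inU|apply: meets => //; exact: outV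
  |apply: meets => //; exact: inU|apply: meets => //; exact: outV].
Qed.

End Loewner.

(** * Curves whose images cross an annulus *)

Section inverse_Poletsky_constant.
Context {R : realType} {n : nat}.
Implicit Types (D : set 'rV[R]_n) (Q : 'rV[R]_n -> \bar R).

Lemma completed_itv (r1 r2 : R) : r1 < r2 ->
  measurable (`]r1, r2[%classic : set (@lebR R)) /\
  (@completed_lebesgue_measure R `]r1, r2[%classic = (r2 - r1)%:E)%E.
Proof.
move=> r12; split.
  apply: sub_caratheodory; exact: (measurable_itv `]r1, r2[).
have -> : @completed_lebesgue_measure R `]r1, r2[%classic = @lebesgue_measure R `]r1, r2[%classic.
  by [].
by rewrite lebesgue_measure_itv/= lte_fin r12.
Qed.

(** The test function is constant, equal to 1 / (r2 - r1). *)
Lemma inverse_Poletsky_const D f Q (y0 : 'rV[R]_n) (q r1 r2 : R) : (0 < n)%N -> open (f @` D) ->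
  (forall y, (f @` D) y -> 0 <= Q y)%E ->
  (lebesgueRn n).-integrable (f @` D) Q ->
  (\int[lebesgueRn n]_(y in f @` D) Q y <= q%:E)%E ->
  inverse_Poletsky D f Q y0 -> 0 < r1 -> r1 < r2 ->
  (modulus (Gamma_f D f y0 r1 r2) <= (q / (r2 - r1) ^+ n)%:E)%E.
Proof.
move=> n0 ofD Q0 iQ Qq ip r10 r12; have d0 : 0 < r2 - r1 by rewrite subr_gt0.
have [mI lI] := completed_itv r12.
pose c := (r2 - r1)^-1; have c0 : 0 < c by rewrite invr_gt0.
pose eta (r : R) : \bar R := c%:E.
have h1 : (1 <= \int[@completed_lebesgue_measure R]_(r in `]r1, r2[) eta r)%E.
  rewrite integral_cst// [X in (_ * X)%E]lI -EFinM /c mulVf//.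
  exact: lt0r_neq0.
have := ip r1 r2 r10 r12 eta (fun _ _ => ltW c0) (@measurable_cst _ _ _ _ _ _) h1.
move=> /le_trans; apply.
have mD : measurable (f @` D : set (lebRn R n)).
  by apply: borel_lebesgue_measurable; exact: sub_sigma_algebra.
have mQ : measurable_fun (f @` D : set (lebRn R n)) Q by case/integrableP: iQ.
have cX0 : 0 <= c ^+ n by rewrite exprn_ge0// ltW.
pose w y : \bar R := ((eta \_ `]r1, r2[) (enorm (y - y0)) ^+ n)%E.
have w0 y : (0 <= w y)%E.
  by apply: expe_ge0; rewrite patchE; case: ifP => // _; rewrite lee_fin ltW.
have wc y : (w y <= (c ^+ n)%:E)%E.
  rewrite /w patchE; case: ifP => _; first by rewrite -EFin_expe.
  by rewrite -(prednK n0) expeS mul0e lee_fin exprn_ge0// ltW.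
have mw : measurable_fun setT (w : borelRn R n -> \bar R).
  apply: emeasurable_funX.
  have mN : measurable_fun setT ((fun y => enorm (y - y0)) : borelRn R n -> R).
    by apply: continuous_borel_measurable; exact: enorm_sub_continuous.
  have me : measurable_fun setT (eta \_ `]r1, r2[ : R -> \bar R).
    by apply/(measurable_restrictT _ (measurable_itv `]r1, r2[)); exact: measurable_cst.
  exact: (measurableT_comp me mN).
have mwD : measurable_fun (f @` D : set (lebRn R n)) (w : lebRn R n -> \bar R).
  by apply: measurable_funTS; exact: measurable_borel_leb.
apply: (@le_trans _ _ (\int[lebesgueRn n]_(y in f @` D) ((c ^+ n)%:E * Q y))%E).
  apply: ge0_le_integral; first exact: mD.
  - by move=> y fy; apply: mule_ge0; [exact: Q0|exact: w0].
  - exact: emeasurable_funM mQ mwD.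
  - by apply: emeasurable_funM mQ; exact: measurable_cst.
  - by move=> y fy; rewrite muleC; apply: lee_wpmul2r; [exact: Q0|exact: wc].
rewrite ge0_integralZl//.
rewrite mulrC EFinM /c exprVn; apply: lee_wpmul2l => //.
by rewrite lee_fin invr_ge0 exprn_ge0// ltW.
Qed.

End inverse_Poletsky_constant.

Section crossing_annuli.
Context {R : realType} {n : nat}.
Implicit Types (D : set 'rV[R]_n) (f : 'rV[R]_n -> 'rV[R]_n) (g : curve R n).

(** The last time below the level r1 and then the first time above r2. *)
Lemma real_crossing (N : R -> R) (u v r1 r2 : R) : {within `[u, v], continuous N} ->
  u <= v -> N u <= r1 -> r1 < r2 -> r2 <= N v ->
  exists c d, [/\ u <= c, c < d, d <= v, N c = r1 &
    N d = r2 /\ forall t, c < t < d -> r1 < N t < r2].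
Proof.
move=> cN uv Nu r12 Nv.
have clo u' (W : set R) : u <= u' -> closed W -> compact (`[u', v] `&` N @^-1` W).
  move=> uu' cW; have cN' : {within `[u', v], continuous N}.
    apply: continuous_subspaceW cN => t; rewrite /= !in_itv/= => /andP[u't ->].
    by rewrite (le_trans uu' u't).
  have /(continuous_closedP _).1/(_ _ cW)/closed_subspaceP[V cV VE] := cN'.
  rewrite setIC -VE setIC; apply: subclosed_compact (@segment_compact R u' v) _ => //.
  by apply: closedI => //; exact: itv_closed.
have [| |c] := compact_EVT_max (f := id) _ (clo u `]-oo, r1]%classic (lexx u) (@lray_closed _ _ r1)).
- by exists u; split; rewrite /= in_itv/= ?lexx.
- by apply: continuous_subspaceT => t; exact: cvg_id.
rewrite inE /= !in_itv/= => -[/andP[uc cv] Nc] maxc.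
have after t : c < t -> t <= v -> r1 < N t.
  move=> ct tv; rewrite ltNge; apply/negP => Nt; have := maxc t.
  rewrite inE /= !in_itv/= tv (le_trans uc (ltW ct)) => /(_ (conj isT Nt)).
  by rewrite leNgt ct.
have [| | |d] := @compact_EVT_max _ R (fun t : R => - t) (`[c, v] `&` N @^-1` `[r2, +oo[%classic).
- by exists v; split; rewrite /= in_itv/= ?lexx ?cv ?Nv.
- by apply: clo => //; exact: rray_closed.
- by apply: continuous_subspaceT => t; exact: opp_continuous.
rewrite inE /= !in_itv/= => -[/andP[cd dv] Nd] mind.
rewrite andbT in Nd.
have before t : c <= t -> t < d -> N t < r2.
  move=> ct td; rewrite ltNge; apply/negP => Nt; have := mind t.
  rewrite inE /= !in_itv/= ct Nt (le_trans (ltW td) dv) => /(_ (conj isT isT)).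
  by rewrite lerN2 leNgt td.
have sub a b : u <= a -> b <= v -> {within `[a, b], continuous N}.
  move=> ua bv; apply: continuous_subspaceW cN => t; rewrite /= !in_itv/= => /andP[at_ tb].
  by rewrite (le_trans ua at_) (le_trans tb bv).
have Ncd : N c < N d by rewrite (le_lt_trans Nc)// (lt_le_trans r12).
have cd' : c < d.
  by rewrite lt_neqAle cd andbT; apply: contraTneq Ncd => ->; rewrite ltxx.
have [|c'] := @IVT _ N c d r1 cd (sub c d uc dv).
  by rewrite min_l ?Nc ?(ltW Ncd)// le_max (ltW (lt_le_trans r12 Nd)) orbT.
rewrite in_itv/= => /andP[cc' c'd] Nc'.
have c'E : c' = c.
  apply/eqP; rewrite eq_le cc' andbT leNgt; apply/negP => cc'2.
  by have := after c' cc'2 (le_trans c'd dv); rewrite Nc' ltxx.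
have [|d'] := @IVT _ N c d r2 cd (sub c d uc dv).
  by rewrite max_r ?(ltW Ncd)// Nd ge_min -[N c]/(N c) (le_trans Nc (ltW r12)).
rewrite in_itv/= => /andP[cd'2 d'd] Nd'.
have d'E : d' = d.
  apply/eqP; rewrite eq_le d'd leNgt; apply/negP => dd'.
  by have := before d' cd'2 dd'; rewrite Nd' ltxx.
exists c, d; split => //; first by rewrite -c'E.
split; first by rewrite -d'E.
move=> t /andP[ct td]; rewrite after ?before ?(ltW ct)//.
by rewrite (le_trans (ltW td)).
Qed.

Lemma curve_pt_vcontinuous g (a b : R) :
  {within `[a, b], continuous (cpath g)} -> (forall t, a <= t <= b -> g t <> infinity) ->
  {within `[a, b], continuous (curve_pt g)}.
Proof.
move=> cg gfin; apply/subspace_continuousP => t tab.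
move/subspace_continuousP : cg => /(_ t tab) gt A /nbhs_ballP[e /= e0 eA].
have [u tu] : exists u, g t = emb u.
  move: tab; rewrite /= in_itv/= => tab.
  by case: (g t) (gfin t tab) => [u _|//]; exists u.
have [d d0 H] := chordal_enorm u e0.
have /gt : nbhs (g t) [set y | chordal (g t) y < d].
  by apply/nbhs_ballP; exists d.
move=> K.
have {K} : \forall s \near within `[a, b] (nbhs t), chordal (g t) (g s) < d by exact: K.
apply: filterS => s; rewrite tu => /H[v sv uv]; apply: eA.
rewrite /from_subspace /curve_pt tu sv -ball_normE /=.
exact: le_lt_trans (norm_le_enorm _) uv.
Qed.

(** Continuity has to be transported through the extended space, in which the
    curve lives, to R^n, in which the mapping is defined. *)
Lemma map_curve_continuous D f g (a b : R) : {within D, continuous f} ->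
  {within `[a, b], continuous (cpath g)} -> (forall t, a <= t <= b -> (emb @` D) (g t)) ->
  {within `[a, b], continuous (cpath (map_curve f g))}.
Proof.
move=> cf cg gD; apply/subspace_continuousP => t tab.
move/subspace_continuousP : cg => /(_ t tab) gt A.
have [u Du tu] : (emb @` D) (g t) by apply: gD; move: tab; rewrite /= in_itv.
rewrite /from_subspace /= -tu => /nbhs_emb fuA.
move/subspace_continuousP : cf => /(_ u Du _ fuA) fB.
have {}fB : nbhs u [set x | D x -> A (emb (f x))] by exact: fB.
have /gt K : nbhs (g t) (emb @` [set x | D x -> A (emb (f x))]) by rewrite -tu; exact: emb_nbhs.
have {}K : \forall s \near within `[a, b] (nbhs t), (emb @` [set x | D x -> A (emb (f x))]) (g s) by exact: K.
have near2 : \forall s \near within `[a, b] (nbhs t), a <= s <= b.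
  by apply: withinT; exact: nbhs_filter.
suff : \forall s \near within `[a, b] (nbhs t), A (omap f (g s)) by [].
move: K near2; apply: filterS2 => s [x Hx xs] sab.
have [y Dy ys] := gD s sab; rewrite -xs; apply: Hx.
by have := etrans ys (esym xs) => -[<-].
Qed.

(** The subcurve runs from the last time on the inner sphere to the next time on
    the outer one. *)
Lemma crossing_subcurve D f g y0 (u v r1 r2 : R) : {within D, continuous f} ->
  {within `[u, v], continuous (cpath g)} -> u <= v ->
  (forall t, u <= t <= v -> (emb @` D) (g t)) ->
  enorm (f (curve_pt g u) - y0) <= r1 -> r1 < r2 -> r2 <= enorm (f (curve_pt g v) - y0) ->
  exists c d, [/\ u <= c, c < d, d <= v & Gamma_f D f y0 r1 r2 (Curve c d g)].
Proof.
move=> cf cg uv gD h1 r12 h2.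
have cfg := map_curve_continuous cf cg gD.
have gE t : u <= t <= v -> g t = emb (curve_pt g t).
  by move=> /gD[x _]; rewrite /curve_pt => <-.
have cp : {within `[u, v], continuous (curve_pt (map_curve f g))}.
  by apply: curve_pt_vcontinuous => // t /gE; rewrite /= => ->.
have ptE t : u <= t <= v -> curve_pt (map_curve f g) t = f (curve_pt g t).
  by move=> /gE tE; rewrite {1}/curve_pt /= tE.
pose N t := enorm (curve_pt (map_curve f g) t - y0).
have cN : {within `[u, v], continuous N}.
  move=> t; apply: (@continuous_comp _ _ _ (from_subspace _ (curve_pt (map_curve f g)))
    (fun z => enorm (z - y0)) t); last exact: enorm_sub_continuous.
  exact: cp.
have [| |c [d [uc cd dv Nc [Nd Ncd]]]] := @real_crossing N u v r1 r2 cN uv _ r12 _.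
- by rewrite /N ptE ?lexx.
- by rewrite /N ptE ?lexx ?uv.
exists c, d; split => //.
have sub t : c <= t <= d -> u <= t <= v.
  by move=> /andP[ct td]; rewrite (le_trans uc ct) (le_trans td dv).
have E t : c <= t <= d -> omap f (g t) = emb (f (curve_pt g t)).
  by move=> /sub/gE ->.
have subI : `[c, d] `<=` `[u, v].
  by move=> t; rewrite /= !in_itv/= => /sub.
split.
- by split => //=; exact: continuous_subspaceW cg.
- by move=> t /= /sub/gD.
split => /=.
- by split => //=; exact: continuous_subspaceW cfg.
- exists (f (curve_pt g c)); last by rewrite E ?lexx ?ltW.
  by move: Nc; rewrite /N ptE// sub// lexx ltW.
- exists (f (curve_pt g d)); last by rewrite E ?lexx ?ltW.
  by move: Nd; rewrite /N ptE// sub// lexx ltW.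
- move=> t tcd; have tcd' : c <= t <= d by case/andP: tcd => /ltW -> /ltW ->.
  exists (f (curve_pt g t)); last by rewrite E.
  by have := Ncd t tcd; rewrite /N ptE// sub.
Qed.

End crossing_annuli.

(** * Proper open maps and lifting of continua *)

Section proper_maps.
Context {R : realType} {n : nat}.
Implicit Types (x y z : 'rV[R]_n) (K O X Z : set 'rV[R]_n).

Lemma open_neq (a : 'rV[R]_n) : open [set w | w <> a].
Proof.
apply: (@closed_openC _ [set a]); apply: compact_closed; first exact: norm_hausdorff.
exact: compact_set1.
Qed.

Lemma compact_closed_rV K : compact K -> closed K.
Proof. by apply: compact_closed; exact: norm_hausdorff. Qed.

Section continuity.
Variables (D : set 'rV[R]_n) (f : 'rV[R]_n -> 'rV[R]_n).
Hypotheses (oD : open D) (cf : {within D, continuous f}).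

Lemma open_continuous_at x : D x -> f @ x --> f x.
Proof.
move=> Dx A fxA; move/subspace_continuousP : cf => /(_ x Dx A fxA) H.
have {}H : nbhs x [set y | D y -> A (f y)] by exact: H.
have ND : nbhs x D by exact: open_nbhs_nbhs.
suff : \forall y \near x, A (f y) by [].
by move: H ND; apply: filterS2 => y Hy Dy; exact: Hy.
Qed.

Lemma open_preimage O : open O -> open (D `&` f @^-1` O).
Proof.
move=> oO; rewrite openE => x [Dx Ofx]; apply: filterI; first exact: open_nbhs_nbhs.
by apply: (open_continuous_at Dx); exact: open_nbhs_nbhs.
Qed.

Lemma image_compact_in K : compact K -> K `<=` D -> compact (f @` K).
Proof.
move=> cK KD; apply: continuous_compact => //.
exact: continuous_subspaceW cf.
Qed.

End continuity.

Section properness.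
Variables (D D' : set 'rV[R]_n) (f : 'rV[R]_n -> 'rV[R]_n).
Hypotheses (n0 : (0 < n)%N) (oD : open D) (cf : {within D, continuous f}).
Hypotheses (fD : f @` D = D') (df : discrete_mapping D f) (clf : closed_mapping D D' f).

Let move_off p (e : R) : 0 < e -> D p ->
  exists z, [/\ D z, `|z - p| < e, enorm (f z - f p) < e & f z <> f p].
Proof.
move=> e0 Dp; have [U pU UE] := @df (f p) p (conj Dp erefl).
have fU : nbhs p (f @^-1` [set w | enorm (f p - w) < e]).
  apply: (open_continuous_at oD cf Dp).
  apply/nbhs_ballP; exists (e / n.+1%:R) => /=; first by rewrite divr_gt0.
  move=> w; rewrite -ball_normE /= ltr_pdivlMr// => fw.
  apply: le_lt_trans (enorm_le_norm _) _; apply: le_lt_trans fw.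
  by rewrite mulrC ler_wpM2l// ler_nat.
have [d /= d0 dU] : nbhs_ball p (U `&` D `&` f @^-1` [set w | enorm (f p - w) < e]).
  by apply/nbhs_ballP; apply: filterI => //; apply: filterI => //; exact: open_nbhs_nbhs.
pose t := Num.min (d / 2) (e / 2).
have t0 : 0 < t by rewrite lt_min !divr_gt0.
pose v : 'rV[R]_n := \row_j t.
have vt : `|v| = t.
  apply/eqP; rewrite eq_le; apply/andP; split.
    by apply: norm_le_coord => [|i]; [exact: ltW|rewrite mxE gtr0_norm].
  by have := coord_le_norm v (Ordinal n0); rewrite mxE gtr0_norm.
have zd : ball p d (p + v).
  rewrite -ball_normE /= opprD addrA subrr add0r normrN vt gt_min.
  by rewrite ltr_pdivrMr// ltr_pMr// ltr1n.
have [[Uz Dz] fz] := dU _ zd.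
exists (p + v); split => //.
- by rewrite addrC addKr vt gt_min [X in _ || X]ltr_pdivrMr// ltr_pMr// ltr1n orbT.
- by rewrite -enormN opprB.
move=> fzp; have : (U `&` (D `&` f @^-1` [set f p])) (p + v) by split.
rewrite UE => /= pE.
have v0 : v = 0 by rewrite -(addrK p v) [v + p]addrC pE subrr.
by move: t0; rewrite -vt v0 normr0 ltxx.
Qed.

(** If a fibre were infinite, slightly moved copies of infinitely many of its
    points would form a closed set whose image accumulates at a point that it
    omits. *)
Lemma fiber_finite y : D' y -> finite_set (D `&` f @^-1` [set y]).
Proof.
move=> D'y; apply: contrapT => /infiniteP/pcard_leP[p].
have pY k : (D `&` f @^-1` [set y]) (p k) by exact: (@funS _ _ _ _ p).
have pinj : injective p.
  by move=> i j ij; apply: (@inj _ _ setT p); rewrite ?inE.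
have Hz k : exists z, [/\ D z, `|z - p k| < k.+1%:R^-1, enorm (f z - y) < k.+1%:R^-1 & f z <> y].
  have [Dp /= fp] := pY k; have k0 : 0 < k.+1%:R^-1 :> R by rewrite invr_gt0.
  have [z [Dz zp fz fzp]] := move_off k0 Dp.
  by exists z; split => //; [move: fz|move: fzp]; rewrite fp.
have [z Pz] := choice Hz; have {Hz} zD k : D (z k) by case: (Pz k).
pose C := range z.
have cl c : D c -> closure C c -> C c.
  move=> Dc clc; apply: contrapT => Cc.
  have far (k0 : nat) (e : R) : 0 < e -> exists2 k, (k0 <= k)%N & `|c - z k| < e.
    move=> e0; have : nbhs c (ball c e `&` \bigcap_(k in [set k | (k < k0)%N]) [set w | w <> z k]).
      apply: filterI; first exact: nbhsx_ballx.
      elim: k0 => [|k0 IH]; first by apply: filterS filterT => w _ k /=.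
      have : nbhs c [set w | w <> z k0].
        apply: open_nbhs_nbhs; split; last by move=> cz; apply: Cc; exists k0.
        exact: open_neq.
      move=> h; apply: filterS (filterI IH h) => w [Hw wk k /=].
      by rewrite ltnS leq_eqVlt => /predU1P[->//|kk0]; exact: Hw.
    move=> /clc[_ [[k _ <-] [ck Hk]]]; exists k; last by move: ck; rewrite -ball_normE.
    by rewrite leqNgt; apply/negP => /Hk; apply.
  have near (k0 : nat) (e : R) : 0 < e -> exists2 k, (k0 <= k)%N & `|c - p k| < e.
    move=> e0; pose k1 := maxn k0 (Num.truncn (2 / e)).+1.
    have [k kk ck] := far k1 (e / 2) (divr_gt0 e0 (ltr0n _ 2)).
    exists k; first by apply: leq_trans kk; exact: leq_maxl.
    have -> : c - p k = (c - z k) + (z k - p k) by rewrite subrKA.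
    apply: le_lt_trans (ler_normD _ _) _; rewrite [ltRHS](splitr e); apply: ltrD => //.
    have [_ h _ _] := Pz k; apply: lt_trans h _.
    rewrite invf_plt ?posrE ?divr_gt0// invf_div.
    apply: lt_le_trans (truncnS_gt _) _; rewrite ler_nat.
    by apply: leq_trans (leqnSn k); apply: leq_trans kk; exact: leq_maxr.
  have [fcy|fcy] := pselect (f c = y).
    have [U cU UE] := @df y c (conj Dc fcy).
    have [e /= e0 eU] : nbhs_ball c U by apply/nbhs_ballP.
    have pc k : `|c - p k| < e -> p k = c.
      move=> ck; have : (U `&` (D `&` f @^-1` [set y])) (p k).
        by split => //; apply: eU; rewrite -ball_normE.
      by rewrite UE.
    have [k1 _ /pc h1] := near 0%N e e0.
    have [k2 k12 /pc h2] := near k1.+1 e e0.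
    by have := pinj _ _ (etrans h1 (esym h2)) => kE; move: k12; rewrite kE ltnn.
  have : nbhs c (f @^-1` [set w | w <> y]).
    by apply: (open_continuous_at oD cf Dc); apply: open_nbhs_nbhs; split => //; exact: open_neq.
  move=> /nbhs_ballP[e /= e0 eU]; have [k _ ck] := near 0%N e e0.
  by have := eU (p k); rewrite -ball_normE => /(_ ck); apply; case: (pY k).
have [C' cC' CE] := clf (@closed_closure _ C).
have : (D' `&` C') y.
  split => //; apply: cC' => B /nbhs_ballP[e /= e0 eB].
  pose k := Num.truncn (e^-1).
  exists (f (z k)); split; last first.
    apply: eB; rewrite -ball_normE /= distrC; apply: le_lt_trans (norm_le_enorm _) _.
    have [_ _ h _] := Pz k; apply: lt_trans h _.
    by rewrite invf_plt ?posrE// truncnS_gt.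
  suff : (D' `&` C') (f (z k)) by case.
  rewrite -CE; exists (z k) => //; split => //; apply: subset_closure; by exists k.
rewrite -CE => -[c [Dc clc] fc]; have [k _ zk] := cl c Dc clc.
by have [_ _ _] := Pz k; rewrite zk.
Qed.

(** A closed map with finite fibres is proper: if an ultrafilter on the preimage
    of K avoided all points of the fibre over the limit of its image, it would
    live on a closed set whose image does not contain that limit. *)
Lemma proper_preimage K : compact K -> K `<=` D' -> compact (D `&` f @^-1` K).
Proof.
move=> cK KD'; rewrite compact_ultra => F UF FX.
have fFK : F (f @^-1` K) by apply: filterS FX; exact: subIsetr.
have [y [Ky cly]] := cK (f x @[x --> F]) _ fFK.
have [s sE] := (finite_seqP _).1 (fiber_finite (KD' _ Ky)).
apply: contrapT => no.
have noU p : (D `&` f @^-1` [set y]) p -> exists2 U, nbhs p U & ~ F U.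
  move=> [Dp fp]; apply: contrapT => H; apply: no; exists p; split.
    by split => //=; rewrite fp.
  by move=> U pU; apply: contrapT => FU; apply: H; exists U.
have [U HU] : exists U : 'rV[R]_n -> set 'rV[R]_n,
    forall p, (D `&` f @^-1` [set y]) p -> nbhs p (U p) /\ ~ F (U p).
  have : forall p, exists U, (D `&` f @^-1` [set y]) p -> nbhs p U /\ ~ F U.
    move=> p; have [/noU[U pU FU]|h] := pselect ((D `&` f @^-1` [set y]) p); first by exists U.
    by exists set0 => /h.
  by move=> /choice[U HU]; exists U.
pose O := \bigcup_(p in [set` s]) (U p)^°.
have oO : open O by apply: bigcup_open => p _; exact: open_interior.
have FO : F (~` O).
  have : forall s' : seq 'rV[R]_n, {subset s' <= s} -> F (~` \bigcup_(p in [set` s']) (U p)^°).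
    elim=> [|p s' IH] sub; first by apply: filterS filterT => x _ [].
    have Fp : F (~` (U p)^°).
      have pY : (D `&` f @^-1` [set y]) p by rewrite sE /=; apply: sub; rewrite mem_head.
      have [_ nF] := HU p pY; have [FU|//] := in_ultra_setVsetC (U p)^° UF.
      by case: nF; apply: filterS FU; exact: interior_subset.
    have sub' : {subset s' <= s} by move=> q qs; apply: sub; rewrite in_cons qs orbT.
    apply: filterS (filterI Fp (IH sub')) => x [h1 h2] [q /=].
    by rewrite in_cons => /predU1P[->//|qs] xq; apply: h2; exists q.
  by apply.
have [C' cC' CE] := clf (open_closedC oO).
have yC' : ~ C' y.
  move=> C'y; have : (D' `&` C') y by split => //; exact: KD'.
  rewrite -CE => -[p [Dp Op] fp]; apply: Op.
  have pY : (D `&` f @^-1` [set y]) p by split.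
  exists p; first by rewrite -sE.
  by have [pU _] := HU p pY; exact: nbhs_singleton (nbhs_interior pU).
have FC' : F (f @^-1` C').
  apply: filterS (filterI FX FO) => x [[Dx _] Ox].
  suff : (D' `&` C') (f x) by case.
  by rewrite -CE; exists x.
have [w [C'w]] := cly C' (~` C') FC' (open_nbhs_nbhs (conj (closed_openC cC') yC')).
by apply.
Qed.

End properness.

Section quasi_component.
Variable (X : set 'rV[R]_n).
Hypothesis cX : compact X.

Definition clopen_in Z := compact Z /\ exists2 O, open O & Z = X `&` O.

(** The intersection of the relatively clopen sets through x. In a compact set it
    is connected, and unlike the component it is directly accessible to
    clopen sets. *)
Definition quasi_component x := \bigcap_(Z in [set Z | clopen_in Z /\ Z x]) Z.

Lemma clopen_inI Z Z' : clopen_in Z -> clopen_in Z' -> clopen_in (Z `&` Z').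
Proof.
move=> [cZ [U oU ZE]] [cZ' [U' oU' ZE']]; split.
  apply: (subclosed_compact _ cZ (@subIsetl _ _ _)).
  apply: closedI; [exact: (compact_closed_rV cZ)|exact: (compact_closed_rV cZ')].
exists (U `&` U'); first exact: openI.
  by rewrite ZE ZE' setIACA setIid.
Qed.

Lemma clopen_in_self : clopen_in X.
Proof. by split => //; exists setT; [exact: openT|rewrite setIT]. Qed.

Lemma quasi_component_sub x : X x -> quasi_component x `<=` X.
Proof. by move=> Xx y; apply; split => //; exact: clopen_in_self. Qed.

Lemma quasi_component_closed x : closed (quasi_component x).
Proof.
by apply: closed_bigI => Z [[cZ _] _]; exact: compact_closed_rV.
Qed.

(** By compactness the clopen sets through x shrink into every neighbourhood of
    the quasi-component. *)
Lemma quasi_component_shrink x O : X x -> open O -> quasi_component x `<=` O ->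
  exists Z, [/\ clopen_in Z, Z x & Z `<=` O].
Proof.
move=> Xx oO QO; apply: contrapT => no.
pose F := filter_from [set Z | clopen_in Z /\ Z x] (fun Z => Z `\` O).
have FF : ProperFilter F.
  apply: filter_from_proper.
    apply: filter_from_filter; first by exists X; split => //; exact: clopen_in_self.
    move=> Z Z' [cZ Zx] [cZ' Zx']; exists (Z `&` Z').
      by split; [exact: clopen_inI|split].
    by move=> y [[Zy Zy'] Oy]; split; split.
  move=> Z [cZ Zx]; apply: contrapT => Z0; apply: no; exists Z; split => // y Zy.
  by apply: contrapT => Oy; apply: Z0; exists y.
have FX : F X by exists X; [split => //; exact: clopen_in_self|exact: subDsetl].
have [y [Xy cly]] := cX FF FX.
have : O y.
  apply: QO => Z [cZ Zx]; apply: (compact_closed_rV cZ.1).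
  move=> B yB; have : F Z by exists Z => //; exact: subDsetl.
  by move=> FZ; have := cly Z B FZ yB.
move=> Oy; have FO : F (~` O) by exists X; [split => //; exact: clopen_in_self|move=> w []].
have [w [nOw Ow]] := cly (~` O) O FO (open_nbhs_nbhs (conj oO Oy)).
exact: nOw Ow.
Qed.

Lemma quasi_component_connected x : X x -> connected (quasi_component x).
Proof.
move=> Xx; set Q := quasi_component x.
have Qx : Q x by move=> Z [].
have cQ : closed Q by exact: quasi_component_closed.
apply: contrapT => /connectedPn[E [E0 QE [sep1 sep2]]].
have clE b : closed (E b).
  move=> y cly; have : Q y.
    apply: cQ; apply: closureS cly => z Ez; rewrite QE.
    by case: b Ez; [right|left].
  rewrite QE => -[] Ey; case: b cly => // cly; exfalso.
    by have : (E false `&` closure (E true)) y by []; rewrite sep2.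
  by have : (closure (E false) `&` E true) y by []; rewrite sep1.
wlog Ex : E E0 QE sep1 sep2 clE / E false x.
  move=> H; have := Qx; rewrite QE => -[Ex|Ex]; first exact: (H E).
  apply: (H (E \o negb)) => //=.
  - by rewrite QE setUC.
  - by rewrite setIC.
  - by rewrite setIC.
have disj : E false `&` E true = set0.
  by apply/seteqP; split => // y [h1 h2]; rewrite -sep1; split => //; exact: subset_closure.
have [N1 [N2 [oO1 oO2 EO1 EO2 O12]]] : exists N1 N2 : set 'rV[R]_n, [/\ open N1, open N2,
    E false `<=` N1, E true `<=` N2 & N1 `&` N2 = set0].
  have nrm : normal_space 'rV[R]_n by exact: pseudometric_normal.
  have [U [V [? ? ? ? ?]]] := (@normal_openP R _).1 nrm _ _ (clE false) (clE true) disj.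
  by exists U, V.
have [Z [[cZ [U oU ZE]] Zx ZO]] : exists Z, [/\ clopen_in Z, Z x & Z `<=` N1 `|` N2].
  apply: quasi_component_shrink => //; first exact: openU.
  by rewrite -/Q QE => y [/EO1|/EO2]; [left|right].
have cZ1 : clopen_in (Z `&` N1).
  split; last by exists (U `&` N1); [exact: openI|rewrite ZE setIA].
  have -> : Z `&` N1 = Z `&` ~` N2.
    apply/seteqP; split => y [Zy h]; split => //.
      by move=> h2; have : (N1 `&` N2) y by []; rewrite O12.
    by case: (ZO y Zy).
  apply: (subclosed_compact _ cZ (@subIsetl _ _ _)); apply: closedI; last exact: open_closedC.
  by exact: compact_closed_rV.
have [y Ey] := E0 true; have : Q y by rewrite QE; right.
move=> /(_ (Z `&` N1)) [|Zy O1y]; first by split => //; split => //; exact: EO1.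
by have : (N1 `&` N2) y by [split => //; exact: EO2]; rewrite O12.
Qed.

End quasi_component.

(** Lifting of continua (Whyburn): under a proper open map the component of the
    preimage of a continuum K through any of its points is mapped onto K. *)
Lemma lift_continuum (D : set 'rV[R]_n) f K x : open D -> {within D, continuous f} ->
  open_mapping D f -> compact (D `&` f @^-1` K) -> continuum K -> D x -> K (f x) ->
  exists E, [/\ continuum E, E `<=` D, E x & f @` E = K].
Proof.
move=> oD cf of_ cX [_ cK conK] Dx Kfx; set X := D `&` f @^-1` K in cX *.
have Xx : X x by [].
exists (quasi_component X x); have Qx : quasi_component X x x by move=> Z [].
have QX := quasi_component_sub cX Xx.
have cZK Z : clopen_in X Z -> Z x -> f @` Z = K.
  move=> [cZ [U oU ZE]] Zx; apply: conK.
  - by exists (f x), x.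
  - exists (f @` (D `&` U)); first by apply: of_; [exact: openI|exact: subIsetl].
    rewrite ZE; apply/seteqP; split => [_ [z [[Dz Kz] Oz] <-]|w [Kw [z [Dz Oz] zw]]].
      by split => //; exists z.
    by exists z => //; split => //; split => //=; rewrite zw.
  - exists (f @` Z).
      apply: compact_closed_rV.
      by apply: (image_compact_in cf cZ) => z; rewrite ZE => -[[]].
    rewrite setIidr// => _ [z + <-]; by rewrite ZE => -[[]].
split => //.
- split; first by exists x.
  + by apply: (subclosed_compact _ cX QX); exact: quasi_component_closed.
  + exact: quasi_component_connected.
- by move=> z /QX[].
apply/seteqP; split => [_ [z /QX[_ Kz] <-]//|w Kw].
apply: contrapT => no.
have [| |Z [cZ Zx ZO]] := @quasi_component_shrink X cX x (D `&` f @^-1` [set u | u <> w]) Xx.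
- by apply: open_preimage => //; exact: open_neq.
- move=> z Qz; have [Dz _] := QX z Qz; split => //= fz; apply: no; by exists z.
have : K w by []; rewrite -(cZK Z cZ Zx) => -[z /ZO[_ /=]].
by [].
Qed.

End proper_maps.

(** * Joining points by continua *)

Section joined.
Context {R : realType} {n : nat}.
Implicit Types (x y z p q a : 'rV[R]_n) (K U C D : set 'rV[R]_n).

(** Joining by continua rather than by paths: lifts under the mappings are only
    known to be continua. *)
Definition joined U x y := exists K, [/\ continuum K, K `<=` U, K x & K y].

Lemma joined_refl U x : U x -> joined U x x.
Proof.
move=> Ux; exists [set x]; split => //; last by move=> _ ->.
by split; [exists x|exact: compact_set1|exact: connected1].
Qed.

Lemma joined_sym U x y : joined U x y -> joined U y x.
Proof. by move=> [K [cK KU Kx Ky]]; exists K. Qed.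

Lemma joined_trans U x y z : joined U x y -> joined U y z -> joined U x z.
Proof.
move=> [K [[_ cK nK] KU Kx Ky]] [L [[_ cL nL] LU Ly Lz]].
exists (K `|` L); split; [|by rewrite subUset|by left|by right].
split; first by exists x; left.
  exact: compactU.
by apply: connectedU => //; exists y.
Qed.

Lemma joined_sub U V x y : U `<=` V -> joined U x y -> joined V x y.
Proof. by move=> UV [K [cK KU Kx Ky]]; exists K; split => //; exact: subset_trans UV. Qed.

Lemma joined_r U x y : joined U x y -> U y.
Proof. by move=> [K [_ KU _ Ky]]; exact: KU. Qed.

Definition segm x y : set 'rV[R]_n := (fun t : R => x + t *: (y - x)) @` `[0, 1]%classic.

Lemma segm_continuous x y : continuous (fun t : R => x + t *: (y - x)).
Proof.
move=> t; apply: cvgD; first exact: cvg_cst.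
by apply: cvgZr_tmp; exact: cvg_id.
Qed.

Lemma segm_l x y : segm x y x.
Proof. by exists 0; rewrite ?scale0r ?addr0//= in_itv/= lexx ler01. Qed.

Lemma segm_r x y : segm x y y.
Proof. by exists 1; rewrite ?scale1r ?subrKC//= ?in_itv/= ?lexx ?ler01// addrC subrK. Qed.

Lemma continuum_segm x y : continuum (segm x y).
Proof.
split; first by exists x; exact: segm_l.
- apply: continuous_compact; last exact: segment_compact.
  by apply: continuous_subspaceT; exact: segm_continuous.
- apply: connected_continuous_connected; last first.
    by apply: continuous_subspaceT; exact: segm_continuous.
  exact/connected_intervalP/interval_is_interval.
Qed.

Lemma segm_ball p (r : R) x y : `|x - p| < r -> `|y - p| < r ->
  forall z, segm x y z -> `|z - p| < r.
Proof.
move=> xr yr _ [t + <-]; rewrite /= in_itv/= => /andP[t0 t1].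
have -> : x + t *: (y - x) - p = (1 - t) *: (x - p) + t *: (y - p).
  by apply/rowP => i; rewrite !mxE; ring.
apply: le_lt_trans (ler_normD _ _) _; rewrite !normrZ !ger0_norm ?subr_ge0//.
move: (`|x - p|) (`|y - p|) xr yr => u v ur vr.
have [->|tN0] := eqVneq t 0; first by rewrite subr0 mul1r mul0r addr0.
have tp : 0 < t by rewrite lt_neqAle eq_sym tN0.
have h1 : (1 - t) * u <= (1 - t) * r by apply: ler_wpM2l; [rewrite subr_ge0|exact: ltW].
have h2 : t * v < t * r by rewrite ltr_pM2l.
by apply: lt_le_trans (ler_ltD h1 h2) _; rewrite -mulrDl subrK mul1r.
Qed.

Lemma joined_segm U x y : segm x y `<=` U -> joined U x y.
Proof.
by move=> sU; exists (segm x y); split => //; [exact: continuum_segm|exact: segm_l|exact: segm_r].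
Qed.

Lemma joined_ball U x : open U -> U x -> exists2 e : R, 0 < e &
  forall y z, `|y - x| < e -> `|z - x| < e -> joined U y z.
Proof.
move=> oU Ux; have [e /= e0 eU] : nbhs_ball x U by apply/nbhs_ballP; exact: open_nbhs_nbhs.
exists e => // y z ye ze; apply: joined_segm => w /(segm_ball ye ze) we.
by apply: eU; rewrite -ball_normE /= distrC.
Qed.

Lemma open_joined U x : open U -> open [set y | joined U x y].
Proof.
move=> oU; rewrite openE => y /= xy; have [e e0 H] := joined_ball oU (joined_r xy).
apply/nbhs_ballP; exists e => //= z; rewrite -ball_normE /= distrC => ze.
by apply: joined_trans xy _; apply: H => //; rewrite subrr normr0.
Qed.

Lemma joined_closure U x y : open U -> U y -> closure [set y | joined U x y] y -> joined U x y.
Proof.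
move=> oU Uy cly; have [e e0 H] := joined_ball oU Uy.
have [z [/= xz]] := cly _ (nbhsx_ballx y e e0).
rewrite -ball_normE /= distrC => zy; apply: joined_trans xz _.
by apply: H => //; rewrite subrr normr0.
Qed.

(** The class of points joined to x is open and relatively closed. *)
Lemma joined_connected U C x y : open U -> connected C -> C `<=` U -> C x -> C y -> joined U x y.
Proof.
move=> oU cC CU Cx Cy.
have E : C `&` [set z | joined U x z] = C.
  apply: cC.
  - by exists x; split => //; apply: joined_refl; exact: CU.
  - by exists [set z | joined U x z]; [exact: open_joined|].
  - exists (closure [set z | joined U x z]); first exact: closed_closure.
    apply/seteqP; split => z [Cz xz]; split => //; first exact: subset_closure.
    by apply: joined_closure => //; exact: CU.
by have : (C `&` [set z | joined U x z]) y by [rewrite E]; case.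
Qed.

Lemma connected_open_split D U V : connected D -> open U -> open V ->
  D `<=` U `|` V -> D `&` U `&` V = set0 -> D `&` U !=set0 -> D `<=` U.
Proof.
move=> cD oU oV DUV dis DU0 x Dx.
have E : D `&` U = D.
  apply: cD => //; first by exists U.
  exists (~` V); first exact: open_closedC.
  apply/seteqP; split => z [Dz h]; split => //.
    by move=> Vz; have : (D `&` U `&` V) z by []; rewrite dis.
  by case: (DUV z Dz).
by have : (D `&` U) x by [rewrite E]; case.
Qed.

Section spheres.
Variable a : 'rV[R]_n.
Hypothesis n1 : (1 < n)%N.

Let phi (s : R) z := a + (s / enorm (z - a)) *: (z - a).

Let phi_continuous s z : z <> a -> continuous_at z (phi s).
Proof.
move=> za; have sub : continuous_at z (fun z => z - a).
  exact: (@cvgB _ _ _ (nbhs z) _ id (cst a) z a (@cvg_id _ _) (cvg_cst _)).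
have en : (fun z => enorm (z - a)) z' @[z' --> z] --> enorm (z - a).
  exact: (@continuous_comp _ _ _ (fun z => z - a) (@enorm R n) z sub (@enorm_continuous R n _)).
have z0 : enorm (z - a) != 0 by apply/eqP => /enorm_eq0/eqP; rewrite subr_eq0 => /eqP.
have qt : (s / enorm (z' - a)) @[z' --> z] --> s / enorm (z - a).
  apply: (@cvgM _ _ (nbhs z) _ (cst s) (fun z' => (enorm (z' - a))^-1)).
    exact: cvg_cst.
  exact: cvgV.
apply: (@cvgD _ _ _ (nbhs z) _ (cst a) (fun z' => (s / enorm (z' - a)) *: (z' - a))).
  exact: cvg_cst.
exact: cvgZ.
Qed.

Let phi_sphere s z : 0 < s -> z <> a -> enorm (phi s z - a) = s.
Proof.
move=> s0 za; rewrite /phi addrC addKr enormZ.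
have z0 : enorm (z - a) != 0 by apply/eqP => /enorm_eq0/eqP; rewrite subr_eq0 => /eqP.
by rewrite ger0_norm ?mulr_ge0 ?invr_ge0 ?enorm_ge0 ?(ltW s0)// mulfVK.
Qed.

Let phi_id s z : 0 < s -> enorm (z - a) = s -> phi s z = z.
Proof. by move=> s0 zs; rewrite /phi zs divff ?gt_eqF// scale1r addrC subrK. Qed.

Let joined_phi s p q : 0 < s -> ~ segm p q a -> joined (esphere a s) (phi s p) (phi s q).
Proof.
move=> s0 pq; exists (phi s @` segm p q); have [_ cS nS] := continuum_segm p q.
have za z : segm p q z -> z <> a by move=> Sz zE; apply: pq; rewrite -zE.
have cphi : {within segm p q, continuous (phi s)}.
  by apply: continuous_in_subspaceT => z /set_mem/za; exact: phi_continuous.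
split.
- split; first by exists (phi s p), p => //; exact: segm_l.
    exact: continuous_compact.
  exact: connected_continuous_connected.
- by move=> _ [z /za zS <-]; exact: phi_sphere.
- by exists p => //; exact: segm_l.
- by exists q => //; exact: segm_r.
Qed.

(** The radial projection of a segment that misses the center a; if the segment
    through p and q contains a, it is replaced by two segments through a point
    off the line. *)
Lemma joined_sphere s p q : 0 < s -> enorm (p - a) = s -> enorm (q - a) = s ->
  joined (esphere a s) p q.
Proof.
move=> s0 ps qs; rewrite -(phi_id s0 ps) -(phi_id s0 qs).
have [[c /=]|pq] := pselect (segm p q a); last exact: joined_phi.
rewrite in_itv/= => /andP[c0 c1] cE.
have u0 : `|p - a| != 0.
  apply: contraTneq s0 => /normr0_eq0 pa; by rewrite -ps pa enorm0 ltxx.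
have [|i ui] := @norm_coord R n (p - a); first by rewrite lt_neqAle eq_sym u0 normr_ge0.
have ui0 : (p - a) 0 i != 0 by rewrite -normr_eq0 ui.
have [j ji] : exists j : 'I_n, j != i.
  have n0 : (0 < n)%N by exact: ltnW.
  have [i0|i0] := eqVneq i (Ordinal n0).
    by exists (Ordinal n1); rewrite i0.
  by exists (Ordinal n0); rewrite eq_sym.
pose w := p + delta_mx 0 j.
have ci0 : p 0 i + c * (q 0 i - p 0 i) = a 0 i by rewrite -cE !mxE.
have cj0 : p 0 j + c * (q 0 j - p 0 j) = a 0 j by rewrite -cE !mxE.
rewrite !mxE subr_eq0 in ui0.
apply: (@joined_trans _ _ (phi s w)); apply: joined_phi => // -[t /=]; rewrite in_itv/= => /andP[t0 t1] tE.
  have := congr1 (fun v : 'rV[R]_n => v 0 i) tE; rewrite !mxE [i == j]eq_sym (negbTE ji) andbF addr0 subrr mulr0 addr0.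
  by move/eqP; rewrite (negbTE ui0).
have := congr1 (fun v : 'rV[R]_n => v 0 i) tE; have := congr1 (fun v : 'rV[R]_n => v 0 j) tE.
rewrite !mxE !eqxx [i == j]eq_sym (negbTE ji) /= addr0.
move: (p 0 i) (p 0 j) (q 0 i) (q 0 j) (a 0 i) (a 0 j) ui0 ci0 cj0 => pi pj qi qj ai aj ui0 ci0 cj0 Ej Ei.
have cN0 : c != 0 by apply: contra_neq ui0 => c00; rewrite -ci0 c00 mul0r addr0.
have e1 : (1 - c) * (pi - ai) + c * (qi - ai) = 0 by rewrite -ci0; ring.
have e2 : (1 - t) * (pi - ai) + t * (qi - ai) = 0 by rewrite -[in LHS]Ei; ring.
have e3 : (c - t) * (pi - ai) = 0.
  have -> : (c - t) * (pi - ai) =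
    c * ((1 - t) * (pi - ai) + t * (qi - ai)) - t * ((1 - c) * (pi - ai) + c * (qi - ai)) by ring.
  by rewrite e1 e2 !mulr0 subrr.
have ct : c = t.
  by move/eqP: e3; rewrite mulf_eq0 subr_eq0 [pi - ai == 0]subr_eq0 (negbTE ui0) orbF => /eqP.
have e4 : 1 - t = 0.
  have : pj + t * (qj - pj) + (1 - t) = aj by rewrite -[RHS]Ej; ring.
  by rewrite -ct cj0 => /eqP; rewrite -subr_eq0 addrAC subrr add0r => /eqP.
move: cE; have -> : c = 1 by rewrite ct; apply/esym/eqP; rewrite -subr_eq0 e4.
rewrite scale1r addrC subrK => qa; move: s0; rewrite -qs qa subrr enorm0.
by rewrite ltxx.
Qed.

Lemma joined_shell (r r' : R) p q : 0 <= r -> r < enorm (p - a) < r' -> r < enorm (q - a) < r' ->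
  joined [set z | r < enorm (z - a) < r'] p q.
Proof.
move=> r0 pr qr; set S := [set z | _].
have rad z : r < enorm (z - a) < r' -> joined S z (phi (enorm (p - a)) z).
  move=> /andP[z1 z2]; apply: joined_segm => _ [t + <-].
  have z0 : 0 < enorm (z - a) by exact: le_lt_trans z1.
  rewrite /= in_itv/= /S/= => /andP[t0 t1].
  have [p1 p2] := andP pr.
  set l := enorm (z - a) in z0 z1 z2 *; set m := enorm (p - a) in p1 p2 *.
  have -> : z + t *: (phi m z - z) - a = ((1 - t) + t * (m / l)) *: (z - a).
    by rewrite /phi -/l; apply/rowP => i; rewrite !mxE; ring.
  have m0 : 0 < m by exact: le_lt_trans p1.
  rewrite enormZ -/l ger0_norm; last first.
    by rewrite addr_ge0 ?subr_ge0// mulr_ge0// divr_ge0// ltW.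
  rewrite mulrDl -mulrA mulfVK ?gt_eqF//.
  have h1 : (1 - t) * (l - r) + t * (m - r) > 0.
    have [->|tN0] := eqVneq t 0; first by rewrite subr0 mul1r mul0r addr0 subr_gt0.
    apply: ltr_wpDl; first by rewrite mulr_ge0// subr_ge0// ltW.
    by rewrite mulr_gt0 ?subr_gt0// lt_neqAle eq_sym tN0.
  have h2 : (1 - t) * (r' - l) + t * (r' - m) > 0.
    have [->|tN0] := eqVneq t 0; first by rewrite subr0 mul1r mul0r addr0 subr_gt0.
    apply: ltr_wpDl; first by rewrite mulr_ge0// subr_ge0// ltW.
    by rewrite mulr_gt0 ?subr_gt0// lt_neqAle eq_sym tN0.
  by apply/andP; split; lra.
have p0 : 0 < enorm (p - a) by case/andP: pr => p1 _; exact: le_lt_trans p1.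
have qa : q <> a.
  by move=> qE; case/andP: qr; rewrite qE subrr enorm0 ltNge r0.
apply: (joined_trans (rad p pr)); apply: joined_trans _ (joined_sym (rad q qr)).
rewrite (phi_id p0 erefl).
apply: joined_sub (joined_sphere p0 erefl (phi_sphere p0 qa)) => z.
by rewrite /esphere/S/= => ->.
Qed.

Lemma open_eball (r : R) : open [set z | enorm (z - a) < r].
Proof.
rewrite (_ : [set z | _] = (fun z => enorm (z - a)) @^-1` `]-oo, r[%classic); last first.
  by apply/seteqP; split => z /=; rewrite in_itv.
by apply: open_comp => //; move=> z _; exact: enorm_sub_continuous.
Qed.

Lemma open_off_ball (r : R) : open [set z | r < enorm (z - a)].
Proof.
rewrite (_ : [set z | _] = (fun z => enorm (z - a)) @^-1` `]r, +oo[%classic); last first.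
  by apply/seteqP; split => z /=; rewrite in_itv/= andbT.
by apply: open_comp => //; move=> z _; exact: enorm_sub_continuous.
Qed.

(** Removing a closed ball (or a point, r = 0) from a domain of dimension at
    least two leaves any two points joined, because the surrounding shell is. *)
Lemma joined_off_ball D (r r' : R) x y : 0 <= r -> r < r' -> open D -> connected D ->
  [set z | enorm (z - a) < r'] `<=` D ->
  (D `&` [set z | r < enorm (z - a)]) x -> (D `&` [set z | r < enorm (z - a)]) y ->
  joined (D `&` [set z | r < enorm (z - a)]) x y.
Proof.
move=> r0 rr' oD cD BD; set U := D `&` _ => Ux Uy.
have oU : open U by apply: openI => //; exact: open_off_ball.
have shellU : [set z | r < enorm (z - a) < r'] `<=` U.
  by move=> z /andP[z1 z2]; split => //; exact: BD.
pose G := [set z | joined U x z]; pose H := U `&` [set z | ~ joined U x z].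
have oG : open G by exact: open_joined.
have oH : open H.
  rewrite openE => z [Uz nz]; have [e e0 He] := joined_ball oU Uz.
  apply/nbhs_ballP; exists e => //= w; rewrite -ball_normE /= distrC => wz.
  have zw : joined U z w by apply: He => //; rewrite subrr normr0.
  split; first exact: joined_r zw.
  by move=> /= xw; apply: nz; exact: joined_trans xw (joined_sym zw).
have shellG : (exists2 w, r < enorm (w - a) < r' & G w) -> G y.
  move=> [w wr Gw]; pose B := [set z | enorm (z - a) < r'].
  have BG z : r < enorm (z - a) < r' -> G z.
    by move=> zr; apply: joined_trans Gw _; apply: joined_sub shellU _; exact: joined_shell.
  have : D `<=` G `|` B.
    apply: (@connected_open_split D _ H) => //.
    - by apply: openU => //; exact: open_eball.
    - move=> z Dz; have [zr|rz] := leP (enorm (z - a)) r.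
        by left; right; exact: le_lt_trans rr'.
      by have [h|h] := pselect (joined U x z); [left; left|right; split].
    - apply/seteqP; split => // z [[_ [Gz|Bz]] [Uz nz]]; first exact: nz.
      by apply: nz; apply: BG; apply/andP; split => //; case: Uz.
    - by exists x; split; [case: Ux|left; exact: joined_refl].
  move=> /(_ y Uy.1)[//|By]; apply: BG; apply/andP; split => //; by case: Uy.
apply: contrapT => nG.
have noshell w : r < enorm (w - a) < r' -> ~ G w.
  by move=> wr Gw; apply: nG; apply: shellG; exists w.
pose V := H `|` [set z | enorm (z - a) < r'].
have : D `<=` G.
  apply: (@connected_open_split D _ V) => //.
  - by apply: openU => //; exact: open_eball.
  - move=> z Dz; have [zr|rz] := leP (enorm (z - a)) r.
      by right; right; exact: le_lt_trans rr'.
    by have [h|h] := pselect (joined U x z); [left|right; left; split].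
  - apply/seteqP; split => // z [[_ Gz] [[_ nz]|Bz]]; first exact: nz.
    apply: (noshell z) => //; apply/andP; split => //.
    by have [] := joined_r Gz.
  - by exists x; split; [case: Ux|exact: joined_refl].
by move=> /(_ y Uy.1).
Qed.

End spheres.

(** The last point up to which the ray stays in K is interior to D, so the ray
    leaves K before it leaves D. *)
Lemma ray_escape D K b (e : 'rV[R]_n) (t0 : R) : open D -> compact K -> K `<=` D ->
  enorm e = 1 -> D (b + t0 *: e) ->
  exists2 t1, t0 <= t1 & (forall t, t0 <= t <= t1 -> D (b + t *: e)) /\ ~ K (b + t1 *: e).
Proof.
move=> oD cK KD e1 Dt0; have [Kt0|nK] := pselect (K (b + t0 *: e)); last first.
  exists t0 => //; split => // t tt; have -> : t = t0 by apply/eqP; rewrite eq_le andbC.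
  by [].
have cline : continuous (fun t : R => b + t *: e).
  move=> t; apply: cvgD; first exact: cvg_cst.
  by apply: cvgZr_tmp; exact: cvg_id.
pose T := [set t | t0 <= t /\ forall s, t0 <= s <= t -> K (b + s *: e)].
have Tt0 : T t0.
  split => // s ss; have -> : s = t0 by apply/eqP; rewrite eq_le andbC.
  by [].
have supT : has_sup T.
  split; first by exists t0.
  have [M [_ HM]] := compact_bounded cK.
  exists (n%:R * (M + 1) + enorm b) => t [tt0 Ht].
  have := HM (M + 1); rewrite ltrDl ltr01 => /(_ isT _ (Ht t _)); rewrite tt0 lexx => /(_ isT) hn.
  have hb : enorm (b + t *: e) <= n%:R * (M + 1).
    apply: le_trans (enorm_le_norm _) _; exact: ler_wpM2l.
  have : enorm (t *: e) <= n%:R * (M + 1) + enorm b.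
    have -> : t *: e = (b + t *: e) + (- b) by rewrite addrC addKr.
    by apply: le_trans (enormD _ _) _; rewrite enormN lerD2r.
  by rewrite enormZ e1 mulr1; apply: le_trans; exact: ler_norm.
pose t1 := sup T.
have t01 : t0 <= t1 by exact: sup_upper_bound.
have below s : t0 <= s -> s < t1 -> K (b + s *: e).
  move=> ts st; have [t [tt0 Ht] tt1] := sup_gt (ex_intro _ _ Tt0) st.
  by apply: Ht; rewrite ts ltW.
have Kt1 : K (b + t1 *: e).
  have [<-//|tN] := eqVneq t0 t1.
  have t01' : t0 < t1 by rewrite lt_neqAle tN.
  apply: (compact_closed_rV cK) => B /cline/nbhs_ballP[d /= d0 dB].
  pose s := Num.max t0 (t1 - d / 2).
  have st1 : s < t1 by rewrite gt_max t01'/= ltrBlDr ltrDl divr_gt0.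
  exists (b + s *: e); split; first by apply: below => //; rewrite le_max lexx.
  apply: dB; rewrite /ball/= ger0_norm ?subr_ge0; last exact: ltW.
  have : t1 - d / 2 <= s by rewrite le_max lexx orbT.
  by move: s st1 => s st1 h; lra.
have /cline/nbhs_ballP[d /= d0 dD] : nbhs (b + t1 *: e) D.
  by apply: open_nbhs_nbhs; split => //; exact: KD.
have [s [ts sd nKs]] : exists s, [/\ t0 <= s, s <= t1 + d / 2 & ~ K (b + s *: e)].
  apply: contrapT => no; have : T (t1 + d / 2).
    split; first by rewrite (le_trans t01)// lerDl divr_ge0// ltW.
    by move=> s /andP[s0 s1]; apply: contrapT => h; apply: no; exists s.
  move=> /(sup_upper_bound supT); rewrite -/t1 gerDl leNgt divr_gt0//.
exists s => //; split => // t /andP[tt ts'].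
have [tt1|t1t] := ltP t t1; first by apply: KD; exact: below.
apply: dD; rewrite /ball/= distrC ger0_norm ?subr_ge0//; lra.
Qed.

End joined.

Section extended_space.
Context {R : realType} {n : nat}.
Local Notation T := (extRn R n).

Lemma extRn_hausdorff : hausdorff_space T.
Proof. exact: metric_hausdorff. Qed.

Lemma emb_inj : injective (emb : 'rV[R]_n -> T).
Proof. by move=> x y [->]. Qed.

(** An ultrafilter that charges no bounded set converges to infinity. *)
Lemma extRn_compact : compact [set: T].
Proof.
rewrite compact_ultra => F UF _.
have [[M FM]|no] := pselect (exists M : R, F (emb @` [set x | `|x| <= M])).
  have cB : compact (emb @` [set x : 'rV[R]_n | `|x| <= M] : set T).
    apply: continuous_compact; first exact/continuous_subspaceT/emb_continuous.
    apply: bounded_closed_compact.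
      by exists M; split; [exact: num_real|move=> M' MM' x /= /le_trans; apply; exact: ltW].
    rewrite (_ : [set x | _] = (fun x : 'rV[R]_n => `|x|) @^-1` `]-oo, M]%classic).
      by apply: closed_comp; [move=> x _; exact: norm_continuous|exact: lray_closed].
    by apply/seteqP; split => x /=; rewrite in_itv.
  move: cB; rewrite compact_ultra => /(_ F UF FM)[x [_ Fx]]; by exists x.
exists infinity; split => // A /nbhs_ballP[e /= e0 eA].
have [FA|FA] := in_ultra_setVsetC A UF; first exact: FA.
exfalso; apply: no; exists (e^-1); apply: filterS FA => -[u|] nA; last first.
  by exfalso; apply: nA; apply: eA; exact: ballxx.
exists u => //=; apply: contrapT => /negP; rewrite -ltNge => eu; apply: nA; apply: eA.
rewrite /ball/=; set s := Num.sqrt _.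
have us : `|u| <= s.
  apply: le_trans (norm_le_enorm _) _; rewrite -[leLHS]ger0_norm ?enorm_ge0//.
  by rewrite -sqrtr_sqr ler_wsqrtr// lerDr.
have es : e^-1 < s by exact: lt_le_trans us.
by rewrite invf_plt ?posrE// (lt_trans _ es)// invr_gt0.
Qed.

End extended_space.

(** * The dichotomy for preimages near a point *)

Section separation.
Context {R : realType} {n : nat}.
Implicit Types (D E F C : set 'rV[R]_n) (f : 'rV[R]_n -> 'rV[R]_n).

(** What the proof uses of a member of the family: it is a proper open map and
    the modulus of the curves whose images cross an annulus is controlled by
    the width of the annulus alone. *)
Definition tame D D' (q : R) f := [/\ {within D, continuous f}, f @` D = D',
  open_mapping D f, (forall K, compact K -> K `<=` D' -> compact (D `&` f @^-1` K)) &
  forall y0 r1 r2, D' y0 -> 0 < r1 -> r1 < r2 ->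
    (modulus (Gamma_f D f y0 r1 r2) <= (q / (r2 - r1) ^+ n)%:E)%E].

Variables (D D' : set 'rV[R]_n) (q : R).
Hypotheses (n1 : (1 < n)%N) (oD : open D) (oD' : open D') (cD' : connected D') (q0 : 0 < q).

Lemma tame_lift f K x : tame D D' q f -> continuum K -> K `<=` D' -> D x -> K (f x) ->
  exists E, [/\ continuum E, E `<=` D, E x & f @` E = K].
Proof.
move=> [cf fD of_ pf _] cK KD' Dx Kfx.
by apply: (lift_continuum oD cf of_ _ cK Dx Kfx); apply: pf => //; case: cK.
Qed.

(** Only the total bound P is fixed in advance; the number and the position of
    the annuli may depend on the mapping. *)
Record annuli (P : R) := Annuli {
  an_num : nat;
  an_ctr : nat -> 'rV[R]_n;
  an_in : nat -> R;
  an_out : nat -> R;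
  an_ok : forall k, (k < an_num)%N -> [/\ D' (an_ctr k), 0 < an_in k & an_in k < an_out k];
  an_sum : \sum_(k < an_num) 2 * (q / (an_out k - an_in k) ^+ n) <= P }.

Definition sep_by P (an : annuli P) C1 C2 := forall c, C1 c ->
  exists2 k, (k < an_num an)%N & enorm (c - an_ctr an k) <= an_in an k /\
    forall c', C2 c' -> an_out an k <= enorm (c' - an_ctr an k).

(** A curve joining E to F starts over the inner ball of some annulus and ends
    over the outside of its outer ball, so it contains a subcurve of the
    corresponding family. *)
Lemma separated_modulus f P (an : annuli P) E F : tame D D' q f -> E `<=` D -> F `<=` D ->
  sep_by an (f @` E) (f @` F) ->
  (modulus (curves_joining (emb @` E) (emb @` F) D) <= P%:E)%E.
Proof.
move=> [cf fD of_ pf mf] ED FD sep; have n0 : (0 < n)%N by exact: ltnW.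
apply: (@le_trans _ _ (\sum_(k < an_num an) 2 * (q / (an_out an k - an_in an k) ^+ n))%:E);
  last by rewrite lee_fin an_sum.
apply: (@modulus_subcurves _ _ (an_num an)
  (fun k => Gamma_f D f (an_ctr an k) (an_in an k) (an_out an k))
  (fun k => q / (an_out an k - an_in an k) ^+ n)) => //.
  move=> k km; have [Dy r0 r12] := an_ok km; split; last exact: mf.
  by rewrite divr_gt0// exprn_gt0// subr_gt0.
move=> g [cg [x Ex xE] [y Fy yE] gD]; split => //.
have [|k km [h1 h2]] := sep (f x); first by exists x.
have [_ _ r12] := an_ok km.
have gD' t : cstart g <= t <= cend g -> (emb @` D) (g t).
  move=> /andP[]; rewrite le_eqVlt => /predU1P[<- _|st]; first by rewrite -xE; exists x => //; exact: ED.
  rewrite le_eqVlt => /predU1P[->|te]; first by rewrite -yE; exists y => //; exact: FD.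
  by apply: gD; rewrite st te.
have [cs cgc] := cg.
have sx : curve_pt g (cstart g) = x by rewrite /curve_pt -xE.
have ey : curve_pt g (cend g) = y by rewrite /curve_pt -yE.
have [| |c [d [c1 cd d2 G]]] := @crossing_subcurve R n D f g (an_ctr an k) (cstart g) (cend g)
  (an_in an k) (an_out an k) cf cgc (ltW cs) gD' _ r12 _.
- by rewrite sx.
- by rewrite ey; apply: h2; exists y.
by exists k, c, d.
Qed.

Lemma loewner_separation x0 (P : R) U : loewner D x0 -> 0 < P -> nbhs x0 U ->
  exists V, [/\ nbhs x0 V, V `<=` U & forall f (an : annuli P) E F, tame D D' q f ->
    continuum E -> continuum F -> E `<=` D -> F `<=` D -> sep_by an (f @` E) (f @` F) ->
    (exists2 x, E x & V (emb x)) -> (exists2 x, F x & V (emb x)) ->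
    (exists2 x, E x & ~ U (emb x)) -> (exists2 x, F x & ~ U (emb x)) -> False].
Proof.
move=> lo P0 x0U; have [V [x0V VU H]] := lo P P0 U x0U; exists V; split => // f an E F tf.
move=> cE cF ED FD sep EV FV EU FU.
have := separated_modulus tf ED FD sep; rewrite leNgt => /negP; apply; apply: H => //.
apply/seteqP; split => // x [Ex Fx].
have [|k km [h1 h2]] := sep (f x); first by exists x.
have [_ _ r12] := an_ok km; have := h2 (f x) (ex_intro2 _ _ x Fx erefl).
by move=> /le_trans/(_ h1); rewrite leNgt r12.
Qed.

(** Of two separated continua in D' that both have preimages near x0, one lies
    in the image of a given neighbourhood: otherwise their lifts through the
    nearby preimages would both be large. *)
Lemma separation_dichotomy x0 (P : R) U : loewner D x0 -> 0 < P -> nbhs x0 U ->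
  exists V, [/\ nbhs x0 V, V `<=` U & forall f (an : annuli P) C1 C2 z1 z2 b1 b2, tame D D' q f ->
    continuum C1 -> continuum C2 -> C1 `<=` D' -> C2 `<=` D' -> sep_by an C1 C2 ->
    D z1 -> V (emb z1) -> C1 (f z1) -> D z2 -> V (emb z2) -> C2 (f z2) -> C1 b1 -> C2 b2 ->
    (forall p, D p -> U (emb p) -> f p <> b1) -> (forall p, D p -> U (emb p) -> f p <> b2) ->
    False].
Proof.
move=> lo P0 x0U; have [V [x0V VU H]] := loewner_separation lo P0 x0U; exists V; split => //.
move=> f an C1 C2 z1 z2 b1 b2 tf cC1 cC2 C1D C2D sep Dz1 Vz1 C1z Dz2 Vz2 C2z C1b C2b no1 no2.
have [E [cE ED Ez fE]] := tame_lift tf cC1 C1D Dz1 C1z.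
have [F [cF FD Fz fF]] := tame_lift tf cC2 C2D Dz2 C2z.
have out C G b : f @` G = C -> G `<=` D -> C b -> (forall p, D p -> U (emb p) -> f p <> b) ->
    exists2 x, G x & ~ U (emb x).
  move=> fG GD; rewrite -fG => -[x Gx xb] no; exists x => // Ux; exact: no (GD _ Gx) Ux xb.
apply: (H f an E F) => //; [by rewrite fE fF|by exists z1|by exists z2|exact: out fE ED C1b no1|
  exact: out fF FD C2b no2].
Qed.

Definition one_annulus (y : 'rV[R]_n) (r1 r2 : R) (Dy : D' y) (r10 : 0 < r1) (r12 : r1 < r2) :
  annuli (2 * (q / (r2 - r1) ^+ n)).
Proof.
exists 1%N (fun=> y) (fun=> r1) (fun=> r2); first by [].
by rewrite big_ord1.
Defined.

Lemma one_annulus_pos (r1 r2 : R) : r1 < r2 -> 0 < 2 * (q / (r2 - r1) ^+ n).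
Proof. by move=> r12; rewrite mulr_gt0// divr_gt0// exprn_gt0// subr_gt0. Qed.

Lemma separated_one y r1 r2 Dy r10 r12 C1 C2 :
  (forall c, C1 c -> enorm (c - y) <= r1) -> (forall c, C2 c -> r2 <= enorm (c - y)) ->
  sep_by (@one_annulus y r1 r2 Dy r10 r12) C1 C2.
Proof. by move=> h1 h2 c C1c; exists 0%N => //=; split; [exact: h1|exact: h2]. Qed.

Section reach.
Variables (T : Type) (G : set_system T) (UG : UltraFilter G) (Fm : T -> 'rV[R]_n -> 'rV[R]_n).
Variable x0 : extRn R n.
Hypotheses (lo : loewner D x0) (Gtame : G [set t | tame D D' q (Fm t)]).

(** The value w is taken near x0, for most parameters in the sense of the
    ultrafilter. *)
Definition reach w := forall V, nbhs x0 V ->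
  G [set t | exists z, [/\ D z, V (emb z) & Fm t z = w]].

Lemma not_reach w : ~ reach w -> exists2 V, nbhs x0 V &
  G [set t | forall z, D z -> V (emb z) -> Fm t z <> w].
Proof.
move=> /existsNP[V /not_implyP[x0V nG]]; exists V => //.
have [//|] := in_ultra_setVsetC [set t | exists z, [/\ D z, V (emb z) & Fm t z = w]] UG.
by apply: filterS => t no z Dz Vz zw; apply: no; exists z.
Qed.

(** Otherwise each region contains a value omitted near x0; continua joining it
    to a value taken near x0 contradict [separation_dichotomy]. *)
Lemma reach_dichotomy (P : R) (an : annuli P) (W1 W2 O1 O2 : set 'rV[R]_n) : 0 < P ->
  O1 `<=` D' -> O2 `<=` D' ->
  (forall u v, W1 u -> W1 v -> joined O1 u v) -> (forall u v, W2 u -> W2 v -> joined O2 u v) ->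
  sep_by an O1 O2 ->
  (forall V, nbhs x0 V -> G [set t | exists z, [/\ D z, V (emb z) & W1 (Fm t z)]]) ->
  (forall V, nbhs x0 V -> G [set t | exists z, [/\ D z, V (emb z) & W2 (Fm t z)]]) ->
  (forall w, W1 w -> reach w) \/ (forall w, W2 w -> reach w).
Proof.
move=> P0 OD1 OD2 J1 J2 sep N1 N2; apply: contrapT => /not_orP[/existsNP[b1 /not_implyP[Wb1 nb1]]].
move=> /existsNP[b2 /not_implyP[Wb2 nb2]].
have [V1 x0V1 G1] := not_reach nb1; have [V2 x0V2 G2] := not_reach nb2.
have [V [x0V VU H]] := separation_dichotomy lo P0 (filterI x0V1 x0V2).
have := filter_ex (filterI Gtame (filterI (filterI G1 G2) (filterI (N1 V x0V) (N2 V x0V)))).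
move=> [t [tt [[g1 g2] [[z1 [Dz1 Vz1 Wz1]] [z2 [Dz2 Vz2 Wz2]]]]]].
have [C1 [cC1 C1O C1z C1b]] := J1 _ _ Wz1 Wb1.
have [C2 [cC2 C2O C2z C2b]] := J2 _ _ Wz2 Wb2.
apply: (H (Fm t) an C1 C2 z1 z2 b1 b2) => //.
- exact: subset_trans OD1.
- exact: subset_trans OD2.
- by move=> c /C1O/sep[k km [h1 h2]]; exists k => //; split => // c' /C2O/h2.
- by move=> p Dp [h _]; exact: g1.
- by move=> p Dp [_ h]; exact: g2.
Qed.

Section first_stage.
Hypothesis lcb : locally_connected_on_boundary D'.
Variables (y1 y2 : extRn R n).
Hypotheses (cl1 : ecl D' y1) (cl2 : ecl D' y2) (y12 : y1 <> y2).
Hypothesis near1 : forall N V, nbhs y1 N -> nbhs x0 V ->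
  G [set t | exists z, [/\ D z, V (emb z) & N (emb (Fm t z))]].
Hypothesis near2 : forall N V, nbhs y2 N -> nbhs x0 V ->
  G [set t | exists z, [/\ D z, V (emb z) & N (emb (Fm t z))]].

Lemma emb_open (O : set 'rV[R]_n) : open O -> open (emb @` O : set (extRn R n)).
Proof.
move=> oO; rewrite openE => _ [x Ox <-]; apply: emb_nbhs; exact: open_nbhs_nbhs.
Qed.

Lemma unemb_continuous x : {for emb x, continuous (odflt 0 : extRn R n -> 'rV[R]_n)}.
Proof.
move=> A /nbhs_ballP[e /= e0 eA]; have [d d0 H] := chordal_enorm x e0.
apply/nbhs_ballP; exists d => //= y /H[u -> xu]; apply: eA.
rewrite -ball_normE /=; exact: le_lt_trans (norm_le_enorm _) xu.
Qed.

(** Local connectedness on the boundary, in the form in which it is used: points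
    of D' close to a point of its closure are joined inside D' by a continuum
    close to that point. *)
Lemma locally_joined y N : ecl D' y -> nbhs y N -> exists N', [/\ nbhs y N', N' `<=` N &
  forall u v, D' u -> D' v -> N' (emb u) -> N' (emb v) -> joined (D' `&` emb @^-1` N°) u v].
Proof.
move=> cly yN; have oN : open (D' `&` emb @^-1` N°).
  apply: openI => //; apply: open_comp; last exact: open_interior.
  by move=> x _; exact: emb_continuous.
have [[u Du uy]|nD] := pselect ((emb @` D') y).
  have Nu : (D' `&` emb @^-1` N°) u by split => //=; rewrite uy; exact: nbhs_singleton (nbhs_interior yN).
  have [e e0 H] := joined_ball oN Nu.
  exists (N `&` emb @` ball u e); split; last 2 first.
  - exact: subIsetl.
  - move=> v w _ _ [_ [v' + /emb_inj vE]] [_ [w' + /emb_inj wE]].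
    rewrite -vE -wE -!ball_normE /= ![`|u - _|]distrC; exact: H.
  - by apply: filterI => //; rewrite -uy; apply: emb_nbhs; exact: nbhsx_ballx.
have eby : ebd D' y.
  split => //; have := emb_open oD'; rewrite interior_id => ->; exact: nD.
have [V [yV VN cV]] := lcb eby (nbhs_interior yN).
exists V; split => //; first by apply: subset_trans VN _; exact: interior_subset.
move=> u v Du Dv Vu Vv.
pose C := (odflt 0 : extRn R n -> 'rV[R]_n) @` (V `&` emb @` D').
have cC : connected C.
  apply: connected_continuous_connected => //; apply: continuous_in_subspaceT => z /set_mem[_ [x _ <-]].
  exact: unemb_continuous.
apply: (joined_connected oN cC).
- by move=> _ [z [Vz [x Dx xz]] <-]; rewrite -xz in Vz *; split => //=; exact: VN.
- by exists (emb u) => //; split => //; exists u.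
- by exists (emb v) => //; split => //; exists v.
Qed.

Lemma ecl_point y N : ecl D' y -> nbhs y N -> exists2 u, D' u & N (emb u).
Proof. by move=> cly /cly[_ [[u Du <-] Nu]]; exists u. Qed.

Let ball_in y M : ecl D' y -> nbhs y M -> (forall w, (D' `&` emb @^-1` M) w -> reach w) ->
  exists w (e : R), 0 < e /\ forall v, `|v - w| < e -> D' v /\ reach v.
Proof.
move=> cly yM H; have [u Du Mu] := ecl_point cly (nbhs_interior yM).
have : nbhs u (D' `&` emb @^-1` M).
  by apply: filterI; [exact: open_nbhs_nbhs|exact: nbhs_emb].
move=> /nbhs_ballP[e /= e0 eM]; exists u, e; split => // v ve.
have [] : (D' `&` emb @^-1` M) v by apply: eM; rewrite -ball_normE /= distrC.
by move=> Dv Mv; split => //; exact: H.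
Qed.

Let reach_open_finite u1 (y2' : extRn R n) : ecl D' (emb u1) -> ecl D' y2' -> emb u1 <> y2' ->
  (forall N V, nbhs (emb u1) N -> nbhs x0 V ->
    G [set t | exists z, [/\ D z, V (emb z) & N (emb (Fm t z))]]) ->
  (forall N V, nbhs y2' N -> nbhs x0 V ->
    G [set t | exists z, [/\ D z, V (emb z) & N (emb (Fm t z))]]) ->
  exists w (e : R), 0 < e /\ forall v, `|v - w| < e -> D' v /\ reach v.
Proof.
move=> clu cl2' uy nr1 nr2.
have [r r0 far] : exists2 r : R, 0 < r & exists2 N2, nbhs y2' N2 &
    forall v, N2 (emb v) -> 4 * r <= enorm (v - u1).
  have /= := @extRn_hausdorff R n (emb u1) y2'.
  move=> hd; apply: contrapT => no; apply: uy; apply: hd => A B uA yB.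
  apply: contrapT => AB; apply: no.
  have [d /= d0 dA] : nbhs_ball u1 (emb @^-1` A) by apply/nbhs_ballP; exact: nbhs_emb.
  exists (d / 4); first by rewrite divr_gt0.
  exists B => // v Bv; rewrite mulrC divfK//.
  rewrite leNgt; apply/negP => vd; apply: AB; exists (emb v); split => //.
  apply: dA; rewrite -ball_normE /= distrC; exact: le_lt_trans (norm_le_enorm _) vd.
have [N2 yN2 farN2] := far.
pose N1 : set (extRn R n) := emb @` [set u | enorm (u - u1) < r].
have uN1 : nbhs (emb u1) N1.
  apply: emb_nbhs; apply: open_nbhs_nbhs; split; first exact: open_eball.
  by rewrite /= subrr enorm0.
have [M1 [uM1 MN1 J1]] := locally_joined clu uN1.
have [M2 [yM2 MN2 J2]] := locally_joined cl2' yN2.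
have [y0 Dy0 N1y0] := ecl_point clu uN1.
have {N1y0} y0r : enorm (y0 - u1) < r by have [z zr /emb_inj <-] := N1y0.
have r23 : 2 * r < 3 * r by lra.
have r2 : 0 < 2 * r by lra.
pose an := one_annulus Dy0 r2 r23.
have [| | | | | | | |H|H] := @reach_dichotomy _ an (D' `&` emb @^-1` M1) (D' `&` emb @^-1` M2)
    (D' `&` emb @^-1` N1°) (D' `&` emb @^-1` N2°).
- exact: one_annulus_pos.
- exact: subIsetl.
- exact: subIsetl.
- by move=> u v [Du Mu] [Dv Mv]; exact: J1.
- by move=> u v [Du Mu] [Dv Mv]; exact: J2.
- apply: separated_one.
    move=> c [_ /interior_subset[z zr /emb_inj zc]]; rewrite -zc.
    have -> : z - y0 = (z - u1) + (- (y0 - u1)) by rewrite opprB subrKA.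
    by apply: le_trans (enormD _ _) _; rewrite enormN; move: zr y0r => /=; lra.
  move=> c [_ /interior_subset/farN2 cr].
  have : enorm (c - u1) <= enorm (c - y0) + enorm (y0 - u1).
    by rewrite -[c - u1](subrKA y0); exact: enormD.
  by move: cr y0r; lra.
- move=> V x0V; apply: filterS (filterI Gtame (nr1 M1 V uM1 x0V)) => t [[_ fD _ _ _] [z [Dz Vz Mz]]].
  by exists z; split => //; split => //; rewrite -fD; exists z.
- move=> V x0V; apply: filterS (filterI Gtame (nr2 M2 V yM2 x0V)) => t [[_ fD _ _ _] [z [Dz Vz Mz]]].
  by exists z; split => //; split => //; rewrite -fD; exists z.
- exact: (ball_in clu uM1).
- exact: (ball_in cl2' yM2).
Qed.

(** The dichotomy is applied to small neighbourhoods of the two limits; the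
    annulus is centered at a point of D' near one of them that is finite. *)
Lemma reach_ball : exists w (e : R), 0 < e /\ forall v, `|v - w| < e -> D' v /\ reach v.
Proof.
case: y1 y2 cl1 cl2 y12 near1 near2 => [u1|] [u2|] c1 c2 c12 nr1 nr2 //.
- exact: (@reach_open_finite u1 (emb u2)).
- exact: (@reach_open_finite u1 infinity).
- by apply: (@reach_open_finite u2 infinity) => // /esym.
Qed.

End first_stage.
End reach.
End separation.

Arguments sep_by {R n D' q P} an C1 C2.

(** * Rays, and the values taken near a point *)

Section rays.
Context {R : realType} {n : nat}.
Variables (D' : set 'rV[R]_n) (q : R).
Hypotheses (n1 : (1 < n)%N) (q0 : 0 < q).
Implicit Types (b e : 'rV[R]_n) (C : set 'rV[R]_n).

Definition ray_bound (eps : R) := 10 * (q * (4 / eps) ^+ n).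

Lemma ray_bound_gt0 eps : 0 < eps -> 0 < ray_bound eps.
Proof. by move=> e0; rewrite !mulr_gt0// exprn_gt0// divr_gt0. Qed.

Let t_ eps k : R := eps * (5 / 4) ^+ k.

Let t_gt0 eps k : 0 < eps -> 0 < t_ eps k.
Proof. by move=> e0; rewrite mulr_gt0// exprn_gt0. Qed.

Let t_mono eps i j : 0 < eps -> (i <= j)%N -> t_ eps i <= t_ eps j.
Proof.
move=> e0; elim: j => [|j IH]; first by rewrite leqn0 => /eqP ->.
rewrite leq_eqVlt => /predU1P[->//|/IH ij]; apply: (le_trans ij).
rewrite /t_ exprS mulrCA ler_peMl//; last by lra.
by apply: ltW; exact: t_gt0.
Qed.

Let t_unbounded eps T : 0 < eps -> exists m, T < t_ eps m.
Proof.
move=> e0; exists (Num.truncn (4 * T / eps)).+1; set m := (Num.truncn _).+1.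
have h : 1 + m%:R / 4 <= (5 / 4) ^+ m :> R.
  elim: m => [|m IH]; first by rewrite mul0r addr0.
  rewrite exprS -natr1; have m0 : 0 <= m%:R :> R by [].
  by move: m0 IH; move: (m%:R : R) ((5 / 4) ^+ m : R) => x y; lra.
have : 4 * T / eps < m%:R by exact: truncnS_gt.
rewrite ltr_pdivrMr// => h2; apply: lt_le_trans (_ : _ < eps * (1 + m%:R / 4)) _; first by nra.
by rewrite /t_ ler_pM2l.
Qed.

Let geo_sum (m : nat) : \sum_(k < m) (4 / 5) ^+ k <= 5 :> R.
Proof.
suff : \sum_(k < m) (4 / 5) ^+ k <= 5 - 5 * (4 / 5) ^+ m :> R.
  move=> /le_trans; apply; rewrite gerBl mulr_ge0// exprn_ge0//.
elim: m => [|m IH]; first by rewrite big_ord0 expr0; lra.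
by rewrite big_ord_recr/= exprS; lra.
Qed.

(** The annuli centered at b + t e of radii t/4 and t/2, with t in geometric
    progression, separate the ray from the opposite ray; the sum of their
    moduli converges, so the bound does not depend on how far the ray is
    followed. *)
Lemma ray_annuli b e eps T : enorm e = 1 -> 0 < eps ->
  (forall t, eps <= t <= T -> D' (b + t *: e)) ->
  exists an : annuli D' q (ray_bound eps), forall C1 C2,
    (forall c, C1 c -> exists2 t, eps <= t <= T & c = b + t *: e) ->
    (forall c, C2 c -> exists2 s, 0 <= s & c = b - s *: e) -> sep_by an C1 C2.
Proof.
move=> e1 e0 HD.
have exm : exists m, T < t_ eps m by exact: t_unbounded.
case: (ex_minnP exm) => m mT mmin.
have tT k : (k < m)%N -> t_ eps k <= T.
  by move=> km; rewrite leNgt; apply/negP => /mmin; rewrite leqNgt km.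
have ok k : (k < m)%N -> [/\ D' (b + t_ eps k *: e), 0 < t_ eps k / 4 & t_ eps k / 4 < t_ eps k / 2].
  move=> km; have tk := t_gt0 k e0; split; [|lra|lra].
  by apply: HD; rewrite tT// andbT -[X in X <= _]mulr1 -(expr0 (5 / 4)); exact: t_mono.
have sm : \sum_(k < m) 2 * (q / (t_ eps k / 2 - t_ eps k / 4) ^+ n) <= ray_bound eps.
  apply: (@le_trans _ _ (\sum_(k < m) 2 * (q * (4 / eps) ^+ n) * (4 / 5) ^+ k)).
    apply: ler_sum => k _; rewrite -mulrA ler_pM2l// -mulrA ler_pM2l//.
    have -> : t_ eps k / 2 - t_ eps k / 4 = (4 / eps * (4 / 5) ^+ k)^-1.
      rewrite /t_ invfM -exprVn (_ : (4 / 5)^-1 = 5 / 4); first by field; rewrite gt_eqF.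
      by field.
    rewrite exprVn invrK exprMn ler_pM2l ?exprn_gt0 ?divr_gt0//.
    rewrite -(prednK (ltnW n1)) exprS ler_piMr ?exprn_ge0//.
    by rewrite exprn_ile1 ?exprn_ge0// exprn_ile1//; lra.
  rewrite -mulr_sumr /ray_bound.
  have h0 : 0 < q * (4 / eps) ^+ n by rewrite mulr_gt0// exprn_gt0// divr_gt0.
  move: (geo_sum m) h0; move: (q * _) (\sum_(k < m) _) => x y; nra.
exists (@Annuli _ _ D' q _ m (fun k => b + t_ eps k *: e) _ _ ok sm) => C1 C2 H1 H2 c /H1[t /andP[t1 t2] ->].
have exj : exists j, t < t_ eps j by exact: t_unbounded.
case: (ex_minnP exj) => -[|k] kt kmin.
  by move: kt; rewrite /t_ expr0 mulr1 ltNge t1.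
have tk : t_ eps k <= t.
  by rewrite leNgt; apply/negP => /kmin; rewrite ltnn.
have tk0 := t_gt0 k e0.
exists k => /=.
  rewrite ltnNge; apply/negP => mk.
  by have := lt_le_trans mT (t_mono e0 mk); rewrite ltNge (le_trans tk t2).
split.
  rewrite opprD addrACA subrr add0r -scalerBl enormZ e1 mulr1 ger0_norm ?subr_ge0//.
  by move: kt; rewrite {1}/t_ exprS mulrCA -/(t_ eps k); lra.
move=> c' /H2[s s0 ->]; rewrite opprD addrACA subrr add0r -opprD -scalerDl enormN enormZ e1 mulr1.
by rewrite ger0_norm ?addr_ge0// ?(ltW tk0)//; lra.
Qed.

Lemma segm_line b e (s t : R) c : s <= t -> segm (b + s *: e) (b + t *: e) c ->
  exists2 u, s <= u <= t & c = b + u *: e.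
Proof.
move=> st [u + <-]; rewrite /= in_itv/= => /andP[u0 u1].
exists (s + u * (t - s)); first by apply/andP; split; nra.
by apply/rowP => i; rewrite !mxE; ring.
Qed.

End rays.

Section stages.
Context {R : realType} {n : nat}.
Variables (D D' : set 'rV[R]_n) (q : R).
Hypotheses (n1 : (1 < n)%N) (oD : open D) (oD' : open D') (cD' : connected D') (q0 : 0 < q).
Variables (T : Type) (G : set_system T) (UG : UltraFilter G) (Fm : T -> 'rV[R]_n -> 'rV[R]_n).
Variable x0 : extRn R n.
Hypotheses (lo : loewner D x0) (Gtame : G [set t | tame D D' q (Fm t)]).
Local Notation reach := (reach D G Fm x0).
Implicit Types (b w u v p e : 'rV[R]_n).

Let add_eq_self u v : u + v = u -> v = 0.
Proof. by move=> h; rewrite -(addKr u v) h addNr. Qed.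

(** Boundary points, relative to D', of the set of values taken near x0. *)
Definition mixed p := D' p /\ forall e : R, 0 < e ->
  (exists u, [/\ D' u, `|u - p| < e & reach u]) /\ (exists v, [/\ D' v, `|v - p| < e & ~ reach v]).

(** Around two mixed points there are disjoint balls containing values of both
    kinds, which the dichotomy forbids. *)
Lemma mixed_unique p1 p2 : mixed p1 -> mixed p2 -> p1 = p2.
Proof.
move=> [Dp1 M1] [Dp2 M2]; apply: contrapT => p12.
pose d := enorm (p1 - p2).
have d0 : 0 < d.
  rewrite lt_neqAle enorm_ge0 andbT eq_sym; apply: contra_not_neq p12 => /enorm_eq0/eqP.
  by rewrite subr_eq0 => /eqP.
have [e1 /= e10 B1] : nbhs_ball p1 D' by apply/nbhs_ballP; exact: open_nbhs_nbhs.
have [e2 /= e20 B2] : nbhs_ball p2 D' by apply/nbhs_ballP; exact: open_nbhs_nbhs.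
pose s := Num.min (Num.min e1 e2) (d / (4 * n.+1%:R)).
have s0 : 0 < s by rewrite !lt_min e10 e20 divr_gt0// mulr_gt0.
have se1 : s <= e1 by rewrite !ge_min lexx.
have se2 : s <= e2 by rewrite !ge_min lexx orbT.
have small v p : `|v - p| < s -> enorm (v - p) <= d / 4.
  move=> vs; apply: le_trans (enorm_le_norm _) _.
  apply: (@le_trans _ _ (n%:R * s)); first by apply: ler_wpM2l => //; exact: ltW.
  apply: (@le_trans _ _ (n.+1%:R * (d / (4 * n.+1%:R)))).
    apply: ler_pM => //; [exact: ltW|by rewrite ler_nat|by rewrite ge_min lexx orbT].
  by rewrite le_eqVlt; apply/orP; left; apply/eqP; field; rewrite nat1r; exact: lt0r_neq0.
have r12 : d / 4 < d / 2 by lra.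
have r1 : 0 < d / 4 by lra.
pose an := one_annulus q Dp1 r1 r12.
pose B p := [set z | `|z - p| < s].
have J p u v : B p u -> B p v -> joined (B p) u v.
  by move=> Bu Bv; apply: joined_segm => z; exact: segm_ball.
have rB p : mixed p -> exists2 u, B p u & reach u.
  by move=> [_ /(_ s s0)[[u [_ up ru]] _]]; exists u.
have nB p : mixed p -> exists2 u, B p u & ~ reach u.
  by move=> [_ /(_ s s0)[_ [u [_ up ru]]]]; exists u.
have near p : mixed p -> forall V, nbhs x0 V -> G [set t | exists z, [/\ D z, V (emb z) & B p (Fm t z)]].
  move=> /rB[u Bu ru] V /ru; apply: filterS => t [z [Dz Vz zu]]; exists z; split => //; by rewrite zu.
have [| | | |H|H] := reach_dichotomy n1 oD q0 UG lo Gtame (an := an) _ _ _ (J p1) (J p2) _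
    (near p1 (conj Dp1 M1)) (near p2 (conj Dp2 M2)).
- exact: one_annulus_pos.
- by move=> z zp; apply: B1; rewrite -ball_normE /= distrC (lt_le_trans zp).
- by move=> z zp; apply: B2; rewrite -ball_normE /= distrC (lt_le_trans zp).
- apply: separated_one => [c /small//|c /small h].
  have : d <= enorm (c - p2) + enorm (c - p1).
    rewrite /d -enormN opprB -[p2 - p1](subrKA c) addrC.
    apply: le_trans (enormD _ _) _; rewrite addrC lerD2r -enormN opprB.
    by [].
  by lra.
- by have [v Bv] := nB p1 (conj Dp1 M1); apply; exact: H.
- by have [v Bv] := nB p2 (conj Dp2 M2); apply; exact: H.
Qed.

(** The values without preimages near x0 form at most one point: near a
    boundary point of the set of values with preimages both kinds of values
    occur, and by the dichotomy there cannot be two such boundary points, while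
    a single point does not disconnect D'. *)
Lemma reach_all_but_one : (exists w (e : R), 0 < e /\ forall v, `|v - w| < e -> D' v /\ reach v) ->
  exists b, D' b /\ forall w, D' w -> w <> b -> reach w.
Proof.
move=> [w0 [e0 [e00 H0]]].
have [b [Db mb]] : exists b, D' b /\ forall p, mixed p -> p = b.
  have [[p mp]|no] := pselect (exists p, mixed p).
    by exists p; split; [case: mp|move=> p' mp'; exact: mixed_unique].
  exists w0; split; first by apply: (H0 w0 _).1; rewrite subrr normr0.
  by move=> p mp; exfalso; apply: no; exists p.
exists b; split => // w Dw wb; apply: contrapT => nw.
have n0 : (0 < n)%N by exact: ltnW.
have [w' w'0 w'b] : exists2 w', `|w' - w0| < e0 & w' <> b.
  have [w0b|w0b] := pselect (w0 = b); last by exists w0; rewrite ?subrr ?normr0.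
  exists (w0 + const_mx (e0 / 2)).
    rewrite addrC addKr; apply: le_lt_trans (_ : _ <= e0 / 2) _; last by lra.
    by apply: norm_le_coord => [|i]; [lra|rewrite mxE ger0_norm//; lra].
  rewrite -w0b => /add_eq_self/rowP/(_ (Ordinal n0)).
  by rewrite !mxE; lra.
have [Dw' rw'] := H0 w' w'0.
have [eb /= eb0 Bb] : nbhs_ball b D' by apply/nbhs_ballP; exact: open_nbhs_nbhs.
have offb z : D' z -> z <> b -> (D' `&` [set z | 0 < enorm (z - b)]) z.
  move=> Dz zb; split => //=; rewrite lt_neqAle enorm_ge0 andbT eq_sym.
  by apply: contra_not_neq zb => /enorm_eq0/eqP; rewrite subr_eq0 => /eqP.
have [|K [[_ _ cK] KD Kw' Kw]] := joined_off_ball n1 (lexx 0) eb0 oD' cD' _ (offb _ Dw' w'b) (offb _ Dw wb).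
  by move=> z zb; apply: Bb; rewrite -ball_normE /= distrC; exact: le_lt_trans (norm_le_enorm _) zb.
pose U1 := [set z | exists2 e : R, 0 < e & forall u, `|u - z| < e -> D' u /\ reach u].
pose U2 := [set z | exists2 e : R, 0 < e & forall u, `|u - z| < e -> D' u /\ ~ reach u].
have openU (P : 'rV[R]_n -> Prop) : open [set z | exists2 e : R, 0 < e & forall u, `|u - z| < e -> P u].
  rewrite openE => z [e e_gt0 He]; apply/nbhs_ballP; exists (e / 2) => /=; first by rewrite divr_gt0.
  move=> u; rewrite -ball_normE /= distrC => uz; exists (e / 2); first by rewrite divr_gt0.
  move=> v vu; apply: He; rewrite -[v - z](subrKA u) (splitr e).
  by apply: le_lt_trans (ler_normD _ _) _; rewrite ltrD.
have : K `<=` U1.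
  apply: (@connected_open_split _ _ K U1 U2) => //.
  - exact: openU.
  - exact: openU.
  - move=> z Kz; have [Dz /= zb] := KD z Kz.
    have nm : ~ mixed z by move=> /mb zE; move: zb; rewrite zE subrr enorm0 ltxx.
    have [ez /= ez0 Bz] : nbhs_ball z D' by apply/nbhs_ballP; exact: open_nbhs_nbhs.
    have Dball u : `|u - z| < ez -> D' u by move=> uz; apply: Bz; rewrite -ball_normE /= distrC.
    apply: contrapT => /not_orP[n1' n2']; apply: nm; split => // e e_gt0.
    have m0 : 0 < Num.min e ez by rewrite lt_min e_gt0.
    split; apply: contrapT => no.
      apply: n2'; exists (Num.min e ez) => // u; rewrite lt_min => /andP[ue uez].
      by split; [exact: Dball|move=> ru; apply: no; exists u; split => //; exact: Dball].
    apply: n1'; exists (Num.min e ez) => // u; rewrite lt_min => /andP[ue uez].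
    split; first exact: Dball.
    by apply: contrapT => ru; apply: no; exists u; split => //; exact: Dball.
  - apply/seteqP; split => // z [[_ [e e_gt0 H1]] [e' e'_gt0 H2]].
    have zz (r : R) : 0 < r -> `|z - z| < r by rewrite subrr normr0.
    by have [_ h] := H2 z (zz _ e'_gt0); have [_ h'] := H1 z (zz _ e_gt0).
  - exists w'; split => //; exists (e0 - `|w' - w0|); first by rewrite subr_gt0.
    move=> u uw; apply: H0; rewrite -[u - w0](subrKA w').
    by apply: le_lt_trans (ler_normD _ _) _; rewrite -ltrBrDr.
move=> /(_ w Kw)[e e_gt0 He]; apply: nw; apply: (He w _).2.
by rewrite subrr normr0.
Qed.

Section last_stage.
Variable b : 'rV[R]_n.
Hypotheses (Db : D' b) (Hb : forall w, D' w -> w <> b -> reach w).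

Lemma unit_vector : exists e : 'rV[R]_n, enorm e = 1.
Proof.
have n0 : (0 < n)%N by exact: ltnW.
exists (delta_mx 0 (Ordinal n0)); rewrite /enorm (bigD1 (Ordinal n0))//= mxE !eqxx expr1n big1.
  by rewrite addr0 sqrtr1.
by move=> i iN; rewrite mxE (negbTE iN) andbF expr0n.
Qed.

Lemma near_b e : enorm e = 1 -> exists2 r : R, 0 < r & forall t, `|t| < r -> D' (b + t *: e).
Proof.
move=> e1; have [r /= r0 Br] : nbhs_ball b D' by apply/nbhs_ballP; exact: open_nbhs_nbhs.
exists r => // t tr; apply: Br; rewrite -ball_normE /= opprD addrA subrr add0r normrN.
by apply: le_lt_trans (norm_le_enorm _) _; rewrite enormZ e1 mulr1.
Qed.

Lemma on_ray_neq e (t : R) : enorm e = 1 -> t != 0 -> b + t *: e <> b.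
Proof.
move=> e1 t0 /add_eq_self te.
have := enormZ t e; rewrite te enorm0 e1 mulr1 => /esym/normr0_eq0 tE.
by rewrite tE eqxx in t0.
Qed.

Lemma compact_sup_ball (x : 'rV[R]_n) (r : R) : compact [set z | `|z - x| <= r].
Proof.
apply: bounded_closed_compact.
  exists (r + `|x|); split; first exact: num_real.
  move=> M rM z /= zr; apply: le_trans (ltW rM).
  by rewrite -{1}(subrK x z); apply: le_trans (ler_normD _ _) _; rewrite lerD2r.
rewrite (_ : [set z | _] = (fun z : 'rV[R]_n => `|z - x|) @^-1` `]-oo, r]%classic).
  apply: closed_comp; last exact: lray_closed.
  by move=> z _; exact: norm_sub_continuous.
by apply/seteqP; split => z /=; rewrite in_itv.
Qed.

(** At an interior point: two opposite rays issuing from b, followed beyond the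
    image of a compact neighbourhood, have large disjoint lifts. *)
Lemma no_interior_point x : D x -> x0 = emb x -> False.
Proof.
move=> Dx x0E; have [e e1] := unit_vector; have [r r0 Hr] := near_b e1.
have e1' : enorm (- e) = 1 by rewrite enormN.
pose eps := r / 2; have eps0 : 0 < eps by rewrite divr_gt0.
have Dp : D' (b + eps *: e) by apply: Hr; rewrite gtr0_norm// /eps; lra.
have Dm : D' (b + eps *: (- e)).
  by rewrite scalerN -scaleNr; apply: Hr; rewrite normrN gtr0_norm// /eps; lra.
have [s /= s0 Bs] : nbhs_ball x D by apply/nbhs_ballP; exact: open_nbhs_nbhs.
pose Kc := [set z | `|z - x| <= s / 2].
have cKc : compact Kc by exact: compact_sup_ball.
have KcD : Kc `<=` D.
  by move=> z zs; apply: Bs; rewrite -ball_normE /= distrC (le_lt_trans zs)//; lra.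
have x0U : nbhs x0 (emb @` Kc).
  rewrite x0E; apply: emb_nbhs; apply/nbhs_ballP; exists (s / 2) => /=; first by rewrite divr_gt0.
  by move=> z; rewrite -ball_normE /= distrC => /ltW.
have [V [x0V VU H]] := separation_dichotomy D' n1 oD q0 lo (ray_bound_gt0 (n := n) q0 eps0) x0U.
have rp := Hb Dp (on_ray_neq e1 (lt0r_neq0 eps0)); have rm := Hb Dm (on_ray_neq e1' (lt0r_neq0 eps0)).
have := filter_ex (filterI Gtame (filterI (rp V x0V) (rm V x0V))).
move=> [t [tt [[z1 [Dz1 Vz1 fz1]] [z2 [Dz2 Vz2 fz2]]]]].
have [cf fD _ _ _] := tt; set f := Fm t in tt cf fD fz1 fz2.
have cfK : compact (f @` Kc) by exact: (image_compact_in cf cKc KcD).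
have fKD : f @` Kc `<=` D' by rewrite -fD => _ [z /KcD Dz <-]; exists z.
have [t1 et1 [D1 n1']] := ray_escape oD' cfK fKD e1 Dp.
have [t2 et2 [D2 n2']] := ray_escape oD' cfK fKD e1' Dm.
have [an Han] := ray_annuli n1 q0 e1 eps0 D1.
apply: (H f an (segm (b + eps *: e) (b + t1 *: e)) (segm (b + eps *: (- e)) (b + t2 *: (- e)))
   z1 z2 (b + t1 *: e) (b + t2 *: (- e))) => //.
- exact: continuum_segm.
- exact: continuum_segm.
- by move=> c /(segm_line et1)[u uu ->]; exact: D1.
- by move=> c /(segm_line et2)[u uu ->]; exact: D2.
- apply: Han; first by move=> c /(segm_line et1).
  move=> c /(segm_line et2)[u /andP[u1 _] ->]; exists u; last by rewrite scalerN.
  exact: le_trans (ltW eps0) u1.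
- by rewrite fz1; exact: segm_l.
- by rewrite fz2; exact: segm_l.
- exact: segm_r.
- exact: segm_r.
- by move=> p Dp' [z Kz /emb_inj <-] fz; apply: n1'; exists z.
- by move=> p Dp' [z Kz /emb_inj <-] fz; apply: n2'; exists z.
Qed.

End last_stage.
End stages.

(** * Counting components of preimages *)

Section squares.
Context {R : realType} {n : nat}.
Variables (m0 : 'rV[R]_n) (h : R).
Hypotheses (n1 : (1 < n)%N) (h0 : 0 < h).

(* Position, direction of the next side, and direction of the side after it. *)
Let step (s : 'rV[R]_n * 'rV[R]_n * 'rV[R]_n) := (s.1.1 + h *: s.1.2, s.2, - s.1.2).

Let i0 : 'I_n := Ordinal (ltnW n1).
Let i1 : 'I_n := Ordinal n1.

Let st k := iter k step (m0, delta_mx 0 i0, delta_mx 0 i1).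

(** The corners of a square of side h, in cyclic order and repeated with
    period four. *)
Definition corner k : 'rV[R]_n := (st k).1.1.

Definition side k := segm (corner k) (corner k.+1).

Definition mid k := 2^-1 *: (corner k + corner k.+1).

Let stS k : st k.+1 = step (st k). Proof. by []. Qed.

Let step4 s : iter 4 step s = s.
Proof.
case: s => [[v u] w]; rewrite /= /step /=; congr (_, _, _); rewrite ?opprK//.
by apply/rowP => i; rewrite !mxE; ring.
Qed.

Let st4 k : st (k + 4) = st k.
Proof. by rewrite /st iterD step4. Qed.

Lemma cornerD4 k : corner (k + 4) = corner k.
Proof. by rewrite /corner st4. Qed.

Let st_mod k : st k = st (k %% 4)%N.
Proof.
rewrite {1}(divn_eq k 4) addnC; elim: (k %/ 4)%N => [|m IH]; first by rewrite mul0n addn0.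
by rewrite mulSn addnCA addnC st4.
Qed.

Lemma corner_mod k : corner k = corner (k %% 4)%N /\ corner k.+1 = corner (k %% 4).+1%N.
Proof. by rewrite /corner !stS st_mod. Qed.

Let frame k : [/\ enorm (st k).1.2 = 1, enorm (st k).2 = 1,
  exists i, (st k).1.2 0 i = 0 /\ `|(st k).2 0 i| = 1 &
  exists i, (st k).2 0 i = 0 /\ `|(st k).1.2 0 i| = 1].
Proof.
have ed (i : 'I_n) : enorm (delta_mx 0 i : 'rV[R]_n) = 1.
  rewrite /enorm (bigD1 i)//= mxE !eqxx expr1n big1 ?addr0 ?sqrtr1//.
  by move=> j ji; rewrite mxE (negbTE ji) andbF expr0n.
elim: k => [|k [IH1 IH2 [i [ui wi]] [j [wj uj]]]].
  split; [exact: ed|exact: ed|exists i1|exists i0]; by rewrite !mxE/= ?normr1.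
rewrite stS /step /=; split => //; first by rewrite enormN.
  by exists j; rewrite mxE normrN.
by exists i; rewrite mxE ui oppr0.
Qed.

Lemma corner_dist k : enorm (corner k - m0) <= k%:R * h.
Proof.
elim: k => [|k IH]; first by rewrite /corner/= subrr enorm0 mul0r.
have [e1 _ _ _] := frame k.
rewrite /corner stS /step/= addrAC -natr1 mulrDl mul1r.
apply: le_trans (enormD _ _) _; rewrite enormZ e1 mulr1 (gtr0_norm h0).
by rewrite lerD2r.
Qed.

Lemma corner_step k : enorm (corner k - corner k.+1) = h.
Proof.
have [e1 _ _ _] := frame k.
by rewrite /corner stS /step/= opprD addrA subrr add0r enormN enormZ e1 mulr1 gtr0_norm.
Qed.

Let mid_side k : mid k = corner k + (h / 2) *: (st k).1.2.
Proof. by rewrite /mid /corner stS /step/=; apply/rowP => i; rewrite !mxE; field. Qed.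

Lemma side_mid k c : side k c -> enorm (c - mid k) <= h / 2.
Proof.
move=> [t + <-]; rewrite /= in_itv/= => /andP[t0 t1]; have [e1 _ _ _] := frame k.
have -> : corner k + t *: (corner k.+1 - corner k) - mid k = (h * t - h / 2) *: (st k).1.2.
  by rewrite mid_side /corner stS /step/=; apply/rowP => i; rewrite !mxE; ring.
have ht0 : 0 <= h * t by apply: mulr_ge0 => //; exact: ltW.
have ht1 : h * t <= h by rewrite ler_piMr// ltW.
by rewrite enormZ e1 mulr1 ler_norml; apply/andP; split; lra.
Qed.

Lemma opposite_mid k c : side k.+2 c -> h <= enorm (c - mid k).
Proof.
move=> [t _ <-]; have [_ _ [i [ui wi]] _] := frame k.
apply: le_trans (coord_le_enorm _ i).
rewrite mid_side /corner !stS /step/= !mxE ui.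
rewrite (_ : _ - _ = h * (st k).2 0 i); last by rewrite /corner; ring.
by rewrite normrM wi mulr1 gtr0_norm.
Qed.

Lemma mid_ball k c : (k < 4)%N -> enorm (c - mid k) <= h -> enorm (c - m0) < 8 * h.
Proof.
move=> k4 ch; have [e1 _ _ _] := frame k.
have -> : c - m0 = (c - mid k) + (corner k - m0) + (h / 2) *: (st k).1.2.
  by rewrite mid_side; apply/rowP => i; rewrite !mxE; ring.
apply: le_lt_trans (enormD _ _) _; rewrite enormZ e1 mulr1 (@gtr0_norm _ (h / 2)) ?divr_gt0//.
apply: (@le_lt_trans _ _ (h + 4 * h + h / 2)); last by have := h0; lra.
rewrite lerD2r; apply: le_trans (enormD _ _) _; apply: lerD => //.
by apply: le_trans (corner_dist k) _; rewrite ler_pM2r// ler_nat ltnW.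
Qed.

End squares.

Section counting.
Context {R : realType} {n : nat}.
Variables (D D' : set 'rV[R]_n) (q : R).
Hypotheses (n1 : (1 < n)%N) (oD : open D) (oD' : open D') (q0 : 0 < q).
Implicit Types (W G : set 'rV[R]_n) (f : 'rV[R]_n -> 'rV[R]_n) (p x y : 'rV[R]_n).
Local Notation lam := (@lebB R n).

Lemma compact_eball (a : 'rV[R]_n) (r : R) : compact [set z | enorm (z - a) <= r].
Proof.
apply: (@subclosed_compact _ _ [set z | `|z - a| <= r]); first last.
- by move=> z /= zr; exact: le_trans (norm_le_enorm _) zr.
- exact: compact_sup_ball.
rewrite (_ : [set z | _] = ~` [set z | r < enorm (z - a)]).
  by apply: open_closedC; exact: open_off_ball.
by apply/seteqP; split => z /=; [move=> h; apply/negP; rewrite -leNgt|move/negP; rewrite -leNgt].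
Qed.

(** A polygon that starts in a class G over the inner ball and ends in G over
    the outside of the outer ball crosses the annulus before it first leaves G:
    where it leaves G the image leaves W, by properness. *)
Lemma polygon_in_class f W p0 rho x s m (h : R) : tame D D' q f -> open W -> W `<=` D' ->
  density rho -> 0 < h ->
  (forall g, Gamma_f D f m (h / 2) h g -> is_curve g -> locally_rectifiable g ->
     1 <= line_integral rho g)%E ->
  (forall z, enorm (z - m) <= h -> W z) ->
  let G := [set y | joined (D `&` f @^-1` W) p0 y] in
  G x -> enorm (f x - m) <= h / 2 -> h <= enorm (f (last x s) - m) -> G (last x s) ->
  (1 <= polycost (restr_to G rho) x s)%E.
Proof.
move=> tf oW WD drho h0 adm BW G Gx fx fl Gl; have [cf fD _ pf _] := tf.
have oO : open (D `&` f @^-1` W) by exact: open_preimage.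
have oG : open G by exact: open_joined.
have GO y : G y -> (D `&` f @^-1` W) y by exact: joined_r.
pose P := polypath x s; pose L := polylen x s.
have sP : short P by exact: polypath_short.
have cP : continuous P.
  move=> t A /nbhs_ballP[e /= e0 eA]; apply/nbhs_ballP; exists e => //= u.
  rewrite /ball/= => tu; apply: eA; rewrite -ball_normE /=.
  by apply: le_lt_trans (norm_le_enorm _) _; apply: le_lt_trans (sP _ _) _.
have L0 : 0 <= L by exact: polylen_ge0.
have P0 : P 0 = x by exact: polypath0.
have PL : P L = last x s by exact: polypath_last.
have [t1 [/andP[t10 t1L] Gt1 ft1]] : exists t1, [/\ 0 <= t1 <= L, forall t, 0 <= t <= t1 -> G (P t) &
    h <= enorm (f (P t1) - m)].
  pose Bd := `[0, L]%classic `&` P @^-1` (~` G).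
  have cBd : compact Bd.
    apply: (subclosed_compact _ (@segment_compact R 0 L) (@subIsetl _ _ _)).
    apply: closedI; first exact: itv_closed.
    by apply: closed_comp => [t _|]; [exact: cP|exact: open_closedC].
  have [Bd0|Bd0] := pselect (Bd !=set0); last first.
    exists L; split; [by rewrite L0 lexx| |by rewrite PL].
    move=> t tL; apply: contrapT => nG; apply: Bd0; exists t; split => //.
  have [|ts] := @compact_EVT_max _ R (fun t : R => - t) Bd Bd0 cBd.
    by apply: continuous_subspaceT => t; exact: opp_continuous.
  rewrite inE /Bd /= in_itv/= => -[/andP[ts0 tsL] nG] mint.
  have before t : 0 <= t -> t < ts -> G (P t).
    move=> t0 tts; apply: contrapT => nGt; have := mint t.
    rewrite inE /Bd /= in_itv/= t0 (le_trans (ltW tts) tsL) => /(_ (conj isT nGt)).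
    by rewrite lerN2 leNgt tts.
  have tsp : 0 < ts.
    by rewrite lt_neqAle ts0 andbT; apply: contra_not_neq nG => <-; rewrite P0.
  apply: contrapT => no.
  have inner t : 0 <= t -> t < ts -> enorm (f (P t) - m) <= h.
    move=> t0 tts; rewrite leNgt; apply/negP => ht; apply: no; exists t; split.
    - by rewrite t0 (le_trans (ltW tts)).
    - by move=> u /andP[u0 ut]; apply: before => //; exact: le_lt_trans tts.
    - exact: ltW.
  have clts A : nbhs (P ts) A -> exists t, [/\ 0 <= t, t < ts & A (P t)].
    move=> /cP/nbhs_ballP[d /= d0 dA]; exists (Num.max 0 (ts - d / 2)).
    have h1 : Num.max 0 (ts - d / 2) < ts by rewrite gt_max tsp ltrBlDr ltrDl divr_gt0.
    split => //; first by rewrite le_max lexx.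
    apply: dA; rewrite /ball/= ger0_norm ?subr_ge0 ?ltW//.
    have : ts - d / 2 <= Num.max 0 (ts - d / 2) by rewrite le_max lexx orbT.
    by move: (Num.max _ _) => u; lra.
  have cX : compact (D `&` f @^-1` [set z | enorm (z - m) <= h]).
    by apply: pf; [exact: compact_eball|move=> z /BW/WD].
  have XPts : (D `&` f @^-1` [set z | enorm (z - m) <= h]) (P ts).
    apply: (compact_closed_rV cX) => A /clts[t [t0 tts At]]; exists (P t); split => //.
    by split; [case: (GO _ (before t t0 tts))|exact: inner].
  apply: nG; apply: (joined_closure oO); first by case: XPts => Dts fts; split => //; exact: BW.
  by move=> A /clts[t [t0 tts At]]; exists (P t); split => //; exact: before.
have PD t : 0 <= t <= t1 -> (emb @` D) ((emb \o P) t).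
  by move=> /Gt1/GO[Dt _]; exists (P t).
have cE : {within `[0, t1], continuous (cpath (Curve 0 L (emb \o P)))}.
  apply: continuous_subspaceT => t; apply: continuous_comp; first exact: cP.
  exact: emb_continuous.
have h2 : h / 2 < h by lra.
have [| |c [d [c0 cd dt1 Gcd]]] := @crossing_subcurve R n D f (Curve 0 L (emb \o P)) m 0 t1 (h / 2) h
  cf cE t10 PD _ h2 _.
- by rewrite /curve_pt/= P0.
- exact: ft1.
have [cg rg] := short_curve sP cd.
have dr : density (restr_to G rho).
  split; last exact: restr_to_ge0 drho.2.
  apply: measurable_restr_to drho.1; exact: sub_sigma_algebra.
apply: (polypath_lower dr c0 cd (le_trans dt1 t1L)).
apply: le_trans (adm _ Gcd cg rg) _; rewrite -/P.
have lcd : (len P c d = (d - c)%:E)%E.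
  exact: (unit_speed_sub sP c0 (ltW cd) (le_trans dt1 t1L) (polypath_unit_speed x s)).
rewrite (line_integral_unit_speed sP cd drho.1 drho.2 lcd).
rewrite (line_integral_unit_speed sP cd dr.1 dr.2 lcd).
rewrite le_eqVlt; apply/orP; left; apply/eqP; apply: eq_integral => t.
rewrite inE/= in_itv/= => /andP[ct td]; rewrite restr_toE//.
by apply: Gt1; rewrite (le_trans c0 ct) (le_trans td dt1).
Qed.

Let far_compact (X Y : set 'rV[R]_n) : compact X -> compact Y -> X `&` Y = set0 ->
  exists2 c : R, 0 < c & forall x y, X x -> Y y -> c <= `|x - y|.
Proof.
move=> cX cY XY; have [[[x y] [Xx Yy]]|no] := pselect ((X `*` Y) !=set0); last first.
  by exists 1 => // x y Xx Yy; case: no; exists (x, y).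
have [| | |[u v] uvXY H] := @compact_EVT_max _ R (fun z : 'rV[R]_n * 'rV[R]_n => - `|z.1 - z.2|) (X `*` Y).
- by exists (x, y).
- exact: compact_setX.
- apply: continuous_subspaceT => z.
  apply: (@cvgN _ _ _ (nbhs z) _ (fun z : 'rV[R]_n * 'rV[R]_n => `|z.1 - z.2|)).
  apply: (@cvg_norm _ _ _ (nbhs z) _ (fun z : 'rV[R]_n * 'rV[R]_n => z.1 - z.2)).
  by apply: cvgB; [exact: cvg_fst|exact: cvg_snd].
move: uvXY; rewrite inE => -[/= Xu Yv]; exists (`|u - v|).
  rewrite lt_neqAle normr_ge0 andbT eq_sym; apply/eqP => /normr0_eq0/eqP.
  rewrite subr_eq0 => /eqP uv; have : (X `&` Y) u by split => //; rewrite uv.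
  by rewrite XY.
by move=> x' y' Xx' Yy'; have := H (x', y'); rewrite inE lerN2; apply; split.
Qed.

(** Only boundedly many components of the preimage of W are mapped onto W: the
    side lifts of a fixed square of W give in each of them a pair of continua,
    over opposite sides of the square, that are large in comparison with their
    distance, and so a fixed amount of the energy of a common admissible
    density lies in each component. *)
Lemma class_count W w0 : open W -> W `<=` D' -> W w0 -> (forall u v, W u -> W v -> joined W u v) ->
  exists N : nat, forall f (p : nat -> 'rV[R]_n), tame D D' q f ->
    (forall i, (i < N)%N -> D (p i) /\ W (f (p i))) ->
    (forall i j, (i < j < N)%N -> ~ joined (D `&` f @^-1` W) (p i) (p j)) -> False.
Proof.
move=> oW WD Ww0 JW; have n0 : (0 < n)%N by exact: ltnW.
have [theta th0 crossH] := @two_center_crossing R n n1.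
have [r /= r0 rW] : nbhs_ball w0 W by apply/nbhs_ballP; exact: open_nbhs_nbhs.
pose h := r / 8; have h0 : 0 < h by rewrite divr_gt0.
pose v := corner w0 h n1.
have midW k z : enorm (z - mid w0 h n1 k) <= h -> W z.
  have -> : mid w0 h n1 k = mid w0 h n1 (k %% 4)%N.
    by rewrite /mid; have [-> ->] := corner_mod w0 h n1 k.
  move=> /(mid_ball h0 (ltn_pmod k (isT : (0 < 4)%N))) zw; apply: rW.
  rewrite -ball_normE /= distrC; apply: le_lt_trans (norm_le_enorm _) _.
  by apply: lt_le_trans zw _; rewrite /h; lra.
have sideW k : side w0 h n1 k `<=` W.
  by move=> c /(side_mid h0) ch; apply: (midW k); apply: le_trans ch _; lra.
pose C := \sum_(k < 4) 2 * (q / (h - h / 2) ^+ n).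
have [N NC] : exists N : nat, C < N%:R * theta.
  by exists (Num.truncn (C / theta)).+1; rewrite -ltr_pdivrMr//; exact: truncnS_gt.
exists N => f p tf pW nj; have [cf fD of_ pf mf] := tf.
pose O := D `&` f @^-1` W; have oO : open O by exact: open_preimage.
pose G i := [set y | joined O (p i) y].
have [rho [drho Irho adm]] : exists rho, [/\ density rho, (\int[lam]_x (rho x ^+ n) <= C%:E)%E &
    forall k g, (k < 4)%N -> Gamma_f D f (mid w0 h n1 k) (h / 2) h g -> is_curve g ->
      locally_rectifiable g -> (1 <= line_integral rho g)%E].
  apply: (@joint_density R n 4 (fun k => Gamma_f D f (mid w0 h n1 k) (h / 2) h)
    (fun=> q / (h - h / 2) ^+ n) n0) => k k4.
  split; first by rewrite divr_gt0// exprn_gt0//; lra.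
  apply: mf; [|lra|lra]; apply/WD/(midW k); rewrite subrr enorm0; exact: ltW.
have admk k g : Gamma_f D f (mid w0 h n1 k) (h / 2) h g -> is_curve g ->
    locally_rectifiable g -> (1 <= line_integral rho g)%E.
  have -> : mid w0 h n1 k = mid w0 h n1 (k %% 4)%N.
    by rewrite /mid; have [-> ->] := corner_mod w0 h n1 k.
  by apply: adm; rewrite ltn_pmod.
suff HG i : (i < N)%N -> (theta%:E <= \int[lam]_(x in G i) (rho x ^+ n))%E.
  have := @integral_disjoint_ge R n G (fun x => rho x ^+ n)%E theta N
    (emeasurable_funX n drho.1) (fun x => expe_ge0 n (drho.2 x)) _ _ HG.
  move=> H; have : ((N%:R * theta)%:E <= C%:E)%E.
    apply: le_trans (H _ _) Irho.
      by move=> k; apply: sub_sigma_algebra; exact: open_joined.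
    move=> j k jk; apply/seteqP; split => // y [Gj Gk]; apply: (nj _ _ jk).
    exact: joined_trans Gj (joined_sym Gk).
  by rewrite lee_fin leNgt NC.
move=> iN; have [Dp Wp] := pW i iN; rewrite leNgt; apply/negP => small.
have GO y : G i y -> O y by exact: joined_r.
have liftG K x : continuum K -> K `<=` W -> G i x -> K (f x) ->
    exists E, [/\ continuum E, E `<=` G i, E x & f @` E = K].
  move=> cK KW Gx Kfx; have [Dx _] := GO x Gx.
  have [E [cE ED Ex fE]] := tame_lift oD tf cK (subset_trans KW WD) Dx Kfx.
  exists E; split => // y Ey; apply: joined_trans Gx _; exists E; split => // z Ez.
  by split; [exact: ED|apply: KW; rewrite -fE; exists z].
have Gpi : G i (p i) by exact: joined_refl.
(* The distances between the end points of the side lifts in this class. *)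
pose Z := [set d : R | exists k x x', [/\ G i x, G i x', f x = v k, f x' = v k.+1 & d = `|x - x'|]].
have v0W : W (v 0%N) by apply: (sideW 0%N); exact: segm_l.
have Z0 : Z !=set0.
  have [K [cK KW Kp Kv]] := JW _ _ Wp v0W.
  have [E [cE EG Ep fE]] := liftG K (p i) cK KW Gpi Kp.
  have [x Ex xv] : (f @` E) (v 0%N) by rewrite fE.
  have [|E' [cE' EG' Ex' fE']] := liftG _ x (continuum_segm (v 0%N) (v 1%N)) (sideW 0%N) (EG _ Ex).
    by rewrite xv; exact: segm_l.
  have [x' Ex'' xv'] : (f @` E') (v 1%N) by rewrite fE'; exact: segm_r.
  by exists (`|x - x'|), 0%N, x, x'; split => //; [exact: EG|exact: EG'].
have [mu0 mu0_gt0 Zmu] : exists2 c : R, 0 < c & forall d, Z d -> c <= d.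
  have ck k : exists c : R, 0 < c /\ forall x y, (D `&` f @^-1` [set v k]) x ->
      (D `&` f @^-1` [set v k.+1]) y -> c <= `|x - y|.
    have cfib j : compact (D `&` f @^-1` [set v j]).
      apply: pf; first exact: compact_set1.
      by move=> _ ->; apply/WD/(sideW j); exact: segm_l.
    have [|c c0 Hc] := far_compact (cfib k) (cfib k.+1).
      apply/seteqP; split => // x [[_ /= e1] [_ /= e2]].
      have := corner_step w0 n1 h0 k; rewrite -/(v k) -/(v k.+1) -e1 -e2 subrr enorm0 => /eqP.
      by rewrite lt_eqF.
    by exists c.
  have [c Hc] := choice ck.
  exists (Num.min (Num.min (c 0%N) (c 1%N)) (Num.min (c 2%N) (c 3%N))).
    by rewrite !lt_min (Hc 0%N).1 (Hc 1%N).1 (Hc 2%N).1 (Hc 3%N).1.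
  move=> d [k [x [x' [/GO[Dx _] /GO[Dx' _] xk xk' ->]]]].
  move: xk xk'; rewrite /v; have [-> ->] := corner_mod w0 h n1 k.
  move=> xk xk'; have := (Hc (k %% 4)%N).2 x x' (conj Dx xk) (conj Dx' xk').
  have := ltn_pmod k (isT : (0 < 4)%N); case: (k %% 4)%N => [|[|[|[|//]]]] _; rewrite !ge_min => ->;
    by rewrite ?orbT.
have infZ : has_inf Z by split => //; exists mu0 => d /Zmu.
pose mu := inf Z.
have mu_gt0 : 0 < mu by apply: lt_le_trans mu0_gt0 _; apply: lb_le_inf.
have Zge d : Z d -> mu <= d by move=> Zd; apply: ge_inf Zd; case: infZ.
have [d [k [x [x' [Gx Gx' xk xk' dE]]]] d2] : exists2 d, Z d & d < 2 * mu.
  have [|d Zd dlt] := @inf_adherent _ Z mu mu_gt0; first by [].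
  by exists d => //; move: dlt; rewrite -/mu; lra.
(* The index of the preceding side, modulo four. *)
pose j := (k + 3)%N.
have xj : f x = v j.+1 by rewrite xk /j -addnS /v cornerD4.
have xj' : f x' = v j.+2.
  by rewrite xk' /v (_ : j.+2 = (k.+1 + 4)%N) ?cornerD4// /j addSnnS !addnS.
have [|E [cE EG Ex fE]] := liftG _ x (continuum_segm (v j) (v j.+1)) (sideW j) Gx.
  by rewrite xj; exact: segm_r.
have [|F [cF FG Fx fF]] := liftG _ x' (continuum_segm (v j.+2) (v j.+3)) (sideW j.+2) Gx'.
  by rewrite xj'; exact: segm_l.
have [xE ExE xEv] : (f @` E) (v j) by rewrite fE; exact: segm_l.
have [xF FxF xFv] : (f @` F) (v j.+3) by rewrite fF; exact: segm_r.
have EE t : mu / 2 <= t <= mu -> exists2 z, E z & `|z - x| = t.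
  move=> /andP[t1 t2]; apply: (@continuum_meets_spheres _ _ E x 0 mu).
  - by case: cE.
  - by exists x => //; rewrite subrr normr0.
  - by exists xE => //; apply: Zge; exists j, xE, x; split => //; exact: EG.
  - by rewrite t2 andbT (le_trans _ t1)// divr_ge0// ltW.
have FF t : mu / 2 <= t <= mu -> exists2 z, F z & `|z - x'| = t.
  move=> /andP[t1 t2]; apply: (@continuum_meets_spheres _ _ F x' 0 mu).
  - by case: cF.
  - by exists x' => //; rewrite subrr normr0.
  - by exists xF => //; rewrite distrC; apply: Zge; exists j.+2, x', xF; split => //; exact: FG.
  - by rewrite t2 andbT (le_trans _ t1)// divr_ge0// ltW.
have xx' : `|x' - x| <= 2 * mu by rewrite distrC -dE ltW.
have oG : open (G i) by exact: open_joined.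
have mG : measurable (G i : set (borelRn R n)) by exact: sub_sigma_algebra.
have Irestr : (\int[lam]_z (restr_to (G i) rho z ^+ n) < theta%:E)%E.
  apply: le_lt_trans small; rewrite [leRHS]integral_indicl le_eqVlt; apply/orP; left; apply/eqP.
  by apply: eq_integral => z _; rewrite restr_to_expe.
have [y [s [Ey Fs cost]]] := crossH (restr_to (G i) rho) E F x x' mu mu_gt0 xx'
  (measurable_restr_to mG drho.1) (restr_to_ge0 (G i) drho.2) EE FF Irestr.
have : (1 <= polycost (restr_to (G i) rho) y s)%E.
  apply: (@polygon_in_class f W (p i) rho y s (mid w0 h n1 j) h) => //.
  - by move=> g Gg cg rg; exact: admk Gg cg rg.
  - exact: midW.
  - exact: EG.
  - by apply: side_mid => //; rewrite -[side _ _ _ _]fE; exists y.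
  - by apply: opposite_mid => //; rewrite -[side _ _ _ _]fF; exists (last y s).
  - exact: FG.
by rewrite leNgt cost.
Qed.

End counting.

(** * Boundary points *)

Section boundary_points.
Context {R : realType} {n : nat}.
Variables (D D' : set 'rV[R]_n) (q : R).
Hypotheses (n1 : (1 < n)%N) (oD : open D) (oD' : open D') (cD' : connected D') (q0 : 0 < q).
Variables (x0 : extRn R n) (a : 'rV[R]_n) (V0 : set (extRn R n)).
Hypotheses (lo : loewner D x0) (ebx0 : ebd D x0) (Da : D' a) (x0V0 : nbhs x0 V0).
Implicit Types (e p z : 'rV[R]_n) (U V : set (extRn R n)) (F : set 'rV[R]_n).

Definition avoids f := forall z, D z -> V0 (emb z) -> f z <> a.

(** Continua that meet V and whose images stay away from a lie in U. *)
Definition shadowed (eps : R) e U V := forall f, tame D D' q f -> avoids f ->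
  (exists z, [/\ D z, V (emb z) & f z = a + eps *: e]) ->
  forall F, continuum F -> F `<=` D -> (exists2 x, F x & V (emb x)) ->
  (forall x, F x -> 2 * eps <= enorm (f x - a)) -> forall x, F x -> U (emb x).

(** A segment from a has a lift that is large, because a is not taken near x0;
    hence lifts of continua far from a that come close to x0 must be small. *)
Lemma shadow (eps : R) e U : 0 < eps -> enorm e = 1 -> (forall t, 0 <= t <= eps -> D' (a + t *: e)) ->
  nbhs x0 U -> U `<=` V0 -> exists V, [/\ nbhs x0 V, V `<=` U & shadowed eps e U V].
Proof.
move=> eps0 e1 De x0U UV0; have e12 : eps < 2 * eps by lra.
pose an := one_annulus q Da eps0 e12.
have [V [x0V VU H]] := loewner_separation D' n1 q0 lo (@one_annulus_pos R n q q0 eps (2 * eps) e12) x0U.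
exists V; split => // f tf av [z [Dz Vz fz]] F cF FD FV Ffar x Fx.
apply: contrapT => nU.
have sD : segm (a + 0 *: e) (a + eps *: e) `<=` D'.
  by move=> c /(segm_line (ltW eps0))[u uu ->]; exact: De.
have [|E [cE ED Ez fE]] := tame_lift oD tf (continuum_segm _ _) sD Dz.
  by rewrite fz; exact: segm_r.
apply: (H f an E F) => //.
- apply: separated_one.
    rewrite fE => c /(segm_line (ltW eps0))[u /andP[u0 u1] ->].
    by rewrite addrC addKr enormZ e1 mulr1 ger0_norm.
  by move=> _ [y Fy <-]; exact: Ffar.
- by exists z.
- have [p Ep fp] : (f @` E) a by rewrite fE -{3}(addr0 a) -(scale0r e); exact: segm_l.
  by exists p => // Up; exact: (av p (ED _ Ep) (UV0 _ Up) fp).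
- by exists x.
Qed.

Lemma closed_nbhs U : nbhs x0 U -> exists C, [/\ closed C, nbhs x0 C & C `<=` U].
Proof.
move=> /nbhs_ballP[e /= e0 eU]; exists (closure (ball x0 (e / 2))).
have e20 : 0 < e / 2 by rewrite divr_gt0.
split; first exact: closed_closure.
  by apply: filterS (nbhsx_ballx x0 _ e20); exact: subset_closure.
move=> y /(_ _ (nbhsx_ballx y _ e20))[z [xz yz]]; apply: eU.
by rewrite (splitr e); apply: ball_triangle xz _; exact: ball_sym.
Qed.

Lemma boundary_notin y : ebd D y -> forall z, D z -> y <> emb z.
Proof.
move=> [_ ny] z Dz yz; apply: ny; have := emb_open oD; rewrite interior_id => ->.
by exists z.
Qed.

Lemma boundary_or_in y : ecl D y -> ebd D y \/ exists2 z, D z & y = emb z.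
Proof.
move=> cly; have [[z Dz zy]|ny] := pselect ((emb @` D) y); first by right; exists z.
by left; split => //; have := emb_open oD; rewrite interior_id => ->.
Qed.

Lemma open_off_point z : open (~` [set emb z] : set (extRn R n)).
Proof.
apply: closed_openC; apply: compact_closed; first exact: extRn_hausdorff.
exact: compact_set1.
Qed.

Variables (T : Type) (G : set_system T) (UG : UltraFilter G) (Fm : T -> 'rV[R]_n -> 'rV[R]_n).
Hypothesis Gtame : G [set t | tame D D' q (Fm t)].
Hypothesis Gav : G [set t | avoids (Fm t)].
Hypothesis Hr : forall w, D' w -> w <> a -> reach D G Fm x0 w.

(** At an isolated boundary point the lifts of two opposite rays stay near x0
    and, being proper, run into x0. *)
Lemma no_isolated_point U1 : nbhs x0 U1 -> (forall y, ebd D y -> U1 y -> y = x0) -> False.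
Proof.
move=> x0U1 iso; have [e e1] := @unit_vector R n n1.
have [r r0 near] := near_b oD' Da e1.
have e1' : enorm (- e) = 1 by rewrite enormN.
pose eps := r / 4; have eps0 : 0 < eps by rewrite divr_gt0.
have Dt t : `|t| <= 2 * eps -> D' (a + t *: e) by move=> th; apply: near; apply: le_lt_trans th _; rewrite /eps; lra.
have [C [clC x0C CU]] := closed_nbhs (filterI x0U1 x0V0).
have De t : 0 <= t <= eps -> D' (a + t *: e).
  by move=> /andP[t0 t1]; apply: Dt; rewrite ger0_norm//; lra.
have [V [x0V VC shad]] := shadow eps0 e1 De x0C (fun y Cy => (CU y Cy).2).
have D1 : D' (a + (2 * eps) *: e) by apply: Dt; rewrite ger0_norm//; lra.
have D2 : D' (a + (2 * eps) *: (- e)).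
  by rewrite scalerN -scaleNr; apply: Dt; rewrite normrN ger0_norm//; lra.
have D0 : D' (a + eps *: e) by apply: De; rewrite (ltW eps0) lexx.
have eps20 : 0 < 2 * eps by lra.
have r0' := Hr D0 (on_ray_neq e1 (lt0r_neq0 eps0)).
have r1' := Hr D1 (on_ray_neq e1 (lt0r_neq0 eps20)).
have r2' := Hr D2 (on_ray_neq e1' (lt0r_neq0 eps20)).
have := filter_ex (filterI (filterI Gtame Gav) (filterI (r0' V x0V) (filterI (r1' V x0V) (r2' V x0V)))).
move=> [t [[tt av] [zP [[z1 [Dz1 Vz1 fz1]] [z2 [Dz2 Vz2 fz2]]]]]].
move: tt av zP; rewrite /= => tt av zP; have [cf fD _ _ _] := tt; move: (Fm t) tt av zP cf fD fz1 fz2 => f tt av zP cf fD fz1 fz2.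
pose U2 : set (extRn R n) := ~` [set emb z1] `&` ~` [set emb z2].
have x0U2 : nbhs x0 U2.
  apply: filterI; apply: open_nbhs_nbhs; (split; first exact: open_off_point).
    exact: boundary_notin Dz1.
  exact: boundary_notin Dz2.
have [V2 [x0V2 V2U H]] := loewner_separation D' n1 q0 lo (ray_bound_gt0 (n := n) q0 eps20) x0U2.
pose Ke : set (extRn R n) := (ecl D `&` C) `&` ~` V2°.
have KeD y : Ke y -> exists2 z, D z & y = emb z.
  move=> [[cly Cy] ny]; have [eby|//] := boundary_or_in cly.
  by exfalso; apply: ny; rewrite (iso y eby (CU y Cy).1); exact: nbhs_singleton (nbhs_interior x0V2).
have cKe : compact Ke.
  apply: (subclosed_compact _ extRn_compact) => //.
  apply: closedI; last by apply: open_closedC; exact: open_interior.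
  by apply: closedI => //; exact: closed_closure.
pose Kd := (odflt 0 : extRn R n -> 'rV[R]_n) @` Ke.
have cKd : compact Kd.
  apply: continuous_compact => //; apply: continuous_in_subspaceT => y /set_mem/KeD[z Dz ->].
  exact: unemb_continuous.
have KdD : Kd `<=` D by move=> _ [y /KeD[z Dz ->] <-].
have cfK : compact (f @` Kd) by exact: (image_compact_in cf cKd KdD).
have fKD : f @` Kd `<=` D' by rewrite -fD => _ [z /KdD Dz <-]; exists z.
have run e' z' : enorm e' = 1 -> D' (a + (2 * eps) *: e') -> D z' -> V (emb z') ->
    f z' = a + (2 * eps) *: e' -> exists t1 F, [/\ 2 * eps <= t1,
      forall t, 2 * eps <= t <= t1 -> D' (a + t *: e'), continuum F, F `<=` D &
      [/\ F z', f @` F = segm (a + (2 * eps) *: e') (a + t1 *: e') &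
          exists2 p, F p & V2 (emb p)]].
  move=> e'1 De' Dz' Vz' fz'.
  have [t1 et1 [Dt1 nK]] := ray_escape oD' cfK fKD e'1 De'.
  have sD : segm (a + (2 * eps) *: e') (a + t1 *: e') `<=` D'.
    by move=> c /(segm_line et1)[u uu ->]; exact: Dt1.
  have [|F [cF FD Fz fF]] := tame_lift oD tt (continuum_segm _ _) sD Dz'.
    by rewrite fz'; exact: segm_l.
  exists t1, F; split => //; split => //.
  have [p Fp fp] : (f @` F) (a + t1 *: e') by rewrite fF; exact: segm_r.
  exists p => //; apply: contrapT => nV2; apply: nK; exists p => //.
  exists (emb p) => //; split; last by move=> /interior_subset.
  split; first by apply: subset_closure; exists p => //; exact: FD.
  apply: (shad f tt av zP F cF FD) => //; first by exists z'.
  move=> y Fy; have : (f @` F) (f y) by exists y.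
  rewrite fF => /(segm_line et1)[u /andP[u0 _] ->].
  by rewrite addrC addKr enormZ e'1 mulr1 ger0_norm// (le_trans _ u0)// ltW.
have [t1 [F1 [et1 Dt1 cF1 F1D [F1z fF1 F1V]]]] := run e z1 e1 D1 Dz1 Vz1 fz1.
have [t2 [F2 [et2 Dt2 cF2 F2D [F2z fF2 F2V]]]] := run (- e) z2 e1' D2 Dz2 Vz2 fz2.
have [an Han] := ray_annuli n1 q0 e1 eps20 Dt1.
apply: (H f an F1 F2) => //.
- rewrite fF1 fF2; apply: Han; first by move=> c /(segm_line et1).
  move=> c /(segm_line et2)[u /andP[u1 _] ->]; exists u; last by rewrite scalerN.
  exact: le_trans (ltW eps20) u1.
- by exists z1 => // -[h _]; exact: h.
- by exists z2 => // -[_ h]; exact: h.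
Qed.

(** At a non-isolated boundary point, points near infinitely many other boundary
    points belong to different components of the preimage of a neighbourhood
    of the boundary of D'; this contradicts the bound on their number. *)
Lemma no_cluster_point : (forall U, nbhs x0 U -> exists y, [/\ ebd D y, U y & y <> x0]) -> False.
Proof.
move=> clus; have [e e1] := @unit_vector R n n1.
have [r /= r0 rD] : nbhs_ball a D' by apply/nbhs_ballP; exact: open_nbhs_nbhs.
have Dball z : enorm (z - a) < r -> D' z.
  move=> zr; apply: rD; rewrite -ball_normE /= distrC; exact: le_lt_trans (norm_le_enorm _) zr.
pose eps := r / 4; have eps0 : 0 < eps by rewrite divr_gt0.
have Dt t : 0 <= t < r -> D' (a + t *: e).
  by move=> /andP[t0 tr]; apply: Dball; rewrite addrC addKr enormZ e1 mulr1 ger0_norm.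
have De t : 0 <= t <= eps -> D' (a + t *: e).
  by move=> /andP[t0 t1]; apply: Dt; rewrite t0 (le_lt_trans t1)// /eps; have := r0; lra.
pose W := D' `&` [set z | 2 * eps < enorm (z - a)].
have oW : open W by apply: openI => //; exact: open_off_ball.
have WD : W `<=` D' by exact: subIsetl.
have Ww : W (a + (3 * eps) *: e).
  split; first by apply: Dt; apply/andP; split; rewrite /eps; have := r0; lra.
  rewrite /= addrC addKr enormZ e1 mulr1 ger0_norm; have := eps0; lra.
have JW u v : W u -> W v -> joined W u v.
  apply: (@joined_off_ball _ _ a n1 D' (2 * eps) r) => //; first exact: ltW (mulr_gt0 _ eps0).
  by rewrite /eps; have := r0; lra.
have [N count] := class_count n1 oD q0 oW WD Ww JW.
pose good U (c : set (extRn R n) * set (extRn R n) * set (extRn R n)) :=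
  nbhs x0 U -> U `<=` V0 ->
  [/\ [/\ nbhs x0 c.1.1, c.1.1 `<=` U & shadowed eps e U c.1.1],
      nbhs x0 c.1.2, c.1.2 `<=` c.1.1, c.2 `&` c.1.2 = set0 &
      c.2 `<=` c.1.1 /\ exists2 y, ebd D y & nbhs y c.2].
have exnext U : exists c, good U c.
  have [[x0U UV0]|no] := pselect (nbhs x0 U /\ U `<=` V0); last first.
    by exists (U, U, U) => x0U UV0; case: no.
  have [V [x0V VU shad]] := shadow eps0 e1 De x0U UV0.
  have [y [eby Vy yx0]] := clus _ (nbhs_interior x0V).
  have [[A B] /= [xA yB] [oA oB AB]] : exists2 AB : set (extRn R n) * set (extRn R n),
      (nbhs x0 AB.1 /\ nbhs y AB.2) & [/\ open AB.1, open AB.2 & AB.1 `&` AB.2 = set0].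
    have H := @extRn_hausdorff R n; rewrite open_hausdorff in H.
    have [|[A B] /= [xA yB] [oA oB /eqP AB]] := H x0 y; first by apply/eqP => xy; apply: yx0.
    exists (A, B) => //=; split; apply: open_nbhs_nbhs; split => //; exact: set_mem.
  exists (V, V `&` A, V° `&` B) => _ _ /=; split => //.
  - exact: filterI.
  - apply/seteqP; split => // u [[_ Bu] [_ Au]]; by have : (A `&` B) u by []; rewrite AB.
  - split; first by move=> u [/interior_subset].
    exists y => //; apply: filterI => //.
    by apply: open_nbhs_nbhs; split => //; exact: open_interior.
have [next nextP] := choice exnext.
pose Us i := iter i (fun U => (next U).1.2) V0.
have Us_ok i : nbhs x0 (Us i) /\ Us i `<=` V0.
  elim: i => [|i [IH1 IH2]]; first by split.
  have [[_ VU _] x0U' U'V _ _] := nextP (Us i) IH1 IH2.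
  by split => //=; apply: subset_trans U'V (subset_trans VU IH2).
pose Vs i := (next (Us i)).1.1; pose Xs i := (next (Us i)).2.
have ok i : [/\ [/\ nbhs x0 (Vs i), Vs i `<=` Us i & shadowed eps e (Us i) (Vs i)],
    nbhs x0 (Us i.+1), Us i.+1 `<=` Vs i, Xs i `&` Us i.+1 = set0 &
    Xs i `<=` Vs i /\ exists2 y, ebd D y & nbhs y (Xs i)].
  by have [h1 h2] := Us_ok i; exact: nextP.
have UsV i j : (i < j)%N -> Us j `<=` Vs i.
  elim: j => // j IH; rewrite ltnS leq_eqVlt => /predU1P[->|ij]; first by case: (ok j).
  by have [[_ VU _] _ UV _ _] := ok j; exact: subset_trans UV (subset_trans VU (IH ij)).
have D0 : D' (a + eps *: e) by apply: De; rewrite (ltW eps0) lexx.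
have r0' := Hr D0 (on_ray_neq e1 (lt0r_neq0 eps0)).
have [t [[tt av] [z [Dz Vz fz]]]] := filter_ex (filterI (filterI Gtame Gav) (r0' _ (Us_ok N).1)).
move: tt av; rewrite /= => tt av; have [cf fD _ pf _] := tt; move: (Fm t) tt av cf fD pf fz => f tt av cf fD pf fz.
have Hp i : exists p, [/\ D p, Xs i (emb p) & W (f p)].
  have [_ _ _ _ [_ [y eby yX]]] := ok i.
  have cK : compact (D `&` f @^-1` [set z | enorm (z - a) <= 2 * eps]).
    apply: pf; first exact: compact_eball.
    by move=> u /= ur; apply: Dball; apply: le_lt_trans ur _; rewrite /eps; have := r0; lra.
  set K := D `&` _ in cK.
  have cK' : closed (emb @` K : set (extRn R n)).
    apply: compact_closed; first exact: extRn_hausdorff.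
    by apply: continuous_compact => //; exact/continuous_subspaceT/emb_continuous.
  have yK : nbhs y (~` (emb @` K) : set (extRn R n)).
    apply: open_nbhs_nbhs; split; first exact: closed_openC.
    by move=> [u [Du _] uy]; exact: (boundary_notin eby Du (esym uy)).
  have [p Dp [Xp nKp]] := ecl_point eby.1 (filterI yX yK).
  exists p; split => //; split; first by rewrite -fD; exists p.
  rewrite /= ltNge; apply/negP => pe; apply: nKp; by exists p.
have [p pP] := choice Hp.
apply: (count f p tt); first by move=> i _; case: (pP i).
move=> i j /andP[ij jN] [F [cF FO Fi Fj]].
have [[_ _ shad] _ _ _ [XV _]] := ok j.
have [Dpj Xpj _] := pP j; have [_ Xpi _] := pP i.
have Upi : Us j (emb (p i)).
  apply: (shad f tt av _ F cF _ _ _ _ Fi).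
  - by exists z; split => //; exact: UsV jN _ Vz.
  - by move=> u /FO[].
  - by exists (p j) => //; exact: XV.
  - by move=> u /FO[_ [_ /ltW]].
have [[_ _ _] _ UV disj _] := ok i.
have U'pi : Us i.+1 (emb (p i)).
  move: ij; rewrite leq_eqVlt => /predU1P[ji|ij]; first by rewrite ji.
  have [[_ VU _] _ _ _ _] := ok i.+1.
  by apply: VU; exact: UsV ij _ Upi.
by have : (Xs i `&` Us i.+1) (emb (p i)) by []; rewrite disj.
Qed.

End boundary_points.

(** * Equicontinuity and extension to the boundary *)

Section equicontinuity.
Context {R : realType} {n : nat}.
Implicit Types (f : 'rV[R]_n -> 'rV[R]_n).

Lemma ultra_limit (T : Type) (G : set_system T) (phi : T -> extRn R n) : UltraFilter G ->
  exists y : extRn R n, forall N, nbhs y N -> G (phi @^-1` N).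
Proof.
move=> UG; have [y [_ cly]] := extRn_compact (F := phi x @[x --> G]) _ filterT.
exists y => N yN; have [//|nN] := in_ultra_setVsetC (phi @^-1` N) UG.
by have [z [nz Nz]] := cly (~` N) N nN yN.
Qed.

Section family.
Variables (D D' : set 'rV[R]_n) (delta : R) (A : set 'rV[R]_n) (Q : 'rV[R]_n -> \bar R).
Hypotheses (n2 : (2 <= n)%N) (dD : domain D) (dD' : domain D') (delta0 : 0 < delta).
Hypotheses (cA : continuum A) (AD : A `<=` D') (Q0 : forall y, D' y -> (0 <= Q y)%E).
Hypotheses (wf : weakly_flat_boundary D) (iQ : (lebesgueRn n).-integrable D' Q).
Hypothesis lcb : locally_connected_on_boundary D'.
Local Notation S := (frakS D D' delta A Q).

Let oD : open D. Proof. by case: dD. Qed.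
Let oD' : open D'. Proof. by case: dD'. Qed.
Let cD' : connected D'. Proof. by case: dD'. Qed.

Let q : R := fine (\int[lebesgueRn n]_(y in D') Q y) + 1.

Let I0 : (0 <= \int[lebesgueRn n]_(y in D') Q y)%E.
Proof. by apply: integral_ge0 => y Dy; exact: Q0. Qed.

Let q0 : 0 < q.
Proof. by rewrite ltr_wpDl// fine_ge0. Qed.

(** Constant test functions suffice: their energy is the integral of Q, up to
    the width of the annulus. *)
Lemma frakS_tame f : S f -> tame D D' q f.
Proof.
move=> [[cf fD] [of_ df clf] ip _]; have n0 : (0 < n)%N by exact: ltn_trans n2.
split => //; first by move=> K; exact: (proper_preimage n0 oD cf df clf).
move=> y0 r1 r2 Dy r10 r12; apply: (inverse_Poletsky_const (Q := Q)) => //.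
- by rewrite fD.
- by rewrite fD.
- by rewrite fD.
- rewrite fD /q EFinD fineK ?leeDl// integrable_fin_num//.
  by apply: borel_lebesgue_measurable; exact: sub_sigma_algebra.
- by apply: ip; rewrite fD.
Qed.

(** The negation provides an ultrafilter on triples (f, x, x'); at a boundary
    point the only value that may be omitted near x0 is then a point of A,
    because f^-1(A) keeps the distance delta from the boundary. *)
Lemma frakS_oscillation x0 (eps : R) : ecl D x0 -> 0 < eps -> exists2 tau : R, 0 < tau &
  forall f, S f -> forall x x', D x -> D x' -> chordal x0 (emb x) < tau ->
    chordal x0 (emb x') < tau -> chordal (emb (f x)) (emb (f x')) < eps.
Proof.
move=> clx0 eps0; apply: contrapT => no.
pose T := (('rV[R]_n -> 'rV[R]_n) * 'rV[R]_n * 'rV[R]_n)%type.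
pose B (tau : R) := [set t : T | [/\ S t.1.1, D t.1.2, D t.2, chordal x0 (emb t.1.2) < tau &
  chordal x0 (emb t.2) < tau /\ eps <= chordal (emb (t.1.1 t.1.2)) (emb (t.1.1 t.2))]].
have FB : ProperFilter (filter_from [set tau : R | 0 < tau] B).
  apply: filter_from_proper.
    apply: filter_from_filter; first by exists 1 => /=.
    move=> s t s0 t0; exists (Num.min s t); first by rewrite /= lt_min s0.
    by move=> u [Su Du Du' + [+ eu]]; rewrite !lt_min => /andP[h1 h2] /andP[h3 h4]; split.
  move=> tau tau0; apply: contrapT => B0; apply: no; exists tau => // f Sf x x' Dx Dx' xt xt'.
  by rewrite ltNge; apply/negP => h; apply: B0; exists (f, x, x').
have [G [UG FG]] := ultraFilterLemma FB.
have GB tau : 0 < tau -> G (B tau) by move=> tau0; apply: FG; exists tau.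
pose Fm (t : T) := t.1.1.
have Gtame : G [set t | tame D D' q (Fm t)].
  by apply: filterS (GB 1 ltr01) => t [St _ _ _ _]; exact: frakS_tame.
have [y1 Hy1] := ultra_limit (fun t : T => emb (t.1.1 t.1.2)) UG.
have [y2 Hy2] := ultra_limit (fun t : T => emb (t.1.1 t.2)) UG.
have inD' (t : T) x : S t.1.1 -> D x -> (emb @` D') (emb (t.1.1 x)).
  by move=> [[_ fD] _ _ _] Dx; exists (t.1.1 x) => //; rewrite -fD; exists x.
have cl1 : ecl D' y1.
  move=> N /Hy1 GN; have [t [Nt [St Dt _ _ _]]] := filter_ex (filterI GN (GB 1 ltr01)).
  by exists (emb (t.1.1 t.1.2)); split => //; exact: inD'.
have cl2 : ecl D' y2.
  move=> N /Hy2 GN; have [t [Nt [St _ Dt _ _]]] := filter_ex (filterI GN (GB 1 ltr01)).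
  by exists (emb (t.1.1 t.2)); split => //; exact: inD'.
have y12 : y1 <> y2.
  move=> y12; have e20 : 0 < eps / 2 by rewrite divr_gt0.
  have h1 := Hy1 _ (nbhsx_ballx y1 _ e20).
  have h2 : G ((fun t : T => emb (t.1.1 t.2)) @^-1` ball y1 (eps / 2)).
    by apply: Hy2; rewrite -y12; exact: nbhsx_ballx.
  have [t [[b1 b2] [_ _ _ _ [_ et]]]] := filter_ex (filterI (filterI h1 h2) (GB 1 ltr01)).
  have : ball (emb (t.1.1 t.1.2)) eps (emb (t.1.1 t.2)).
    by rewrite (splitr eps); apply: ball_triangle b2; exact: ball_sym.
  by rewrite /ball/= ltNge et.
have near0 V : nbhs x0 V -> G [set t : T | [/\ D t.1.2, D t.2, V (emb t.1.2) & V (emb t.2)]].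
  move=> /nbhs_ballP[e /= e0 eV]; apply: filterS (GB e e0) => t [_ Dt Dt' h [h' _]].
  by split => //; apply: eV.
have near1 N V : nbhs y1 N -> nbhs x0 V ->
    G [set t | exists z, [/\ D z, V (emb z) & N (emb (Fm t z))]].
  move=> /Hy1 GN /near0 GV; apply: filterS (filterI GN GV) => t [Nt [Dt _ Vt _]].
  by exists t.1.2.
have near2 N V : nbhs y2 N -> nbhs x0 V ->
    G [set t | exists z, [/\ D z, V (emb z) & N (emb (Fm t z))]].
  move=> /Hy2 GN /near0 GV; apply: filterS (filterI GN GV) => t [Nt [_ Dt _ Vt]].
  by exists t.2.
have lo : loewner D x0.
  have [ebx0|[x Dx ->]] := boundary_or_in oD clx0; first exact: loewner_boundary.
  exact: loewner_interior.
have ball0 := reach_ball n2 oD oD' q0 UG lo Gtame lcb cl1 cl2 y12 near1 near2.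
have [b [Db Hb]] := reach_all_but_one n2 oD oD' cD' q0 UG lo Gtame ball0.
have [ebx0|[x Dx x0E]] := boundary_or_in oD clx0; last first.
  exact: (no_interior_point n2 oD oD' q0 UG lo Gtame Db Hb Dx x0E).
pose V0 : set (extRn R n) := ball x0 delta.
have x0V0 : nbhs x0 V0 by exact: nbhsx_ballx.
have av a f : A a -> S f -> avoids D a V0 f.
  move=> Aa [_ _ _ dist] z Dz Vz fz.
  have : (chordal_dist (emb @` (D `&` f @^-1` A)) (ebd D) <= (chordal (emb z) x0)%:E)%E.
    apply: ereal_inf_lbound; exists (emb z, x0) => //; split => //=.
    by exists z => //; split => //=; rewrite fz.
  move=> /(le_trans dist); rewrite lee_fin leNgt => /negP; apply.
  by rewrite chordal_sym.
have [[a Aa] _ _] := cA.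
have Gav : G [set t | avoids D a V0 (Fm t)].
  by apply: filterS (GB 1 ltr01) => t [St _ _ _ _]; exact: av.
have ab : a = b.
  apply: contrapT => ab; have /(_ V0 x0V0) ra := Hb a (AD Aa) ab.
  by have [t [avt [z [Dz Vz fz]]]] := filter_ex (filterI Gav ra); exact: avt z Dz Vz fz.
rewrite -ab in Hb.
have [[U1 x0U1 iso]|clus] := pselect (exists2 U1, nbhs x0 U1 & forall y, ebd D y -> U1 y -> y = x0).
  exact: (no_isolated_point n2 oD oD' q0 lo ebx0 (AD Aa) x0V0 UG Gtame Gav Hb x0U1 iso).
apply: (no_cluster_point n2 oD oD' cD' q0 lo (AD Aa) x0V0 UG Gtame Gav Hb) => U x0U.
apply: contrapT => nU; apply: clus; exists U => // y eby Uy.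
by apply: contrapT => yx0; apply: nU; exists y.
Qed.

(** Small oscillation near x makes the cluster points of f at x limits. *)
Lemma frakS_limit f x : S f -> ecl D x -> exists y, forall eps : R, 0 < eps ->
  exists2 tau : R, 0 < tau & forall u, D u -> chordal x (emb u) < tau ->
    chordal y (emb (f u)) < eps.
Proof.
move=> Sf clx; pose B (tau : R) := [set y | exists2 u, D u & chordal x (emb u) < tau /\ y = emb (f u)].
have FB : ProperFilter (filter_from [set tau : R | 0 < tau] B).
  apply: filter_from_proper.
    apply: filter_from_filter; first by exists 1 => /=.
    move=> s t s0 t0; exists (Num.min s t); first by rewrite /= lt_min s0.
    move=> y [u Du [+ yu]]; rewrite lt_min => /andP[h1 h2].
    by split; exists u.
  move=> tau tau0; have [u Du ux] := ecl_point clx (nbhsx_ballx x tau tau0).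
  by exists (emb (f u)), u.
have [y [_ cly]] := extRn_compact FB filterT.
exists y => eps eps0; have e20 : 0 < eps / 2 by rewrite divr_gt0.
have [tau tau0 Htau] := frakS_oscillation clx e20.
exists tau => // u Du ux.
have Bt : filter_from [set tau : R | 0 < tau] B (B tau) by exists tau.
have [_ [[u' Du' [ux' ->]] yu']] := cly _ _ Bt (nbhsx_ballx y _ e20).
apply: le_lt_trans (chordal_triangle (emb (f u')) _ _) _.
by rewrite (splitr eps) ltrD//; exact: (Htau f).
Qed.

(** The values at the boundary are limits from inside; surjectivity holds because
    the image of the compact closure is closed and contains D'. *)
Lemma frakS_extension f : S f -> exists2 g, continuous_extension D D' f g & g @` ecl D = ecl D'.
Proof.
move=> Sf; have [[cf fD] _ _ _] := Sf.
have Hlim x : exists y, ecl D x -> forall eps : R, 0 < eps ->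
    exists2 tau : R, 0 < tau & forall u, D u -> chordal x (emb u) < tau ->
    chordal y (emb (f u)) < eps.
  by have [/(frakS_limit Sf)[y Hy]|no] := pselect (ecl D x); [exists y|exists x].
have [g Hg] := choice Hlim.
have approx x eps tau : ecl D x -> 0 < eps -> 0 < tau ->
    exists u, [/\ D u, chordal x (emb u) < tau & chordal (g x) (emb (f u)) < eps].
  move=> clx eps0 tau0; have [s s0 Hs] := Hg x clx eps eps0.
  have m0 : 0 < Num.min s tau by rewrite lt_min s0.
  have [u Du] := ecl_point clx (nbhsx_ballx x _ m0).
  rewrite /ball/= lt_min => /andP[us ut]; exists u; split => //; exact: Hs.
have DD' u : D u -> D' (f u) by move=> Du; rewrite -fD; exists u.
have cg : {within ecl D, continuous g}.
  apply/subspace_continuousP => x clx N /nbhs_ballP[e /= e0 eN].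
  have e20 : 0 < e / 2 by rewrite divr_gt0.
  have [tau tau0 Htau] := Hg x clx _ e20.
  have t20 : 0 < tau / 2 by rewrite divr_gt0.
  have K : \forall y \near within (ecl D) (nbhs x), chordal x y < tau / 2 /\ ecl D y.
    apply: filterI; last by apply: withinT; exact: nbhs_filter.
    by apply: cvg_within; exact: (nbhsx_ballx x _ t20).
  suff : \forall y \near within (ecl D) (nbhs x), N (g y) by [].
  apply: filterS K => y [xy cly]; apply: eN; rewrite /ball/=.
  have [u [Du yu gu]] := approx y _ _ cly e20 t20.
  apply: le_lt_trans (chordal_triangle (emb (f u)) _ _) _.
  rewrite (splitr e) ltrD//; last by rewrite chordal_sym.
  apply: Htau => //; apply: le_lt_trans (chordal_triangle y _ _) _.
  by rewrite (splitr tau) ltrD.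
have gD' : {homo g : x / ecl D x >-> ecl D' x}.
  move=> x clx N /nbhs_ballP[e /= e0 eN]; have [u [Du _ gu]] := approx x e 1 clx e0 ltr01.
  by exists (emb (f u)); split; [exists (f u) => //; exact: DD'|exact: eN].
have gf x : D x -> g (emb x) = emb (f x).
  move=> Dx; apply: chordal_positivity; apply/eqP; rewrite eq_le; apply/andP; split; last first.
    by rewrite chordalE enorm_ge0.
  rewrite leNgt; apply/negP => c0.
  have clx : ecl D (emb x) by apply: subset_closure; exists x.
  have [tau tau0 Htau] := Hg _ clx _ c0.
  by have := Htau x Dx; rewrite chordalxx ltxx => /(_ tau0).
exists g => //; apply/seteqP; split => [_ [x clx <-]|]; first exact: gD'.
have cK : compact (g @` ecl D).
  apply: continuous_compact => //.
  apply: (subclosed_compact _ extRn_compact) => //; exact: closed_closure.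
have clK := compact_closed (@extRn_hausdorff R n) cK.
move=> y cly; apply: clK; apply: closureS cly => _ [v + <-]; rewrite -fD => -[u Du <-].
by exists (emb u); [apply: subset_closure; exists u|exact: gf].
Qed.

Lemma frakS_ext_equicontinuous : equicontinuous_in (ecl D) (frakS_ext D D' delta A Q).
Proof.
move=> x0 clx0 e e0; have e20 : 0 < e / 2 by rewrite divr_gt0.
have e40 : 0 < e / 2 / 2 by rewrite divr_gt0.
have [tau tau0 Htau] := frakS_oscillation clx0 e20.
exists tau => // g [f Sf [cg _ gf]] x clx xx0.
have near y : ecl D y -> chordal x0 y < tau -> exists u, [/\ D u, chordal x0 (emb u) < tau &
    chordal (g y) (emb (f u)) < e / 2 / 2].
  move=> cly ytau; move/subspace_continuousP : cg => /(_ y cly _ (nbhsx_ballx (g y) _ e40)) K.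
  have {}K : nbhs y [set z | ecl D z -> chordal (g y) (g z) < e / 2 / 2] by exact: K.
  have t0 : 0 < tau - chordal x0 y by rewrite subr_gt0.
  have [u Du [Ku yu]] := ecl_point cly (filterI K (nbhsx_ballx y _ t0)).
  exists u; split => //.
    apply: le_lt_trans (chordal_triangle y _ _) _.
    by rewrite -ltrBrDl.
  rewrite -gf//; apply: Ku; apply: subset_closure; by exists u.
have [|u [Du ux0 gu]] := near x clx; first by rewrite chordal_sym.
have [|u' [Du' ux0' gu']] := near x0 clx0; first by rewrite chordalxx.
apply: le_lt_trans (chordal_triangle (emb (f u)) _ _) _.
have := chordal_triangle (emb (f u')) (emb (f u)) (g x0).
have := Htau f Sf u u' Du Du' ux0 ux0'.
rewrite [chordal (emb (f u')) (g x0)]chordal_sym.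
by move: gu gu'; lra.
Qed.

End family.
End equicontinuity.

Theorem mainTheorem2 (R : realType) (n : nat) (D D' : set 'rV[R]_n)
    (delta : R) (A : set 'rV[R]_n) (Q : 'rV[R]_n -> \bar R) :
  (2 <= n)%N -> domain D -> domain D' -> 0 < delta ->
  continuum A -> A `<=` D' ->
  (forall y, D' y -> 0 <= Q y)%E ->
  measurable_fun (D' : set (lebRn R n)) (Q : lebRn R n -> \bar R) ->
  weakly_flat_boundary D ->
  (lebesgueRn n).-integrable D' Q ->
  locally_connected_on_boundary D' ->
  (forall f, frakS D D' delta A Q f ->
    exists2 g, continuous_extension D D' f g & g @` ecl D = ecl D') /\
  equicontinuous_in (ecl D) (frakS_ext D D' delta A Q).
Proof.
move=> n2 dD dD' delta0 cA AD Q0 _ wf iQ lcb; split; first by move=> f; exact: frakS_extension.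
exact: frakS_ext_equicontinuous.
Qed.
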